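(* Let $H>0$, $\lambda>0$, $a\in\mathbb{R}$, $b>0$, $\sigma>0$, $y_0\in\mathbb{R}$, let $B_{H,\lambda}$ be the tempered fractional Brownian motion with parameters $H,\lambda$, let $Y$ be the solution of $Y_t = y_0 + \int_0^t (a+bY_s)\,ds + \sigma B_{H,\lambda}(t)$, $t\ge 0$, and let $$\hat a_T = \frac{(Y_T - y_0)\left(\int_0^T Y_t^2\, dt - \frac12 (Y_T+y_0)\int_0^T Y_t\, dt\right)}{T\int_0^T Y_t^2\, dt - \left(\int_0^T Y_t\, dt\right)^2},\qquad \hat b_T = \frac{(Y_T - y_0)\left(\frac12 T (Y_T+y_0) - \int_0^T Y_t\, dt\right)}{T\int_0^T Y_t^2\, dt - \left(\int_0^T Y_t\, dt\right)^2}.$$ Then the estimators $\hat a_T$ and $\hat b_T$ are not asymptotically independent. More precisely, as $T\to\infty$, $$\begin{pmatrix}T(\hat a_T-a)\\ e^{bT}(\hat b_T-b)\end{pmatrix}\xrightarrow{d}\begin{pmatrix}b\sigma\xi_2-\sigma\xi_3\\[2pt] \dfrac{2b\sigma\xi_3}{y_0+\frac ab+b\sigma\xi_1}\end{pmatrix},$$ where $(\xi_1,\xi_2,\xi_3)$ is a Gaussian vector with distribution $\mathcal N(\mathbf 0,\Sigma)$, $$\Sigma=\begin{pmatrix} b^{-2}\beta_{H,\lambda,b}^2 & b^{-2}\beta_{H,\lambda,b}^2 & 0\\ b^{-2}\beta_{H,\lambda,b}^2 & b^{-2}\left(\alpha_{H,\lambda}^2-\beta_{H,\lambda,b}^2\right)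 & 0\\ 0&0&\beta_{H,\lambda,b}^2\end{pmatrix},$$ and the two components of the limiting vector are not independent.
   Context: Tempered fractional Brownian motion (TFBM). Let $W=\{W_x, x\in\mathbb{R}\}$ be a two-sided Wiener process, $H>0$, $\lambda>0$. The TFBM $B_{H,\lambda}=\{B_{H,\lambda}(t), t\ge 0\}$ is the zero-mean Gaussian process defined by the Wiener integral $$B_{H,\lambda}(t)=\int_{\mathbb{R}}\left[e^{-\lambda(t-x)_+}(t-x)_+^{H-\frac12}-e^{-\lambda(-x)_+}(-x)_+^{H-\frac12}\right]dW_x,$$ where $(y)_+=\max(y,0)$ and $(y)_+^{p}$ means $y^p$ if $y>0$ and $0$ if $y\le 0$. A version with continuous sample paths is used. Its covariance is $$\operatorname{Cov}[B_{H,\lambda}(t),B_{H,\lambda}(s)]=\tfrac12\left(C_t^2t^{2H}+C_s^2s^{2H}-C_{|t-s|}^2|t-s|^{2H}\right),$$ $$C_t^2=\frac{2\Gamma(2H)}{(2\lambda t)^{2H}}-\frac{2\Gamma(H+\frac12)}{\sqrt\pi\,(2\lambda t)^H}K_H(\lambda t),\quad t>0,$$ with $C_t^2t^{2H}$ read as $0$ at $t=0$, where $K_\nu(x)=\int_0^\infty e^{-x\cosh t}\cosh(\nu t)\,dt$ ($x>0$) is the modified Bessel function of the second kind. Constants: $$\alpha_{H,\lambda}^2=\frac{2\Gamma(2H)}{(2\lambda)^{2H}},\qquad \beta_{H,\lambda,b}^2=\frac b2\int_0^\infty e^{-bu}C_u^2u^{2H}\,du.$$ The process $Y$ is given explicitly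 by $Y_t=(y_0+\frac ab)e^{bt}-\frac ab+\sigma\int_0^te^{b(t-s)}dB_{H,\lambda}(s)$, where $\int_0^te^{b(t-s)}dB_{H,\lambda}(s):=B_{H,\lambda}(t)+b\int_0^te^{b(t-s)}B_{H,\lambda}(s)\,ds$. $\xrightarrow{d}$ denotes convergence in distribution. Asymptotic independence of the (normalized) estimators means independence of the two components of their joint limit in distribution. *)

(* Defs.v *)
From HB Require Import structures.
From mathcomp Require Import all_boot all_order all_algebra.
From mathcomp Require Import all_classical all_reals all_analysis.

Set Implicit Arguments.
Unset Strict Implicit.
Unset Printing Implicit Defensive.

Import Order.TTheory GRing.Theory Num.Theory.
Import numFieldNormedType.Exports.

Local Open Scope classical_set_scope.
Local Open Scope ring_scope.

Notation leb := lebesgue_measure.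

Section special_functions.
Context {R : realType}.
Implicit Types (s nu x u : R).

Definition Gamma s : R :=
  \int[leb]_(x in `]0, +oo[) (x `^ (s - 1) * expR (- x)).

Definition cosh x : R := (expR x + expR (- x)) / 2.

(* Modified Bessel function of the second kind, for 0 < x. *)
Definition besselK nu x : R :=
  \int[leb]_(u in `[0, +oo[) (expR (- (x * cosh u)) * cosh (nu * u)).

Definition pos_part x : R := Num.max x 0.

(* (x)_+ ^ p, equal to 0 for x <= 0 even when p <= 0; the library's power
   satisfies 0 `^ 0 = 1, which would be wrong here for p = 0. *)
Definition pos_pow x p : R := if 0 < x then x `^ p else 0.

End special_functions.

Section probability_notions.
Context d (T : measurableType d) (R : realType) (P : probability T R).

Definition independent_family n (X : 'I_n -> T -> R) : Prop :=
  forall A : 'I_n -> set R, (forall i, measurable (A i)) ->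
    P [set w | forall i, A i (X i w)] = (\prod_(i < n) P (X i @^-1` A i))%E.

Definition independent2 (U V : T -> R) : Prop :=
  forall A B : set R, measurable A -> measurable B ->
    P (U @^-1` A `&` V @^-1` B) = (P (U @^-1` A) * P (V @^-1` B))%E.

(* X has law N(0, v). The case v = 0 is the Dirac mass at 0: the library's
   normal_prob takes the standard deviation, and for standard deviation 0 it
   is by convention the uniform law on [0, 1]. *)
Definition centered_gaussian (X : T -> R) (v : R) : Prop :=
  0 <= v /\
  forall A : set R, measurable A ->
    P (X @^-1` A) =
      if v == 0 then \d_(0 : R) A else normal_prob 0 (Num.sqrt v) A.

(* xi is a Gaussian vector with law N(0, S): every linear combination is
   Gaussian, with variance given by S. *)
Definition centered_gaussian_vector n (S : 'M[R]_n)
    (xi : 'I_n -> {RV P >-> R}) : Prop :=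
  S^T = S /\
  forall c : 'I_n -> R,
    centered_gaussian (fun w => \sum_(i < n) c i * xi i w)
                      (\sum_(i < n) \sum_(j < n) c i * S i j * c j).

Record wiener_process (W : R -> {RV P >-> R}) : Prop := {
  wiener_0 : {ae P, forall w, W 0 w = 0};
  wiener_increment : forall s t : R, s <= t ->
    centered_gaussian (fun w => W t w - W s w) (t - s);
  wiener_independent : forall n (t : nat -> R),
    {homo t : i j / (i <= j)%N >-> i <= j} ->
    independent_family (fun (i : 'I_n) w => W (t i.+1) w - W (t i) w);
  wiener_continuous : {ae P, forall w, continuous (fun t : R => W t w)} }.

(* A list of triples (c, u, v) with u <= v encodes the step function
   \sum c * \1_]u, v]. *)
Definition step_wf (s : seq (R * R * R)) : bool :=
  all (fun q => q.1.2 <= q.2) s.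

Definition step_fun (s : seq (R * R * R)) (x : R) : R :=
  \sum_(q <- s) q.1.1 * \1_(`]q.1.2, q.2]) x.

Definition step_integral (W : R -> {RV P >-> R}) (s : seq (R * R * R))
    (w : T) : R :=
  \sum_(q <- s) q.1.1 * (W q.2 w - W q.1.2 w).

(* X is (a version of) the Wiener integral \int f dW: the L^2(P) limit of the
   integrals of step functions converging to f in L^2(dx). *)
Definition wiener_integral (W : R -> {RV P >-> R}) (f : R -> R)
    (X : {RV P >-> R}) : Prop :=
  exists s : nat -> seq (R * R * R),
    [/\ forall n, step_wf (s n),
        (\int[leb]_x ((step_fun (s n) x - f x) ^+ 2)%:E)%E @[n --> \oo]
          --> 0%E &
        ('E_P[fun w => ((step_integral W (s n) w - X w) ^+ 2)%R])%E
          @[n --> \oo] --> 0%E].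

End probability_notions.

(* Convergence in distribution, as t -> +oo, of the random vectors X t of R^2
   to Z, which may live on another probability space. *)
Definition cvg_in_distribution d (T : measurableType d) d'
    (T' : measurableType d') (R : realType)
    (P : probability T R) (P' : probability T' R)
    (X : R -> T -> R * R) (Z : T' -> R * R) : Prop :=
  [/\ \forall t \near +oo, measurable_fun setT (X t),
      measurable_fun setT Z &
      forall f : R * R -> R, continuous f ->
        (exists M : R, forall z, `|f z| <= M) ->
        ('E_P[fun w => f (X t w)])%E @[t --> +oo] -->
          ('E_P'[fun w => f (Z w)])%E].

Definition asymptotically_independent d (T : measurableType d) (R : realType)
    (P : probability T R) (U V : R -> T -> R) : Prop :=
  exists d' (T' : measurableType d') (P' : probability T' R)
      (Z : T' -> R * R),
    cvg_in_distribution P P' (fun t w => (U t w, V t w)) Z /\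
    independent2 P' (fun w => (Z w).1) (fun w => (Z w).2).

Section tempered_fbm.
Context {R : realType} (H lambda : R).

Definition tfbm_kernel (t x : R) : R :=
  expR (- (lambda * pos_part (t - x))) * pos_pow (t - x) (H - 2^-1)
  - expR (- (lambda * pos_part (- x))) * pos_pow (- x) (H - 2^-1).

Record tfbm d (T : measurableType d) (P : probability T R)
    (W B : R -> {RV P >-> R}) : Prop := {
  tfbm_integral : forall t : R, 0 <= t -> wiener_integral W (tfbm_kernel t) (B t);
  tfbm_continuous :
    forall w, {within `[0, +oo[, continuous (fun t : R => B t w)} }.

(* C_t ^ 2, for 0 < t. *)
Definition C2 (t : R) : R :=
  2 * Gamma (2 * H) / (2 * lambda * t) `^ (2 * H)
  - 2 * Gamma (H + 2^-1) / (Num.sqrt pi * (2 * lambda * t) `^ H)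
    * besselK H (lambda * t).

Definition C2t2H (t : R) : R := if 0 < t then C2 t * t `^ (2 * H) else 0.

Definition alpha2 : R := 2 * Gamma (2 * H) / (2 * lambda) `^ (2 * H).

Definition beta2 (b : R) : R :=
  b / 2 * \int[leb]_(u in `[0, +oo[) (expR (- (b * u)) * C2t2H u).

Definition Sigma (b : R) : 'M[R]_3 :=
  \matrix_(i < 3, j < 3)
    nth 0 (nth [::]
      [:: [:: beta2 b / b ^+ 2; beta2 b / b ^+ 2; 0];
          [:: beta2 b / b ^+ 2; (alpha2 - beta2 b) / b ^+ 2; 0];
          [:: 0; 0; beta2 b]] i) j.

End tempered_fbm.

(* The equation is read pathwise; integrability gives its integral a meaning,
   the library's integral being total. *)
Definition vasicek_solution d (T : measurableType d) (R : realType)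
    (P : probability T R) (a b sigma y0 : R) (B Y : R -> {RV P >-> R}) : Prop :=
  forall (w : T) (t : R), 0 <= t ->
    leb.-integrable `[0, t] (fun s : R => (Y s w)%:E) /\
    Y t w = y0 + \int[leb]_(s in `[0, t]) (a + b * Y s w) + sigma * B t w.

Section estimators.
Context {R : realType} (y0 : R) (y : R -> R) (t : R).

Let I1 : R := \int[leb]_(s in `[0, t]) y s.
Let I2 : R := \int[leb]_(s in `[0, t]) (y s ^+ 2).

Definition a_hat : R :=
  (y t - y0) * (I2 - 2^-1 * (y t + y0) * I1) / (t * I2 - I1 ^+ 2).

Definition b_hat : R :=
  (y t - y0) * (2^-1 * t * (y t + y0) - I1) / (t * I2 - I1 ^+ 2).

End estimators.

(* Main.v *)
(* Put Z_t = \int_0^t e^(-bs) B_s ds, Q_t = \int_0^t e^(-b(t-s)) B_s ds and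
   eta_t = y0 + a/b + b sigma Z_t, so that Y_t = e^(bt) eta_t - a/b + sigma B_t.
   The normalized errors are continuous functions of (Z_T, Q_T, B_T - b Q_T) and of
   remainders of order T^2 e^(-bT) and 1/T, away from the event eta_T = 0, which is
   null in the limit. As B_t = X_t - X_0 for a stationary Gaussian process X whose
   autocovariance r(u) is a mixture of Gaussians e^(-s u^2) (this mixture is the
   Bessel function in C_t^2), the triple is Gaussian and its covariance tends to
   Sigma; its law is identified through characteristic functions and Bernstein
   polynomials in sin(x/N).

   For the dependence, let e = b xi1 + (y0 + a/b) / sigma and z = b xi2 - b xi1,
   which are independent of each other and of xi3. The second limit component
   determines h = 2 xi3 e / (xi3^2 + e^2), the first one b xi2 - xi3. Flipping the
   signs of xi3 and z gives
     E cos (u (e + z - xi3)) h = E sin (u e) sin (u xi3) cos (u z) h.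
   Under independence the left side is a multiple of E h = 0 (the case u = 0), for
   every u; dividing the right side by u^2 and letting u tend to 0 would give
   E 2 xi3^2 e^2 / (xi3^2 + e^2) = 0. *)
Require Import Defs.
From HB Require Import structures.
From mathcomp Require Import all_boot all_order all_algebra.
From mathcomp Require Import all_classical all_reals all_analysis.
From mathcomp Require Import measurable_realfun ring lra.

Set Implicit Arguments.
Unset Strict Implicit.
Unset Printing Implicit Defensive.

Import Order.TTheory GRing.Theory Num.Theory.
Import numFieldNormedType.Exports.

Local Open Scope classical_set_scope.
Local Open Scope ring_scope.

(** * Integration tools *)

(** Gaussian laws enter through the means E cos (X + phi) = cos phi * [gauss_cf v]. Here
    [gauss_cf v] is e^(-v/2), but it is governed by its functional equation, which the independent
    increments of [W] supply; the same equation yields second moment bounds. These bounds control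
    the laws outside a large cube, and inside it a continuous test function is replaced by a
    trigonometric polynomial, whose mean is a combination of characteristic functions. The remainder
    E_T e^(-bT) is quadratic in the energy of the path, the integral of B^2, of which the mean is
    controlled; hence it is measured through a square root. Events on which the quotients degenerate
    are not estimated by probabilities: each is paid for by a nonnegative function of controlled
    mean that is at least 1 there. The dependence argument works with bounded continuous functions
    of the two components (h is homogeneous of degree 0, hence a function of the second one), so it
    applies to every limit in distribution and refutes asymptotic independence as well. *)

Section real_integrals.
Context d (T : measurableType d) (R : realType).
Variables (mu : {measure set T -> \bar R}) (D : set T).
Hypothesis mD : measurable D.

Lemma bounded_integrable (f : T -> R) (M : R) :
  (mu D < +oo)%E -> measurable_fun D f -> (forall x, D x -> `|f x| <= M) ->
  mu.-integrable D (EFin \o f).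
Proof.
move=> muD mf fM; apply: measurable_bounded_integrable => //.
exists M; split; first by rewrite num_real.
by move=> x Mx y Dy /=; apply: (le_trans (fM _ Dy)); exact: ltW.
Qed.

Lemma le_dominated_integrable (f g : T -> R) :
  measurable_fun D f -> mu.-integrable D (EFin \o g) ->
  (forall x, D x -> `|f x| <= g x) -> mu.-integrable D (EFin \o f).
Proof.
move=> mf ig fg; apply: (le_integrable mD _ _ ig).
  exact/measurable_EFinP.
move=> x Dx /=; rewrite lee_fin (le_trans (fg x Dx))//; exact: ler_norm.
Qed.

Lemma integrable_funZ (k : R) (f : T -> R) :
  mu.-integrable D (EFin \o f) -> mu.-integrable D (EFin \o (fun x => k * f x)).
Proof. by move=> h; have := integrableZl mD k h; apply: eq_integrable. Qed.

Lemma integrable_funD (f g : T -> R) :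
  mu.-integrable D (EFin \o f) -> mu.-integrable D (EFin \o g) ->
  mu.-integrable D (EFin \o (fun x => f x + g x)).
Proof. by move=> hf hg; have := integrableD mD hf hg; apply: eq_integrable. Qed.

Lemma integrable_funB (f g : T -> R) :
  mu.-integrable D (EFin \o f) -> mu.-integrable D (EFin \o g) ->
  mu.-integrable D (EFin \o (fun x => f x - g x)).
Proof. by move=> hf hg; have := integrableB mD hf hg; apply: eq_integrable. Qed.

Lemma integrable_fun_sum (I : Type) (s : seq I) (f : I -> T -> R) :
  (forall i, mu.-integrable D (EFin \o f i)) ->
  mu.-integrable D (EFin \o (fun x => \sum_(i <- s) f i x)).
Proof.
move=> hf; have := @integrable_sum _ _ _ mu D mD I s xpredT (fun i => EFin \o f i) (fun i _ => hf i).
by apply: eq_integrable => // x _ /=; rewrite sumEFin.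
Qed.

Lemma Rintegral_sum (I : Type) (s : seq I) (f : I -> T -> R) :
  (forall i, mu.-integrable D (EFin \o f i)) ->
  \int[mu]_(x in D) (\sum_(i <- s) f i x) = \sum_(i <- s) \int[mu]_(x in D) f i x.
Proof.
move=> hf; elim: s => [|i s ih].
  by under eq_Rintegral do rewrite big_nil; rewrite Rintegral_cst// mul0r big_nil.
under eq_Rintegral do rewrite big_cons.
rewrite RintegralD//; first by rewrite ih big_cons.
exact: integrable_fun_sum.
Qed.

Lemma EFin_Rintegral (f : T -> R) : mu.-integrable D (EFin \o f) ->
  (\int[mu]_(x in D) (f x)%:E)%E = (\int[mu]_(x in D) f x)%:E.
Proof. by move=> If; rewrite /Rintegral fineK// integrable_fin_num. Qed.

Lemma cvg_Rintegral_ae (f_ : nat -> T -> R) (f g : T -> R) :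
  (forall n, measurable_fun D (f_ n)) -> measurable_fun D f ->
  {ae mu, forall x, D x -> f_ n x @[n --> \oo] --> f x} ->
  mu.-integrable D (EFin \o g) ->
  (forall n x, D x -> `|f_ n x| <= g x) ->
  \int[mu]_(x in D) f_ n x @[n --> \oo] --> \int[mu]_(x in D) f x.
Proof.
move=> mf_ mf f_f ig fg.
have [iff _ h] : [/\ mu.-integrable D (EFin \o f),
    ((\int[mu]_(x in D) `|(f_ n x)%:E - (f x)%:E|)%E @[n --> \oo] --> 0%E) &
    ((\int[mu]_(x in D) (f_ n x)%:E)%E @[n --> \oo] -->
      (\int[mu]_(x in D) (f x)%:E)%E)].
  apply: (@dominated_convergence _ _ _ mu D mD (fun n x => (f_ n x)%:E)
            (EFin \o f) (EFin \o g)) => //.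
  - by move=> n; exact/measurable_EFinP.
  - exact/measurable_EFinP.
  - apply: filterS f_f => x h Dx; apply: cvg_EFin; last exact: h.
    by apply: nearW.
  - by apply: aeW => x n Dx; rewrite /= lee_fin fg.
move: h; rewrite EFin_Rintegral// => h.
by have := fine_cvg h; apply.
Qed.

Lemma cvg_Rintegral (f_ : nat -> T -> R) (f g : T -> R) :
  (forall n, measurable_fun D (f_ n)) ->
  (forall x, D x -> f_ n x @[n --> \oo] --> f x) ->
  mu.-integrable D (EFin \o g) ->
  (forall n x, D x -> `|f_ n x| <= g x) ->
  \int[mu]_(x in D) f_ n x @[n --> \oo] --> \int[mu]_(x in D) f x.
Proof.
move=> mf_ f_f ig fg; apply: cvg_Rintegral_ae ig fg => //.
- exact: measurable_fun_cvg f_f.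
- exact: aeW.
Qed.

Lemma le_normr_Rintegral_bounded (f : T -> R) (M : R) :
  mu D = 1%E -> measurable_fun D f -> (forall x, D x -> `|f x| <= M) ->
  `|\int[mu]_(x in D) f x| <= M.
Proof.
move=> muD mf fM.
have muDoo : (mu D < +oo)%E by rewrite muD ltry.
have i1 := bounded_integrable muDoo mf fM.
apply: (le_trans (le_normr_Rintegral mD i1)).
have -> : M = \int[mu]_(x in D) M by rewrite Rintegral_cst// muD mulr1.
apply: le_Rintegral => //.
- exact: integrable_norm.
- by apply: (bounded_integrable (M := `|M|)) => //.
Qed.

End real_integrals.

Section limits_at_infinity.
Context {R : realType}.

(** Dominated convergence and the laws of the path functionals are handled along sequences; this
    returns to the continuous time T. If the limit failed, points beyond every [n] at distance at
    least [e] would form a forbidden sequence. *)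
Lemma cvg_pinfty_seq (f : R -> R) (l : R) :
  (forall u : nat -> R, (forall n, 0 < u n) -> u n @[n --> \oo] --> +oo ->
     f (u n) @[n --> \oo] --> l) ->
  f x @[x --> +oo] --> l.
Proof.
move=> h; apply: contrapT => nfl.
have [e e0 he] : exists2 e : R, 0 < e &
    forall M : R, exists2 x, M < x & e <= `|l - f x|.
  apply: contrapT => nh; apply: nfl; apply/cvgrPdist_lt => e e0.
  have [M hM] : exists M : R, forall x, M < x -> `|l - f x| < e.
    apply: contrapT => nM; apply: nh; exists e => // M.
    apply: contrapT => nx; apply: nM; exists M => x Mx.
    by rewrite ltNge; apply/negP => ?; apply: nx; exists x.
  by exists M; split; [exact: num_real|exact: hM].
have /choice[u hu] : forall n : nat, exists x : R,
    (n%:R < x) /\ e <= `|l - f x|.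
  by move=> n; have [x ? ?] := he n%:R; exists x.
have u0 n : 0 < u n by rewrite (le_lt_trans _ (hu n).1).
have uoo : u n @[n --> \oo] --> +oo.
  apply/cvgryPge => A; near=> n; apply: (le_trans _ (ltW (hu n).1)).
  by near: n; exact: nbhs_infty_ger.
have /cvgrPdist_lt /(_ _ e0) [N _ hN] := h u u0 uoo.
by have := hN N (leqnn N); rewrite /= ltNge (hu N).2.
Unshelve. all: by end_near. Qed.

Lemma continuous_seq (f : R -> R) (x : R) :
  (forall u : nat -> R, u n @[n --> \oo] --> x -> f (u n) @[n --> \oo] --> f x) ->
  {for x, continuous f}.
Proof.
move=> h; apply: contrapT => nfl.
have [e e0 he] : exists2 e : R, 0 < e &
    forall n : nat, exists y, `|x - y| < n.+1%:R^-1 /\ e <= `|f x - f y|.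
  apply: contrapT => nh; apply: nfl; apply/cvgrPdist_lt => e e0.
  have [n hn] : exists n : nat, forall y, `|x - y| < n.+1%:R^-1 -> `|f x - f y| < e.
    apply: contrapT => nM; apply: nh; exists e => // n.
    apply: contrapT => nx; apply: nM; exists n => y xy.
    by rewrite ltNge; apply/negP => ?; apply: nx; exists y.
  by exists n.+1%:R^-1 => //=; rewrite ?invr_gt0// => y; exact: hn.
have /choice[u hu] := he.
have ux : u n @[n --> \oo] --> x.
  apply/cvgrPdist_lt => d d0; near=> n; apply: (lt_trans (hu n).1).
  by near: n; exact: near_infty_natSinv_lt (PosNum d0).
have /cvgrPdist_lt /(_ _ e0) [N _ hN] := h u ux.
by have := hN N (leqnn N); rewrite /= ltNge (hu N).2.
Unshelve. all: by end_near. Qed.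

End limits_at_infinity.

Section lebesgue_invariance.
Context {R : realType}.
Local Notation mu := (@lebesgue_measure R).

(** Lebesgue measure is determined by its values on half-open intervals, and there a translation
    only shifts both endpoints. *)
Lemma lebesgue_measureD (c : R) (A : set R) : measurable A ->
  pushforward mu ((fun x => x + c) : _ -> measurableTypeR R) A = mu A.
Proof.
move=> mA; apply/esym.
have mf : measurable_fun setT (fun x : measurableTypeR R => x + c : measurableTypeR R).
  by apply: measurable_funD => //.
pose phi : {mfun measurableTypeR R >-> measurableTypeR R} :=
  HB.pack (fun x : measurableTypeR R => x + c : measurableTypeR R)
    (isMeasurableFun.Build _ _ _ _ _ mf).
apply: (@lebesgue_measure_unique R (pushforward mu phi)) => //= _ [[a b]] _ <-.
rewrite /pushforward/=.
have -> : (fun x : R => x + c) @^-1` [set` `]a, b]] = [set` `]a - c, b - c]].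
  by apply/seteqP; split => x /=; rewrite !in_itv/= ltrBlDr lerBrDr.
rewrite !lebesgue_measure_itv/= !lte_fin ltrD2r.
by case: ifP => // _; rewrite -!EFinB; congr (_%:E); ring.
Qed.

Lemma ge0_integral_shift (c : R) (f : R -> R) :
  measurable_fun setT f -> (forall x, 0 <= f x) ->
  (\int[mu]_x (f (x + c))%:E = \int[mu]_x (f x)%:E)%E.
Proof.
move=> mf f0.
rewrite -[LHS](@ge0_integral_pushforward _ _ (measurableTypeR R) (measurableTypeR R) _
   ((fun x => x + c) : _ -> measurableTypeR R) _ (@lebesgue_measure R) setT (fun x => (f x)%:E))//.
- by apply: eq_measure_integral; first exact: measurable_funD; move=> mf' A mA _; exact: lebesgue_measureD.
- by apply: measurable_funD => //.
- exact/measurable_EFinP.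
- by move=> x _; rewrite lee_fin.
Qed.

Lemma ge0_integral_opp (f : R -> R) :
  measurable_fun setT f -> (forall x, 0 <= f x) ->
  (\int[mu]_x (f (- x))%:E = \int[mu]_x (f x)%:E)%E.
Proof.
move=> mf f0.
rewrite -[LHS](@ge0_integral_pushforward _ _ (measurableTypeR R) (measurableTypeR R) _
   (-%R : _ -> measurableTypeR R) _ (@lebesgue_measure R) setT (fun x => (f x)%:E))//.
- by apply: eq_measure_integral => //= A mA _; exact: lebesgue_measureN.
- exact/measurable_EFinP.
- by move=> x _; rewrite lee_fin.
Qed.

End lebesgue_invariance.

(** * Change of variables for nonnegative integrands *)

Section substitution.
Context {R : realType}.
Local Notation mu := (@lebesgue_measure R).

Lemma measurable_fun_itvcc_continuous (g : R -> R) (a b : R) :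
  (forall x, x \in `[a, b] -> {for x, continuous g}) ->
  measurable_fun (`[a, b] : set (measurableTypeR R)) g.
Proof.
move=> cg; apply: subspace_continuous_measurable_fun => //.
by apply: continuous_in_subspaceT => x /set_mem /cg.
Qed.

(** [D] and [E] may be unbounded and the integrals infinite: the substitution rule is applied on the
    compact intervals [[a n, b n]], which exhaust [D], and both sides pass to the limit by monotone
    convergence. *)
Lemma ge0_integral_substitution (F f G : R -> R) (D E : set R) (a b : nat -> R) :
  (forall x, D x -> is_derive x 1 F (f x)) ->
  (forall x, D x -> {for x, continuous f}) ->
  (forall x, D x -> 0 <= f x) ->
  (forall x y, D x -> D y -> x < y -> F x < F y) ->
  (forall n, a n <= b n) ->
  (forall n m, (n <= m)%N -> a m <= a n /\ b n <= b m) ->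
  D = \bigcup_n `[a n, b n]%classic -> E = \bigcup_n `[F (a n), F (b n)]%classic ->
  (forall y, E y -> {for y, continuous G}) ->
  (forall y, E y -> 0 <= G y) ->
  (\int[mu]_(y in E) (G y)%:E = \int[mu]_(x in D) (G (F x) * f x)%:E)%E.
Proof.
move=> dF cf f0 iF ab abm DE EE cG G0.
have Dn n x : x \in `[a n, b n] -> D x by move=> xn; rewrite DE; exists n.
have En n x : x \in `[F (a n), F (b n)] -> E x by move=> xn; rewrite EE; exists n.
have Da n : D (a n) by apply: (Dn n); rewrite in_itv/= lexx ab.
have Db n : D (b n) by apply: (Dn n); rewrite in_itv/= lexx ab.
have leF x y : D x -> D y -> x <= y -> F x <= F y.
  by move=> Dx Dy; rewrite le_eqVlt => /predU1P[->//|xy]; exact/ltW/iF.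
have cF x : D x -> {for x, continuous F}.
  by move=> Dx; apply: differentiable_continuous; apply/derivable1_diffP; have [] := dF x Dx.
have DF n x : x \in `[a n, b n] -> E (F x).
  move=> xn; apply: (En n); have Dx := Dn _ _ xn.
  by move: xn; rewrite !in_itv/= => /andP[ax xb]; rewrite !leF.
have dFE x : D x -> F^`()%classic x = f x.
  by move=> Dx; rewrite derive1E; have ? := dF x Dx; rewrite derive_val.
have cGFf n x : x \in `[a n, b n] -> {for x, continuous (fun x => G (F x) * f x)}.
  move=> xn; have Dx := Dn _ _ xn; apply: continuousM; last exact: cf.
  by apply: continuous_comp; [exact: cF|exact/cG/(DF n)].
have step n : (\int[mu]_(y in `[F (a n), F (b n)]) (G y)%:E =
    \int[mu]_(x in `[a n, b n]) (G (F x) * f x)%:E)%E.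
  (* The rule on compact intervals wants [a n < b n]; in the degenerate case both integrals are over
     a point. *)
  have [abn|] := ltP (a n) (b n); last first.
    move=> ba; have -> : b n = a n by apply/le_anti; rewrite ba ab.
    by rewrite !set_itv1 !integral_set1.
  have oDn x : x \in `]a n, b n[ -> D x.
    by move=> xn; apply: (Dn n); apply: subset_itv_oo_cc.
  rewrite (@integration_by_substitution_increasing R F G (a n) (b n))//.
  - by apply: eq_integral => x /set_mem /= xn; rewrite !fctE dFE//; apply: (Dn n).
  - by move=> x y /Dn Dx /Dn Dy; exact: iF.
  - move=> x xn; have Dx := oDn _ xn.
    have h : {for x, continuous f} by exact: cf.
    rewrite /continuous_at dFE//; apply: cvg_trans h; apply: near_eq_cvg.
    have : \forall y \near x, y \in `]a n, b n[ by exact: near_in_itvoo.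
    by apply: filterS => y /oDn Dy; rewrite dFE.
  - apply/cvg_ex; exists (f (a n)).
    have h : f x @[x --> (a n)^'+] --> f (a n) by apply: cvg_at_right_filter; exact/cf/Da.
    apply: cvg_trans h; apply: near_eq_cvg; near=> y; rewrite dFE//.
    by apply: oDn; rewrite in_itv/=; apply/andP; split; near: y;
      [exact: nbhs_right_gt|exact: nbhs_right_lt].
  - apply/cvg_ex; exists (f (b n)).
    have h : f x @[x --> (b n)^'-] --> f (b n) by apply: cvg_at_left_filter; exact/cf/Db.
    apply: cvg_trans h; apply: near_eq_cvg; near=> y; rewrite dFE//.
    by apply: oDn; rewrite in_itv/=; apply/andP; split; near: y;
      [exact: nbhs_left_gt|exact: nbhs_left_lt].
  - split.
    + by move=> x /oDn Dx; have [] := dF x Dx.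
    + apply: cvg_at_right_filter; exact: cF.
    + apply: cvg_at_left_filter; exact: cF.
  - apply: continuous_in_subspaceT => x /set_mem /= xn.
    exact/cG/(En n).
have ndD : nondecreasing_seq (fun n => `[a n, b n]%classic : set R).
  move=> n m nm; rewrite subsetEset; apply: subset_itvScc.
  - by rewrite bnd_simp; exact: (abm _ _ nm).1.
  - by rewrite bnd_simp; exact: (abm _ _ nm).2.
have ndE : nondecreasing_seq (fun n => `[F (a n), F (b n)]%classic : set R).
  move=> n m nm; have [h1 h2] := abm _ _ nm.
  by rewrite subsetEset; apply: subset_itvScc; rewrite bnd_simp leF.
have mG n := measurable_fun_itvcc_continuous (fun x xn => cG _ (En n x xn)).
have mGFf n := measurable_fun_itvcc_continuous (cGFf n).
have c1 : (\int[mu]_(y in `[F (a n), F (b n)]) (G y)%:E @[n --> \oo] -->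
     \int[mu]_(y in E) (G y)%:E)%E.
  rewrite EE; apply: (@ge0_nondecreasing_set_cvg_integral _ (measurableTypeR R) _
    (fun n => `[F (a n), F (b n)]%classic) (fun y => (G y)%:E) mu) => //.
  - by move=> n; apply/measurable_EFinP; exact: mG.
  - by move=> n x xn; rewrite lee_fin G0//; apply: (En n).
have c2 : (\int[mu]_(x in `[a n, b n]) (G (F x) * f x)%:E @[n --> \oo] -->
     \int[mu]_(x in D) (G (F x) * f x)%:E)%E.
  rewrite DE; apply: (@ge0_nondecreasing_set_cvg_integral _ (measurableTypeR R) _
    (fun n => `[a n, b n]%classic) (fun x => (G (F x) * f x)%:E) mu) => //.
  - by move=> n; apply/measurable_EFinP; exact: mGFf.
  - move=> n x xn; rewrite lee_fin mulr_ge0//; first exact/G0/(DF n).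
    exact/f0/(Dn n).
apply/(cvg_unique _ c1)/(cvg_trans _ c2) => //.
by apply: near_eq_cvg; apply: nearW => n; rewrite step.
Unshelve. all: by end_near. Qed.

End substitution.

(** * Automation for limits and derivatives *)

Section limit_rules.
Context {T : Type} {R : realType} (F : set_system T) {FF : Filter F}.
Implicit Types (f g : T -> R) (l k : R).

Lemma cvg_comp_continuous (h : R -> R) f l :
  {for l, continuous h} -> f x @[x --> F] --> l -> h (f x) @[x --> F] --> h l.
Proof. by move=> ch fl; apply: (cvg_comp f h fl); exact: ch. Qed.

(* A synonym of convergence on which [cvg_tac] can match syntactically. *)
Definition tends_to f l : Prop := f x @[x --> F] --> l.

Lemma tends_toP f l : tends_to f l -> f x @[x --> F] --> l.
Proof. by []. Qed.

Lemma tends_to_cst l : tends_to (fun=> l) l.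
Proof. exact: cvg_cst. Qed.

Lemma tends_toD f g l k : tends_to f l -> tends_to g k -> tends_to (fun x => f x + g x) (l + k).
Proof. exact: cvgD. Qed.

Lemma tends_toN f l : tends_to f l -> tends_to (fun x => - f x) (- l).
Proof. exact: cvgN. Qed.

Lemma tends_toM f g l k : tends_to f l -> tends_to g k -> tends_to (fun x => f x * g x) (l * k).
Proof. exact: cvgM. Qed.

Lemma tends_toX f l n : tends_to f l -> tends_to (fun x => f x ^+ n) (l ^+ n).
Proof.
move=> fl; elim: n => [|n ih].
  by rewrite expr0 (_ : (fun _ => _) = fun=> 1); [exact: tends_to_cst|apply/funext => x; rewrite expr0].
rewrite exprS (_ : (fun _ => _) = fun x => f x * f x ^+ n); first exact: tends_toM.
by apply/funext => x; rewrite exprS.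
Qed.

Lemma tends_toV f l : l != 0 -> tends_to f l -> tends_to (fun x => (f x)^-1) l^-1.
Proof. by move=> l0 fl; exact: cvgV. Qed.

Lemma tends_to_expR f l : tends_to f l -> tends_to (fun x => expR (f x)) (expR l).
Proof. by apply: cvg_comp_continuous; exact: continuous_expR. Qed.

Lemma tends_to_cos f l : tends_to f l -> tends_to (fun x => cos (f x)) (cos l).
Proof. by apply: cvg_comp_continuous; exact: continuous_cos. Qed.

Lemma tends_to_sin f l : tends_to f l -> tends_to (fun x => sin (f x)) (sin l).
Proof. by apply: cvg_comp_continuous; exact: continuous_sin. Qed.

Lemma tends_to_norm f l : tends_to f l -> tends_to (fun x => `|f x|) `|l|.
Proof. exact: cvg_norm. Qed.

Lemma tends_to_powR f l p : 0 < l -> tends_to f l -> tends_to (fun x => f x `^ p) (l `^ p).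
Proof.
move=> l0; apply: (@cvg_comp_continuous (fun x => x `^ p)).
apply: differentiable_continuous; apply/derivable1_diffP.
by apply: derivable_powR; rewrite in_itv/= l0.
Qed.

Lemma tends_to_cosh f l : tends_to f l -> tends_to (fun x => Defs.cosh (f x)) (Defs.cosh l).
Proof.
move=> fl; apply: tends_toM; last exact: tends_to_cst.
by apply: tends_toD; apply: tends_to_expR => //; exact: tends_toN.
Qed.

End limit_rules.

(** Descends through the syntax of the function and leaves as goals the nonvanishing of
    denominators, the positivity of bases of powers, and the leaves that no assumption closes. *)
Ltac cvg_loop := cbv beta; lazymatch goal with
  | |- tends_to _ (fun _ => ?c) _ => exact: tends_to_cst
  | |- tends_to _ (fun y => y) _ => try first [assumption | by move=> ? ?]
  | |- @tends_to ?T ?R ?F (fun y => @GRing.add _ (@?f y) (@?g y)) _ =>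
      refine (@tends_toD T R F _ f g _ _ _ _); cvg_loop
  | |- @tends_to ?T ?R ?F (fun y => @GRing.opp _ (@?f y)) _ =>
      refine (@tends_toN T R F _ f _ _); cvg_loop
  | |- @tends_to ?T ?R ?F (fun y => @GRing.mul _ (@?f y) (@?g y)) _ =>
      refine (@tends_toM T R F _ f g _ _ _ _); cvg_loop
  | |- @tends_to ?T ?R ?F (fun y => @GRing.exp _ (@?f y) ?n) _ =>
      refine (@tends_toX T R F _ f _ n _); cvg_loop
  | |- @tends_to ?T ?R ?F (fun y => @GRing.inv _ (@?f y)) _ =>
      refine (@tends_toV T R F _ f _ _ _); [|cvg_loop]
  | |- @tends_to ?T ?R ?F (fun y => expR (@?f y)) _ =>
      refine (@tends_to_expR T R F f _ _); cvg_loop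
  | |- @tends_to ?T ?R ?F (fun y => cos (@?f y)) _ =>
      refine (@tends_to_cos T R F f _ _); cvg_loop
  | |- @tends_to ?T ?R ?F (fun y => sin (@?f y)) _ =>
      refine (@tends_to_sin T R F f _ _); cvg_loop
  | |- @tends_to ?T ?R ?F (fun y => Defs.cosh (@?f y)) _ =>
      refine (@tends_to_cosh T R F _ f _ _); cvg_loop
  | |- @tends_to ?T ?R ?F (fun y => @Num.norm _ _ (@?f y)) _ =>
      refine (@tends_to_norm T R F _ f _ _); cvg_loop
  | |- @tends_to ?T ?R ?F (fun y => powR (@?f y) ?p) _ =>
      refine (@tends_to_powR T R F f _ p _ _); [|cvg_loop]
  | |- tends_to ?F ?f ?l => try (first [assumption | change (f x @[x --> F] --> l)])
  end.

Ltac cvg_tac := apply: tends_toP;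
  lazymatch goal with
  | |- @tends_to ?T ?R ?F ?f ?l => change (@tends_to T R F (fun y => f y) l)
  end; cvg_loop; try assumption.

Section derivative_rules.
Context {R : realType}.
Implicit Types (f g : R -> R) (x a b c : R).

Lemma is_derive_fun_cst c x : is_derive x 1 (fun=> c : R) 0.
Proof. exact: is_derive_cst. Qed.

Lemma is_derive_fun_id x : is_derive x 1 (fun y : R => y) 1.
Proof. exact: is_derive_id. Qed.

Lemma is_derive_funD f g x a b : is_derive x 1 f a -> is_derive x 1 g b ->
  is_derive x 1 (fun y => f y + g y) (a + b).
Proof. exact: is_deriveD. Qed.

Lemma is_derive_funN f x a : is_derive x 1 f a -> is_derive x 1 (fun y => - f y) (- a).
Proof. exact: is_deriveN. Qed.

Lemma is_derive_funM f g x a b : is_derive x 1 f a -> is_derive x 1 g b ->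
  is_derive x 1 (fun y => f y * g y) (f x * b + g x * a).
Proof. exact: is_deriveM. Qed.

Lemma is_derive_fun_expR f x a : is_derive x 1 f a ->
  is_derive x 1 (fun y => expR (f y)) (expR (f x) * a).
Proof. by move=> fa; exact: is_derive1_comp. Qed.

End derivative_rules.

Ltac derive_tac := repeat first
  [ eassumption | exact: is_derive_fun_cst | exact: is_derive_fun_id
  | eapply is_derive_fun_expR | eapply is_derive_funN
  | eapply is_derive_funD | eapply is_derive_funM ].

(** * Bessel and Gamma integrals *)

Section special_integrals.
Context {R : realType}.
Local Notation mu := (@lebesgue_measure R).
Implicit Types (c s u v x y z nu : R).

Lemma powRE x p : 0 < x -> x `^ p = expR (p * ln x).
Proof. by move=> x0; rewrite /powR gt_eqF. Qed.

Lemma bigcup_sym_itv : [set: R] = \bigcup_n `[- n%:R, n%:R]%classic.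
Proof.
apply/seteqP; split => // x _; exists (Num.truncn `|x|).+1 => //=.
by rewrite in_itv/= -ler_norml ltW// truncnS_gt.
Qed.

Lemma sym_itv_homo (n m : nat) : (n <= m)%N -> - m%:R <= - n%:R :> R /\ n%:R <= m%:R :> R.
Proof. by move=> nm; rewrite lerN2 ler_nat. Qed.

(** The exponential carries the intervals [[-n, n]] onto compact intervals that exhaust the
    half-line. The free scale [c] is chosen later so as to make exponents symmetric in [v]. *)
Lemma ge0_integral_exp_substitution c (G : R -> R) : 0 < c ->
  (forall y, 0 < y -> {for y, continuous G}) -> (forall y, 0 < y -> 0 <= G y) ->
  (\int[mu]_(y in `]0%R, +oo[) (G y)%:E =
   \int[mu]_v (G (c * expR v) * (c * expR v))%:E)%E.
Proof.
move=> c0 cG G0.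
apply: (@ge0_integral_substitution R (fun v => c * expR v) (fun v => c * expR v) G setT
  _ (fun n => - n%:R) (fun n => n%:R)) => //.
- by move=> x _; cvg_tac.
- by move=> x _; rewrite mulr_ge0 ?expR_ge0// ltW.
- by move=> x y _ _ xy; rewrite ltr_pM2l// ltr_expR.
- by move=> n; rewrite (@le_trans _ _ 0)// oppr_le0.
- exact: sym_itv_homo.
- exact: bigcup_sym_itv.
- apply/seteqP; split => y /=.
    rewrite in_itv/= andbT => y0; have yc : 0 < y / c by rewrite divr_gt0.
    have [n] : exists n : nat, `|ln (y / c)| <= n%:R.
      by exists (Num.truncn `|ln (y / c)|).+1; rewrite ltW// truncnS_gt.
    rewrite ler_norml => /andP[h1 h2]; exists n => //=.
    have e1 : expR (- n%:R) <= y / c by rewrite -[leRHS](lnK yc) ler_expR.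
    have e2 : y / c <= expR n%:R by rewrite -[leLHS](lnK yc) ler_expR.
    by rewrite in_itv/= -ler_pdivrMl// -ler_pdivlMl// [c^-1 * y]mulrC e1 e2.
  by move=> [n _] /=; rewrite !in_itv/= andbT => /andP[h _]; rewrite (lt_le_trans _ h)// mulr_gt0// expR_gt0.
- by move=> y /=; rewrite in_itv/= andbT; exact: cG.
- by move=> y /=; rewrite in_itv/= andbT; exact: G0.
Qed.

Lemma bigcup_pos_itv : `]0%R, +oo[%classic = \bigcup_n `[n.+1%:R^-1, n.+1%:R]%classic :> set R.
Proof.
apply/seteqP; split => x /=.
  rewrite in_itv/= andbT => x0.
  pose N := maxn (Num.truncn x) (Num.truncn x^-1); exists N => //=.
  rewrite in_itv/= -(invrK x) lef_pV2 ?posrE ?invr_gt0// invrK; apply/andP; split.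
    apply: (le_trans (ltW (truncnS_gt _))); rewrite ler_nat ltnS; exact: leq_maxr.
  apply: (le_trans (ltW (truncnS_gt _))); rewrite ler_nat ltnS; exact: leq_maxl.
by move=> [n _] /=; rewrite !in_itv/= andbT => /andP[h _]; rewrite (lt_le_trans _ h).
Qed.

Lemma pos_itv_homo (n m : nat) : (n <= m)%N ->
  m.+1%:R^-1 <= n.+1%:R^-1 :> R /\ n.+1%:R <= m.+1%:R :> R.
Proof. by move=> nm; rewrite lef_pV2 ?posrE// ler_nat ltnS. Qed.

Lemma ge0_integral_scale_substitution c (G : R -> R) : 0 < c ->
  (forall y, 0 < y -> {for y, continuous G}) -> (forall y, 0 < y -> 0 <= G y) ->
  (\int[mu]_(y in `]0%R, +oo[) (G y)%:E =
   \int[mu]_(y in `]0%R, +oo[) (G (c * y) * c)%:E)%E.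
Proof.
move=> c0 cG G0.
apply: (@ge0_integral_substitution R (fun v => c * v) (fun v => c) G _
  _ (fun n => n.+1%:R^-1) (fun n => n.+1%:R)) => //.
- by move=> x _; eapply is_derive_eq; [derive_tac|rewrite /=; ring].
- by move=> x _; cvg_tac.
- by move=> x _; rewrite ltW.
- by move=> x y _ _ xy; rewrite ltr_pM2l.
- by move=> n; rewrite (@le_trans _ _ 1)// ?invf_le1// ler1n.
- exact: pos_itv_homo.
- exact: bigcup_pos_itv.
- apply/seteqP; split => y /=.
    rewrite in_itv/= andbT => y0; have yc : 0 < y / c by rewrite divr_gt0.
    have : `]0%R, +oo[%classic (y / c) by rewrite /= in_itv/= andbT.
    rewrite bigcup_pos_itv => -[n _] /=; rewrite in_itv/= => /andP[h1 h2]; exists n => //=.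
    by rewrite in_itv/= -ler_pdivrMl// -ler_pdivlMl// [c^-1 * y]mulrC h1 h2.
  by move=> [n _] /=; rewrite !in_itv/= andbT => /andP[h _]; rewrite (lt_le_trans _ h)// mulr_gt0.
- by move=> y /=; rewrite in_itv/= andbT; exact: cG.
- by move=> y /=; rewrite in_itv/= andbT; exact: G0.
Qed.

(** Meant for the product of [ou_kernel] at [y] and [y + u], whose power factor depends on
    [y * (y + u)]. The Jacobian [2 * y + u] will be supplied by the factor 1/a of
    [integral_inverse_gaussian]. *)
Lemma ge0_integral_quadratic_substitution u (G : R -> R) : 0 <= u ->
  (forall y, 0 < y -> {for y, continuous G}) -> (forall y, 0 < y -> 0 <= G y) ->
  (\int[mu]_(y in `]0%R, +oo[) (G y)%:E =
   \int[mu]_(y in `]0%R, +oo[) (G (y * (y + u)) * (2 * y + u))%:E)%E.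
Proof.
move=> u0 cG G0.
have mono x y : 0 < x -> x <= y -> x * (x + u) <= y * (y + u).
  by move=> x0 xy; apply: ler_pM => //; [exact: ltW|apply: addr_ge0 => //; exact: ltW|rewrite lerD2r].
apply: (@ge0_integral_substitution R (fun y => y * (y + u)) (fun y => 2 * y + u) G _
  _ (fun n => n.+1%:R^-1) (fun n => n.+1%:R)) => //.
- by move=> x _; eapply is_derive_eq; [derive_tac|rewrite /=; ring].
- by move=> x _; cvg_tac.
- by move=> x /=; rewrite in_itv/= andbT => x0; rewrite addr_ge0// mulr_ge0// ltW.
- move=> x y /=; rewrite !in_itv/= !andbT => x0 y0 xy.
  by apply: ltr_pM => //; [exact: ltW|rewrite addr_ge0// ltW|rewrite ltrD2r].
- by move=> n; rewrite (@le_trans _ _ 1)// ?invf_le1// ler1n.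
- exact: pos_itv_homo.
- exact: bigcup_pos_itv.
- apply/seteqP; split => y /=; last first.
    move=> [n _] /=; rewrite !in_itv/= andbT => /andP[h _]; rewrite (lt_le_trans _ h)// mulr_gt0//.
    by rewrite ltr_wpDr.
  rewrite in_itv/= andbT => y0.
  (* Points on either side of the preimage of [y]: m (m + u) <= m (1 + u) <= y, and M (M + u) >= M
     >= y. *)
  pose m := Num.min 1 (y / (1 + u)); pose M := Num.max 1 y.
  have u1 : 0 < 1 + u by rewrite ltr_pwDl.
  have m0 : 0 < m by rewrite lt_min ltr01 divr_gt0.
  have M0 : 0 < M by rewrite lt_max ltr01.
  have : `]0%R, +oo[%classic m by rewrite /= in_itv/= m0.
  rewrite bigcup_pos_itv => -[n _] /=; rewrite in_itv/= => /andP[h1 _].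
  have : `]0%R, +oo[%classic M by rewrite /= in_itv/= M0.
  rewrite bigcup_pos_itv => -[k _] /=; rewrite in_itv/= => /andP[_ h2].
  exists (maxn n k) => //=; rewrite in_itv/=; apply/andP; split.
    apply: (@le_trans _ _ (m * (m + u))).
      apply: mono => //; apply: le_trans h1.
      by apply: (pos_itv_homo _).1; exact: leq_maxl.
    have m1 : m <= 1 by rewrite ge_min lexx.
    have m2 : m <= y / (1 + u) by rewrite ge_min lexx orbT.
    apply: (@le_trans _ _ (m * (1 + u))); first by rewrite ler_wpM2l ?lerD2r// ltW.
    by rewrite -ler_pdivlMr.
  apply: (@le_trans _ _ (M * (M + u))); last first.
    apply: mono => //; apply: (le_trans h2).
    by apply: (pos_itv_homo _).2; exact: leq_maxr.
  have M1 : 1 <= M by rewrite le_max lexx.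
  have M2 : y <= M by rewrite le_max lexx orbT.
  by apply: (le_trans M2); rewrite -[leLHS]mulr1 ler_wpM2l ?(ltW M0)// ler_wpDr.
- by move=> y /=; rewrite in_itv/= andbT; exact: cG.
- by move=> y /=; rewrite in_itv/= andbT; exact: G0.
Qed.

End special_integrals.

Section bessel_integrals.
Context {R : realType}.
Local Notation mu := (@lebesgue_measure R).
Implicit Types (c s u v x y z nu : R).

Lemma coshN x : Defs.cosh (- x) = Defs.cosh x.
Proof. by rewrite /Defs.cosh opprK addrC. Qed.

Lemma cosh_gt0 x : 0 < Defs.cosh x.
Proof. by rewrite /Defs.cosh divr_gt0// addr_gt0// expR_gt0. Qed.

Lemma continuous_cosh : continuous (@Defs.cosh R).
Proof. by move=> x; rewrite /Defs.cosh; cvg_tac. Qed.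

Lemma continuous_scale (k : R) : continuous (fun v : R => k * v).
Proof. by move=> x; cvg_tac. Qed.

(** The reflection v |-> -v preserves the integral and turns e^(kv) into e^(-kv); averaging the two
    forms gives the hyperbolic cosine. *)
Lemma integral_expR_even (k : R) (g : R -> R) : continuous g ->
  (forall v, 0 <= g v) -> (forall v, g (- v) = g v) ->
  (\int[mu]_v (expR (k * v) * g v)%:E = \int[mu]_v (Defs.cosh (k * v) * g v)%:E)%E.
Proof.
move=> cg g0 ge; pose f v := expR (k * v) * g v.
have cf : continuous f by move=> v; apply: cvgM; [cvg_tac|exact: cg].
have mf : measurable_fun setT f by exact: continuous_measurable_fun.
have f0 v : 0 <= f v by rewrite mulr_ge0 ?expR_ge0.
have mfN : measurable_fun setT (fun v => f (- v)).
  apply: continuous_measurable_fun => v; apply: continuous_comp; first exact: continuousN.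
  exact: cf.
have -> : (\int[mu]_v (Defs.cosh (k * v) * g v)%:E =
    \int[mu]_v ((2^-1)%:E * ((f v)%:E + (f (- v))%:E)))%E.
  apply: eq_integral => v _; rewrite -EFinD -EFinM; congr EFin.
  by rewrite /f /Defs.cosh ge mulrN; field.
rewrite ge0_integralZl//=; last 2 first.
  by apply: emeasurable_funD; apply/measurable_EFinP.
  by move=> v _; rewrite adde_ge0// lee_fin.
rewrite ge0_integralD//=; last 4 first.
- by move=> v _; rewrite lee_fin.
- exact/measurable_EFinP.
- by move=> v _; rewrite lee_fin.
- exact/measurable_EFinP.
rewrite ge0_integral_opp//.
rewrite -mule2n -(@mule_natl R _ 2) muleA -EFinM mulVf ?mul1e//.
Qed.

(** The exponential substitution produces integrals over the whole line; by evenness such an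
    integral is twice the one that defines [besselK]. *)
Lemma integral_besselK_full nu z : 
  (\int[mu]_v (expR (nu * v) * expR (- (z * Defs.cosh v)))%:E =
   2%:E * \int[mu]_(u in `[0%R, +oo[) (expR (- (z * Defs.cosh u)) * Defs.cosh (nu * u))%:E)%E.
Proof.
have cg : continuous (fun v : R => expR (- (z * Defs.cosh v))).
  by move=> v; cvg_tac; exact: continuous_cosh.
rewrite (integral_expR_even _ cg); last 2 first.
- by move=> v; rewrite expR_ge0.
- by move=> v; rewrite coshN.
rewrite ge0_symfun_integralT; last 3 first.
- by move=> v; rewrite mulr_ge0 ?expR_ge0// ltW// cosh_gt0.
- move=> v; apply: cvgM; last exact: cg.
  by apply: cvg_comp_continuous; [exact: continuous_cosh|exact: continuous_scale].
- by move=> v /=; rewrite mulrN !coshN.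
congr (_ * _)%E; rewrite set_itvcy.
by apply: eq_integral => v _; rewrite mulrC.
Qed.

Lemma cosh_sinh_half v : Defs.cosh v = 1 + 2 * ((expR (v / 2) - expR (- (v / 2))) / 2) ^+ 2.
Proof.
rewrite /Defs.cosh; have {1}-> : v = v / 2 + v / 2 by field.
have -> : expR (- v) = expR (- (v / 2)) * expR (- (v / 2)) by rewrite -expRD; congr expR; field.
rewrite expRD; have h : expR (v / 2) * expR (- (v / 2)) = 1 by rewrite -expRD subrr expR0.
rewrite expr2.
have -> : (2 * ((expR (v / 2) - expR (- (v / 2))) / 2 * ((expR (v / 2) - expR (- (v / 2))) / 2))) =
  (expR (v / 2) * expR (v / 2) + expR (- (v / 2)) * expR (- (v / 2)) - 2 * (expR (v / 2) * expR (- (v / 2)))) / 2 by field.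
by rewrite h; field.
Qed.

(** At order 1/2 the Bessel function is elementary: 2 K_(1/2)(z) = sqrt (2 pi / z) e^(-z). As z cosh
    v = z + 2 z sinh^2 (v/2), the substitution y = sqrt (2 z) sinh (v/2) yields the Gaussian
    integral. *)
Lemma integral_besselK_half z : 0 < z ->
  (\int[mu]_v (Defs.cosh (2^-1 * v) * expR (- (z * Defs.cosh v)))%:E =
   (2 / Num.sqrt (2 * z) * expR (- z) * Num.sqrt pi)%:E)%E.
Proof.
move=> z0; pose k : R := Num.sqrt (2 * z).
have k0 : 0 < k by rewrite sqrtr_gt0 mulr_gt0.
have k2 : k ^+ 2 = 2 * z by rewrite sqr_sqrtr// ltW// mulr_gt0.
pose sh v : R := (expR (v / 2) - expR (- (v / 2))) / 2.
have incr_sh x y : x < y -> sh x < sh y.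
  move=> xy; rewrite ltr_pM2r// ltrB// ltr_expR ?ltrN2 ltr_pM2r//.
have -> : (\int[mu]_v (Defs.cosh (2^-1 * v) * expR (- (z * Defs.cosh v)))%:E =
  \int[mu]_v ((2 / k * expR (- z))%:E * (gauss_fun (k * sh v) * (k * (Defs.cosh (2^-1 * v) / 2)))%:E))%E.
  apply: eq_integral => v _; rewrite -EFinM; congr EFin; rewrite /gauss_fun exprMn k2.
  have -> : - (2 * z * sh v ^+ 2) = z - z * Defs.cosh v.
    by rewrite cosh_sinh_half -/(sh v); ring.
  rewrite expRD; have e : expR (- z) * expR z = 1 by rewrite -expRD addrC subrr expR0.
  transitivity (expR (- z) * expR z * (Defs.cosh (2^-1 * v) * expR (- (z * Defs.cosh v)))).
    by rewrite e mul1r.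
  by field; rewrite gt_eqF.
have cc : continuous (fun v => k * (Defs.cosh (2^-1 * v) / 2)).
  by move=> v; cvg_tac.
have csh : continuous (fun v => k * sh v) by move=> v; rewrite /sh; cvg_tac.
have kc0 v : 0 <= k * (Defs.cosh (2^-1 * v) / 2).
  by rewrite mulr_ge0 ?(ltW k0)// divr_ge0// ltW// cosh_gt0.
rewrite ge0_integralZl//=; last 3 first.
- apply/measurable_EFinP; apply: continuous_measurable_fun => v; apply: cvgM; last exact: cc.
  by apply: (cvg_comp_continuous (@continuous_gauss_fun R _)); exact: csh.
- by move=> v _; rewrite lee_fin mulr_ge0// gauss_fun_ge0.
- by rewrite lee_fin mulr_ge0 ?expR_ge0// divr_ge0// ltW.
have <- : (\int[mu]_x (gauss_fun x)%:E =
    \int[mu]_v (gauss_fun (k * sh v) * (k * (Defs.cosh (2^-1 * v) / 2)))%:E)%E; last first.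
  by rewrite integralT_gauss -EFinM.
apply: (@ge0_integral_substitution R (fun v => k * sh v)
  (fun v => k * (Defs.cosh (2^-1 * v) / 2)) gauss_fun setT setT
  (fun n => - n%:R) (fun n => n%:R)) => //.
- move=> x _; rewrite /sh; eapply is_derive_eq; first by derive_tac.
  by rewrite /= /Defs.cosh [2^-1 * x]mulrC; field.
- by move=> x _; exact: cc.
- by move=> x y _ _ xy; rewrite ltr_pM2l// incr_sh.
- by move=> n; rewrite (@le_trans _ _ 0)// oppr_le0.
- exact: sym_itv_homo.
- exact: bigcup_sym_itv.
- apply/esym/seteqP; split => // y _.
  (* That is, sinh (n/2) >= n/4, so that the images of [[-n, n]] exhaust the line. *)
  have lesh (n : nat) : n%:R / 2 <= sh n%:R * 2.
    rewrite /sh divfK//.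
    have := expR_ge1Dx (n%:R / 2 : R).
    have : expR (- (n%:R / 2)) <= 1 :> R by rewrite expR_le1 oppr_le0 divr_ge0.
    by move=> *; lra.
  exists (Num.truncn (`|y| / k * 4)).+1 => //=.
  set N := (Num.truncn _).+1.
  have hN : `|y| <= k * sh N%:R.
    have : `|y| / k * 4 <= N%:R by rewrite ltW// truncnS_gt.
    have := lesh N => h1 h2.
    have : `|y| / k <= sh N%:R by lra.
    by rewrite ler_pdivrMr// mulrC.
  have shN : sh (- N%:R) = - sh N%:R by rewrite /sh mulNr opprK; ring.
  by rewrite in_itv/= shN mulrN -ler_norml.
- by move=> y _; exact: continuous_gauss_fun.
- by move=> y _; exact: gauss_fun_ge0.
Qed.

(* The Laplace transform of the inverse Gaussian density. *)
Lemma integral_inverse_gaussian a l : 0 < a -> 0 < l ->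
  (\int[mu]_(s in `]0%R, +oo[)
     (s `^ (- 2^-1) * expR (- (l ^+ 2 / (4 * s) + a ^+ 2 * s)))%:E =
   (Num.sqrt pi / a * expR (- (l * a)))%:E)%E.
Proof.
(* This scale makes the two terms of the exponent (l a / 2) e^(-v) and (l a / 2) e^v; their sum is l
   a cosh v, and [integral_besselK_half] applies. *)
move=> a0 l0; pose c := l / (2 * a); have c0 : 0 < c by rewrite divr_gt0// mulr_gt0.
rewrite (ge0_integral_exp_substitution c0); last 2 first.
- move=> y y0; apply: cvgM; first by cvg_tac.
  by cvg_tac; rewrite mulf_neq0// gt_eqF.
- by move=> y y0; rewrite mulr_ge0 ?powR_ge0 ?expR_ge0.
have -> : (\int[mu]_v ((c * expR v) `^ (- 2^-1) *
    expR (- (l ^+ 2 / (4 * (c * expR v)) + a ^+ 2 * (c * expR v))) * (c * expR v))%:E =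
  \int[mu]_v ((Num.sqrt c)%:E * (expR (2^-1 * v) * expR (- (l * a * Defs.cosh v)))%:E))%E.
  apply: eq_integral => v _; rewrite -EFinM; congr EFin.
  have e0 := expR_gt0 v.
  have -> : l ^+ 2 / (4 * (c * expR v)) + a ^+ 2 * (c * expR v) = l * a * Defs.cosh v.
    rewrite /Defs.cosh expRN /c; field.
    by rewrite !gt_eqF.
  rewrite mulrAC [RHS]mulrA; congr (_ * _).
  have x0 : 0 < c * expR v by rewrite mulr_gt0.
  rewrite -{2}[c * expR v]powRr1 ?(ltW x0)// -powRD; last by rewrite (gt_eqF x0) implybT.
  have -> : - 2^-1 + 1 = 2^-1 :> R by field.
  by rewrite powRM ?expR_ge0 ?(ltW c0)// powR12_sqrt ?(ltW c0)// -expRM [v * _]mulrC.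
rewrite ge0_integralZl//=; last first.
- apply/measurable_EFinP; apply: continuous_measurable_fun => v; cvg_tac; exact: continuous_cosh.
rewrite integral_expR_even; last 3 first.
- by move=> v; cvg_tac; exact: continuous_cosh.
- by move=> v; rewrite expR_ge0.
- by move=> v; rewrite coshN.
rewrite integral_besselK_half ?mulr_gt0// -EFinM; congr EFin.
have -> : 2 * (l * a) = c * (2 * a) ^+ 2 by rewrite /c; field; rewrite gt_eqF.
rewrite (@sqrtrM _ c ((2 * a) ^+ 2)) ?(ltW c0)// sqrtr_sqr ger0_norm; last by rewrite mulr_ge0// ltW.
by field; rewrite !gt_eqF// sqrtr_gt0.
Qed.

End bessel_integrals.

Section measurability_lemmas.
Context {R : realType}.

(** The continuous functions x / (x^2 + 1/(n+1)) converge to the inverse everywhere, also at 0,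
    where both sides are 0. *)
Lemma measurable_invr : measurable_fun setT (fun x : R => x^-1).
Proof.
apply: (@measurable_fun_cvg _ _ _ setT (fun (n : nat) (x : R) => x / (x ^+ 2 + n.+1%:R^-1))).
  move=> n; apply: continuous_measurable_fun => x.
  apply: cvgM; first exact: cvg_id.
  apply: cvgV; first by rewrite gt_eqF// ltr_wpDl// sqr_ge0.
  by apply: cvgD; [apply: cvgM; exact: cvg_id|exact: cvg_cst].
move=> x _; have [->|x0] := eqVneq x 0.
  by under eq_fun do rewrite mul0r; rewrite invr0; exact: cvg_cst.
suff : x / (x ^+ 2 + n.+1%:R^-1) @[n --> \oo] --> x / (x ^+ 2 + 0).
  by rewrite addr0 expr2 invfM mulVKf.
apply: cvgM; first exact: cvg_cst.
apply: cvgV; first by rewrite addr0 sqrf_eq0.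
apply: cvgD; first exact: cvg_cst.
exact: cvg_harmonic.
Qed.

Context d (T : measurableType d) (D : set T).
Implicit Types f g : T -> R.

Lemma measurable_fun_inv f : measurable_fun D f -> measurable_fun D (fun x => (f x)^-1).
Proof. exact: (measurableT_comp measurable_invr). Qed.

Lemma measurable_fun_expR f : measurable_fun D f -> measurable_fun D (fun x => expR (f x)).
Proof. exact: (measurableT_comp (@measurable_expR R)). Qed.

Lemma measurable_fun_cos f : measurable_fun D f -> measurable_fun D (fun x => cos (f x)).
Proof.
by apply: measurableT_comp; apply: continuous_measurable_fun; exact: continuous_cos.
Qed.

Lemma measurable_fun_sin f : measurable_fun D f -> measurable_fun D (fun x => sin (f x)).
Proof.
by apply: measurableT_comp; apply: continuous_measurable_fun; exact: continuous_sin.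
Qed.

Lemma measurable_fun_powR f p : measurable_fun D f -> measurable_fun D (fun x => f x `^ p).
Proof. move=> mf; exact: (measurableT_comp (measurable_powR p) mf). Qed.

Lemma measurable_fun_norm f : measurable_fun D f -> measurable_fun D (fun x => `|f x|).
Proof. move=> mf; exact: (measurableT_comp (@normr_measurable R setT) mf). Qed.

Lemma measurable_fun_indic f (A : set R) : measurable A ->
  measurable_fun D f -> measurable_fun D (fun x => \1_A (f x) : R).
Proof. by move=> mA; apply: measurableT_comp; exact: measurable_indic. Qed.

End measurability_lemmas.

Ltac meas_tac := repeat first
  [ assumption | exact: measurable_cst | exact: measurable_id | exact: measurable_fst | exact: measurable_snd
  | apply: measurable_funD | apply: measurable_funB | apply: measurable_funN | apply: measurable_funM
  | apply: measurable_fun_expR | apply: measurable_fun_powR | apply: measurable_fun_inv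
  | apply: measurable_fun_cos | apply: measurable_fun_sin | apply: measurable_fun_norm
  | apply: measurable_funX | (apply: measurable_fun_indic; first by []) ].

Section gamma_integral.
Context {R : realType}.
Local Notation mu := (@lebesgue_measure R).
Implicit Types (s u v x y z nu b : R).

Lemma integral_expRN b : 0 < b ->
  (\int[mu]_(x in `[0%R, +oo[) (expR (- (b * x)))%:E = (b^-1)%:E)%E.
Proof.
move=> b0.
have dF x : is_derive x 1 (fun x => - b^-1 * expR (- (b * x))) (expR (- (b * x))).
  eapply is_derive_eq; first by derive_tac.
  by rewrite /=; field; rewrite gt_eqF.
rewrite (@ge0_continuous_FTC2y _ _ (fun x => - b^-1 * expR (- (b * x))) 0 0).
- by rewrite mulr0 oppr0 expR0 mulr1 -EFinB sub0r opprK.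
- by move=> x _; exact: expR_ge0.
- by apply: continuous_subspaceT => x; cvg_tac.
- rewrite -[X in _ --> X](mulr0 (- b^-1)); apply: cvgM; first exact: cvg_cst.
  apply: (cvg_comp (fun x => b * x) (fun x => expR (- x))); last exact: cvgr_expR.
  apply/cvgryPge => A; near=> x; rewrite -ler_pdivrMl//; near: x; exact: nbhs_pinfty_ge.
- by move=> x _; have [] := dF x.
- by apply: cvg_at_right_filter; cvg_tac.
- by move=> x _; rewrite derive1E; have ? := dF x; rewrite derive_val.
Unshelve. all: by end_near. Qed.

Lemma integral_expRN_norm b : 0 < b ->
  (\int[mu]_x (expR (- (b * `|x|)))%:E = (2 / b)%:E)%E.
Proof.
move=> b0; rewrite ge0_symfun_integralT.
- rewrite EFinM -(integral_expRN b0) set_itvcy; congr (_ * _)%E.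
  by apply: eq_integral => x; rewrite inE/= => x0; rewrite ger0_norm.
- by move=> x; exact: expR_ge0.
- by move=> x; cvg_tac; apply: cvg_norm; exact: cvg_id.
- by move=> x /=; rewrite normrN.
Qed.

Lemma Gamma_lty s : 0 < s ->
  (\int[mu]_(x in `]0%R, +oo[) (x `^ (s - 1) * expR (- x))%:E < +oo)%E.
Proof.
move=> s0; rewrite (ge0_integral_exp_substitution ltr01); last 2 first.
- by move=> y y0; cvg_tac.
- by move=> y y0; rewrite mulr_ge0 ?powR_ge0 ?expR_ge0.
pose k := Num.min s 1; have k0 : 0 < k by rewrite lt_min s0 ltr01.
(* After x = e^v the exponent is s v - e^v. For v >= 0, e^v >= v^2/2, and completing the square
   bounds it by C - v; for v < 0 it is at most s v <= - k |v|. *)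
pose C := (s + 1) ^+ 2 / 2.
apply: (@le_lt_trans _ _ (\int[mu]_v ((expR C)%:E * (expR (- (k * `|v|)))%:E))%E); last first.
  rewrite ge0_integralZl//=; last first.
    by apply/measurable_EFinP; meas_tac.
  by rewrite integral_expRN_norm// -EFinM ltry.
under [X in (_ <= X)%E]eq_integral do rewrite -EFinM.
have key w : (s - 1) * w - expR w + w <= C - k * `|w|.
  have [w0|w0] := leP 0 w.
    have := @expR_ge1Dxn R w 1 w0; rewrite (_ : 2`! = 2)%N// ger0_norm// => h.
    have kw : k * w <= w by rewrite ler_piMl// ge_min lexx orbT.
    have := sqr_ge0 (w - (s + 1)); rewrite /C; nra.
  have kw : s * w <= k * w by rewrite ler_wnM2r ?(ltW w0)// ge_min lexx.
  rewrite ltr0_norm// /C; have := expR_gt0 w; have := sqr_ge0 (s + 1); nra.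
apply: ge0_le_integral => //=; [by apply/measurable_EFinP; meas_tac..|].
move=> v _; rewrite lee_fin !mul1r powRE ?expR_gt0// expRK -!expRD ler_expR.
exact: key.
Qed.

Lemma GammaE s : 0 < s ->
  (\int[mu]_(x in `]0%R, +oo[) (x `^ (s - 1) * expR (- x))%:E = (Gamma s)%:E)%E.
Proof.
move=> s0; rewrite /Gamma /Rintegral fineK// ge0_fin_numE ?Gamma_lty//.
by apply: integral_ge0 => x _; rewrite lee_fin mulr_ge0 ?powR_ge0 ?expR_ge0.
Qed.

(** A positive lower bound of the integrand on [[1, 2]] suffices. The power is monotone there,
    increasing or decreasing according to the sign of [s - 1], whence the minimum of its two
    endpoint values. *)
Lemma Gamma_gt0 s : 0 < s -> 0 < Gamma s.
Proof.
move=> s0; rewrite -lte_fin -GammaE//.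
pose c : R := Num.min (1 `^ (s - 1)) (2 `^ (s - 1)) * expR (- 2).
have c0 : 0 < c by rewrite mulr_gt0 ?expR_gt0// lt_min !powR_gt0.
apply: (@lt_le_trans _ _ (\int[mu]_(x in `[1%R, 2%R]) c%:E)%E).
  rewrite integral_cst//= lebesgue_measure_itv/= lte_fin ltr1n -EFinB -EFinM lte_fin.
  by rewrite mulr_gt0//; lra.
apply: (@le_trans _ _ (\int[mu]_(x in `[1%R, 2%R]) (x `^ (s - 1) * expR (- x))%:E)%E).
  apply: ge0_le_integral => //=; [by move=> x _; rewrite lee_fin ltW|by apply/measurable_EFinP; meas_tac|].
  move=> x /=; rewrite in_itv/= => /andP[x1 x2]; rewrite lee_fin.
    apply: ler_pM; rewrite ?expR_ge0 ?le_min ?powR_ge0//.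
      have [s1|s1] := leP 1 s.
        by rewrite ge_min ge0_ler_powR// ?nnegrE ?subr_ge0//; lra.
      have e t : 0 < t -> t `^ (s - 1) = (t `^ (1 - s))^-1.
        by move=> t0; rewrite -powRN opprB.
      rewrite ge_min (e 2)// (e x) ?(lt_le_trans ltr01)//.
      rewrite lef_pV2 ?posrE ?powR_gt0 ?(lt_le_trans ltr01 x1)//.
      by rewrite ge0_ler_powR ?orbT// ?nnegrE//; lra.
    by rewrite ler_expR lerN2.
apply: ge0_subset_integral => //=.
- by apply/measurable_EFinP; meas_tac.
- by move=> x _; rewrite lee_fin mulr_ge0 ?powR_ge0 ?expR_ge0.
- by move=> x /=; rewrite !in_itv/= andbT => /andP[x1 _]; rewrite (lt_le_trans ltr01).
Qed.

End gamma_integral.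

(** * Covariance of the tempered fractional Brownian motion *)

Section autocovariance.
Context {R : realType} (H lambda : R).
Hypotheses (H_gt0 : 0 < H) (lambda_gt0 : 0 < lambda).
Local Notation mu := (@lebesgue_measure R).
Implicit Types (s u v x y z : R).

(* [tfbm_kernel t x = ou_kernel (t - x) - ou_kernel (- x)] and [autocov] is the
   covariance function of the stationary process with moving average kernel
   [ou_kernel], of which tempered fractional Brownian motion is an increment. *)
Definition ou_kernel x : R :=
  if 0 < x then expR (- (lambda * x)) * x `^ (H - 2^-1) else 0.

Definition autocov u : R := \int[mu]_x (ou_kernel x * ou_kernel (x + u)).

(** The weight of e^(-s u^2) in the covariance, up to a constant. The factors s^(-1/2) and
    e^(-lambda^2/(4s)) stem from [integral_inverse_gaussian], the power of 4s from
    [integral_quadratic_gamma]. *)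
Definition mixing_density s : R :=
  s `^ (- 2^-1) * (4 * s) `^ (- (H + 2^-1)) * expR (- (lambda ^+ 2 / (4 * s))).

Lemma ou_kernel_ge0 x : 0 <= ou_kernel x.
Proof. by rewrite /ou_kernel; case: ifP => // _; rewrite mulr_ge0 ?expR_ge0 ?powR_ge0. Qed.

Lemma ou_kernelE x :
  ou_kernel x = \1_`]0, +oo[ x * (expR (- (lambda * x)) * x `^ (H - 2^-1)).
Proof.
rewrite /ou_kernel indicE mem_setE in_itv/= andbT.
by case: ifP; rewrite ?mul1r ?mul0r.
Qed.

Lemma measurable_ou_kernel : measurable_fun setT ou_kernel.
Proof. by have -> := funext ou_kernelE; meas_tac. Qed.

Lemma mixing_density_ge0 s : 0 <= mixing_density s.
Proof. by rewrite !mulr_ge0 ?powR_ge0 ?expR_ge0. Qed.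

Lemma measurable_mixing_density D : measurable_fun D mixing_density.
Proof. by apply: measurable_funTS; rewrite /mixing_density; meas_tac. Qed.

Lemma restrict_indic (D : set R) (f : R -> R) :
  ((EFin \o f) \_ D) = fun x => (\1_D x * f x)%:E.
Proof.
apply/funext => x; rewrite /patch indicE; case: ifPn => _; rewrite ?mul1r ?mul0r//.
Qed.

Lemma integral_indic_mul (D : set R) (f : R -> R) :
  (\int[mu]_(x in D) (f x)%:E = \int[mu]_x (\1_D x * f x)%:E)%E.
Proof. by rewrite integral_mkcond (restrict_indic D f). Qed.

(** With w = y (y + u) and dw = (2 y + u) dy this is a Gamma integral at rate 4 s, in which [u] has
    disappeared. *)
Lemma integral_quadratic_gamma s u : 0 < s -> 0 <= u ->
  (\int[mu]_(y in `]0%R, +oo[) ((y * (y + u)) `^ (H - 2^-1) *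
     expR (- (4 * s * (y * (y + u)))) * (2 * y + u))%:E =
   ((4 * s) `^ (- (H + 2^-1)) * Gamma (H + 2^-1))%:E)%E.
Proof.
move=> s0 u0; have s4 : 0 < 4 * s by rewrite mulr_gt0.
rewrite -(@ge0_integral_quadratic_substitution R u
  (fun w => w `^ (H - 2^-1) * expR (- (4 * s * w))))//; last 2 first.
- by move=> y y0; cvg_tac.
- by move=> y y0; rewrite mulr_ge0 ?powR_ge0 ?expR_ge0.
rewrite [RHS]EFinM -GammaE ?addr_gt0// -ge0_integralZl//=; last 3 first.
- by apply/measurable_EFinP; meas_tac.
- by move=> x _; rewrite lee_fin mulr_ge0 ?powR_ge0 ?expR_ge0.
- by rewrite lee_fin powR_ge0.
under [RHS]eq_integral do rewrite -EFinM.
rewrite [RHS](ge0_integral_scale_substitution s4); last 2 first.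
- by move=> y y0; cvg_tac.
- by move=> y y0; rewrite !mulr_ge0 ?powR_ge0 ?expR_ge0.
apply: eq_integral => x; rewrite inE/= in_itv/= andbT => x0; congr EFin.
have -> : H + 2^-1 - 1 = H - 2^-1 by field.
rewrite (@powRM _ (4 * s) x) ?(ltW s4)// ?(ltW x0)//.
have e : (4 * s) `^ (- (H + 2^-1)) * (4 * s) `^ (H - 2^-1) * (4 * s) = 1.
  rewrite -[X in _ * X]powRr1 ?(ltW s4)// -!powRD ?(gt_eqF s4) ?implybT//.
  by rewrite (_ : _ + _ + _ = 0) ?powRr0//; field.
by rewrite -[LHS]mul1r -[X in X * _ = _]e; ring.
Qed.

(** The factor e^(-lambda (2 y + u)) of the kernel product is expanded by
    [integral_inverse_gaussian] with a = 2 y + u. Since (2 y + u)^2 = u^2 + 4 y (y + u), the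
    variable [u] separates as e^(-u^2 s), and after Tonelli's theorem the integral in [y] is the one
    of [integral_quadratic_gamma]. *)
Lemma autocov_mixing u : 0 <= u ->
  (\int[mu]_x (ou_kernel x * ou_kernel (x + u))%:E =
   (Gamma (H + 2^-1) / Num.sqrt pi)%:E *
     \int[mu]_(s in `]0%R, +oo[) (mixing_density s * expR (- (u ^+ 2 * s)))%:E)%E.
Proof.
move=> u0; have pi0 : 0 < Num.sqrt pi :> R by rewrite sqrtr_gt0 pi_gt0.
pose J : R -> R := \1_`]0%R, +oo[.
have J0 x : 0 <= J x by rewrite /J indicE.
have J1 x : 0 < x -> J x = 1 by rewrite /J indicE mem_setE in_itv/= => ->.
have J1' x : ~~ (0 < x) -> J x = 0 by rewrite /J indicE mem_setE in_itv/= andbT => /negbTE ->.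
(* The indicators extend both half-lines to the whole line, so that the order of integration can be
   exchanged on the plane. *)
pose k y s : R := J y * J s * ((Num.sqrt pi)^-1 *
  (s `^ (- 2^-1) * expR (- (lambda ^+ 2 / (4 * s))) * expR (- (u ^+ 2 * s))) *
  ((y * (y + u)) `^ (H - 2^-1) * expR (- (4 * s * (y * (y + u)))) * (2 * y + u))).
have k0 y s : 0 <= k y s.
  have [y0|y0] := boolP (0 < y); last by rewrite /k J1'// !mul0r.
  rewrite /k !mulr_ge0 ?powR_ge0 ?expR_ge0 ?invr_ge0 ?(ltW pi0)//.
  by rewrite addr_ge0// mulr_ge0// ltW.
have mk : measurable_fun setT (fun z : R * R => (k z.1 z.2)%:E).
  by apply/measurable_EFinP; rewrite /k /J; meas_tac.
transitivity (\int[mu]_y \int[mu]_s (k y s)%:E)%E.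
  apply: eq_integral => y _.
  have [y0|y0] := boolP (0 < y); last first.
    rewrite /ou_kernel (negbTE y0) mul0r integral0_eq// => s _.
    by rewrite /k J1'// !mul0r.
  rewrite /ou_kernel y0 ltr_wpDr//.
  have yu0 : 0 < y + u by rewrite ltr_wpDr.
  have a0 : 0 < 2 * y + u by rewrite ltr_wpDr// mulr_gt0.
  transitivity (\int[mu]_s (((Num.sqrt pi)^-1 * (y * (y + u)) `^ (H - 2^-1) * (2 * y + u))%:E *
     (J s * (s `^ (- 2^-1) * expR (- (lambda ^+ 2 / (4 * s) + (2 * y + u) ^+ 2 * s))))%:E))%E.
    rewrite ge0_integralZl//=; last 3 first.
    - by apply/measurable_EFinP; rewrite /J; meas_tac.
    - by move=> s _; rewrite lee_fin !mulr_ge0 ?powR_ge0 ?expR_ge0.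
    - by rewrite lee_fin !mulr_ge0 ?invr_ge0 ?(ltW pi0) ?powR_ge0 ?(ltW a0).
    rewrite -integral_indic_mul integral_inverse_gaussian// -EFinM; congr EFin.
    rewrite powRM ?(ltW y0) ?(ltW yu0)//.
    have -> : expR (- (lambda * (2 * y + u))) = expR (- (lambda * y)) * expR (- (lambda * (y + u))).
      by rewrite -expRD; congr expR; ring.
    by field; rewrite !gt_eqF.
  apply: eq_integral => s _; rewrite -EFinM; congr EFin.
  rewrite /k (J1 y)// mul1r.
  have -> : expR (- (lambda ^+ 2 / (4 * s) + (2 * y + u) ^+ 2 * s)) =
      expR (- (lambda ^+ 2 / (4 * s))) * expR (- (u ^+ 2 * s)) * expR (- (4 * s * (y * (y + u)))).
    by rewrite -!expRD; congr expR; ring.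
  by ring.
rewrite (@fubini_tonelli _ _ (measurableTypeR R) (measurableTypeR R) R mu mu
  (fun z : R * R => (k z.1 z.2)%:E))//=; last by move=> z; rewrite lee_fin; exact: k0.
transitivity (\int[mu]_s ((Gamma (H + 2^-1) / Num.sqrt pi)%:E *
    (J s * (mixing_density s * expR (- (u ^+ 2 * s))))%:E))%E.
  apply: eq_integral => s _.
  have [s0|s0] := boolP (0 < s); last first.
    rewrite integral0_eq; last by move=> y _; rewrite /k (J1' s)// mulr0 !mul0r.
    by rewrite J1'// mul0r mule0.
  rewrite (J1 s)// mul1r.
  transitivity (\int[mu]_y (((Num.sqrt pi)^-1 *
      (s `^ (- 2^-1) * expR (- (lambda ^+ 2 / (4 * s))) * expR (- (u ^+ 2 * s))))%:E *
    (J y * ((y * (y + u)) `^ (H - 2^-1) * expR (- (4 * s * (y * (y + u)))) * (2 * y + u)))%:E))%E.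
    by apply: eq_integral => y _; rewrite -EFinM; congr EFin; rewrite /k (J1 s)// mulr1; ring.
  rewrite ge0_integralZl//=; last 3 first.
  - by apply/measurable_EFinP; rewrite /J; meas_tac.
  - move=> y _; rewrite lee_fin; have [y0|y0] := boolP (0 < y); last by rewrite J1'// mul0r.
    by rewrite !mulr_ge0 ?powR_ge0 ?expR_ge0// addr_ge0// mulr_ge0// ltW.
  - by rewrite lee_fin !mulr_ge0 ?invr_ge0 ?(ltW pi0) ?powR_ge0 ?expR_ge0.
  rewrite -integral_indic_mul integral_quadratic_gamma// -!EFinM; congr EFin.
  by rewrite /mixing_density; field; rewrite gt_eqF.
rewrite ge0_integralZl//=; last 3 first.
- by apply/measurable_EFinP; rewrite /J; meas_tac; apply: measurable_mixing_density.
- by move=> s _; rewrite lee_fin; apply: mulr_ge0; [exact: J0|apply: mulr_ge0; [exact: mixing_density_ge0|exact: expR_ge0]].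
- by rewrite lee_fin divr_ge0 ?(ltW pi0)// ltW// Gamma_gt0// addr_gt0.
by rewrite -integral_indic_mul.
Qed.

End autocovariance.

Section autocovariance_properties.
Context {R : realType} (H lambda : R).
Hypotheses (H_gt0 : 0 < H) (lambda_gt0 : 0 < lambda).
Local Notation mu := (@lebesgue_measure R).
Local Notation r := (autocov H lambda).
Local Notation m := (ou_kernel H lambda).
Local Notation rho := (mixing_density H lambda).
Local Notation kap := (Gamma (H + 2^-1) / Num.sqrt pi).
Implicit Types (s t u v x y z : R).

Lemma kap_gt0 : 0 < kap.
Proof. by rewrite divr_gt0 ?sqrtr_gt0 ?pi_gt0// Gamma_gt0// addr_gt0. Qed.

Lemma integral_ou_kernel_sqr :
  (\int[mu]_x (m x * m (x + 0))%:E =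
   (Gamma (2 * H) / (2 * lambda) `^ (2 * H))%:E)%E.
Proof.
have l2 : 0 < 2 * lambda by rewrite mulr_gt0.
have -> : (\int[mu]_x (m x * m (x + 0))%:E =
   \int[mu]_(x in `]0%R, +oo[) (expR (- (2 * lambda * x)) * x `^ (2 * H - 1))%:E)%E.
  rewrite [RHS]integral_indic_mul; apply: eq_integral => x _; congr EFin.
  rewrite addr0 /ou_kernel indicE mem_setE in_itv/= andbT; case: ifPn => x0; last by rewrite !mul0r.
  have -> : 2 * H - 1 = (H - 2^-1) + (H - 2^-1) by field.
  rewrite (@powRD _ x (H - 2^-1) (H - 2^-1)) ?(gt_eqF x0) ?implybT//.
  have -> : expR (- (2 * lambda * x)) = expR (- (lambda * x)) * expR (- (lambda * x)).
    by rewrite -expRD; congr expR; ring.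
  by rewrite mul1r; ring.
rewrite [Gamma _ / _]mulrC EFinM -GammaE ?mulr_gt0//.
rewrite [X in _ = (_ * X)%E](ge0_integral_scale_substitution l2); last 2 first.
- by move=> y y0; cvg_tac.
- by move=> y y0; rewrite mulr_ge0 ?powR_ge0 ?expR_ge0.
rewrite -ge0_integralZl//=; last 3 first.
- by apply/measurable_EFinP; meas_tac.
- by move=> x _; rewrite lee_fin !mulr_ge0 ?powR_ge0 ?expR_ge0 ?(ltW lambda_gt0).
- by rewrite lee_fin invr_ge0 powR_ge0.
apply: eq_integral => x; rewrite inE/= in_itv/= andbT => x0; rewrite -EFinM; congr EFin.
rewrite (@powRM _ (2 * lambda) x) ?(ltW x0) ?(ltW l2)// -powRN.
have e : (2 * lambda) `^ (- (2 * H)) * (2 * lambda) `^ (2 * H - 1) * (2 * lambda) = 1.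
  rewrite -[X in _ * X]powRr1 ?(ltW l2)// -!powRD ?(gt_eqF l2) ?implybT//.
  by rewrite (_ : _ + _ + _ = 0) ?powRr0//; ring.
by rewrite -[LHS]mul1r -[X in X * _ = _]e; ring.
Qed.

Lemma autocov0 : r 0 = Gamma (2 * H) / (2 * lambda) `^ (2 * H).
Proof. by rewrite /autocov /Rintegral integral_ou_kernel_sqr. Qed.

Lemma autocov0_gt0 : 0 < r 0.
Proof. by rewrite autocov0 divr_gt0 ?powR_gt0 ?Gamma_gt0// mulr_gt0. Qed.

(** Read off the mixture formula at [u = 0]: its left side is the finite value of
    [integral_ou_kernel_sqr], and the constant in front of the mixture is positive. *)
Lemma integrable_mixing_density : mu.-integrable `]0%R, +oo[ (EFin \o rho).
Proof.
have := integral_ou_kernel_sqr; rewrite autocov_mixing// => h.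
apply/integrableP; split; first by apply/measurable_EFinP; exact: measurable_mixing_density.
apply/abse_integralP => //=; first by apply/measurable_EFinP; exact: measurable_mixing_density.
have -> : (\int[mu]_(s in `]0%R, +oo[) (rho s)%:E =
    \int[mu]_(s in `]0%R, +oo[) (rho s * expR (- (0 ^+ 2 * s)))%:E)%E.
  by apply: eq_integral => s _; rewrite expr2 mul0r mul0r oppr0 expR0 mulr1.
set I := (\int[mu]_(s in _) _)%E in h *.
have I0 : (0 <= I)%E.
  by apply: integral_ge0 => s _; rewrite lee_fin mulr_ge0 ?expR_ge0// mixing_density_ge0.
rewrite gee0_abs//; case: I I0 h => [i _ _| |//]; first exact: ltry.
by rewrite gt0_muley ?lte_fin ?kap_gt0.
Qed.

(* For negative arguments [acov] is the even extension of the autocovariance. *)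
Definition acov u : R :=
  locked (fun v => kap * \int[mu]_(s in `]0%R, +oo[) (rho s * expR (- (v ^+ 2 * s)))) u.

Lemma acov_def u : acov u = kap * \int[mu]_(s in `]0%R, +oo[) (rho s * expR (- (u ^+ 2 * s))).
Proof. by rewrite /acov -lock. Qed.

Lemma acovN u : acov (- u) = acov u.
Proof. by rewrite !acov_def sqrrN. Qed.

Lemma acov_norm u : acov `|u| = acov u.
Proof. by rewrite !acov_def real_normK// num_real. Qed.

Lemma mixing_le u s : 0 < s -> `|rho s * expR (- (u ^+ 2 * s))| <= rho s.
Proof.
move=> s0; have h : 0 <= rho s * expR (- (u ^+ 2 * s)).
  by apply: mulr_ge0; [exact: mixing_density_ge0|exact: expR_ge0].
rewrite ger0_norm// ler_piMr ?mixing_density_ge0// expR_le1 oppr_le0 mulr_ge0 ?sqr_ge0//.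
exact: ltW.
Qed.

Lemma measurable_mixing (D : set R) u : measurable_fun D (fun s => rho s * expR (- (u ^+ 2 * s))).
Proof. by apply: measurable_funM; [exact: measurable_mixing_density|meas_tac]. Qed.

Lemma integrable_mixing u :
  mu.-integrable `]0%R, +oo[ (EFin \o (fun s => rho s * expR (- (u ^+ 2 * s)))).
Proof.
apply: (@le_dominated_integrable _ (measurableTypeR R) _ mu _ _ _ rho) => //.
- exact: measurable_mixing.
- exact: integrable_mixing_density.
- by move=> s /=; rewrite in_itv/= andbT; exact: mixing_le.
Qed.

Lemma EFin_acov u : 0 <= u ->
  (\int[mu]_x (m x * m (x + u))%:E = (acov u)%:E)%E.
Proof.
move=> u0; by rewrite acov_def autocov_mixing// (EFin_Rintegral _ (integrable_mixing u))// -EFinM.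
Qed.

Lemma acovE u : 0 <= u -> acov u = r u.
Proof. by move=> u0; rewrite /autocov /Rintegral EFin_acov. Qed.

Lemma acov_ge0 u : 0 <= acov u.
Proof.
rewrite acov_def mulr_ge0 ?(ltW kap_gt0)// Rintegral_ge0// => s _.
by rewrite mulr_ge0 ?expR_ge0 ?mixing_density_ge0.
Qed.

(** Visible under the mixture integral, as every e^(-s v^2) decreases in |v|. Continuity and decay
    at infinity are obtained from the same representation, with the density itself as dominating
    function. *)
Lemma acov_homo u v : 0 <= u -> u <= v -> acov v <= acov u.
Proof.
move=> u0 uv; rewrite !acov_def ler_wpM2l ?(ltW kap_gt0)//.
apply: le_Rintegral => //; [exact: integrable_mixing|exact: integrable_mixing|].
move=> s /=; rewrite in_itv/= andbT => s0.
rewrite ler_wpM2l ?mixing_density_ge0// ler_expR lerN2 ler_wpM2r ?(ltW s0)//.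
by rewrite ler_sqr ?nnegrE// (le_trans u0).
Qed.

Lemma acov_le u : acov u <= acov 0.
Proof. by rewrite -acov_norm acov_homo. Qed.

Lemma norm_acov_le u : `|acov u| <= acov 0.
Proof. by rewrite ger0_norm ?acov_le ?acov_ge0. Qed.

Lemma acov_continuous : continuous acov.
Proof.
move=> x; apply: continuous_seq => v vx; rewrite acov_def (funext (fun n => acov_def (v n))).
apply: cvgM; first exact: cvg_cst.
apply: (@cvg_Rintegral _ (measurableTypeR R) _ mu _ _ _ _ rho) => //.
- by move=> n; exact: measurable_mixing.
- move=> s _; apply: cvgM; first exact: cvg_cst.
  by cvg_tac.
- exact: integrable_mixing_density.
- by move=> n s /=; rewrite in_itv/= andbT; exact: mixing_le.
Qed.

Lemma cvg_acov_seq (u : nat -> R) : u n @[n --> \oo] --> +oo -> acov (u n) @[n --> \oo] --> 0.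
Proof.
move=> uoo; rewrite (funext (fun n => acov_def (u n))).
rewrite -[X in _ --> X](mulr0 kap); apply: cvgM; first exact: cvg_cst.
have i0 : \int[mu]_(s in `]0%R, +oo[) (fun=> 0 : R) s = 0 by rewrite Rintegral_cst// mul0r.
rewrite -{2}i0.
apply: (@cvg_Rintegral _ (measurableTypeR R) _ mu `]0%R, +oo[%classic _
  (fun n s => rho s * expR (- (u n ^+ 2 * s))) (fun=> 0) rho) => //.
- by move=> n; exact: measurable_mixing.
- move=> s /=; rewrite in_itv/= andbT => s0.
  rewrite -[X in _ --> X](mulr0 (rho s)); apply: cvgM; first exact: cvg_cst.
  apply: (cvg_comp (fun n => u n ^+ 2 * s) (fun x => expR (- x))); last exact: cvgr_expR.
  apply/cvgryPge => A; near=> n.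
  have un : Num.max 1 (A / s) <= u n by near: n; move/cvgryPge : uoo; exact.
  move: un; rewrite ge_max => /andP[u1 uA].
  rewrite -ler_pdivrMr//; apply: (le_trans uA); rewrite expr2 ler_peMr//.
  exact: le_trans u1.
- exact: integrable_mixing_density.
- by move=> n s /=; rewrite in_itv/= andbT; exact: mixing_le.
Unshelve. all: by end_near. Qed.

(** Links the covariance to the formula for [C2]: the mixture, after an exponential substitution, is
    the Bessel integral of order [H]. *)
Lemma autocov_besselK u : 0 < u ->
  acov u = kap * ((u / (2 * lambda)) `^ H * besselK H (lambda * u)).
Proof.
move=> u0; rewrite acov_def; congr (_ * _).
(* Balances the two terms of the exponent, whose sum becomes lambda u cosh v. *)
pose c := lambda / (2 * u); have c0 : 0 < c by rewrite divr_gt0// mulr_gt0.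
have l0 := lambda_gt0.
have : (\int[mu]_(s in `]0%R, +oo[) (rho s * expR (- (u ^+ 2 * s)))%:E =
   (4 `^ (- (H + 2^-1)) * c `^ (- H))%:E *
     \int[mu]_v (expR (- H * v) * expR (- (lambda * u * Defs.cosh v)))%:E)%E.
  rewrite (ge0_integral_exp_substitution c0); last 2 first.
  - by move=> y y0; rewrite /mixing_density; cvg_tac; rewrite ?mulf_neq0 ?gt_eqF// mulr_gt0.
  - by move=> y y0; rewrite mulr_ge0 ?expR_ge0 ?mixing_density_ge0.
  rewrite -ge0_integralZl//=; last by rewrite lee_fin mulr_ge0 ?powR_ge0.
    2: by apply/(@measurable_EFinP _ (measurableTypeR R)); rewrite /Defs.cosh; meas_tac.
  apply: eq_integral => v _; rewrite -EFinM; congr EFin.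
  have x0 : 0 < c * expR v by rewrite mulr_gt0 ?expR_gt0.
  have e0 := expR_gt0 v.
  rewrite /mixing_density.
  have -> : expR (- (lambda * u * Defs.cosh v)) =
      expR (- (lambda ^+ 2 / (4 * (c * expR v)))) * expR (- (u ^+ 2 * (c * expR v))).
    rewrite -expRD; congr expR; rewrite /Defs.cosh expRN /c; field.
    by rewrite !gt_eqF.
  have -> : expR (- H * v) = (expR v) `^ (- H) by rewrite -expRM mulrC.
  have -> : 4 `^ (- (H + 2^-1)) * c `^ (- H) * (expR v `^ (- H) *
      (expR (- (lambda ^+ 2 / (4 * (c * expR v)))) * expR (- (u ^+ 2 * (c * expR v))))) =
      4 `^ (- (H + 2^-1)) * (c * expR v) `^ (- H) *
      expR (- (lambda ^+ 2 / (4 * (c * expR v)))) * expR (- (u ^+ 2 * (c * expR v))).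
    by rewrite (@powRM _ c) ?expR_ge0 ?(ltW c0)//; ring.
  have -> : (c * expR v) `^ (- H) =
      (c * expR v) `^ (- 2^-1) * (c * expR v) `^ (- (H + 2^-1)) * (c * expR v).
    move: (c * expR v) x0 => x x0.
    transitivity (x `^ (- 2^-1) * x `^ (- (H + 2^-1)) * x `^ 1); last by rewrite powRr1// ltW.
    by rewrite -!powRD ?(gt_eqF x0) ?implybT//; congr (_ `^ _); field.
  by rewrite (@powRM _ 4) ?(ltW x0)//; ring.
rewrite integral_besselK_full muleA -EFinM.
have -> : (\int[mu]_(v in `[0%R, +oo[) (expR (- (lambda * u * Defs.cosh v)) * Defs.cosh (- H * v))%:E =
  \int[mu]_(v in `[0%R, +oo[) (expR (- (lambda * u * Defs.cosh v)) * Defs.cosh (H * v))%:E)%E.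
  by apply: eq_integral => v _; rewrite mulNr coshN.
rewrite (EFin_Rintegral _ (integrable_mixing u))//.
rewrite /besselK /Rintegral; set K := (\int[mu]_(v in _) _)%E.
have K0 : (0 <= K)%E.
  by apply: integral_ge0 => v _; rewrite lee_fin mulr_ge0 ?expR_ge0// ltW// cosh_gt0.
have C0 : 0 < 4 `^ (- (H + 2^-1)) * c `^ (- H) * 2 by rewrite !mulr_gt0 ?powR_gt0.
(* An infinite Bessel integral is excluded, because the other side of the identity is a real
   number. *)
case: K K0 => [k _|_|//]; last by rewrite gt0_muley ?lte_fin.
rewrite -EFinM => -[->] /=; congr (_ * _).
rewrite (_ : u / (2 * lambda) = c^-1 * 4^-1); last by rewrite /c; field; rewrite !gt_eqF.
have eV x : 0 < x -> x^-1 `^ H = x `^ (- H).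
  by move=> x0; rewrite -powR_inv1 ?(ltW x0)// -powRrM mulN1r.
rewrite (@powRM _ c^-1) ?invr_ge0 ?(ltW c0)// !eV//.
have e4 : 4 `^ (- H) = 4 `^ (- (H + 2^-1)) * 2 :> R.
  have {2}-> : 2 = 4 `^ 2^-1 :> R.
    by rewrite powR12_sqrt// (_ : 4 = 2 ^+ 2 :> R) ?sqrtr_sqr ?ger0_norm//; ring.
  by rewrite -powRD ?pnatr_eq0 ?implybT//; congr (_ `^ _); field.
rewrite e4; ring.
Qed.

(** C_t^2 t^(2H) is the variance of the increment over time t of a stationary process with
    covariance [acov]; this replaces the special functions by one positive, decreasing function. *)
Lemma C2t2HE u : 0 <= u -> C2t2H H lambda u = 2 * (acov 0 - acov u).
Proof.
rewrite le_eqVlt => /predU1P[<-|u0]; first by rewrite /C2t2H ltxx subrr mulr0.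
rewrite /C2t2H u0 /C2 (autocov_besselK u0) (acovE (lexx 0)) autocov0.
have l0 := lambda_gt0; have l2 : 0 < 2 * lambda by rewrite mulr_gt0.
rewrite !(@powRM _ (2 * lambda) u) ?(ltW l2) ?(ltW u0)//.
rewrite (_ : u `^ (2 * H) = u `^ H * u `^ H); last first.
  by rewrite -powRD ?(gt_eqF u0) ?implybT//; congr (_ `^ _); ring.
rewrite (@powRM _ u) ?invr_ge0 ?(ltW u0) ?(ltW l2)//.
rewrite (_ : (2 * lambda)^-1 `^ H = ((2 * lambda) `^ H)^-1); last first.
  by rewrite -powR_inv1 ?(ltW l2)// -powRrM mulN1r powRN.
have p0 : 0 < Num.sqrt pi :> R by rewrite sqrtr_gt0 pi_gt0.
by field; rewrite !gt_eqF ?powR_gt0.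
Qed.

Lemma alpha2E : alpha2 H lambda = 2 * acov 0.
Proof. by rewrite /alpha2 (acovE (lexx 0)) autocov0 mulrA. Qed.

Section laplace.
Variable b : R.
Hypothesis b_gt0 : 0 < b.

Definition acov_laplace : R := \int[mu]_(u in `[0%R, +oo[) (expR (- (b * u)) * acov u).

Lemma integrable_expRN : mu.-integrable `[0%R, +oo[ (EFin \o (fun u => expR (- (b * u)))).
Proof.
apply/integrableP; split; first by apply/measurable_EFinP; meas_tac.
apply/abse_integralP => //=; first by apply/measurable_EFinP; meas_tac.
by rewrite integral_expRN// abse_EFin ltry.
Qed.

Lemma Rintegral_expRN : \int[mu]_(u in `[0%R, +oo[) expR (- (b * u)) = b^-1.
Proof. by rewrite /Rintegral integral_expRN. Qed.

Lemma measurable_acov D : measurable_fun D acov.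
Proof. by apply: measurable_funTS; apply: continuous_measurable_fun; exact: acov_continuous. Qed.

Lemma integrable_acov_laplace :
  mu.-integrable `[0%R, +oo[ (EFin \o (fun u => expR (- (b * u)) * acov u)).
Proof.
apply: (@le_dominated_integrable _ (measurableTypeR R) _ mu _ _ _ (fun u => acov 0 * expR (- (b * u)))) => //.
- by apply: measurable_funM; [meas_tac|exact: measurable_acov].
- rewrite (_ : EFin \o _ = fun u => (acov 0)%:E * (expR (- (b * u)))%:E)%E//.
  by apply: integrableZl => //; exact: integrable_expRN.
- move=> u _; rewrite normrM ger0_norm ?expR_ge0// mulrC ler_wpM2r ?expR_ge0//.
  exact: norm_acov_le.
Qed.

Lemma beta2E : beta2 H lambda b = acov 0 - b * acov_laplace.
Proof.
rewrite /beta2.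
have -> : \int[mu]_(u in `[0%R, +oo[) (expR (- (b * u)) * C2t2H H lambda u) =
   \int[mu]_(u in `[0%R, +oo[) (2 * acov 0 * expR (- (b * u)) - 2 * (expR (- (b * u)) * acov u)).
  apply: eq_Rintegral => u; rewrite inE/= in_itv/= andbT => u0.
  by rewrite C2t2HE//; ring.
rewrite RintegralB//; last 2 first.
- rewrite (_ : EFin \o _ = fun u => (2 * acov 0)%:E * (expR (- (b * u)))%:E)%E//.
  by apply: integrableZl => //; exact: integrable_expRN.
- rewrite (_ : EFin \o _ = fun u => 2%:E * (expR (- (b * u)) * acov u)%:E)%E//.
  by apply: integrableZl => //; exact: integrable_acov_laplace.
rewrite !RintegralZl ?Rintegral_expRN//; first by rewrite -/acov_laplace; field; rewrite gt_eqF.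
- exact: integrable_acov_laplace.
- exact: integrable_expRN.
Qed.

Lemma acov_laplace_ge0 : 0 <= acov_laplace.
Proof. by apply: Rintegral_ge0 => u _; rewrite mulr_ge0 ?expR_ge0 ?acov_ge0. Qed.

(** By [beta2E] this is b times the integral of e^(-bu) (r(0) - r(u)), and r falls below r(0)/2 at
    some integer [N]; the interval [[N, N + 1]] alone makes the integral positive. Positivity
    excludes atoms of the first and third limit variables. *)
Lemma beta2_gt0 : 0 < beta2 H lambda b.
Proof.
rewrite beta2E subr_gt0.
have a0 : 0 < acov 0 by rewrite acovE// autocov0_gt0.
have [N hN] : exists N : nat, acov N%:R < acov 0 / 2.
  have /cvgrPdist_lt /(_ (acov 0 / 2)) := @cvg_acov_seq (fun n => n%:R) (@cvgr_idn R).
  rewrite divr_gt0// => /(_ isT) [N _ hN]; exists N.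
  by have := hN N (leqnn N); rewrite /= sub0r normrN ger0_norm ?acov_ge0.
pose c := acov 0 / 2 * expR (- (b * (N%:R + 1))).
have c0 : 0 < c by rewrite mulr_gt0 ?expR_gt0// divr_gt0.
pose g u := expR (- (b * u)) * (acov 0 - acov u).
have g0 u : 0 <= g u by rewrite mulr_ge0 ?expR_ge0// subr_ge0 acov_le.
have mg D : measurable_fun D g.
  by apply: measurable_funM; [meas_tac|apply: measurable_funB => //; exact: measurable_acov].
have : (c%:E <= \int[mu]_(u in `[0%R, +oo[) (g u)%:E)%E.
  apply: (@le_trans _ _ (\int[mu]_(u in `[N%:R, (N%:R + 1)%R]) (g u)%:E)%E); last first.
    apply: ge0_subset_integral => //=; first by apply/(@measurable_EFinP _ (measurableTypeR R)); exact: mg.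
      by move=> u _; rewrite lee_fin.
    by move=> u /=; rewrite !in_itv/= andbT => /andP[+ _]; apply: le_trans.
  apply: (@le_trans _ _ (\int[mu]_(u in `[N%:R, (N%:R + 1)%R]) c%:E)%E).
    rewrite integral_cst//= lebesgue_measure_itv/= lte_fin ltrDl ltr01 -EFinB -EFinM lee_fin.
    by rewrite addrAC subrr add0r mulr1.
  apply: ge0_le_integral => //=; [by move=> u _; rewrite lee_fin ltW|by apply/(@measurable_EFinP _ (measurableTypeR R)); exact: mg|].
  move=> u /=; rewrite in_itv/= => /andP[uN uN1]; rewrite lee_fin /c /g mulrC.
  apply: ler_pM; rewrite ?expR_ge0//; first by rewrite divr_ge0// ltW.
    by rewrite ler_expR lerN2 ler_wpM2l// ltW.
  have := acov_homo (ler0n _ N) uN; lra.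
have ig : (\int[mu]_(u in `[0%R, +oo[) (g u)%:E = (acov 0 / b - acov_laplace)%:E)%E.
  rewrite (_ : (fun u => (g u)%:E) = fun u => ((acov 0)%:E * (expR (- (b * u)))%:E - (expR (- (b * u)) * acov u)%:E)%E); last first.
    by apply/funext => u; rewrite -EFinM -EFinB; congr EFin; rewrite /g; ring.
  rewrite integralB_EFin//; last 2 first.
    by apply: integrable_funZ => //; exact: integrable_expRN.
    exact: integrable_acov_laplace.
  rewrite (EFin_Rintegral _ (@integrable_funZ _ _ _ _ _ _ (acov 0) _ integrable_expRN))//.
  rewrite (EFin_Rintegral _ integrable_acov_laplace)// RintegralZl ?Rintegral_expRN//.
  exact: integrable_expRN.
rewrite ig lee_fin => h; have : 0 < acov 0 / b - acov_laplace by exact: lt_le_trans h.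
by rewrite subr_gt0 ltr_pdivlMr// mulrC.
Qed.

End laplace.

End autocovariance_properties.

Section tfbm_covariance.
Context {R : realType} (H lambda : R).
Hypotheses (H_gt0 : 0 < H) (lambda_gt0 : 0 < lambda).
Local Notation mu := (@lebesgue_measure R).
Local Notation m := (ou_kernel H lambda).
Local Notation k := (tfbm_kernel H lambda).
Local Notation acov := (acov H lambda).
Implicit Types (s t u v x y z : R).

(** Covariance of X_s - X_0 and X_t - X_0 for a stationary process X with covariance function
    [acov]. *)
Definition tfbm_cov s t : R := acov (s - t) - acov s - acov t + acov 0.

Lemma tfbm_kernelE t x : k t x = m (t - x) - m (0 - x).
Proof.
rewrite /tfbm_kernel /ou_kernel /pos_pow sub0r /pos_part.
have e y : expR (- (lambda * Num.max y 0)) * (if 0 < y then y `^ (H - 2^-1) else 0) =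
    if 0 < y then expR (- (lambda * y)) * y `^ (H - 2^-1) else 0.
  by case: ifPn => y0; rewrite ?mulr0// max_l// ltW.
by rewrite (e (t - x)) (e (- x)).
Qed.

Lemma measurable_ou_kernel_sub t : measurable_fun setT (fun x : R => m (t - x)).
Proof.
apply: measurableT_comp; first exact: measurable_ou_kernel.
by apply: measurable_funB; [exact: measurable_cst|exact: measurable_id].
Qed.

Lemma acov_subC s t : acov (s - t) = acov (t - s).
Proof. by rewrite -[s - t]opprB acovN. Qed.

(** For s <= t, the reflection x |-> -x followed by a translation by [s] gives the integral that
    defines the covariance at lag t - s; the other order follows by symmetry. *)
Lemma integral_ou_cross s t :
  (\int[mu]_x (m (s - x) * m (t - x))%:E = (acov (s - t))%:E)%E.
Proof.
wlog st : s t / s <= t => [h|].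
  have [|ts] := leP s t; first exact: h.
  rewrite acov_subC -(h t s (ltW ts)).
  by apply: eq_integral => x _; rewrite mulrC.
have ts0 : 0 <= t - s by rewrite subr_ge0.
rewrite acov_subC -(EFin_acov H_gt0 lambda_gt0 ts0).
rewrite -(@ge0_integral_opp _ (fun x => m (s - x) * m (t - x))); last 2 first.
- by apply: measurable_funM; exact: measurable_ou_kernel_sub.
- by move=> x; rewrite mulr_ge0 ?ou_kernel_ge0.
rewrite -(@ge0_integral_shift _ s (fun x => m x * m (x + (t - s)))); last 2 first.
- apply: measurable_funM; first exact: measurable_ou_kernel.
  by apply: measurableT_comp; [exact: measurable_ou_kernel|meas_tac].
- by move=> x; rewrite mulr_ge0 ?ou_kernel_ge0.
apply: eq_integral => x _.
have -> : x + s + (t - s) = t - - x by ring.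
by have -> : x + s = s - - x by ring.
Qed.

Lemma integrable_ou_cross s t :
  mu.-integrable setT (EFin \o (fun x => m (s - x) * m (t - x))).
Proof.
have mf : measurable_fun setT (fun x : R => m (s - x) * m (t - x)).
  by apply: measurable_funM; exact: measurable_ou_kernel_sub.
apply/integrableP; split; first exact/measurable_EFinP.
have -> : (\int[mu]_x `|(EFin \o (fun x => m (s - x) * m (t - x))%R) x| =
   \int[mu]_x (m (s - x) * m (t - x))%:E)%E.
  by apply: eq_integral => x _; rewrite gee0_abs// lee_fin mulr_ge0 ?ou_kernel_ge0.
by rewrite integral_ou_cross ltry.
Qed.

Lemma Rintegral_ou_cross s t :
  \int[mu]_x (m (s - x) * m (t - x)) = acov (s - t).
Proof. by rewrite /Rintegral integral_ou_cross. Qed.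

Lemma tfbm_kernelME s t x : k s x * k t x =
  (m (s - x) * m (t - x) - m (s - x) * m (0 - x)) -
  (m (0 - x) * m (t - x) - m (0 - x) * m (0 - x)).
Proof. by rewrite !tfbm_kernelE; ring. Qed.

Lemma integrable_tfbm_kernelM s t : mu.-integrable setT (EFin \o (fun x => k s x * k t x)).
Proof.
under [X in EFin \o X]eq_fun do rewrite tfbm_kernelME.
by apply: integrable_funB => //; apply: integrable_funB => //; exact: integrable_ou_cross.
Qed.

Lemma Rintegral_tfbm_kernelM s t : \int[mu]_x (k s x * k t x) = tfbm_cov s t.
Proof.
under eq_Rintegral do rewrite tfbm_kernelME.
have ic := integrable_ou_cross.
rewrite RintegralB//; [|by apply: integrable_funB..].
rewrite !RintegralB// !Rintegral_ou_cross /tfbm_cov !subr0 sub0r acovN; ring.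
Qed.

Lemma tfbm_covC s t : tfbm_cov s t = tfbm_cov t s.
Proof. by rewrite /tfbm_cov acov_subC; ring. Qed.

Lemma tfbm_cov_diag t : tfbm_cov t t <= 2 * acov 0.
Proof. by rewrite /tfbm_cov subrr; have := acov_ge0 lambda H_gt0 t; lra. Qed.

Lemma measurable_tfbm_kernel t : measurable_fun setT (k t).
Proof.
rewrite (funext (tfbm_kernelE t)); apply: measurable_funB; exact: measurable_ou_kernel_sub.
Qed.

End tfbm_covariance.

(** * Independence and characteristic functions *)

Section trigonometric_bounds.
Context {R : realType}.
Implicit Types (x y a b : R).

Lemma mean_value (f f' : R -> R) x y : (forall z : R, is_derive z 1 f (f' z)) ->
  exists2 c, `|c - x| <= `|y - x| & f y - f x = f' c * (y - x).
Proof.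
move=> df; have cf : continuous f.
  by move=> z; apply: differentiable_continuous; apply/derivable1_diffP; have [] := df z.
have [xy|yx|->] := ltgtP x y; last by exists y; rewrite ?subrr ?mulr0.
- have [|c cxy e] := @MVT R f f' x y xy.
    exact: continuous_subspaceT.
  exists c => //; move: cxy; rewrite in_itv/= => /andP[xc cy].
  by rewrite !gtr0_norm ?subr_gt0// lerD2r ltW.
- have [|c cxy e] := @MVT R f f' y x yx.
    exact: continuous_subspaceT.
  exists c; last by rewrite -opprB e -mulrN opprB.
  move: cxy; rewrite in_itv/= => /andP[xc cy].
  by rewrite distrC [leRHS]distrC !gtr0_norm ?subr_gt0// lerD2l lerN2 ltW.
Qed.

Lemma lipschitz1 (f f' : R -> R) x y : (forall z : R, is_derive z 1 f (f' z)) ->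
  (forall z, `|f' z| <= 1) -> `|f y - f x| <= `|y - x|.
Proof.
move=> df f'1; have [c _ ->] := mean_value x y df.
by rewrite normrM ler_piMl.
Qed.

Lemma cos_lipschitz x y : `|cos y - cos x| <= `|y - x|.
Proof.
by apply: (lipschitz1 (f' := fun z => - sin z)) => z; rewrite normrN sin_max.
Qed.

Lemma norm_sin_le x : `|sin x| <= `|x|.
Proof.
have := @lipschitz1 sin cos 0 x (@is_derive_sin R) (@cos_max R).
by rewrite sin0 !subr0.
Qed.

Lemma cos_half x : 1 - cos x = 2 * sin (x / 2) ^+ 2.
Proof.
have {1}-> : x = (x / 2) *+ 2 by rewrite mulr2n; field.
by rewrite cos_mulr2n cos2sin2 mulr2n; ring.
Qed.

Lemma cos_ge_quadratic x : 1 - cos x <= x ^+ 2 / 2.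
Proof.
rewrite cos_half; have : sin (x / 2) ^+ 2 <= (x / 2) ^+ 2.
  by rewrite -[leLHS]real_normK ?num_real// -[leRHS]real_normK ?num_real// lerXn2r ?nnegrE// norm_sin_le.
rewrite exprMn => h; have : 2 * (x ^+ 2 * 2^-1 ^+ 2) = x ^+ 2 / 2 by field.
by lra.
Qed.

Lemma sin_sub_le x : `|sin x - x| <= `|x| ^+ 3.
Proof.
have [c cx e] := @mean_value (fun z => sin z - z) (fun z => cos z - 1) 0 x
  (fun z => is_derive_funD (is_derive_sin z) (is_derive_funN (is_derive_fun_id z))).
move: cx e; rewrite sin0 !subr0 => cx ->.
rewrite normrM exprSr ler_wpM2r// distrC ger0_norm ?subr_ge0 ?cos_le1//.
apply: (le_trans (cos_ge_quadratic c)); rewrite -[c ^+ 2]real_normK ?num_real//.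
by have := normr_ge0 c; nra.
Qed.

(** Serves twice: it recovers X^2 from n^2 sin^2 (X/n) in the moment bound, and it takes the limit u
    -> 0 in the dependence argument. *)
Lemma cvg_scaled_sin x : n.+1%:R * sin (x / n.+1%:R) @[n --> \oo] --> x.
Proof.
apply/cvgrPdist_le => e e0; near=> n.
have n0 : 0 < n.+1%:R :> R by [].
have -> : x - n.+1%:R * sin (x / n.+1%:R) = n.+1%:R * (x / n.+1%:R - sin (x / n.+1%:R)).
  by field.
rewrite normrM gtr0_norm// distrC.
apply: (@le_trans _ _ (n.+1%:R * `|x / n.+1%:R| ^+ 3)).
  by rewrite ler_pM2l// sin_sub_le.
rewrite normrM [`|_^-1|]gtr0_norm ?invr_gt0//.
have -> : n.+1%:R * (`|x| / n.+1%:R) ^+ 3 = `|x| ^+ 3 / n.+1%:R / n.+1%:R.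
  by field.
have n1 : n.+1%:R^-1 <= 1 :> R by rewrite invf_le1// ler1n.
apply: (@le_trans _ _ (`|x| ^+ 3 / n.+1%:R)).
  by rewrite ler_piMr// divr_ge0// exprn_ge0.
rewrite ler_pdivrMr// -ler_pdivrMl// mulrC.
apply: (@le_trans _ _ n%:R); last by rewrite ler_nat.
by near: n; exact: nbhs_infty_ger.
Unshelve. all: by end_near. Qed.

End trigonometric_bounds.

Section orthogonality.
Context d (T : measurableType d) (R : realType) (P : probability T R).
Implicit Types (X U V : T -> R).

Local Notation E f := (\int[P]_w f w).

Lemma integrable_bounded (f : T -> R) (M : R) : measurable_fun setT f ->
  (forall w, `|f w| <= M) -> P.-integrable setT (EFin \o f).
Proof.
move=> mf fM; apply: (@bounded_integrable _ _ _ P setT measurableT f M) => //.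
by rewrite (le_lt_trans (probability_le1 _ _))// ltry.
Qed.

Lemma Rintegral_prob_cst (c : R) : \int[P]_w c = c.
Proof.
transitivity (c * fine (P setT)); first exact: Rintegral_cst.
by rewrite probability_setT mulr1.
Qed.

Lemma norm_Rintegral_prob_le (f : T -> R) (M : R) : measurable_fun setT f ->
  (forall w, `|f w| <= M) -> `|E f| <= M.
Proof.
by move=> mf fM; apply: le_normr_Rintegral_bounded => //; exact: (@probability_setT _ _ _ P).
Qed.

(** Counting the levels 1, 2, ... not above [y] writes the integer part as a sum of indicators;
    level sets thereby give a uniform approximation of a function. *)
Lemma count_le_trunc (y : R) (K : nat) : 0 <= y -> y < K.+1%:R ->
  (\sum_(j < K) nat_of_bool (j.+1%:R <= y)%R)%N = Num.truncn y.
Proof.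
move=> y0 yK.
have /andP[t1 t2] := truncn_itv y0.
have tK : (Num.truncn y <= K)%N by rewrite -ltnS -(ltr_nat R) (le_lt_trans t1).
rewrite -(big_mkord xpredT (fun j => nat_of_bool (j.+1%:R <= y))) /=.
rewrite (big_cat_nat (n := Num.truncn y))//=.
rewrite (eq_big_nat _ _ (F2 := fun=> 1%N)); last first.
  by move=> j /andP[_ jt]; rewrite (le_trans _ t1)// ler_nat.
rewrite sum_nat_const_nat subn0 muln1 [X in (_ + X)%N]big1_seq ?addn0// => j.
rewrite mem_index_iota => /andP[_ /andP[tj _]].
by rewrite leNgt (lt_le_trans t2)// ler_nat.
Qed.

(** Independence is given on events; this is the passage to functions. The level sets of [g] at mesh
    1/(n+1) give a finite combination of indicators that is uniformly within 1/(n+1) of [g]. *)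
Lemma orthogonal_to_indicators (V X : T -> R) (M : R) (g : R -> R) (K : R) :
  measurable_fun setT V -> (forall w, `|V w| <= M) ->
  measurable_fun setT X ->
  (forall A : set R, measurable A -> \int[P]_w (V w * \1_A (X w)) = 0) ->
  measurable_fun setT g -> (forall x, `|g x| <= K) ->
  \int[P]_w (V w * g (X w)) = 0.
Proof.
move=> mV VM mX VA mg gK.
have M0 : 0 <= M by rewrite (le_trans _ (VM point)).
have K0 : 0 <= K by rewrite (le_trans _ (gK 0)).
(* Enough levels, since 0 <= g + K <= 2 K. *)
pose N n := (Num.truncn (n.+1%:R * (2 * K))).
pose A (n j : nat) : set R := [set x | j.+1%:R <= n.+1%:R * (g x + K)].
have mA n j : measurable (A n j).
  have : measurable_fun setT (fun x => n.+1%:R * (g x + K)) by meas_tac.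
  move=> /(_ measurableT `[j.+1%:R, +oo[%classic (measurable_itv _)).
  by rewrite setTI; congr measurable; apply/seteqP; split => x /=; rewrite /A/= in_itv/= andbT.
pose h n x : R := n.+1%:R^-1 * (\sum_(j < N n) \1_(A n j) x) - K.
have hE n x : h n x = n.+1%:R^-1 * (Num.truncn (n.+1%:R * (g x + K)))%:R - K.
  rewrite /h; congr (_ * _ - _).
  have gx : 0 <= g x + K <= 2 * K by have := gK x; rewrite ler_norml => /andP[*]; lra.
  rewrite -(@count_le_trunc _ (N n)).
  - rewrite natr_sum; apply: eq_bigr => j _; rewrite indicE.
    by congr (_%:R); congr nat_of_bool; apply/idP/idP; rewrite inE.
  - by rewrite mulr_ge0//; case/andP: gx.
  - apply: (@le_lt_trans _ _ (n.+1%:R * (2 * K))); last exact: truncnS_gt.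
    by rewrite ler_wpM2l//; case/andP: gx.
have hg n x : `|h n x - g x| <= n.+1%:R^-1.
  have gx : 0 <= g x + K by have := gK x; rewrite ler_norml => /andP[*]; lra.
  have /andP[t1 t2] := truncn_itv (mulr_ge0 (ler0n R n.+1) gx).
  rewrite hE; set t := (Num.truncn _)%:R in t1 t2 *.
  have n0 : 0 < n.+1%:R :> R by [].
  have -> : n.+1%:R^-1 * t - K - g x = n.+1%:R^-1 * (t - n.+1%:R * (g x + K)) by field.
  rewrite normrM gtr0_norm ?invr_gt0// ler_piMr ?invr_ge0// ler_norml.
  by move: t2; rewrite -[X in _ < X]natr1 -/t => t2; apply/andP; split; lra.
have mh n : measurable_fun setT (fun w => h n (X w)).
  apply: measurable_funB => //; apply: measurable_funM => //.
  by apply: measurable_sum => j; apply: measurable_fun_indic.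
have Vh n : \int[P]_w (V w * h n (X w)) = 0.
  have -> : \int[P]_w (V w * h n (X w)) =
    \int[P]_w (n.+1%:R^-1 * (\sum_(j < N n) V w * \1_(A n j) (X w)) - K * (V w * \1_setT (X w))).
    apply: eq_Rintegral => w _; rewrite /h indicT mulr1 -mulr_sumr; ring.
  have iV B : measurable B -> P.-integrable setT (EFin \o (fun w => V w * \1_B (X w))).
    move=> mB; apply: (integrable_bounded (M := M)).
      by apply: measurable_funM => //; apply: measurable_fun_indic.
    move=> w; rewrite normrM indicE; case: (_ \in _); rewrite ?normr1 ?mulr1// normr0 mulr0//.
  rewrite RintegralB//; last 2 first.
  - by apply: integrable_funZ => //; apply: integrable_fun_sum => // j; exact: iV.
  - by apply: integrable_funZ => //; exact: iV.
  rewrite !RintegralZl//; [|by first [exact: iV | apply: integrable_fun_sum => // j; exact: iV]..].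
  rewrite Rintegral_sum//; last by move=> j; exact: iV.
  by rewrite VA// big1 ?mulr0 ?subrr// => j _; rewrite VA.
have mgX : measurable_fun setT (fun w => g (X w)) by exact: measurableT_comp.
apply/eqP; rewrite -normr_le0; apply/ler_addgt0Pl => e e0; rewrite addr0.
have [n hn] : exists n : nat, M * n.+1%:R^-1 <= e.
  exists (Num.truncn (M / e)); rewrite ler_pdivrMr// mulrC -ler_pdivrMr//.
  by rewrite ltW// truncnS_gt.
rewrite -[X in `|X|]subr0 -(Vh n) -RintegralB//.
- apply: le_trans hn; apply: norm_Rintegral_prob_le.
    by apply: measurable_funB; apply: measurable_funM.
  by move=> w; rewrite -mulrBr normrM ler_pM// distrC.
- apply: (integrable_bounded (M := M * K)); first exact: measurable_funM.
  by move=> w; rewrite normrM ler_pM.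
- apply: (integrable_bounded (M := M * (K + n.+1%:R^-1))); first exact: measurable_funM.
  move=> w; rewrite normrM ler_pM//.
  rewrite -(subrK (g (X w)) (h n (X w))) addrC [leRHS]addrC.
  by rewrite (le_trans (ler_normD _ _))// addrC lerD.
Qed.

End orthogonality.

Section independence.
Context d (T : measurableType d) (R : realType) (P : probability T R).

Lemma measurable_preimage (X : T -> R) (A : set R) :
  measurable_fun setT X -> measurable A -> measurable (X @^-1` A).
Proof. by move=> mX mA; rewrite -[_ @^-1` _]setTI; exact: mX. Qed.

Lemma Rintegral_prob_indic (B : set T) : measurable B -> \int[P]_w (\1_B w : R) = fine (P B).
Proof. by move=> mB; rewrite /Rintegral integral_indic// setIT. Qed.

Lemma prob_EFin (B : set T) : measurable B -> P B = (fine (P B))%:E.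
Proof. by move=> mB; rewrite fineK// fin_num_measure. Qed.

Lemma indicM (A B : set T) (w : T) : \1_A w * \1_B w = \1_(A `&` B) w :> R.
Proof. by rewrite indicI. Qed.

Lemma norm_indic_le1 (U : Type) (A : set U) (x : U) : `|\1_A x| <= 1 :> R.
Proof. by rewrite indicE; case: (_ \in _); rewrite /= ?normr1 ?normr0. Qed.

Lemma norm_mul_le (x y M K : R) : `|x| <= M -> `|y| <= K -> `|x * y| <= M * K.
Proof. by move=> *; rewrite normrM ler_pM. Qed.

Lemma norm_sub_le (x y M K : R) : `|x| <= M -> `|y| <= K -> `|x - y| <= M + K.
Proof. by move=> hx hy; rewrite (le_trans (ler_normB _ _))// lerD. Qed.

(** Two applications of [orthogonal_to_indicators]: a centred indicator of [U] is orthogonal to the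
    indicators of [V], hence to [g (V)]; then the centred [g (V)] is orthogonal to the indicators of
    [U], hence to [f (U)]. *)
Lemma independent2_Rintegral (U V : T -> R) (f g : R -> R) (M K : R) :
  measurable_fun setT U -> measurable_fun setT V -> independent2 P U V ->
  measurable_fun setT f -> (forall x, `|f x| <= M) ->
  measurable_fun setT g -> (forall x, `|g x| <= K) ->
  \int[P]_w (f (U w) * g (V w)) = \int[P]_w f (U w) * \int[P]_w g (V w).
Proof.
move=> mU mV UV mf fM mg gK.
have mfU : measurable_fun setT (fun w => f (U w)) by exact: measurableT_comp.
have mgV : measurable_fun setT (fun w => g (V w)) by exact: measurableT_comp.
have igV := integrable_bounded P mgV (fun w => gK (V w)).
have step A : measurable A ->
    \int[P]_w (\1_A (U w) * g (V w)) = \int[P]_w (\1_A (U w) : R) * \int[P]_w g (V w).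
  move=> mA; pose p := \int[P]_w (\1_A (U w) : R).
  have m1 : measurable_fun setT (fun w => \1_A (U w) : R) by apply: measurable_fun_indic.
  have i1 : P.-integrable setT (EFin \o (fun w => \1_A (U w) * g (V w))).
    apply: (integrable_bounded P (M := 1 * K)); first exact: measurable_funM.
    by move=> w; apply: norm_mul_le => //; exact: norm_indic_le1.
  have : \int[P]_w ((\1_A (U w) - p) * g (V w)) = 0.
    apply: (orthogonal_to_indicators (M := 1 + `|p|) (K := K)) => //.
    - exact: measurable_funB.
    - by move=> w; apply: norm_sub_le => //; exact: norm_indic_le1.
    move=> B mB.
    have e1 : \int[P]_w (\1_A (U w) * \1_B (V w)) = p * \int[P]_w (\1_B (V w) : R).
      have -> : \int[P]_w (\1_A (U w) * \1_B (V w)) =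
          \int[P]_w (\1_(U @^-1` A `&` V @^-1` B) w : R).
        by apply: eq_Rintegral => w _; rewrite -indicM.
      rewrite /p -[\int[P]_w (\1_A _)]/(\int[P]_w (\1_(U @^-1` A) w : R)).
      rewrite -[\int[P]_w (\1_B _)]/(\int[P]_w (\1_(V @^-1` B) w : R)).
      rewrite !Rintegral_prob_indic//; [|exact: measurable_preimage..|].
        by rewrite UV// fineM// fin_num_measure//; exact: measurable_preimage.
      by apply: measurableI; exact: measurable_preimage.
    have mB' : measurable_fun setT (fun w => \1_B (V w) : R) by apply: measurable_fun_indic.
    have iB : P.-integrable setT (EFin \o (fun w => \1_B (V w) : R)).
      by apply: (integrable_bounded P (M := 1)) => // w; exact: norm_indic_le1.
    under eq_Rintegral do rewrite mulrBl.
    rewrite RintegralB//.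
    - by rewrite e1 RintegralZl// subrr.
    - apply: (integrable_bounded P (M := 1 * 1)); first exact: measurable_funM.
      by move=> w; apply: norm_mul_le => //; exact: norm_indic_le1.
    - exact: integrable_funZ.
  under eq_Rintegral do rewrite mulrBl.
  rewrite RintegralB//; last exact: integrable_funZ.
  by rewrite RintegralZl// => /eqP; rewrite subr_eq0 => /eqP.
pose q := \int[P]_w g (V w).
have : \int[P]_w ((g (V w) - q) * f (U w)) = 0.
  apply: (orthogonal_to_indicators (M := K + `|q|) (K := M)) => //.
  - exact: measurable_funB.
  - by move=> w; exact: norm_sub_le.
  move=> A mA; have m1 : measurable_fun setT (fun w => \1_A (U w) : R) by apply: measurable_fun_indic.
  have i1 : P.-integrable setT (EFin \o (fun w => \1_A (U w) * g (V w))).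
    apply: (integrable_bounded P (M := 1 * K)); first exact: measurable_funM.
    by move=> w; apply: norm_mul_le => //; exact: norm_indic_le1.
  have i2 : P.-integrable setT (EFin \o (fun w => \1_A (U w) : R)).
    by apply: (integrable_bounded P (M := 1)) => // w; exact: norm_indic_le1.
  have -> : \int[P]_w ((g (V w) - q) * \1_A (U w)) =
      \int[P]_w (\1_A (U w) * g (V w) - q * \1_A (U w)).
    by apply: eq_Rintegral => w _; ring.
  rewrite RintegralB//; last exact: integrable_funZ.
  by rewrite step// RintegralZl// mulrC subrr.
have ifU := integrable_bounded P mfU (fun w => fM (U w)).
have -> : \int[P]_w ((g (V w) - q) * f (U w)) = \int[P]_w (f (U w) * g (V w) - q * f (U w)).
  by apply: eq_Rintegral => w _; ring.
rewrite RintegralB//; last 2 first.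
- apply: (integrable_bounded P (M := M * K)); first exact: measurable_funM.
  by move=> w; exact: norm_mul_le.
- exact: integrable_funZ.
by rewrite RintegralZl// => /eqP; rewrite subr_eq0 => /eqP ->; rewrite mulrC.
Qed.

Lemma independent_family_indic n (Y : nat -> T -> R) (A : nat -> set R) :
  (forall i, measurable_fun setT (Y i)) ->
  independent_family P (fun i : 'I_n => Y i) -> (forall i, measurable (A i)) ->
  \int[P]_w (\prod_(0 <= i < n) \1_(A i) (Y i w)) =
  \prod_(0 <= i < n) \int[P]_w (\1_(A i) (Y i w) : R).
Proof.
move=> mY iY mA.
pose B := [set w | forall i : 'I_n, A i (Y i w)].
have -> : \int[P]_w (\prod_(0 <= i < n) \1_(A i) (Y i w)) = \int[P]_w (\1_B w : R).
  apply: eq_Rintegral => w _; rewrite big_mkord indicE.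
  have [wB|wB] := pselect (B w).
    by rewrite mem_set// big1// => i _; rewrite indicE mem_set//; exact: wB.
  rewrite memNset//; have [i nA] : exists i : 'I_n, ~ A i (Y i w).
    by apply: contrapT => h; apply: wB => i; apply: contrapT => ?; apply: h; exists i.
  by rewrite (bigD1 i)//= indicE memNset// mul0r.
have mB : measurable B.
  rewrite (_ : B = \bigcap_(i in `I_n) (Y i @^-1` A i)).
    by rewrite bigcap_mkord; apply: bigsetI_measurable => i _; exact: measurable_preimage.
  apply/seteqP; split => w /= h i; first by move=> ni; exact: (h (Ordinal ni)).
  by apply: h => /=.
rewrite Rintegral_prob_indic// big_mkord.
have := iY (fun i => A i) (fun i => mA i).
rewrite -/B => ->.
have -> : (\prod_(i < n) P (Y i @^-1` A i))%E = (\prod_(i < n) fine (P (Y i @^-1` A i)))%:E.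
  rewrite -prodEFin; by apply: eq_bigr => i _; apply: prob_EFin; exact: measurable_preimage.
apply: eq_bigr => i _.
rewrite -[\int[P]_w (\1_(A i) _)]/(\int[P]_w (\1_(Y i @^-1` A i) w : R)).
by rewrite Rintegral_prob_indic//; exact: measurable_preimage.
Qed.

(** The product rule for characteristic functions of independent summands. The hypothesis on [c]
    expresses that each summand has a symmetric characteristic function; it removes the sine terms
    of the addition formula. *)
Lemma independent_family_cos n (Y : nat -> T -> R) (c : nat -> R) :
  (forall i, measurable_fun setT (Y i)) ->
  independent_family P (fun i : 'I_n => Y i) ->
  (forall i phi, \int[P]_w cos (Y i w + phi) = cos phi * c i) ->
  forall phi, \int[P]_w cos (\sum_(0 <= i < n) Y i w + phi) = cos phi * \prod_(0 <= i < n) c i.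
Proof.
move=> mY iY Yc.
pose G (A : nat -> set R) k w : R := \prod_(k <= i < n) \1_(A i) (Y i w).
pose p (A : nat -> set R) k : R := \prod_(k <= i < n) \int[P]_w (\1_(A i) (Y i w) : R).
have mG A k : (forall i, measurable (A i)) -> measurable_fun setT (G A k).
  by move=> mA; apply: measurable_prod => i _; apply: measurable_fun_indic.
have G1 A k w : `|G A k w| <= 1.
  rewrite /G big_seq; elim/big_ind : _ => [|x y hx hy|i _]; rewrite ?normr1//.
    by rewrite -[1]mulr1; exact: norm_mul_le.
  exact: norm_indic_le1.
pose S k w := \sum_(0 <= i < k) Y i w.
have mS k : measurable_fun setT (S k) by apply: measurable_sum.
have mcS k phi : measurable_fun setT (fun w => cos (S k w + phi)).
  by apply: measurable_fun_cos; apply: measurable_funD.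
(* A mixed statement for the induction: the cosine of the first [k] summands times indicators of the
   others. At [k = 0] it is independence on events, at [k = n] the claim. *)
have main k : (k <= n)%N -> forall A phi, (forall i, measurable (A i)) ->
    \int[P]_w (cos (S k w + phi) * G A k w) =
    cos phi * \prod_(0 <= i < k) c i * p A k.
  elim: k => [_ A phi mA|k ih kn A phi mA].
    have -> : \int[P]_w (cos (S 0%N w + phi) * G A 0%N w) = \int[P]_w (cos phi * G A 0%N w).
      by apply: eq_Rintegral => w _; rewrite /S big_nil add0r.
    rewrite RintegralZl//; last exact: (integrable_bounded P (mG A 0%N mA) (G1 A 0%N)).
    by rewrite big_nil mulr1 /G independent_family_indic.
  (* Replaces the indicator of summand [k] by any bounded function: the induction hypothesis, used
     with [A k] exchanged for an arbitrary [B], is an orthogonality to indicators. *)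
  have orth psi (g : R -> R) : measurable_fun setT g -> (forall x, `|g x| <= 1) ->
      \int[P]_w (cos (S k w + psi) * G A k.+1 w * g (Y k w)) =
      cos psi * \prod_(0 <= i < k) c i * p A k.+1 * \int[P]_w g (Y k w).
    move=> mg g1; set C := cos psi * _ * _.
    have mV : measurable_fun setT (fun w => cos (S k w + psi) * G A k.+1 w).
      by apply: measurable_funM => //; exact: mG.
    have bV w : `|cos (S k w + psi) * G A k.+1 w| <= 1 * 1.
      by apply: norm_mul_le => //; exact: cos_max.
    have mgY : measurable_fun setT (fun w => g (Y k w)) by exact: measurableT_comp.
    have : \int[P]_w ((cos (S k w + psi) * G A k.+1 w - C) * g (Y k w)) = 0.
      apply: (orthogonal_to_indicators (M := 1 * 1 + `|C|) (K := 1)) => //.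
      - exact: measurable_funB.
      - by move=> w; exact: norm_sub_le.
      move=> B mB; pose A' i := if i == k then B else A i.
      have mA' i : measurable (A' i) by rewrite /A'; case: ifP.
      have := ih (ltnW kn) A' psi mA'.
      have GA' w : G A' k w = \1_B (Y k w) * G A k.+1 w.
        rewrite /G big_ltn// /A' eqxx; congr (_ * _).
        by apply: eq_big_nat => i /andP[ki _]; rewrite gtn_eqF.
      have -> : p A' k = \int[P]_w (\1_B (Y k w) : R) * p A k.+1.
        rewrite /p big_ltn// /A' eqxx; congr (_ * _).
        by apply: eq_big_nat => i /andP[ki _]; rewrite gtn_eqF.
      under eq_Rintegral do rewrite GA'.
      move=> e.
      have iB : P.-integrable setT (EFin \o (fun w => \1_B (Y k w) : R)).
        apply: (integrable_bounded P (M := 1)); first by apply: measurable_fun_indic.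
        by move=> w; exact: norm_indic_le1.
      under eq_Rintegral do rewrite mulrBl.
      rewrite RintegralB//; last 2 first.
      - apply: (integrable_bounded P (M := 1 * 1 * 1)).
          by apply: measurable_funM => //; apply: measurable_fun_indic.
        by move=> w; apply: norm_mul_le => //; exact: norm_indic_le1.
      - exact: integrable_funZ.
      rewrite RintegralZl//.
      have -> : \int[P]_w (cos (S k w + psi) * G A k.+1 w * \1_B (Y k w)) =
          \int[P]_w (cos (S k w + psi) * (\1_B (Y k w) * G A k.+1 w)).
        by apply: eq_Rintegral => w _; ring.
      by rewrite e /C; ring.
    under eq_Rintegral do rewrite mulrBl.
    rewrite RintegralB//; last 2 first.
    - apply: (integrable_bounded P (M := 1 * 1 * 1)); first exact: measurable_funM.
      by move=> w; apply: norm_mul_le.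
    - by apply: integrable_funZ => //; exact: (integrable_bounded P mgY (fun w => g1 _)).
    rewrite RintegralZl//; last exact: (integrable_bounded P mgY (fun w => g1 _)).
    by move/eqP; rewrite subr_eq0 => /eqP.
  have mc : measurable_fun setT (@cos R) by apply: continuous_measurable_fun; exact: continuous_cos.
  have ms : measurable_fun setT (@sin R) by apply: continuous_measurable_fun; exact: continuous_sin.
  (* A phase shift by pi/2 writes the sine of the partial sum as a cosine, so that [orth] covers
     both terms of the addition formula. *)
  have -> : \int[P]_w (cos (S k.+1 w + phi) * G A k.+1 w) =
    \int[P]_w (cos (S k w + phi) * G A k.+1 w * cos (Y k w) -
               cos (S k w + (phi - pi / 2)) * G A k.+1 w * sin (Y k w)).
    apply: eq_Rintegral => w _; rewrite /S big_nat_recr//= -/(S k w).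
    have -> : S k w + (phi - pi / 2) = (S k w + phi) - pi / 2 by ring.
    rewrite cosB cos_pihalf sin_pihalf mulr0 add0r mulr1.
    have -> : S k w + Y k w + phi = (S k w + phi) + Y k w by ring.
    by rewrite cosD; ring.
  have ibd psi (g : R -> R) : measurable_fun setT g -> (forall x, `|g x| <= 1) ->
      P.-integrable setT (EFin \o (fun w => cos (S k w + psi) * G A k.+1 w * g (Y k w))).
    move=> mg g1; apply: (integrable_bounded P (M := 1 * 1 * 1)).
      apply: measurable_funM; last exact: measurableT_comp.
      by apply: measurable_funM => //; exact: mG.
    move=> w; apply: norm_mul_le => //; apply: norm_mul_le => //; exact: cos_max.
  rewrite RintegralB//; [|by apply: ibd => // x; exact: cos_max|by apply: ibd => // x; exact: sin_max].
  rewrite !orth//; [|exact: sin_max|exact: cos_max].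
  have -> : \int[P]_w cos (Y k w) = c k.
    have := Yc k 0; rewrite cos0 mul1r => <-.
    by apply: eq_Rintegral => w _; rewrite addr0.
  have -> : \int[P]_w sin (Y k w) = 0.
    have := Yc k (- (pi / 2)); rewrite cosN cos_pihalf mul0r => <-.
    by apply: eq_Rintegral => w _; rewrite cosB cos_pihalf sin_pihalf mulr0 add0r mulr1.
  by rewrite mulr0 subr0 big_nat_recr//=; ring.
move=> phi; have := main n (leqnn n) (fun=> setT) phi (fun=> measurableT).
rewrite /p (@big_geq _ _ _ n n)// mulr1 => <-.
by apply: eq_Rintegral => w _; rewrite /G big_geq// mulr1.
Qed.

End independence.

(** * Normal laws and the Gaussian characteristic function *)

Section normal_law.
Context {R : realType}.
Local Notation mu := (@lebesgue_measure R).

Lemma lebesgue_measureZ (c : R) (A : set R) : 0 < c -> measurable A ->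
  (c%:E * pushforward mu ((fun x => (c * x)%R) : _ -> measurableTypeR R) A = mu A)%E.
Proof.
move=> c0 mA; apply/esym.
have mf : measurable_fun setT (fun x : measurableTypeR R => c * x : measurableTypeR R).
  by apply: measurable_funM => //.
pose phi : {mfun measurableTypeR R >-> measurableTypeR R} :=
  HB.pack (fun x : measurableTypeR R => c * x : measurableTypeR R)
    (isMeasurableFun.Build _ _ _ _ _ mf).
apply: (@lebesgue_measure_unique R (mscale (NngNum (ltW c0)) (pushforward mu phi))) => //= _ [[a b]] _ <-.
rewrite /mscale/= /pushforward/=.
have -> : (fun x : R => c * x) @^-1` [set` `]a, b]] = [set` `]a / c, b / c]].
  by apply/seteqP; split => x /=; rewrite !in_itv/= ltr_pdivrMr// ler_pdivlMr// [x * c]mulrC.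
rewrite !lebesgue_measure_itv/= !lte_fin ltr_pM2r ?invr_gt0//.
case: ifP => _; last by rewrite mule0.
by rewrite -!EFinB -EFinM; congr (_%:E); field; rewrite gt_eqF.
Qed.

Lemma ge0_integral_scale (c : R) (f : R -> R) : 0 < c ->
  measurable_fun setT f -> (forall x, 0 <= f x) ->
  (c%:E * \int[mu]_x (f (c * x))%:E = \int[mu]_x (f x)%:E)%E.
Proof.
move=> c0 mf f0.
have mphi : measurable_fun setT (fun x : measurableTypeR R => c * x : measurableTypeR R).
  by apply: measurable_funM => //.
rewrite -[X in (_ * X)%E](@ge0_integral_pushforward _ _ (measurableTypeR R) (measurableTypeR R) _
  (fun x => c * x) mphi mu setT (fun x => (f x)%:E))//; last 2 first.
  exact/measurable_EFinP.
  by move=> x _; rewrite lee_fin.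
rewrite -(@ge0_integral_mscale _ _ _ _ _ _ (NngNum (ltW c0)))//; last 2 first.
  by apply/(@measurable_EFinP _ (measurableTypeR R)).
  by move=> x _; rewrite lee_fin.
by apply: eq_measure_integral => A mA _; rewrite /= /mscale/=; exact: lebesgue_measureZ.
Qed.

Lemma normal_probE (s : R) (A : set R) : measurable A ->
  (normal_prob 0 s A = \int[mu]_x (\1_A x * normal_pdf 0 s x)%:E)%E.
Proof.
by move=> mA; rewrite /normal_prob integral_indic_mul.
Qed.

(** Reduces every standard deviation to 1, so that a single reference law carries all characteristic
    functions. *)
Lemma normal_prob_scale (s : R) (A : set R) : 0 < s -> measurable A ->
  normal_prob 0 s A = normal_prob 0 1 ((fun x => s * x) @^-1` A).
Proof.
move=> s0 mA.
have mB : measurable ((fun x => s * x) @^-1` A).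
  by apply: measurable_preimage => //; apply: measurable_funM.
rewrite (normal_probE s mA) (normal_probE 1 mB).
rewrite -(@ge0_integral_scale s (fun x => \1_A x * normal_pdf 0 s x))//; last 2 first.
- by apply: measurable_funM; [exact: measurable_indic|exact: measurable_normal_pdf].
- by move=> x; rewrite mulr_ge0 ?normal_pdf_ge0// indicE.
rewrite -ge0_integralZl//=; last 3 first.
- apply/measurable_EFinP; apply: measurable_funM; first by apply: measurable_fun_indic => //; apply: measurable_funM.
  by apply: (measurableT_comp (measurable_normal_pdf 0 s)); apply: measurable_funM.
- by move=> x _; rewrite lee_fin mulr_ge0 ?normal_pdf_ge0// indicE.
- by rewrite lee_fin ltW.
apply: eq_integral => x _; rewrite -EFinM; congr EFin.
have -> : \1_((fun x => s * x) @^-1` A) x = \1_A (s * x) :> R by [].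
rewrite mulrCA; congr (_ * _).
rewrite !normal_pdfE ?oner_neq0 ?gt_eqF// /normal_peak /normal_fun !subr0.
rewrite mulrA; congr (_ * expR _); last first.
  by rewrite exprMn; field; rewrite gt_eqF.
by rewrite expr1n mul1r -mulrnAr sqrtrM ?sqr_ge0// sqrtr_sqr gtr0_norm// invfM mulrA divff ?gt_eqF// mul1r.
Qed.

Lemma normal_probN (A : set R) : measurable A ->
  normal_prob 0 1 A = normal_prob 0 1 ((fun x => - x) @^-1` A).
Proof.
move=> mA.
have mB : measurable ((fun x => - x) @^-1` A).
  by apply: measurable_preimage => //; apply: measurable_funN.
rewrite (normal_probE 1 mA) (normal_probE 1 mB).
rewrite -[LHS](@ge0_integral_opp _ (fun x => \1_A x * normal_pdf 0 1 x)); last 2 first.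
- by apply: measurable_funM; [exact: measurable_indic|exact: measurable_normal_pdf].
- by move=> x; rewrite mulr_ge0 ?normal_pdf_ge0// indicE.
apply: eq_integral => x _; congr (_ * _)%:E.
by rewrite !normal_pdfE ?oner_neq0// /normal_fun !subr0 sqrrN.
Qed.

End normal_law.

Section laws.
Context d (T : measurableType d) (R : realType) (P : probability T R).
Context d' (T' : measurableType d') (P' : probability T' R).

Lemma eq_law_Rintegral (X : T -> R) (X' : T' -> R) (g : R -> R) (M : R) :
  measurable_fun setT X -> measurable_fun setT X' ->
  (forall A, measurable A -> P (X @^-1` A) = P' (X' @^-1` A)) ->
  measurable_fun setT g -> (forall x, `|g x| <= M) ->
  \int[P]_w g (X w) = \int[P']_w g (X' w).
Proof.
move=> mX mX' XX' mg gM; rewrite /Rintegral; congr fine.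
have mgE : measurable_fun setT (EFin \o g) by exact/measurable_EFinP.
rewrite -[LHS](@integral_pushforward _ _ _ _ R X mX P setT (EFin \o g))//; last first.
  by apply: (integrable_bounded P (M := M)) => //; exact: measurableT_comp.
rewrite -[RHS](@integral_pushforward _ _ _ _ R X' mX' P' setT (EFin \o g))//; last first.
  by apply: (integrable_bounded P' (M := M)) => //; exact: measurableT_comp.
by apply: eq_measure_integral => A mA _; exact: XX'.
Qed.

End laws.

Section gaussian_characteristic_function.
Context {R : realType}.

(** The function e^(-v/2) for v >= 0. For negative [v] the square root is 0 and the value is 1. *)
Definition gauss_cf (v : R) : R := \int[normal_prob 0 1]_x cos (Num.sqrt v * x).

Lemma Rintegral_normal_sin (c : R) : \int[normal_prob 0 1]_x sin (c * x) = 0.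
Proof.
have mf : measurable_fun setT (fun x : R => c * x) by apply: measurable_funM.
have msin : measurable_fun setT (@sin R) by apply: continuous_measurable_fun; exact: continuous_sin.
have e : \int[normal_prob 0 1]_x sin (c * x) = \int[normal_prob 0 1]_x sin (c * (- x)).
  apply: (@eq_law_Rintegral _ _ R (normal_prob 0 1) _ _ (normal_prob 0 1) idfun (fun x => - x)
    (fun x => sin (c * x)) 1) => //; first exact: measurable_id.
  - exact: measurable_funN.
  - by move=> A mA; exact: normal_probN.
  - exact: measurable_fun_sin.
  - by move=> x; exact: sin_max.
have e2 : \int[normal_prob 0 1]_x sin (c * (- x)) = - \int[normal_prob 0 1]_x sin (c * x).
  rewrite -mulN1r -RintegralZl//; first by apply: eq_Rintegral => x _; rewrite mulrN sinN mulN1r.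
  apply: (integrable_bounded _ (M := 1)); first exact: measurable_fun_sin.
  by move=> x; exact: sin_max.
have h : forall I : R, I = - I -> I = 0 by clear; move=> I h; lra.
by apply: h; rewrite -e2.
Qed.

Lemma Rintegral_normal_cos (c phi : R) :
  \int[normal_prob 0 1]_x cos (c * x + phi) = cos phi * \int[normal_prob 0 1]_x cos (c * x).
Proof.
have mf : measurable_fun setT (fun x : R => c * x) by apply: measurable_funM.
have ic : (normal_prob (0:R) 1).-integrable setT (EFin \o (fun x => cos (c * x))).
  by apply: (integrable_bounded _ (M := 1)) => [|x]; [exact: measurable_fun_cos|exact: cos_max].
have is_ : (normal_prob (0:R) 1).-integrable setT (EFin \o (fun x => sin (c * x))).
  by apply: (integrable_bounded _ (M := 1)) => [|x]; [exact: measurable_fun_sin|exact: sin_max].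
have -> : \int[normal_prob 0 1]_x cos (c * x + phi) =
    \int[normal_prob 0 1]_x (cos phi * cos (c * x) - sin phi * sin (c * x)).
  by apply: eq_Rintegral => x _; rewrite cosD; ring.
rewrite RintegralB//; [|exact: integrable_funZ..].
by rewrite !RintegralZl// Rintegral_normal_sin mulr0 subr0.
Qed.

Lemma gauss_cf_sqr (c v : R) : 0 <= v ->
  gauss_cf (c ^+ 2 * v) = \int[normal_prob 0 1]_x cos (c * Num.sqrt v * x).
Proof.
move=> v0; rewrite /gauss_cf sqrtrM ?sqr_ge0// sqrtr_sqr.
apply: eq_Rintegral => x _; have [c0|c0] := leP 0 c.
  by rewrite ger0_norm.
by rewrite ltr0_norm// !mulNr cosN.
Qed.

Lemma gauss_cf0 : gauss_cf 0 = 1.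
Proof.
rewrite /gauss_cf sqrtr0.
have -> : \int[normal_prob 0 1]_x cos (0 * x) = \int[normal_prob (0:R) 1]_x (1 : R).
  by apply: eq_Rintegral => x _; rewrite mul0r cos0.
exact: Rintegral_prob_cst.
Qed.

Lemma gauss_cf_le1 v : gauss_cf v <= 1.
Proof.
apply: le_trans (ler_norm _) _; apply: norm_Rintegral_prob_le.
  by apply: measurable_fun_cos; apply: measurable_funM.
by move=> x; exact: cos_max.
Qed.

Lemma cvg_gauss_cf (v : nat -> R) (l : R) :
  v n @[n --> \oo] --> l -> gauss_cf (v n) @[n --> \oo] --> gauss_cf l.
Proof.
move=> vl; apply: (@cvg_Rintegral _ _ _ (normal_prob 0 1) setT _
  (fun n x => cos (Num.sqrt (v n) * x)) (fun x => cos (Num.sqrt l * x)) (fun=> 1)) => //.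
- by move=> n; apply: measurable_fun_cos; apply: measurable_funM.
- move=> x _; apply: (cvg_comp_continuous (@continuous_cos R _)).
  apply: cvgM; last exact: cvg_cst.
  exact: (cvg_comp_continuous (@sqrt_continuous R _)).
- by apply: (integrable_bounded _ (M := 1)) => // x; rewrite normr1.
- by move=> n x _; exact: cos_max.
Qed.

Section char_gaussian.
Context d (T : measurableType d) (P : probability T R).

(* The phase [phi] carries both the real and the imaginary part. *)
Definition char_gaussian (X : T -> R) (v : R) : Prop :=
  forall phi : R, \int[P]_w cos (X w + phi) = cos phi * gauss_cf v.

Lemma centered_gaussian_char (X : T -> R) (c v : R) :
  measurable_fun setT X -> centered_gaussian P X v ->
  char_gaussian (fun w => c * X w) (c ^+ 2 * v).
Proof.
move=> mX [v0 law] phi.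
have mc : measurable_fun setT (fun x : R => cos (c * x + phi)).
  by apply: measurable_fun_cos; apply: measurable_funD => //; apply: measurable_funM.
have [vE|vN] := eqVneq v 0.
  have Z : \int[P]_w cos (c * X w + phi) = \int[P]_w cos (c * 0 + phi).
    apply: (@eq_law_Rintegral _ _ R P _ _ P X (fun=> 0) (fun x => cos (c * x + phi)) 1) => //.
      move=> A mA; rewrite law// vE eqxx diracE.
      have [A0|A0] := pselect (A 0).
        rewrite mem_set// (_ : _ @^-1` A = setT) ?probability_setT//.
        by apply/seteqP; split.
      rewrite memNset// (_ : _ @^-1` A = set0) ?measure0//.
      by apply/seteqP; split.
    by move=> x; exact: cos_max.
  by rewrite Z mulr0 add0r Rintegral_prob_cst vE mulr0 gauss_cf0 mulr1.
have vp : 0 < v by rewrite lt_neqAle eq_sym vN.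
have s0 : 0 < Num.sqrt v by rewrite sqrtr_gt0.
rewrite gauss_cf_sqr//.
have -> : \int[P]_w cos (c * X w + phi) =
   \int[normal_prob 0 1]_x cos (c * (Num.sqrt v * x) + phi).
  apply: (@eq_law_Rintegral _ _ R P _ _ (normal_prob 0 1) X (fun x => Num.sqrt v * x)
    (fun x => cos (c * x + phi)) 1) => //.
  - by apply: measurable_funM.
  - by move=> A mA; rewrite law// (negbTE vN) normal_prob_scale.
  - by move=> x; exact: cos_max.
under eq_Rintegral do rewrite mulrA.
exact: Rintegral_normal_cos.
Qed.

Lemma centered_gaussian_neq (X : T -> R) (v x : R) :
  centered_gaussian P X v -> v != 0 -> P [set w | X w = x] = 0%E.
Proof.
move=> [_ law] vN.
have -> : [set w | X w = x] = X @^-1` [set x] by [].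
rewrite law// (negbTE vN).
have /null_content_dominatesP := @normal_prob_dominates R 0 (Num.sqrt v).
by apply => //; exact: lebesgue_measure_set1.
Qed.

End char_gaussian.

End gaussian_characteristic_function.

(** * Wiener integrals *)

Section step_functions.
Context {R : realType}.
Local Notation mu := (@lebesgue_measure R).
Implicit Types (t : nat -> R) (s : seq (R * R * R)).

(** A grid through all the given points, as a nondecreasing sequence on all of nat, the form in
    which the increments of [W] are independent. Beyond the sorted list the sequence repeats its
    last point ([minn i K]), which only adds zero increments. *)
Lemma nondecreasing_enumeration (ts : seq R) :
  exists t N, {homo t : i j / (i <= j)%N >-> i <= j} /\
    forall x, x \in ts -> exists2 i, (i <= N)%N & t i = x.
Proof.
pose ss := sort <=%R ts; pose K := (size ss).-1.
exists (fun i => nth 0 ss (minn i K)), K; split.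
  move=> i j ij; have [ss0|ss0] := posnP (size ss).
    by rewrite !nth_default ?ss0.
  apply: (sorted_leq_nth le_trans le_refl) => //.
  - exact: sort_le_sorted.
  - by rewrite inE (leq_ltn_trans (geq_minr _ _))// prednK.
  - by rewrite inE (leq_ltn_trans (geq_minr _ _))// prednK.
  - by rewrite leq_min geq_minr andbT (leq_trans (geq_minl _ _)).
move=> x; rewrite -(mem_sort <=%R) => xs; exists (index x ss).
  by rewrite -ltnS prednK ?index_mem// (leq_ltn_trans _ (_ : index x ss < size ss)%N)// index_mem.
rewrite (minn_idPl _) ?nth_index//.
by rewrite -ltnS prednK ?index_mem// (leq_ltn_trans _ (_ : index x ss < size ss)%N)// index_mem.
Qed.

(** With repeated grid points the indices may come in the wrong order; then [t i0 = t j0] and every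
    term vanishes. *)
Lemma telescope_between (f : R -> R) t (N i0 j0 : nat) :
  {homo t : i j / (i <= j)%N >-> i <= j} -> (i0 <= N)%N -> (j0 <= N)%N -> t i0 <= t j0 ->
  \sum_(0 <= i < N) (if (t i0 <= t i) && (t i.+1 <= t j0) then f (t i.+1) - f (t i) else 0) =
  f (t j0) - f (t i0).
Proof.
move=> ht i0N j0N tij.
have tS i : t i <= t i.+1 by exact: ht.
have z i : t i.+1 <= t i -> f (t i.+1) - f (t i) = 0.
  by move=> h; rewrite (@le_anti _ _ (t i.+1) (t i)) ?subrr// h tS.
have [ij|ji] := leqP i0 j0.
  rewrite (big_cat_nat (n := i0))//= (big_cat_nat (n := j0) (m := i0))//=.
  rewrite big_nat big1 ?add0r; last first.
    move=> i /andP[_ ii0]; case: ifP => // /andP[h _]; apply: z.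
    by apply: le_trans h; exact: ht.
  rewrite [X in _ + X]big_nat [X in _ + X]big1 ?addr0; last first.
    move=> i /andP[ji _]; case: ifP => // /andP[_ h]; apply: z.
    by apply: (le_trans h); exact: ht.
  rewrite (eq_big_nat _ _ (F2 := fun i => f (t i.+1) - f (t i))).
    by rewrite (telescope_sumr (fun i => f (t i))).
  by move=> i /andP[ii ij0]; rewrite !ht.
rewrite (@le_anti _ _ (t i0) (t j0)) ?subrr; last by rewrite tij ht// ltnW.
rewrite big1// => i _; case: ifP => // /andP[h1 h2]; apply: z.
exact: le_trans h1.
Qed.

Definition step_coef t s (i : nat) : R :=
  \sum_(q <- s) (if (q.1.2 <= t i) && (t i.+1 <= q.2) then q.1.1 else 0).

(** Stated for an arbitrary [f] because two of them occur: the function y |-> (x <= y), which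
    refines the step function at x, and a path of [W], which refines its integral. *)
Lemma step_refine t (N : nat) s (f : R -> R) :
  {homo t : i j / (i <= j)%N >-> i <= j} -> step_wf s ->
  (forall q, q \in s -> (exists2 i, (i <= N)%N & t i = q.1.2) /\
                         (exists2 i, (i <= N)%N & t i = q.2)) ->
  \sum_(q <- s) q.1.1 * (f q.2 - f q.1.2) =
  \sum_(0 <= i < N) step_coef t s i * (f (t i.+1) - f (t i)).
Proof.
move=> ht /allP wf ts.
under [RHS]eq_bigr do rewrite /step_coef mulr_suml.
rewrite exchange_big /= big_seq [RHS]big_seq; apply: eq_bigr => q qs.
have [[i0 i0N ti0] [j0 j0N tj0]] := ts q qs; have uv := wf q qs.
rewrite -ti0 -tj0 in uv *; rewrite -(telescope_between f ht i0N j0N uv) mulr_sumr.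
by apply: eq_bigr => i _; case: ifP => _; rewrite ?mulr0 ?mul0r.
Qed.

Lemma indic_ocitv (u v x : R) : u <= v ->
  \1_(`]u, v]) x = (x <= v)%R%:R - (x <= u)%R%:R :> R.
Proof.
move=> uv; rewrite indicE mem_setE in_itv/= ltNge.
have [xu|ux] := leP x u; first by rewrite (le_trans xu uv) subrr.
by rewrite subr0.
Qed.

Lemma step_fun_refine t (N : nat) s x :
  {homo t : i j / (i <= j)%N >-> i <= j} -> step_wf s ->
  (forall q, q \in s -> (exists2 i, (i <= N)%N & t i = q.1.2) /\
                         (exists2 i, (i <= N)%N & t i = q.2)) ->
  step_fun s x = \sum_(0 <= i < N) step_coef t s i * \1_(`]t i, t i.+1]) x.
Proof.
move=> ht wf ts.
under [RHS]eq_bigr => i _ do rewrite indic_ocitv ?ht//.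
rewrite -(step_refine (fun y => (x <= y)%R%:R) ht wf ts) /step_fun.
rewrite big_seq [RHS]big_seq; apply: eq_bigr => q qs.
by rewrite indic_ocitv//; move/allP : wf => /(_ q qs).
Qed.

Lemma sqr_sum_disjoint t (a : nat -> R) (N : nat) x :
  {homo t : i j / (i <= j)%N >-> i <= j} ->
  (\sum_(0 <= i < N) a i * \1_(`]t i, t i.+1]) x) ^+ 2 =
  \sum_(0 <= i < N) a i ^+ 2 * \1_(`]t i, t i.+1]) x.
Proof.
move=> ht; elim: N => [|N ih]; first by rewrite !big_nil expr0n.
rewrite !big_nat_recr//= sqrrD ih.
have [xN|xN] := boolP (x \in `]t N, t N.+1]%classic); last first.
  by rewrite !indicE (negbTE xN) !mulr0 mul0rn expr0n !addr0.
rewrite [X in X *+ 2](_ : _ = 0).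
  by rewrite mul0rn addr0 !indicE xN !mulr1.
rewrite big_nat big1 ?mul0r// => i /andP[_ iN].
rewrite indicE memNset ?mulr0//= in_itv/=.
move: xN; rewrite inE/= in_itv/= => /andP[tN _] /andP[_ xi].
by move: tN; rewrite ltNge (le_trans xi)//; exact: ht.
Qed.

Lemma Rintegral_indic_ocitv (u v : R) : u <= v -> \int[mu]_x (\1_(`]u, v]) x : R) = v - u.
Proof.
move=> uv; rewrite /Rintegral integral_indic//= setIT lebesgue_measure_itv/= lte_fin.
by case: ltP => h//=; rewrite (@le_anti _ _ u v) ?subrr// uv.
Qed.

Lemma integrable_indic_ocitv (u v : R) : mu.-integrable setT (EFin \o (\1_(`]u, v]) : R -> R)).
Proof. by apply: integrable_indic_itv. Qed.

Lemma step_fun_sqr_refine t (N : nat) s :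
  {homo t : i j / (i <= j)%N >-> i <= j} -> step_wf s ->
  (forall q, q \in s -> (exists2 i, (i <= N)%N & t i = q.1.2) /\
                         (exists2 i, (i <= N)%N & t i = q.2)) ->
  mu.-integrable setT (EFin \o (fun x => step_fun s x ^+ 2)) /\
  \int[mu]_x (step_fun s x ^+ 2) =
  \sum_(0 <= i < N) step_coef t s i ^+ 2 * (t i.+1 - t i).
Proof.
move=> ht wf ts.
have e : (fun x => step_fun s x ^+ 2) =
   (fun x => \sum_(0 <= i < N) step_coef t s i ^+ 2 * \1_(`]t i, t i.+1]) x).
  by apply/funext => x; rewrite (step_fun_refine x ht wf ts) sqr_sum_disjoint.
have ii i : mu.-integrable setT (EFin \o (fun x => step_coef t s i ^+ 2 * \1_(`]t i, t i.+1]) x)).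
  by apply: integrable_funZ => //; exact: integrable_indic_ocitv.
rewrite e; split; first exact: integrable_fun_sum.
rewrite Rintegral_sum//; apply: eq_bigr => i _.
rewrite RintegralZl//; last exact: integrable_indic_ocitv.
by rewrite Rintegral_indic_ocitv// ht.
Qed.

Lemma step_endpoints s : exists t N, {homo t : i j / (i <= j)%N >-> i <= j} /\
  forall q, q \in s -> (exists2 i, (i <= N)%N & t i = q.1.2) /\
                         (exists2 i, (i <= N)%N & t i = q.2).
Proof.
have [t [N [ht tx]]] := nondecreasing_enumeration
  ([seq q.1.2 | q : R * R * R <- s] ++ [seq q.2 | q : R * R * R <- s]).
exists t, N; split => // q qs; split; apply: tx; rewrite mem_cat.
  by apply/orP; left; exact: (map_f (fun q : R * R * R => q.1.2)).
by apply/orP; right; exact: (map_f (fun q : R * R * R => q.2)).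
Qed.

Lemma measurable_step_fun s : measurable_fun setT (step_fun s).
Proof.
by apply: measurable_sum => q; apply: measurable_funM.
Qed.

End step_functions.

Section wiener_steps.
Context d (T : measurableType d) (R : realType) (P : probability T R).
Variable W : R -> {RV P >-> R}.
Hypothesis W_wiener : wiener_process W.

Lemma wiener_increment_char (a s t : R) : s <= t ->
  char_gaussian P (fun w => a * (W t w - W s w)) (a ^+ 2 * (t - s)).
Proof.
move=> st; apply: centered_gaussian_char; last exact: wiener_increment.
by apply: measurable_funB.
Qed.

Lemma wiener_increments_char (t a : nat -> R) (N : nat) :
  {homo t : i j / (i <= j)%N >-> i <= j} ->
  forall phi, \int[P]_w cos (\sum_(0 <= i < N) a i * (W (t i.+1) w - W (t i) w) + phi) =
    cos phi * \prod_(0 <= i < N) gauss_cf (a i ^+ 2 * (t i.+1 - t i)).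
Proof.
move=> ht; apply: (@independent_family_cos _ _ _ P N
  (fun i w => a i * (W (t i.+1) w - W (t i) w))).
- by move=> i; apply: measurable_funM => //; apply: measurable_funB.
- move=> A mA; have mA' (i : 'I_N) : measurable ((fun x => a i * x) @^-1` A i).
    by apply: measurable_preimage => //; apply: measurable_funM.
  have := wiener_independent W_wiener ht mA'; exact.
- by move=> i phi; apply: wiener_increment_char; exact: ht.
Qed.

(** Read off the process: the increment of [W] over [0, v + u] is the sum of two independent
    increments, of variances [v] and [u]. *)
Lemma gauss_cfD (v u : R) : 0 <= v -> 0 <= u -> gauss_cf (v + u) = gauss_cf v * gauss_cf u.
Proof.
move=> v0 u0; pose t i : R := if i is 0%N then 0 else if i is 1%N then v else v + u.
have ht : {homo t : i j / (i <= j)%N >-> i <= j}.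
  by move=> [|[|i]] [|[|j]] //= _; rewrite /t ?addr_ge0 ?lerDl.
have := @wiener_increments_char t (fun=> 1) 2 ht 0.
rewrite cos0 mul1r big_nat_recr//= big_nat1 /t !expr1n !mul1r subr0 addrAC subrr add0r => <-.
have := @wiener_increment_char 1 0 (v + u) (addr_ge0 v0 u0) 0.
rewrite cos0 mul1r expr1n mul1r subr0 => <-.
apply: eq_Rintegral => w _; congr cos; congr (_ + _).
by rewrite big_nat_recr//= big_nat1; ring.
Qed.

Lemma gauss_cf_prod (N : nat) (v : nat -> R) : (forall i, 0 <= v i) ->
  \prod_(0 <= i < N) gauss_cf (v i) = gauss_cf (\sum_(0 <= i < N) v i).
Proof.
move=> v0; elim: N => [|N ih]; first by rewrite !big_nil gauss_cf0.
by rewrite !big_nat_recr//= ih -gauss_cfD// sumr_ge0.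
Qed.

Lemma step_integral_char s : step_wf s ->
  char_gaussian P (step_integral W s) (\int[lebesgue_measure]_x (step_fun s x ^+ 2)).
Proof.
move=> wf phi; have [t [N [ht ts]]] := step_endpoints s.
rewrite (step_fun_sqr_refine ht wf ts).2 -gauss_cf_prod; last first.
  by move=> i; rewrite mulr_ge0 ?sqr_ge0// subr_ge0 ht.
rewrite -wiener_increments_char//; apply: eq_Rintegral => w _.
by rewrite /step_integral (step_refine (fun y => W y w) ht wf ts).
Qed.

Lemma integrable_step_fun_sqr s : step_wf s ->
  lebesgue_measure.-integrable setT (EFin \o (fun x : R => step_fun s x ^+ 2)).
Proof.
by move=> wf; have [t [N [ht ts]]] := step_endpoints s; have [] := step_fun_sqr_refine ht wf ts.
Qed.

Lemma measurable_step_integral s : measurable_fun setT (step_integral W s).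
Proof.
apply: measurable_sum => q; apply: measurable_funM => //; exact: measurable_funB.
Qed.

End wiener_steps.

Section square_limits.
Context {R : realType}.

Lemma cvge0_eventually (u : nat -> \bar R) : u n @[n --> \oo] --> 0%E ->
  forall e : R, 0 < e -> exists N, forall n, (N <= n)%N -> (u n < e%:E)%E.
Proof.
move=> /fine_cvgP[[N1 _ h1] /cvgrPdist_lt h2] e e0.
have [N2 _ h] := h2 e e0; exists (maxn N1 N2) => n; rewrite geq_max => /andP[n1 n2].
have := h n n2; have fn := h1 n n1; rewrite /= sub0r normrN => hn.
by rewrite -(fineK fn) lte_fin (le_lt_trans (ler_norm _)).
Qed.

(** Young's inequality for x^2 - y^2 = (x - y)^2 + 2 (x - y) y, with a small weight [del] on y^2; it
    deduces convergence of norms from convergence in L^2. *)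
Lemma sqr_sub_bound (x y del : R) : 0 < del ->
  `|x ^+ 2 - y ^+ 2| <= (1 + del^-1) * (x - y) ^+ 2 + del * y ^+ 2.
Proof.
move=> d0; have d1 : 0 < del^-1 by rewrite invr_gt0.
have h (z : R) : 2 * (z * y) <= del^-1 * z ^+ 2 + del * y ^+ 2.
  have : 0 <= del^-1 * (z - del * y) ^+ 2 by rewrite mulr_ge0 ?sqr_ge0// ltW.
  have -> : del^-1 * (z - del * y) ^+ 2 = del^-1 * z ^+ 2 - 2 * (z * y) + del * y ^+ 2.
    by field; rewrite gt_eqF.
  by clear; lra.
have -> : x ^+ 2 - y ^+ 2 = (x - y) ^+ 2 + 2 * ((x - y) * y) by ring.
have := h (x - y); have := h (- (x - y)); rewrite sqrrN mulNr mulrN.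
rewrite (mulrDl 1 del^-1) mul1r ler_norml; have := sqr_ge0 (x - y).
move: ((x - y) ^+ 2) ((x - y) * y) => p q.
move: (del^-1 * p) (del * y ^+ 2) => u v; clear => h1 h2 h3; apply/andP; split; lra.
Qed.

Context d (T : measurableType d) (mu : {measure set T -> \bar R}).

Lemma integrable_sqr_of_lty (f : T -> R) : measurable_fun setT f ->
  (\int[mu]_x (f x ^+ 2)%:E < +oo)%E -> mu.-integrable setT (EFin \o (fun x => f x ^+ 2)).
Proof.
move=> mf fy; apply/integrableP; split; first by apply/measurable_EFinP; apply: measurable_funX.
by rewrite (_ : (fun x => _) = fun x => (f x ^+ 2)%:E)//; apply/funext => x /=; rewrite ger0_norm// sqr_ge0.
Qed.

Lemma cvg_Rintegral_sqr (f_ : nat -> T -> R) (f : T -> R) :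
  (forall n, measurable_fun setT (f_ n)) -> measurable_fun setT f ->
  (forall n, mu.-integrable setT (EFin \o (fun x => f_ n x ^+ 2))) ->
  mu.-integrable setT (EFin \o (fun x => f x ^+ 2)) ->
  (\int[mu]_x ((f_ n x - f x) ^+ 2)%:E)%E @[n --> \oo] --> 0%E ->
  \int[mu]_x (f_ n x ^+ 2) @[n --> \oo] --> \int[mu]_x (f x ^+ 2).
Proof.
move=> mf_ mf if_ if_f h; apply/cvgrPdist_le => e e0.
pose V := \int[mu]_x (f x ^+ 2).
have V0 : 0 <= V by apply: Rintegral_ge0 => x _; exact: sqr_ge0.
(* [del] makes the contribution of the limit at most e/2; [eta] is then how small the squared L^2
   distance must be for the other half. *)
pose del := e / (2 * (V + 1)).
have V1 : 0 < V + 1 by rewrite ltr_wpDl.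
have d0 : 0 < del by rewrite divr_gt0// mulr_gt0.
pose eta := e / (2 * (1 + del^-1)).
have dd : 0 < 1 + del^-1 by rewrite ltr_pwDl// ltW// invr_gt0.
have eta0 : 0 < eta by rewrite divr_gt0// mulr_gt0.
have [N hN] := cvge0_eventually h eta0; exists N => // n /hN hn.
have iD : mu.-integrable setT (EFin \o (fun x => (f_ n x - f x) ^+ 2)).
  by apply: integrable_sqr_of_lty; [exact: measurable_funB|rewrite (lt_le_trans hn)// leey].
have hn' : \int[mu]_x ((f_ n x - f x) ^+ 2) <= eta.
  by rewrite -lee_fin -EFin_Rintegral// ltW.
rewrite distrC -RintegralB//; apply: (le_trans (le_normr_Rintegral _ _)) => //.
  exact: integrable_funB.
apply: (@le_trans _ _ (\int[mu]_x ((1 + del^-1) * (f_ n x - f x) ^+ 2 + del * f x ^+ 2))).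
  apply: le_Rintegral => //.
  - by apply: integrable_norm => //; exact: integrable_funB.
  - by apply: integrable_funD => //; apply: integrable_funZ.
  - by move=> x _; exact: sqr_sub_bound.
rewrite RintegralD//; [|by apply: integrable_funZ..].
rewrite !RintegralZl// -/V.
have h1 : (1 + del^-1) * \int[mu]_x (f_ n x - f x) ^+ 2 <= e / 2.
  apply: (@le_trans _ _ ((1 + del^-1) * eta)); first by rewrite ler_wpM2l// ltW.
  suff -> : (1 + del^-1) * eta = e / 2 by [].
  by rewrite /eta; move: (gt_eqF dd); move: (1 + del^-1) => z z0; field; rewrite z0.
have h2 : del * V <= e / 2.
  have -> : e / 2 = del * (V + 1) by rewrite /del; field; rewrite gt_eqF.
  by rewrite ler_wpM2l ?(ltW d0)// lerDl.
by rewrite [leRHS](splitr e) lerD.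
Qed.

End square_limits.

Section wiener_integrals.
Context d (T : measurableType d) (R : realType) (P : probability T R).
Variable W : R -> {RV P >-> R}.
Hypothesis W_wiener : wiener_process W.
Local Notation mu := (@lebesgue_measure R).

(** A form of [wiener_integral] suited to linear combinations: plain functions in place of bundled
    random variables, measurability recorded, the expectation written as an integral. *)
Definition is_wiener_integral (f : R -> R) (X : T -> R) : Prop :=
  [/\ measurable_fun setT f, measurable_fun setT X &
   exists s : nat -> seq (R * R * R),
   [/\ forall n, step_wf (s n),
     (\int[mu]_x ((step_fun (s n) x - f x) ^+ 2)%:E)%E @[n --> \oo] --> 0%E &
     (\int[P]_w ((step_integral W (s n) w - X w) ^+ 2)%:E)%E @[n --> \oo] --> 0%E]].

Lemma wiener_integralP (f : R -> R) (X : {RV P >-> R}) : measurable_fun setT f ->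
  wiener_integral W f X -> is_wiener_integral f X.
Proof.
move=> mf [s [wf h1 h2]]; split => //; exists s; split => //.
by rewrite unlock in h2.
Qed.

Lemma is_wiener_integral0 : is_wiener_integral (fun=> 0) (fun=> 0).
Proof.
split => //; exists (fun=> [::]); split => //.
  under eq_fun => n do under eq_integral do rewrite /step_fun big_nil subrr expr0n.
  by rewrite integral0_eq//; exact: cvg_cst.
under eq_fun => n do under eq_integral do rewrite /step_integral big_nil subrr expr0n.
by rewrite integral0_eq//; exact: cvg_cst.
Qed.

Lemma cvg_integral_sqr_comb d1 (S : measurableType d1) (nu : {measure set S -> \bar R})
    (u v : nat -> S -> R) (c : R) :
  (forall n, measurable_fun setT (u n)) -> (forall n, measurable_fun setT (v n)) ->
  (\int[nu]_x (u n x ^+ 2)%:E)%E @[n --> \oo] --> 0%E ->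
  (\int[nu]_x (v n x ^+ 2)%:E)%E @[n --> \oo] --> 0%E ->
  (\int[nu]_x ((c * u n x + v n x) ^+ 2)%:E)%E @[n --> \oo] --> 0%E.
Proof.
move=> mu_ mv hu hv.
have m2 (g : S -> R) k : measurable_fun setT g -> measurable_fun setT (fun x => (k * g x ^+ 2)%:E).
  by move=> mg; apply/measurable_EFinP; apply: measurable_funM => //; apply: measurable_funX.
have m1 (g : S -> R) : measurable_fun setT g -> measurable_fun setT (fun x => (g x ^+ 2)%:E).
  by move=> mg; apply/measurable_EFinP; apply: measurable_funX.
have ez (g : S -> R) (k : R) : 0 <= k -> measurable_fun setT g ->
    (\int[nu]_x (k * g x ^+ 2)%:E = k%:E * \int[nu]_x (g x ^+ 2)%:E)%E.
  move=> k0 mg; rewrite -ge0_integralZl//; first by apply: m1.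
  by move=> x _; rewrite lee_fin sqr_ge0.
have c2 : 0 <= 2 * c ^+ 2 by rewrite mulr_ge0 ?sqr_ge0.
apply: (@squeeze_cvge _ _ _ _ (cst 0%E) _ (fun n => (2 * c ^+ 2)%:E * \int[nu]_x (u n x ^+ 2)%:E
   + 2%:E * \int[nu]_x (v n x ^+ 2)%:E)%E).
- near=> n; apply/andP; split; first by apply: integral_ge0 => x _; rewrite lee_fin sqr_ge0.
  rewrite -!ez// -ge0_integralD//; last 4 first.
  + by move=> x _; rewrite lee_fin mulr_ge0 ?sqr_ge0.
  + exact: m2.
  + by move=> x _; rewrite lee_fin mulr_ge0 ?sqr_ge0.
  + exact: m2.
  apply: ge0_le_integral => //.
  + by move=> x _; rewrite lee_fin sqr_ge0.
  + by apply: m1; apply: measurable_funD => //; apply: measurable_funM.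
  + by apply: emeasurable_funD; exact: m2.
  + move=> x _; rewrite -EFinD lee_fin.
    have h (p q k : R) : (k * p + q) ^+ 2 <= 2 * k ^+ 2 * p ^+ 2 + 2 * q ^+ 2.
      have -> : 2 * k ^+ 2 * p ^+ 2 + 2 * q ^+ 2 = (k * p + q) ^+ 2 + (k * p - q) ^+ 2 by ring.
      by rewrite lerDl sqr_ge0.
    exact: h.
- exact: cvg_cst.
- have -> : 0%E = ((2 * c ^+ 2)%:E * 0 + 2%:E * 0)%E :> \bar R by rewrite !mule0 adde0.
  by apply: cvgeD; [rewrite !mule0|apply: cvgeZl|apply: cvgeZl].
Unshelve. all: by end_near. Qed.

Lemma is_wiener_integral_comb (f g : R -> R) (X Y : T -> R) (c : R) :
  is_wiener_integral f X -> is_wiener_integral g Y ->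
  is_wiener_integral (fun x => c * f x + g x) (fun w => c * X w + Y w).
Proof.
move=> [mf mX [s [swf s1 s2]]] [mg mY [s' [swf' s1' s2']]].
split; [by apply: measurable_funD => //; apply: measurable_funM
       |by apply: measurable_funD => //; apply: measurable_funM|].
(* Scaling the coefficients of one list and appending the other represents the combination, for step
   functions and for their integrals alike. *)
pose sc n := [seq (c * q.1.1, q.1.2, q.2) | q : R * R * R <- s n] ++ s' n.
have e1 n x : step_fun (sc n) x = c * step_fun (s n) x + step_fun (s' n) x.
  rewrite /step_fun big_cat/= big_map mulr_sumr; congr (_ + _).
  by apply: eq_bigr => q _; rewrite mulrA.
have e2 n w : step_integral W (sc n) w = c * step_integral W (s n) w + step_integral W (s' n) w.
  rewrite /step_integral big_cat/= big_map mulr_sumr; congr (_ + _).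
  by apply: eq_bigr => q _; rewrite mulrA.
exists sc; split.
- move=> n; rewrite /step_wf all_cat all_map; apply/andP; split; last exact: swf'.
  exact: swf.
- have := @cvg_integral_sqr_comb _ (measurableTypeR R) mu (fun n x => step_fun (s n) x - f x)
    (fun n x => step_fun (s' n) x - g x) c _ _ s1 s1'.
  have m1 n : measurable_fun setT (fun x => step_fun (s n) x - f x).
    by apply: measurable_funB => //; exact: measurable_step_fun.
  have m2 n : measurable_fun setT (fun x => step_fun (s' n) x - g x).
    by apply: measurable_funB => //; exact: measurable_step_fun.
  move=> /(_ m1 m2); rewrite (_ : (fun n => _) = (fun n => \int[mu]_x ((step_fun (sc n) x - (c * f x + g x)) ^+ 2)%:E)%E)//.
  apply/funext => n; apply: eq_integral => x _; congr (_ ^+ 2)%:E; rewrite e1; ring.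
- have := @cvg_integral_sqr_comb _ T P (fun n x => step_integral W (s n) x - X x)
    (fun n x => step_integral W (s' n) x - Y x) c _ _ s2 s2'.
  have m1 n : measurable_fun setT (fun x => step_integral W (s n) x - X x).
    by apply: measurable_funB => //; exact: measurable_step_integral.
  have m2 n : measurable_fun setT (fun x => step_integral W (s' n) x - Y x).
    by apply: measurable_funB => //; exact: measurable_step_integral.
  move=> /(_ m1 m2); rewrite (_ : (fun n => _) = (fun n => \int[P]_x ((step_integral W (sc n) x - (c * X x + Y x)) ^+ 2)%:E)%E)//.
  apply/funext => n; apply: eq_integral => x _; congr (_ ^+ 2)%:E; rewrite e2; ring.
Qed.

Lemma is_wiener_integral_sum (n : nat) (c : nat -> R) (f : nat -> R -> R) (X : nat -> T -> R) :
  (forall i, is_wiener_integral (f i) (X i)) ->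
  is_wiener_integral (fun x => \sum_(0 <= i < n) c i * f i x) (fun w => \sum_(0 <= i < n) c i * X i w).
Proof.
move=> h; elim: n => [|n ih].
  have e0 (A : Type) (F : nat -> A -> R) : (fun x => \sum_(0 <= i < 0) c i * F i x) = fun=> 0.
    by apply/funext => x; rewrite big_nil.
  by rewrite !e0; exact: is_wiener_integral0.
rewrite (_ : (fun x => _) = fun x => c n * f n x + \sum_(0 <= i < n) c i * f i x); last first.
  by apply/funext => x; rewrite big_nat_recr//= addrC.
rewrite (_ : (fun w => _) = fun w => c n * X n w + \sum_(0 <= i < n) c i * X i w); last first.
  by apply/funext => x; rewrite big_nat_recr//= addrC.
exact: is_wiener_integral_comb.
Qed.

Lemma cvg_Rintegral_cos (phi : R) (I : nat -> T -> R) (X : T -> R) :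
  (forall n, measurable_fun setT (I n)) -> measurable_fun setT X ->
  (\int[P]_w ((I n w - X w) ^+ 2)%:E)%E @[n --> \oo] --> 0%E ->
  \int[P]_w cos (I n w + phi) @[n --> \oo] --> \int[P]_w cos (X w + phi).
Proof.
move=> mI mX h; apply/cvgrPdist_le => e e0.
have e2 : 0 < e ^+ 2 by rewrite exprn_gt0.
have [N hN] := cvge0_eventually h e2; exists N => // n /hN hn.
have mD : measurable_fun setT (fun w => I n w - X w) by exact: measurable_funB.
have iD : P.-integrable setT (EFin \o (fun w => (I n w - X w) ^+ 2)).
  by apply: integrable_sqr_of_lty => //; rewrite (lt_le_trans hn)// leey.
have ic (Z : T -> R) : measurable_fun setT Z -> P.-integrable setT (EFin \o (fun w => cos (Z w + phi))).
  move=> mZ; apply: (integrable_bounded P (M := 1)) => [|w]; last exact: cos_max.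
  by apply: measurable_fun_cos; apply: measurable_funD.
rewrite distrC -RintegralB//; [|exact: ic..].
apply: (le_trans (le_normr_Rintegral _ _)) => //; first by apply: integrable_funB => //; exact: ic.
have hn' : \int[P]_w ((I n w - X w) ^+ 2) <= e ^+ 2.
  by rewrite -lee_fin -EFin_Rintegral// ltW.
(* Completing the square gives |x| <= e/2 + x^2/(2e), for which a squared L^2 distance below e^2 is
   enough. *)
apply: (@le_trans _ _ (\int[P]_w (e / 2 + (2 * e)^-1 * (I n w - X w) ^+ 2))).
  apply: le_Rintegral => //.
  - by apply: integrable_norm => //; apply: integrable_funB => //; exact: ic.
  - apply: integrable_funD => //; last exact: integrable_funZ.
    by apply: (integrable_bounded P (M := `|e / 2|)).
  move=> w _; apply: (le_trans (cos_lipschitz _ _)).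
  have -> : I n w + phi - (X w + phi) = I n w - X w by ring.
  have -> : e / 2 + (2 * e)^-1 * (I n w - X w) ^+ 2 =
      (2 * e)^-1 * (`|I n w - X w| - e) ^+ 2 + `|I n w - X w|.
    rewrite -[(I n w - X w) ^+ 2]real_normK ?num_real//; field; rewrite gt_eqF//.
  by rewrite lerDr mulr_ge0 ?sqr_ge0// invr_ge0 mulr_ge0// ltW.
rewrite RintegralD//; last 2 first.
- by apply: (integrable_bounded P (M := `|e / 2|)).
- exact: integrable_funZ.
rewrite Rintegral_prob_cst RintegralZl//.
have h3 : (2 * e)^-1 * \int[P]_w (I n w - X w) ^+ 2 <= e / 2.
  have -> : e / 2 = (2 * e)^-1 * e ^+ 2 by field; rewrite gt_eqF.
  by rewrite ler_wpM2l// invr_ge0 mulr_ge0// ltW.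
by rewrite [leRHS](splitr e) lerD2l.
Qed.

(** Passes to the limit on both sides of [step_integral_char]: in the random variables by the
    Lipschitz bound of cos, in the integrands by convergence of the norms. *)
Lemma is_wiener_integral_char (f : R -> R) (X : T -> R) :
  mu.-integrable setT (EFin \o (fun x => f x ^+ 2)) ->
  is_wiener_integral f X -> char_gaussian P X (\int[mu]_x (f x ^+ 2)).
Proof.
move=> if_ [mf mX [s [swf s1 s2]]] phi.
have c1 := cvg_Rintegral_cos (phi := phi) (fun n => measurable_step_integral W (s n)) mX s2.
have c2 : \int[mu]_x (step_fun (s n) x ^+ 2) @[n --> \oo] --> \int[mu]_x (f x ^+ 2).
  apply: cvg_Rintegral_sqr => //.
  - by move=> n; exact: measurable_step_fun.
  - by move=> n; exact: integrable_step_fun_sqr.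
have c3 : cos phi * gauss_cf (\int[mu]_x (step_fun (s n) x ^+ 2)) @[n --> \oo] -->
    cos phi * gauss_cf (\int[mu]_x (f x ^+ 2)).
  by apply: cvgM; [exact: cvg_cst|exact: cvg_gauss_cf].
have e : (fun n => \int[P]_w cos (step_integral W (s n) w + phi)) =
    (fun n => cos phi * gauss_cf (\int[mu]_x (step_fun (s n) x ^+ 2))).
  by apply/funext => n; exact: (step_integral_char W_wiener (swf n) phi).
by move: c1; rewrite e => c1; exact: (cvg_unique _ c1 c3).
Qed.

End wiener_integrals.

Section fatou_bound.
Context d (T : measurableType d) (R : realType) (mu : {measure set T -> \bar R}).

Lemma integral_limit_le (f_ : nat -> T -> R) (f : T -> R) (C : R) :
  (forall n, measurable_fun setT (f_ n)) -> (forall n x, 0 <= f_ n x) ->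
  (forall x, f_ n x @[n --> \oo] --> f x) ->
  (forall n, (\int[mu]_x (f_ n x)%:E <= C%:E)%E) ->
  (\int[mu]_x (f x)%:E <= C%:E)%E.
Proof.
move=> mf f0 ff fC.
have -> : (fun x => (f x)%:E) = (fun x => limn_einf (fun n => (f_ n x)%:E)).
  apply/funext => x; apply/esym.
  have h : (f_ n x)%:E @[n --> \oo] --> (f x)%:E by apply/cvg_EFin; [exact: nearW|exact: ff].
  by have [-> _] := cvg_limn_einf_sup h.
apply: (@le_trans _ _ (limn_einf (fun n => \int[mu]_x (f_ n x)%:E)%E)).
  apply: (@fatou _ _ _ mu setT measurableT (fun n x => (f_ n x)%:E)) => //.
  - by move=> n; exact/measurable_EFinP.
  - by move=> n x _; rewrite lee_fin.
rewrite limn_einf_lim; apply: lime_le; first exact: is_cvg_einfs.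
apply: nearW => n; apply: le_trans (fC n); apply: ereal_inf_lbound => /=.
by exists n => //=.
Qed.

End fatou_bound.

(** Bernoulli's inequality for 1/y = 1 + (1 - y)/y. With y a value of [gauss_cf] at v/n it bounds n
    (1 - y) by 1/[gauss_cf v]. *)
Lemma bernoulli_inv (R : realType) (y : R) (n : nat) : 0 < y -> y <= 1 ->
  n.+1%:R * (1 - y) <= (y ^+ n.+1)^-1.
Proof.
move=> y0 y1; have z1 : 1 <= y^-1 by rewrite invf_ge1.
have hz (z : R) (m : nat) : 0 <= z -> m%:R * z <= (1 + z) ^+ m.
  move=> z0; have : 1 + m%:R * z <= (1 + z) ^+ m.
    elim: m => [|m ih]; first by rewrite mul0r addr0 expr0.
    rewrite exprS; apply: (@le_trans _ _ ((1 + z) * (1 + m%:R * z))); last first.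
      by rewrite ler_wpM2l// addr_ge0.
    have -> : (1 + z) * (1 + m%:R * z) = 1 + m.+1%:R * z + m%:R * z ^+ 2 by rewrite -natr1; ring.
    by rewrite lerDl mulr_ge0 ?sqr_ge0.
  by apply: le_trans; rewrite lerDr.
rewrite -exprVn; have -> : y^-1 = 1 + (y^-1 - 1) by ring.
apply: le_trans (hz _ _ _); last by rewrite subr_ge0.
rewrite ler_wpM2l//; have -> : y^-1 - 1 = (1 - y) / y by field; rewrite gt_eqF.
by rewrite ler_pdivlMr// ler_piMr// subr_ge0.
Qed.

(** * Second moments recovered from characteristic functions *)

Section gaussian_moments.
Context d (T : measurableType d) (R : realType) (P : probability T R).
Variable W : R -> {RV P >-> R}.
Hypothesis W_wiener : wiener_process W.

Lemma gauss_cf_expn (v : R) (n : nat) : 0 <= v -> gauss_cf (v / n.+1%:R) ^+ n.+1 = gauss_cf v.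
Proof.
move=> v0; have h : 0 <= v / n.+1%:R by rewrite divr_ge0.
have := gauss_cf_prod W_wiener n.+1 (v := fun=> v / n.+1%:R) (fun=> h).
by rewrite prodr_const_nat subn0 sumr_const_nat subn0 -[(v / _) *+ _]mulr_natr divfK.
Qed.

(** The value at [v] is a power of the value at v/n, and the latter tends to [gauss_cf 0], which is
    1. *)
Lemma gauss_cf_gt0 (v : R) : 0 <= v -> 0 < gauss_cf v.
Proof.
move=> v0.
have h : gauss_cf (v / n.+1%:R) @[n --> \oo] --> (1 : R).
  rewrite -[X in _ --> X]gauss_cf0; apply: cvg_gauss_cf.
  rewrite -[X in _ --> X](mulr0 v); apply: cvgM; first exact: cvg_cst.
  exact: cvg_harmonic.
have [N _ hN] := cvgr_gt 1 h 0 ltr01.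
by rewrite -(gauss_cf_expn N v0) exprn_gt0//; exact: (hN N (leqnn N)).
Qed.

Lemma gauss_cf_homo (v w : R) : 0 <= v -> v <= w -> gauss_cf w <= gauss_cf v.
Proof.
move=> v0 vw; have wv : 0 <= w - v by rewrite subr_ge0.
rewrite -(subrK v w) addrC (gauss_cfD W_wiener)//.
by rewrite ger_pMr ?gauss_cf_gt0// gauss_cf_le1.
Qed.

(* n (1 - gauss_cf (v / n)) is bounded because gauss_cf (v / n) ^ n = gauss_cf v,
   and Fatou's lemma applies as 2 n^2 (1 - cos (X / n)) tends to X^2. *)
Lemma char_gaussian_moment d' (T' : measurableType d') (P' : probability T' R) (X : T' -> R) (v V : R) :
  measurable_fun setT X ->
  0 <= v -> v <= V -> (forall c, char_gaussian P' (fun w => c * X w) (c ^+ 2 * v)) ->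
  (\int[P']_w (X w ^+ 2)%:E <= (2 / gauss_cf V)%:E)%E.
Proof.
move=> mX v0 vV hX; have V0 := le_trans v0 vV.
pose f n w : R := 2 * (n.+1%:R ^+ 2) * (1 - cos (n.+1%:R^-1 * X w)).
have fE n w : f n w = (2 * (n.+1%:R * sin (X w / 2 / n.+1%:R))) ^+ 2.
  rewrite /f cos_half (_ : n.+1%:R^-1 * X w / 2 = X w / 2 / n.+1%:R); first ring.
  by rewrite -mulrA mulrC.
apply: (@integral_limit_le _ _ _ P' f) => [n|n w|w|n].
- apply: measurable_funM => //; apply: measurable_funB => //.
  by apply: measurable_fun_cos; apply: measurable_funM.
- by rewrite fE sqr_ge0.
- rewrite (funext (fun n => fE n w)) {2}(_ : X w = 2 * (X w / 2)); last by rewrite mulrC divfK.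
  have h : 2 * (n.+1%:R * sin (X w / 2 / n.+1%:R)) @[n --> \oo] --> 2 * (X w / 2).
    by apply: cvgM; [exact: cvg_cst|exact: cvg_scaled_sin].
  by rewrite expr2; under eq_fun do rewrite expr2; exact: cvgM.
have mc : measurable_fun setT (fun w => cos (n.+1%:R^-1 * X w)).
  by apply: measurable_fun_cos; apply: measurable_funM.
have ic : P'.-integrable setT (EFin \o (fun w => cos (n.+1%:R^-1 * X w))).
  by apply: (integrable_bounded P' (M := 1)) => // w; exact: cos_max.
have i1 : P'.-integrable setT (EFin \o (fun w => 1 - cos (n.+1%:R^-1 * X w))).
  apply: integrable_funB => //.
  by apply: (integrable_bounded P' (M := 1)) => // w; rewrite normr1.
have if_ : P'.-integrable setT (EFin \o f n) by exact: integrable_funZ.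
rewrite EFin_Rintegral// lee_fin RintegralZl// RintegralB//; last first.
  by apply: (integrable_bounded P' (M := 1)) => // w; rewrite normr1.
rewrite Rintegral_prob_cst.
have := hX n.+1%:R^-1 0; under eq_Rintegral do rewrite addr0.
rewrite cos0 mul1r => ->.
(* The square of n+1 is itself a successor, so that [gauss_cf_expn] splits [v] into that many equal
   parts. *)
have [m hm] : exists m, (n.+1 ^ 2)%N = m.+1 by exists (n.+1 ^ 2).-1; rewrite prednK// expn_gt0.
have -> : n.+1%:R^-1 ^+ 2 * v = v / m.+1%:R by rewrite -hm natrX mulrC exprVn.
rewrite -natrX hm -mulrA ler_wpM2l//.
apply: (@le_trans _ _ (gauss_cf v)^-1); last first.
  by rewrite lef_pV2 ?posrE ?gauss_cf_gt0// gauss_cf_homo.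
rewrite -(gauss_cf_expn m v0); apply: bernoulli_inv; last exact: gauss_cf_le1.
by rewrite gauss_cf_gt0// divr_ge0.
Qed.

End gaussian_moments.

Section tfbm_linear_combinations.
Context d (T : measurableType d) (R : realType) (P : probability T R).
Variables (H lambda : R) (W B : R -> {RV P >-> R}).
Hypotheses (H_gt0 : 0 < H) (lambda_gt0 : 0 < lambda).
Hypotheses (W_wiener : wiener_process W) (B_tfbm : tfbm H lambda W B).

Lemma tfbm_char (n : nat) (c tau : nat -> R) : (forall i, 0 <= tau i) ->
  char_gaussian P (fun w => \sum_(0 <= i < n) c i * B (tau i) w)
    (\sum_(0 <= i < n) \sum_(0 <= j < n) c i * c j * tfbm_cov H lambda (tau i) (tau j)).
Proof.
move=> t0; pose k i := tfbm_kernel H lambda (tau i).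
have hk i : is_wiener_integral W (k i) (B (tau i)).
  apply: wiener_integralP; first exact: measurable_tfbm_kernel.
  exact: (tfbm_integral B_tfbm).
have e x : (\sum_(0 <= i < n) c i * k i x) ^+ 2 =
    \sum_(0 <= i < n) \sum_(0 <= j < n) c i * c j * (k i x * k j x).
  rewrite expr2 mulr_suml; apply: eq_bigr => i _; rewrite mulr_sumr.
  by apply: eq_bigr => j _; ring.
have ik i j : (@lebesgue_measure R).-integrable setT (EFin \o (fun x => c i * c j * (k i x * k j x))).
  by apply: integrable_funZ => //; exact: integrable_tfbm_kernelM.
have h := is_wiener_integral_sum n c hk.
have -> : \sum_(0 <= i < n) \sum_(0 <= j < n) c i * c j * tfbm_cov H lambda (tau i) (tau j) =
    \int[@lebesgue_measure R]_x (\sum_(0 <= i < n) c i * k i x) ^+ 2.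
  rewrite (funext e) Rintegral_sum//; last by move=> i; exact: integrable_fun_sum.
  apply: eq_bigr => i _; rewrite Rintegral_sum//.
  apply: eq_bigr => j _; rewrite RintegralZl//; last exact: integrable_tfbm_kernelM.
  by rewrite Rintegral_tfbm_kernelM.
apply: (is_wiener_integral_char W_wiener) => //.
by rewrite (funext e); apply: integrable_fun_sum => // i; exact: integrable_fun_sum.
Qed.

(** The bound is uniform in [t], as the variance of [B t] never exceeds 2 r(0). *)
Lemma tfbm_moment (t : R) : 0 <= t ->
  (\int[P]_w (B t w ^+ 2)%:E <= (2 / gauss_cf (2 * acov H lambda 0))%:E)%E.
Proof.
move=> t0; apply: (char_gaussian_moment W_wiener (v := tfbm_cov H lambda t t)) => //.
- by rewrite -Rintegral_tfbm_kernelM//; apply: Rintegral_ge0 => x _; rewrite -expr2 sqr_ge0.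
- exact: tfbm_cov_diag.
move=> c; have := tfbm_char 1 (fun=> c) (fun=> t0).
rewrite !big_nat1 expr2; under [X in char_gaussian _ X]eq_fun do rewrite big_nat1.
by [].
Qed.

End tfbm_linear_combinations.

(** * Convergence in law from characteristic functions *)

Section bernstein.
Context {R : realType}.
Implicit Types (u : R) (phi psi : nat -> R).

(* The expectation of phi (K) for K binomial with parameters n and u. *)
Fixpoint bern (n : nat) u phi : R :=
  if n is m.+1 then u * bern m u (phi \o S) + (1 - u) * bern m u phi else phi 0%N.

(** [bern n u] is a convex average: positive and equal to the identity on constants. *)
Lemma bern_dist n u phi psi (c : R) : 0 <= u -> u <= 1 ->
  (forall k, `|phi k - c| <= psi k) -> `|bern n u phi - c| <= bern n u psi.
Proof.
move=> u0 u1; have v0 : 0 <= 1 - u by rewrite subr_ge0.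
elim: n phi psi => [|n ih] phi psi h /=; first exact: h.
have -> : u * bern n u (phi \o S) + (1 - u) * bern n u phi - c =
  u * (bern n u (phi \o S) - c) + (1 - u) * (bern n u phi - c) by ring.
rewrite (le_trans (ler_normD _ _))// !normrM (ger0_norm u0) (ger0_norm v0).
by rewrite lerD// ler_wpM2l// ih// => k; exact: h.
Qed.

Lemma bern_affine n u phi (c k : R) :
  bern n u (fun i => c + k * phi i) = c + k * bern n u phi.
Proof.
elim: n phi => [//|n ih] phi /=.
by rewrite (ih phi) -[bern n u (_ \o S)]/(bern n u (fun i => c + k * (phi \o S) i)) ih; ring.
Qed.

Lemma bern_sqr n u (a b : R) :
  bern n u (fun k => (a * k%:R + b) ^+ 2) =
  (a * (n%:R * u) + b) ^+ 2 + a ^+ 2 * (n%:R * (u * (1 - u))).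
Proof.
elim: n b => [|n ih] b /=; first by rewrite !mul0r !mulr0 addr0.
rewrite ih (_ : _ \o S = fun k => (a * k%:R + (a + b)) ^+ 2); last first.
  by apply/funext => k /=; rewrite -natr1; congr (_ ^+ 2); ring.
by rewrite ih -natr1; ring.
Qed.

(** With m = N + 1 and m^3 trials, the mean of [bern_node] is m sin (x/m), which tends to x, and its
    variance is 4 u (1 - u)/m, where u is [bern_arg N x]. So the average runs over nodes close to x,
    yet depends on x through a sine alone. *)
Definition bern_arg (N : nat) (x : R) : R := (1 + sin (x / N.+1%:R)) / 2.
Definition bern_node (N k : nat) : R := 2 / N.+1%:R ^+ 2 * k%:R - N.+1%:R.

Lemma bern_arg_itv N x : 0 <= bern_arg N x <= 1.
Proof.
have := sin_max (x / N.+1%:R); rewrite ler_norml /bern_arg => /andP[].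
move: (sin _) => z; clear => h1 h2; apply/andP; split; lra.
Qed.

(** Variance plus squared bias: with m = N + 1 they are at most 1/m and (r^3/m^2)^2 <= r^6/m. *)
Lemma bern_node_sqr_le N x (r : R) : `|x| <= r ->
  bern (N.+1 ^ 3) (bern_arg N x) (fun k => (bern_node N k - x) ^+ 2) <= (1 + r ^+ 6) / N.+1%:R.
Proof.
move=> xr; have r0 : 0 <= r := le_trans (normr_ge0 _) xr.
have /andP[u0 u1] := bern_arg_itv N x.
rewrite (_ : (fun k => _) = fun k => (2 / N.+1%:R ^+ 2 * k%:R + (- N.+1%:R - x)) ^+ 2); last first.
  by apply/funext => k; rewrite /bern_node; congr (_ ^+ 2); ring.
rewrite bern_sqr; move: u0 u1; set u := bern_arg N x => u0 u1.
rewrite natrX; have uE : u = (1 + sin (x / N.+1%:R)) / 2 by [].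
have [m mE m1] : exists2 m : R, m = N.+1%:R & 1 <= m by exists N.+1%:R; rewrite ?ler1n.
have m0 : 0 < m := lt_le_trans ltr01 m1.
rewrite -!mE in uE *; rewrite [leRHS]mulrDl mul1r addrC; apply: lerD.
  rewrite (_ : (2 / m ^+ 2) ^+ 2 * (m ^+ 3 * (u * (1 - u))) = (4 * (u * (1 - u))) * m^-1); last first.
    by field; rewrite gt_eqF.
  rewrite -[leRHS]mul1r ler_pM2r ?invr_gt0//; have := sqr_ge0 (1 - 2 * u).
  by have -> : (1 - 2 * u) ^+ 2 = 1 - 4 * (u * (1 - u)); [ring|rewrite subr_ge0].
have -> : 2 / m ^+ 2 * (m ^+ 3 * u) + (- m - x) = m * (sin (x / m) - x / m).
  by rewrite uE; field; rewrite gt_eqF.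
rewrite -real_normK ?num_real//.
have h : `|m * (sin (x / m) - x / m)| <= r ^+ 3 / m ^+ 2.
  rewrite normrM gtr0_norm//.
  apply: (@le_trans _ _ (m * `|x / m| ^+ 3)); first by rewrite ler_pM2l// sin_sub_le.
  rewrite normrM normfV (gtr0_norm m0) expr_div_n.
  have -> : m * (`|x| ^+ 3 / m ^+ 3) = `|x| ^+ 3 / m ^+ 2 by field; rewrite gt_eqF.
  by rewrite ler_pM2r ?invr_gt0 ?exprn_gt0// lerXn2r.
apply: (@le_trans _ _ ((r ^+ 3 / m ^+ 2) ^+ 2)); first by rewrite lerXn2r// nnegrE (le_trans _ h).
rewrite expr_div_n -!exprM ler_wpM2l ?exprn_ge0//.
by rewrite lef_pV2 ?posrE ?exprn_gt0// ler_eXnr.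
Qed.

Lemma cvg_bern_error (r : R) : (1 + r ^+ 6) / N.+1%:R @[N --> \oo] --> 0.
Proof.
by rewrite -[X in _ --> X](mulr0 (1 + r ^+ 6)); apply: cvgM; [exact: cvg_cst|exact: cvg_harmonic].
Qed.

End bernstein.

(** * Approximation by trigonometric polynomials *)

Section trigonometric_polynomials.
Context {R : realType}.

(** Multiplication by a cosine is a constructor because the Bernstein recursion multiplies by
    cosines; products are turned into sums in [trig_poly_cos_cvg]. *)
Inductive trig_poly : (R -> R -> R -> R) -> Prop :=
| trig_cst k : trig_poly (fun _ _ _ => k)
| trig_lin (a : R) h g : trig_poly h -> trig_poly g ->
    trig_poly (fun x y z => a * h x y z + g x y z)
| trig_cos (c1 c2 c3 phi : R) h : trig_poly h ->
    trig_poly (fun x y z => cos (c1 * x + c2 * y + c3 * z + phi) * h x y z).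

Lemma trig_poly_bounded h : trig_poly h -> exists M, forall x y z, `|h x y z| <= M.
Proof.
elim=> [k|a g1 g2 _ [M1 h1] _ [M2 h2]|c1 c2 c3 phi g _ [M hM]].
- by exists `|k|.
- exists (`|a| * M1 + M2) => x y z; rewrite (le_trans (ler_normD _ _))// normrM lerD//.
  by rewrite ler_wpM2l.
- exists M => x y z; rewrite normrM -[leRHS]mul1r ler_pM//; exact: cos_max.
Qed.

Lemma measurable_trig_poly h : trig_poly h ->
  forall d (S : measurableType d) (x y z : S -> R), measurable_fun setT x -> measurable_fun setT y ->
  measurable_fun setT z -> measurable_fun setT (fun s => h (x s) (y s) (z s)).
Proof.
move=> th d S x y z mx my mz; elim: th => [k//|a g1 g2 _ h1 _ h2|c1 c2 c3 phi g _ hg].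
  by apply: measurable_funD => //; apply: measurable_funM.
apply: measurable_funM => //; apply: measurable_fun_cos; apply: measurable_funD => //.
by apply: measurable_funD => //; [apply: measurable_funD => //|]; exact: measurable_funM.
Qed.

Definition bern_approx (f : R -> R -> R -> R) (N : nat) (x y z : R) : R :=
  bern (N.+1 ^ 3) (bern_arg N x) (fun i =>
   bern (N.+1 ^ 3) (bern_arg N y) (fun j =>
    bern (N.+1 ^ 3) (bern_arg N z) (fun k => f (bern_node N i) (bern_node N j) (bern_node N k)))).

(** The recursion of [bern] multiplies by u and 1 - u, both affine in one and the same cosine. *)
Lemma trig_poly_bern (n : nat) (u : R -> R -> R -> R) (c1 c2 c3 phi : R) (h : nat -> R -> R -> R -> R) :
  (forall x y z, u x y z = (1 + cos (c1 * x + c2 * y + c3 * z + phi)) / 2) ->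
  (forall k, trig_poly (h k)) ->
  trig_poly (fun x y z => bern n (u x y z) (fun k => h k x y z)).
Proof.
move=> uE; elim: n h => [|n ih] h hh; first exact: hh.
have t1 := ih _ (fun k => hh k.+1); have t2 := ih _ hh.
have -> : (fun x y z => bern n.+1 (u x y z) (fun k => h k x y z)) = fun x y z =>
   2^-1 * bern n (u x y z) (fun k => h k.+1 x y z) + (
   2^-1 * bern n (u x y z) (fun k => h k x y z) + (
   2^-1 * (cos (c1 * x + c2 * y + c3 * z + phi) * bern n (u x y z) (fun k => h k.+1 x y z)) + (
   (- 2^-1) * (cos (c1 * x + c2 * y + c3 * z + phi) * bern n (u x y z) (fun k => h k x y z)) + 0))).
  apply/funext => x; apply/funext => y; apply/funext => z /=; rewrite {1 3}uE.
  rewrite -[bern n (u x y z) (_ \o S)]/(bern n (u x y z) (fun k => h k.+1 x y z)); by field.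
do 2 apply: trig_lin => //.
by do 2 (apply: trig_lin; first exact: trig_cos); exact: trig_cst.
Qed.

Lemma trig_poly_bern_approx f N : trig_poly (bern_approx f N).
Proof.
have e (x : R) : bern_arg N x = (1 + cos (x / N.+1%:R - pi / 2)) / 2.
  by rewrite /bern_arg -cosBpihalf.
apply: (@trig_poly_bern _ _ N.+1%:R^-1 0 0 (- (pi / 2))) => [x y z|i].
  by rewrite e; congr ((1 + cos _) / 2); ring.
apply: (@trig_poly_bern _ _ 0 N.+1%:R^-1 0 (- (pi / 2))) => [x y z|j].
  by rewrite e; congr ((1 + cos _) / 2); ring.
apply: (@trig_poly_bern _ _ 0 0 N.+1%:R^-1 (- (pi / 2))) => [x y z|k].
  by rewrite e; congr ((1 + cos _) / 2); ring.
exact: trig_cst.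
Qed.

(** The coordinates are averaged one after the other, [bern_affine] carrying the bound of the inner
    average through the outer one. *)
Lemma bern_approx_dist (f : R -> R -> R -> R) (N : nat) (x y z e k r : R) : 0 <= k ->
  `|x| <= r -> `|y| <= r -> `|z| <= r ->
  (forall x' y' z', `|f x' y' z' - f x y z| <=
     e + k * (x' - x) ^+ 2 + k * (y' - y) ^+ 2 + k * (z' - z) ^+ 2) ->
  `|bern_approx f N x y z - f x y z| <= e + 3 * k * ((1 + r ^+ 6) / N.+1%:R).
Proof.
move=> k0 xr yr zr h; pose q (v : R) i := (bern_node N i - v) ^+ 2.
pose n := (N.+1 ^ 3)%N.
have b3 i j : `|bern n (bern_arg N z) (fun l => f (bern_node N i) (bern_node N j) (bern_node N l)) - f x y z|
   <= e + k * q x i + k * q y j + k * bern n (bern_arg N z) (q z).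
  have /andP[u0 u1] := bern_arg_itv N z.
  by rewrite -bern_affine; apply: bern_dist => // l; exact: h.
have b2 i : `|bern n (bern_arg N y) (fun j =>
     bern n (bern_arg N z) (fun l => f (bern_node N i) (bern_node N j) (bern_node N l))) - f x y z|
   <= e + k * q x i + k * bern n (bern_arg N z) (q z) + k * bern n (bern_arg N y) (q y).
  have /andP[u0 u1] := bern_arg_itv N y.
  rewrite -bern_affine; apply: bern_dist => // j; apply: (le_trans (b3 i j)).
  by rewrite le_eqVlt; apply/orP; left; apply/eqP; ring.
have b1 : `|bern_approx f N x y z - f x y z| <= e + k * bern n (bern_arg N z) (q z)
     + k * bern n (bern_arg N y) (q y) + k * bern n (bern_arg N x) (q x).
  have /andP[u0 u1] := bern_arg_itv N x.
  rewrite -bern_affine; apply: bern_dist => // i; apply: (le_trans (b2 i)).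
  by rewrite le_eqVlt; apply/orP; left; apply/eqP; ring.
apply: (le_trans b1).
have -> : e + 3 * k * ((1 + r ^+ 6) / N.+1%:R) = e + k * ((1 + r ^+ 6) / N.+1%:R) +
  k * ((1 + r ^+ 6) / N.+1%:R) + k * ((1 + r ^+ 6) / N.+1%:R) by ring.
by rewrite !lerD// ler_wpM2l// bern_node_sqr_le.
Qed.

End trigonometric_polynomials.

Section compact_modulus.
Context {R : realType}.

(** Uniformity in [x] of the limit at [d0]: joint continuity gives it near each point, compactness
    of [K] on the whole set. *)
Lemma compact_modulus (X : topologicalType) (D : topologicalType) (K : set X) (d0 : D)
    (G : X -> D -> R) : compact K ->
  (forall x, K x -> {for (x, d0), continuous (fun p : X * D => G p.1 p.2)}) ->
  forall e : R, 0 < e -> \forall d \near d0, forall x, K x -> `|G x d - G x d0| < e.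
Proof.
move=> /compact_near_coveringP cK cG e e0.
apply: (cK D (nbhs d0) (fun d x => `|G x d - G x d0| < e)) => x Kx.
have e2 : 0 < e / 2 by rewrite divr_gt0.
have /cvgrPdist_lt/(_ _ e2) h := cG x Kx.
have h1 : \forall p \near (x, d0), `|G x d0 - G p.1 d0| < e / 2.
  have : {for (x, d0), continuous (fun p : X * D => G p.1 d0)}.
    have c : {for (x, d0), continuous (fun p : X * D => (p.1, d0))}.
      by apply: cvg_pair; [exact: cvg_fst|exact: cvg_cst].
    exact: (@continuous_comp _ _ _ (fun p : X * D => (p.1, d0)) (fun p => G p.1 p.2) (x, d0) c (cG x Kx)).
  by move=> /cvgrPdist_lt/(_ _ e2).
near=> p.
have -> : G p.1 p.2 - G p.1 d0 = (G x d0 - G p.1 d0) - (G x d0 - G p.1 p.2) by ring.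
rewrite (le_lt_trans (ler_normB _ _))// [ltRHS](splitr e) ltrD//.
  by near: p.
by near: p.
Unshelve. all: by end_near. Qed.

(** The quadratic form of the bound fits the second moments of the nodes. Displacements below [del]
    cost [e] by uniform continuity; a larger one in any coordinate is covered by 2 M = k del^2. The
    primed point is not confined to the cube, as the nodes are not. *)
Lemma quadratic_modulus (f : R * R * R -> R) (M : R) : continuous f -> (forall z, `|f z| <= M) ->
  forall (e : R) (r : R), 0 < e -> exists2 k : R, 0 <= k & forall x y z x' y' z',
    `|x| <= r -> `|y| <= r -> `|z| <= r ->
    `|f (x', y', z') - f (x, y, z)| <=
      e + k * (x' - x) ^+ 2 + k * (y' - y) ^+ 2 + k * (z' - z) ^+ 2.
Proof.
move=> cf fM e r e0; pose K : set (R * R * R) := `[- r, r] `*` `[- r, r] `*` `[- r, r].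
have cK : compact K by apply: compact_setX; [apply: compact_setX|]; exact: segment_compact.
have cG x : K x -> {for (x, (0 : R * R * R)), continuous (fun p : (R * R * R) * (R * R * R) => f (p.1 + p.2))}.
  move=> _; apply: continuous_comp; last exact: cf.
  exact: add_continuous.
have /nbhs_ballP[del /= del0 h] := @compact_modulus _ _ K (0 : R * R * R) (fun x d => f (x + d)) cK cG e e0.
have M0 : 0 <= M := le_trans (normr_ge0 _) (fM 0).
exists (2 * M / del ^+ 2); first by rewrite divr_ge0 ?sqr_ge0 ?mulr_ge0.
set k := _ / _; have k0 : 0 <= k by rewrite divr_ge0 ?sqr_ge0 ?mulr_ge0.
move=> x y z x' y' z' xr yr zr.
have q (u v : R) : 0 <= k * (u - v) ^+ 2 by rewrite mulr_ge0 ?sqr_ge0.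
have big (u v : R) : del <= `|u - v| -> 2 * M <= k * (u - v) ^+ 2.
  move=> d1; have -> : 2 * M = k * del ^+ 2 by rewrite /k divfK// expf_neq0// gt_eqF.
  by rewrite ler_wpM2l// -[(u - v) ^+ 2]real_normK ?num_real// lerXn2r// nnegrE// ltW.
have f2 : `|f (x', y', z') - f (x, y, z)| <= 2 * M.
  by rewrite (le_trans (ler_normB _ _))// mulr2n mulrDl !mul1r lerD.
have [dx|/big hx] := ltP `|x' - x| del; last first.
  apply: (le_trans f2); apply: (le_trans hx).
  by rewrite -!addrA [e + _]addrC -!addrA lerDl !addr_ge0// ltW.
have [dy|/big hy] := ltP `|y' - y| del; last first.
  apply: (le_trans f2); apply: (le_trans hy).
  by rewrite [e + _ + _]addrC -!addrA lerDl !addr_ge0// ltW.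
have [dz|/big hz] := ltP `|z' - z| del; last first.
  apply: (le_trans f2); apply: (le_trans hz).
  by rewrite [e + _ + _ + _]addrC -!addrA lerDl !addr_ge0// ltW.
have Kx : K (x, y, z) by rewrite /K /=; split; [split|]; rewrite /= in_itv/= -ler_norml.
have b : ball (0 : R * R * R) del ((x', y', z') - (x, y, z)).
  by split; [split|]; rewrite /= -ball_normE/= sub0r normrN.
have E : (x, y, z) + ((x', y', z') - (x, y, z)) = (x', y', z') by rewrite addrC subrK.
have := h _ b (x, y, z) Kx; rewrite E addr0 => /ltW h1.
by apply: (le_trans h1); rewrite -!addrA lerDl !addr_ge0.
Qed.

End compact_modulus.

Section continuous_test_functions.
Context {R : realType}.
Variables (f : R * R * R -> R) (M : R).
Hypotheses (cf : continuous f) (fM : forall z, `|f z| <= M).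
Let F x y z := f (x, y, z).

(** Inside the cube of half-side [r] this is the Bernstein estimate; outside it, the term in x^2 +
    y^2 + z^2 exceeds the trivial bound 2 M. *)
Lemma bern_approx_error (e r : R) : 0 < e -> 0 < r -> exists2 k : R, 0 <= k &
  forall N x y z, `|bern_approx F N x y z - F x y z| <=
    e + 3 * k * ((1 + r ^+ 6) / N.+1%:R) + 2 * M / r ^+ 2 * (x ^+ 2 + y ^+ 2 + z ^+ 2).
Proof.
move=> e0 r0; have [k k0 hk] := quadratic_modulus cf fM r e0; exists k => // N x y z.
have M0 : 0 <= M := le_trans (normr_ge0 _) (fM (0, 0, 0)).
have c0 : 0 <= 2 * M / r ^+ 2 by rewrite divr_ge0 ?sqr_ge0 ?mulr_ge0.
have s0 : 0 <= e + 3 * k * ((1 + r ^+ 6) / N.+1%:R).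
  apply: addr_ge0; first exact: ltW.
  apply: mulr_ge0; first exact: mulr_ge0.
  by apply: divr_ge0 => //; apply: addr_ge0 => //; apply: exprn_ge0; exact: ltW.
have [/andP[/andP[xr yr] zr]|nr] := boolP ((`|x| <= r) && (`|y| <= r) && (`|z| <= r)).
  apply: (@le_trans _ _ (e + 3 * k * ((1 + r ^+ 6) / N.+1%:R))).
    by apply: bern_approx_dist => // x' y' z'; exact: hk.
  by rewrite lerDl mulr_ge0// !addr_ge0 ?sqr_ge0.
have h2 : 2 * M <= 2 * M / r ^+ 2 * (x ^+ 2 + y ^+ 2 + z ^+ 2).
  rewrite -mulrA ler_peMr ?mulr_ge0// mulrC ler_pdivlMr ?exprn_gt0// mul1r.
  have rr (u : R) : r < `|u| -> r ^+ 2 <= u ^+ 2.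
    by move=> ru; rewrite -[u ^+ 2]real_normK ?num_real// lerXn2r ?nnegrE// ltW.
  have x2 := sqr_ge0 x; have y2 := sqr_ge0 y; have z2 := sqr_ge0 z.
  move: nr; rewrite !negb_and -!ltNge => /orP[/orP[]|] /rr h.
  - by apply: (le_trans h); rewrite -addrA lerDl addr_ge0.
  - by apply: (le_trans h); rewrite addrAC lerDr addr_ge0.
  - by apply: (le_trans h); rewrite lerDr addr_ge0.
(* With e = 2 M and k = 0, and a cube just large enough for the point, [bern_approx_dist] gives the
   trivial bound. *)
apply: (@le_trans _ _ (2 * M + 3 * 0 * ((1 + (Num.max `|x| (Num.max `|y| `|z|)) ^+ 6) / N.+1%:R))).
  apply: bern_approx_dist => //; rewrite ?le_max ?lexx ?orbT//.
  move=> x' y' z'; rewrite !mul0r !addr0 (le_trans (ler_normB _ _))//.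
  by rewrite mulr2n mulrDl !mul1r lerD// fM.
by rewrite mulr0 mul0r addr0 (le_trans h2)// lerDr.
Qed.

Lemma cvg_bern_approx x y z : bern_approx F N x y z @[N --> \oo] --> F x y z.
Proof.
apply/cvgrPdist_le => e e0; pose r := 1 + Num.max `|x| (Num.max `|y| `|z|).
have e2 : 0 < e / 2 by rewrite divr_gt0.
have [k k0 hk] := quadratic_modulus cf fM r e2.
have h : 3 * k * ((1 + r ^+ 6) / N.+1%:R) @[N --> \oo] --> (0 : R).
  by rewrite -[X in _ --> X](mulr0 (3 * k)); apply: cvgM; [exact: cvg_cst|exact: cvg_bern_error].
have [N0 _ hN] := cvgr_le 0 h (e / 2) e2; exists N0 => // N /hN /= hN'.
have l : Num.max `|x| (Num.max `|y| `|z|) <= r by rewrite lerDr.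
have [/andP[/andP[l1 l2] l3]] : (`|x| <= r) && (`|y| <= r) && (`|z| <= r).
  by move: l; rewrite !ge_max => /andP[-> /andP[-> ->]].
rewrite distrC [leRHS](splitr e).
apply: le_trans (lerD (lexx (e / 2)) hN').
by apply: bern_approx_dist => // x' y' z'; exact: hk.
Qed.

(** The composite is a pointwise limit of trigonometric polynomials in the three measurable
    functions. *)
Lemma measurable_continuous_comp3 d (S : measurableType d) (x y z : S -> R) :
  measurable_fun setT x -> measurable_fun setT y -> measurable_fun setT z ->
  measurable_fun setT (fun s => f (x s, y s, z s)).
Proof.
move=> mx my mz.
apply: (@measurable_fun_cvg _ _ _ setT (fun N s => bern_approx F N (x s) (y s) (z s))).
  by move=> N; apply: (measurable_trig_poly (trig_poly_bern_approx F N)).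
by move=> s _; exact: cvg_bern_approx.
Qed.

Lemma norm_Rintegral_bern_approx d (S : measurableType d) (P : probability S R) (x y z : S -> R)
    (C e r k : R) (N : nat) :
  measurable_fun setT x -> measurable_fun setT y -> measurable_fun setT z ->
  (\int[P]_s (x s ^+ 2)%:E <= C%:E)%E -> (\int[P]_s (y s ^+ 2)%:E <= C%:E)%E ->
  (\int[P]_s (z s ^+ 2)%:E <= C%:E)%E -> 0 < r ->
  (forall u v t, `|bern_approx F N u v t - F u v t| <=
    e + 3 * k * ((1 + r ^+ 6) / N.+1%:R) + 2 * M / r ^+ 2 * (u ^+ 2 + v ^+ 2 + t ^+ 2)) ->
  `|\int[P]_s bern_approx F N (x s) (y s) (z s) - \int[P]_s f (x s, y s, z s)| <=
    e + 3 * k * ((1 + r ^+ 6) / N.+1%:R) + 2 * M / r ^+ 2 * (3 * C).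
Proof.
move=> mx my mz xC yC zC r0 hN.
have M0 : 0 <= M := le_trans (normr_ge0 _) (fM (0, 0, 0)).
have c0 : 0 <= 2 * M / r ^+ 2 by rewrite divr_ge0 ?sqr_ge0 ?mulr_ge0.
have i2 (u : S -> R) : measurable_fun setT u -> (\int[P]_s (u s ^+ 2)%:E <= C%:E)%E ->
    P.-integrable setT (EFin \o (fun s => u s ^+ 2)) /\ \int[P]_s (u s ^+ 2) <= C.
  move=> mu uC; have iu : P.-integrable setT (EFin \o (fun s => u s ^+ 2)).
    by apply: integrable_sqr_of_lty => //; rewrite (le_lt_trans uC)// ltry.
  by split => //; rewrite -lee_fin -EFin_Rintegral.
have [ix x2] := i2 x mx xC; have [iy y2] := i2 y my yC; have [iz z2] := i2 z mz zC.
have ib : P.-integrable setT (EFin \o (fun s => bern_approx F N (x s) (y s) (z s))).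
  have [M' hM'] := trig_poly_bounded (trig_poly_bern_approx F N).
  apply: (integrable_bounded P (M := M')) => //.
  exact: (measurable_trig_poly (trig_poly_bern_approx F N)).
have if_ : P.-integrable setT (EFin \o (fun s => f (x s, y s, z s))).
  by apply: (integrable_bounded P (M := M)) => //; exact: measurable_continuous_comp3.
rewrite -RintegralB//; apply: (le_trans (le_normr_Rintegral _ _)) => //; first exact: integrable_funB.
set c := e + _; have ic : P.-integrable setT (EFin \o (fun=> c : R)).
  by apply: (integrable_bounded P (M := `|c|)).
have iq : P.-integrable setT (EFin \o (fun s => x s ^+ 2 + y s ^+ 2 + z s ^+ 2)).
  by apply: integrable_funD => //; apply: integrable_funD.
apply: (@le_trans _ _ (\int[P]_s (c + 2 * M / r ^+ 2 * (x s ^+ 2 + y s ^+ 2 + z s ^+ 2)))).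
  apply: le_Rintegral => //.
  - by apply: integrable_norm => //; exact: integrable_funB.
  - by apply: integrable_funD => //; exact: integrable_funZ.
rewrite RintegralD//; last exact: integrable_funZ.
rewrite Rintegral_prob_cst RintegralZl// lerD2l ler_wpM2l//.
rewrite RintegralD//; last exact: integrable_funD.
rewrite RintegralD//; move: x2 y2 z2; move: (\int[P]_s _) (\int[P]_s _) (\int[P]_s _) => p q t.
by clear; lra.
Qed.

End continuous_test_functions.

Lemma norm_sub_chain (R : realType) (z p q u v s t : R) : `|p - u| <= z + s + t ->
  `|q - v| <= z + s + t -> `|q - p| <= z -> s <= z -> t <= z -> `|v - u| <= 7 * z.
Proof.
rewrite !ler_norml => /andP[h1 h2] /andP[h3 h4] /andP[h5 h6] h7 h8.
by apply/andP; split; lra.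
Qed.

Section trigonometric_convergence.
Context d (T : measurableType d) d' (T' : measurableType d') (R : realType).
Variables (P : probability T R) (P' : probability T' R).
Variables (x1 x2 x3 : nat -> T -> R) (z1 z2 z3 : T' -> R) (C : R).
Hypotheses (mx1 : forall n, measurable_fun setT (x1 n))
  (mx2 : forall n, measurable_fun setT (x2 n)) (mx3 : forall n, measurable_fun setT (x3 n))
  (mz1 : measurable_fun setT z1) (mz2 : measurable_fun setT z2) (mz3 : measurable_fun setT z3).
Hypothesis cos_cvg : forall c1 c2 c3 phi,
  \int[P]_w cos (c1 * x1 n w + c2 * x2 n w + c3 * x3 n w + phi) @[n --> \oo] -->
  \int[P']_w cos (c1 * z1 w + c2 * z2 w + c3 * z3 w + phi).

Let tr (c1 c2 c3 phi x y z : R) := cos (c1 * x + c2 * y + c3 * z + phi).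

Lemma cos_cosM (a b : R) : cos a * cos b = 2^-1 * cos (a + b) + 2^-1 * cos (a - b).
Proof. by rewrite cosD cosB; field. Qed.

(** The extra cosine factor closes the induction: in the product case it merges with the new cosine
    by the product-to-sum formula. *)
Lemma trig_poly_cos_cvg h : trig_poly h -> forall c1 c2 c3 phi,
  \int[P]_w (tr c1 c2 c3 phi (x1 n w) (x2 n w) (x3 n w) * h (x1 n w) (x2 n w) (x3 n w)) @[n --> \oo] -->
  \int[P']_w (tr c1 c2 c3 phi (z1 w) (z2 w) (z3 w) * h (z1 w) (z2 w) (z3 w)).
Proof.
have ii d0 (S : measurableType d0) (Q : probability S R) (u1 u2 u3 : S -> R) g c1 c2 c3 phi :
    measurable_fun setT u1 -> measurable_fun setT u2 -> measurable_fun setT u3 -> trig_poly g ->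
    Q.-integrable setT (EFin \o (fun w => tr c1 c2 c3 phi (u1 w) (u2 w) (u3 w) * g (u1 w) (u2 w) (u3 w))).
  move=> m1 m2 m3 tg; have t := trig_cos c1 c2 c3 phi tg.
  have [M' hM'] := trig_poly_bounded t.
  apply: (integrable_bounded Q (M := M')); first exact: (measurable_trig_poly t).
  by move=> w; exact: hM'.
elim=> [k|a g1 g2 t1 h1 t2 h2|e1 e2 e3 psi g tg hg] c1 c2 c3 phi.
- have E d0 (S : measurableType d0) (Q : probability S R) (u1 u2 u3 : S -> R) :
    measurable_fun setT u1 -> measurable_fun setT u2 -> measurable_fun setT u3 ->
    \int[Q]_w (tr c1 c2 c3 phi (u1 w) (u2 w) (u3 w) * k) =
    k * \int[Q]_w (tr c1 c2 c3 phi (u1 w) (u2 w) (u3 w)).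
    move=> m1 m2 m3; under eq_Rintegral do rewrite mulrC.
    rewrite RintegralZl//; have := ii _ _ Q u1 u2 u3 _ c1 c2 c3 phi m1 m2 m3 (trig_cst 1).
    by apply: eq_integrable => // w _ /=; rewrite mulr1.
  rewrite E//; rewrite (funext (fun n => E _ _ P (x1 n) (x2 n) (x3 n) (mx1 n) (mx2 n) (mx3 n))).
  by apply: cvgM; [exact: cvg_cst|exact: cos_cvg].
- have E d0 (S : measurableType d0) (Q : probability S R) (u1 u2 u3 : S -> R) :
    measurable_fun setT u1 -> measurable_fun setT u2 -> measurable_fun setT u3 ->
    \int[Q]_w (tr c1 c2 c3 phi (u1 w) (u2 w) (u3 w) * (a * g1 (u1 w) (u2 w) (u3 w) + g2 (u1 w) (u2 w) (u3 w))) =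
    a * \int[Q]_w (tr c1 c2 c3 phi (u1 w) (u2 w) (u3 w) * g1 (u1 w) (u2 w) (u3 w)) +
    \int[Q]_w (tr c1 c2 c3 phi (u1 w) (u2 w) (u3 w) * g2 (u1 w) (u2 w) (u3 w)).
    move=> m1 m2 m3; under eq_Rintegral do rewrite mulrDr mulrCA.
    rewrite RintegralD//; [|by apply: integrable_funZ => //; exact: ii|exact: ii].
    by rewrite RintegralZl//; exact: ii.
  rewrite E//; rewrite (funext (fun n => E _ _ P (x1 n) (x2 n) (x3 n) (mx1 n) (mx2 n) (mx3 n))).
  by apply: cvgD; [apply: cvgM; [exact: cvg_cst|exact: h1]|exact: h2].
- have E d0 (S : measurableType d0) (Q : probability S R) (u1 u2 u3 : S -> R) :
    measurable_fun setT u1 -> measurable_fun setT u2 -> measurable_fun setT u3 ->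
    \int[Q]_w (tr c1 c2 c3 phi (u1 w) (u2 w) (u3 w) *
       (cos (e1 * u1 w + e2 * u2 w + e3 * u3 w + psi) * g (u1 w) (u2 w) (u3 w))) =
    2^-1 * \int[Q]_w (tr (c1 + e1) (c2 + e2) (c3 + e3) (phi + psi) (u1 w) (u2 w) (u3 w) * g (u1 w) (u2 w) (u3 w)) +
    2^-1 * \int[Q]_w (tr (c1 - e1) (c2 - e2) (c3 - e3) (phi - psi) (u1 w) (u2 w) (u3 w) * g (u1 w) (u2 w) (u3 w)).
    move=> m1 m2 m3; rewrite -!RintegralZl//; [|exact: ii..].
    rewrite -RintegralD//; [|by apply: integrable_funZ => //; exact: ii..].
    apply: eq_Rintegral => w _; rewrite mulrA cos_cosM mulrDl !mulrA.
    by congr (_ * cos _ * _ + _ * cos _ * _); ring.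
  rewrite E//; rewrite (funext (fun n => E _ _ P (x1 n) (x2 n) (x3 n) (mx1 n) (mx2 n) (mx3 n))).
  by apply: cvgD; (apply: cvgM; [exact: cvg_cst|exact: hg]).
Qed.

Lemma trig_poly_cvg h : trig_poly h ->
  \int[P]_w h (x1 n w) (x2 n w) (x3 n w) @[n --> \oo] --> \int[P']_w h (z1 w) (z2 w) (z3 w).
Proof.
move=> th; have := @trig_poly_cos_cvg h th 0 0 0 0.
have e x y z : tr 0 0 0 0 x y z * h x y z = h x y z.
  by rewrite /tr !mul0r !addr0 cos0 mul1r.
by under eq_Rintegral do rewrite e; under eq_fun do under eq_Rintegral do rewrite e.
Qed.

Hypotheses (mom1 : forall n, (\int[P]_w (x1 n w ^+ 2)%:E <= C%:E)%E)
  (mom2 : forall n, (\int[P]_w (x2 n w ^+ 2)%:E <= C%:E)%E)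
  (mom3 : forall n, (\int[P]_w (x3 n w ^+ 2)%:E <= C%:E)%E)
  (moz1 : (\int[P']_w (z1 w ^+ 2)%:E <= C%:E)%E)
  (moz2 : (\int[P']_w (z2 w ^+ 2)%:E <= C%:E)%E)
  (moz3 : (\int[P']_w (z3 w ^+ 2)%:E <= C%:E)%E).

(** A continuity theorem for characteristic functions in dimension 3. The common second moment bound
    [C] makes the error of one trigonometric polynomial small under all the laws at once. *)
Lemma trigonometric_cvg (f : R * R * R -> R) (M : R) : continuous f -> (forall z, `|f z| <= M) ->
  \int[P]_w f (x1 n w, x2 n w, x3 n w) @[n --> \oo] --> \int[P']_w f (z1 w, z2 w, z3 w).
Proof.
(* The approximation error consists of three terms of size [e] (modulus, mesh, exterior of the cube)
   and occurs on both sides; the polynomial itself adds one more. *)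
move=> cf fM; apply/cvgrPdist_le => eps eps0; pose e := eps / 7.
have e0 : 0 < e by rewrite divr_gt0.
have M0 : 0 <= M := le_trans (normr_ge0 _) (fM (0, 0, 0)).
have C0 : 0 <= C.
  by rewrite -lee_fin (le_trans _ moz1)// integral_ge0// => x _; rewrite lee_fin sqr_ge0.
(* The cube is large enough for its exterior to cost at most [e], in the manner of Chebyshev's
   inequality. *)
pose r := Num.sqrt ((2 * M * (3 * C) + 1) / e).
have A0 : 0 < 2 * M * (3 * C) + 1 by rewrite ltr_wpDl// !mulr_ge0.
have r0 : 0 < r by rewrite sqrtr_gt0 divr_gt0.
have r2 : 2 * M / r ^+ 2 * (3 * C) <= e.
  rewrite sqr_sqrtr; last by rewrite ltW// divr_gt0.
  have -> : 2 * M / ((2 * M * (3 * C) + 1) / e) * (3 * C) =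
     e * ((2 * M * (3 * C)) / (2 * M * (3 * C) + 1)) by field; rewrite !gt_eqF.
  by rewrite ler_piMr ?(ltW e0)// ler_pdivrMr// mul1r lerDl.
have [k k0 hk] := bern_approx_error cf fM e0 r0.
have hc : 3 * k * ((1 + r ^+ 6) / N.+1%:R) @[N --> \oo] --> (0 : R).
  by rewrite -[X in _ --> X](mulr0 (3 * k)); apply: cvgM; [exact: cvg_cst|exact: cvg_bern_error].
have [N _ hN] := cvgr_le 0 hc e e0; have {}hN := hN N (leqnn N).
have /cvgrPdist_le/(_ e e0)[n0 _ hn] := trig_poly_cvg (trig_poly_bern_approx (fun x y z => f (x, y, z)) N).
exists n0 => // n /hn /= {}hn.
have h1 := norm_Rintegral_bern_approx cf fM (mx1 n) (mx2 n) (mx3 n) (mom1 n) (mom2 n) (mom3 n) r0 (hk N).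
have h2 := norm_Rintegral_bern_approx cf fM mz1 mz2 mz3 moz1 moz2 moz3 r0 (hk N).
have eE : eps = 7 * e by rewrite /e mulrC divfK.
by rewrite eE; exact: (norm_sub_chain h1 h2 hn hN r2).
Qed.

End trigonometric_convergence.

(** * The path of the solution and the estimation errors *)

Section primitives.
Context {R : realType}.
Local Notation mu := (@lebesgue_measure R).
Implicit Types (g G : R -> R).

Lemma integrable_continuous_itvcc g (a b : R) : continuous g ->
  mu.-integrable `[a, b] (EFin \o g).
Proof.
move=> cg; apply: continuous_compact_integrable; first exact: segment_compact.
exact: continuous_subspaceT.
Qed.

(** Makes a function that is continuous on [A] only, such as a path on the half-line, continuous on
    the whole line by composing it with a continuous map into [A]. *)
Lemma continuous_within_comp (A : set R) (f p : R -> R) : {within A, continuous f} ->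
  continuous p -> (forall t, A (p t)) -> continuous (fun t => f (p t)).
Proof.
move=> /subspace_continuousP cf cp Ap t.
apply: (@cvg_comp _ _ _ p f _ _ _ _ (cf _ (Ap t))) => B /= hB.
have h : \forall s \near t, A (p s) -> B (p s) := cp t _ hB.
change (\forall s \near t, B (p s)).
by apply: filterS h => s; apply.
Qed.

Lemma continuous_max0 : continuous (fun t : R => Num.max t 0).
Proof. by move=> t; apply: continuous_max; [exact: cvg_id|exact: cvg_cst]. Qed.

Lemma is_derive1_continuous f (x l : R) : is_derive x 1 f l -> {for x, continuous f}.
Proof. by move=> [df _]; apply/differentiable_continuous/derivable1_diffP. Qed.

(** For t < 0 the interval is empty and the value 0. So [prim g] is continuous on the whole line
    with a possible kink at 0, which is why derivatives are taken at t > 0. *)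
Definition prim g (t : R) : R := \int[mu]_(x in `[0, t]) g x.

Lemma is_derive_Rintegral g (a t : R) : continuous g -> a < t ->
  is_derive t 1 (fun t => \int[mu]_(x in `[a, t]) g x) (g t).
Proof.
move=> cg at_; have t2 : t < t + 1 by rewrite ltrDl.
have [d1 d2] := continuous_FTC1_closed t2 (integrable_continuous_itvcc a (t + 1) cg) at_ (cg t).
have e : 'D_1 (fun t => \int[mu]_(x in `[a, t]) g x) t = g t by rewrite -derive1E; exact: d2.
exact: DeriveDef d1 e.
Qed.

Lemma is_derive_prim g (t : R) : continuous g -> 0 < t -> is_derive t 1 (prim g) (g t).
Proof. exact: is_derive_Rintegral. Qed.

Lemma prim0 g : prim g 0 = 0.
Proof. by rewrite /prim set_itv1 Rintegral_set1. Qed.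

Lemma prim_continuous g : continuous g -> continuous (prim g).
Proof.
move=> cg; pose F (t : R) := \int[mu]_(x in `[-1, t]) g x.
have -> : prim g = fun t : R => F (Num.max t 0) - F 0.
  apply/funext => t; rewrite /prim; have [t0|t0] := leP 0 t; last first.
    by rewrite subrr set_itv_ge ?bnd_simp -?ltNge// Rintegral_set0.
  rewrite /F Rintegral_itvB ?bnd_simp//; last exact: integrable_continuous_itvcc.
  apply/esym/Rintegral_itv_obnd_cbnd; apply: integrableS (integrable_continuous_itvcc 0 t cg) => //.
  by apply: subset_itv; rewrite bnd_simp.
have c : continuous (fun t : R => F (Num.max t 0)).
  move=> t; apply: (@continuous_comp _ _ _ (fun t : R => Num.max t 0) F); first exact: continuous_max0.
  apply: is_derive1_continuous (is_derive_Rintegral cg _).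
  by rewrite (lt_le_trans (ltrN10 R))// le_max lexx orbT.
by move=> t; apply: cvgB; [exact: c|exact: cvg_cst].
Qed.

Lemma primitive_mean_value g G (a b : R) : continuous G ->
  (forall t : R, 0 < t -> is_derive t 1 G (g t)) ->
  0 <= a -> a <= b -> exists2 c, a <= c <= b & G b - G a = g c * (b - a).
Proof.
move=> cG dG a0 ab.
have [|c hc e] := @MVT_segment _ G g a b ab _ (continuous_subspaceT cG).
  by move=> x; rewrite in_itv/= => /andP[xa _]; apply: dG; exact: (le_lt_trans a0).
by exists c => //; move: hc; rewrite in_itv.
Qed.

Lemma Rintegral_primitive g G (t : R) : continuous g -> continuous G ->
  (forall t : R, 0 < t -> is_derive t 1 G (g t)) -> 0 <= t ->
  prim g t = G t - G 0.
Proof.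
move=> cg cG dG t0.
have dd (x : R) : 0 < x -> is_derive x 1 (fun y => prim g y - G y) 0.
  move=> x0; have d1 := is_derive_prim cg x0; have d2 := dG x x0.
  by eapply is_derive_eq; [derive_tac|rewrite /=; ring].
have cc : continuous (fun y => prim g y - G y).
  by move=> x; apply: cvgB; [exact: prim_continuous|exact: cG].
have [c _] := @primitive_mean_value (fun=> 0) (fun y => prim g y - G y) 0 t cc dd (lexx 0) t0.
by rewrite mul0r prim0 => /eqP; rewrite subr_eq0 sub0r => /eqP e; rewrite -[prim g t](subrK (G t)) e addrC.
Qed.

Lemma Rintegral_itv_cst (k t : R) : 0 <= t -> \int[mu]_(x in `[0, t]) k = k * t.
Proof.
have d (x : R) : 0 < x -> is_derive x 1 (fun x : R => k * x) k.
  by move=> _; eapply is_derive_eq; [derive_tac|rewrite /=; ring].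
have c : continuous (fun x : R => k * x) by move=> x; apply: cvgM; [exact: cvg_cst|exact: cvg_id].
move=> t0; rewrite -/(prim (fun=> k) t) (Rintegral_primitive (g := fun=> k) _ c d)//.
  by rewrite mulr0 subr0.
by move=> x; exact: cvg_cst.
Qed.

Lemma norm_Rintegral_itv_le g (M t : R) : 0 <= t -> mu.-integrable `[0, t] (EFin \o g) ->
  (forall x, 0 <= x <= t -> `|g x| <= M) -> `|\int[mu]_(x in `[0, t]) g x| <= M * t.
Proof.
move=> t0 ig gM; rewrite -Rintegral_itv_cst//.
apply: (le_trans (le_normr_Rintegral _ _)) => //; apply: le_Rintegral => //.
- exact: integrable_norm.
- by apply: integrable_continuous_itvcc => x; exact: cvg_cst.
Qed.

Lemma itvcc_modulus g (a b e : R) : continuous g -> 0 < e ->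
  exists2 d : R, 0 < d & forall x h : R, a <= x <= b -> `|h| < d -> `|g (x + h) - g x| < e.
Proof.
move=> cg e0.
have c x : `[a, b]%classic x -> {for (x, (0 : R)), continuous (fun p : R * R => g (p.1 + p.2))}.
  by move=> _; apply: continuous_comp; [exact: add_continuous|exact: cg].
have /nbhs_ballP[d /= d0 hd] := @compact_modulus _ R R `[a, b]%classic 0 (fun x h => g (x + h))
  (@segment_compact _ a b) c e e0.
exists d => // x h xab hd'; have := hd h _ x _; rewrite addr0; apply.
  by rewrite -ball_normE/= sub0r normrN.
by rewrite /= in_itv.
Qed.

Definition riemann_sum (N : nat) (t : R) g : R :=
  \sum_(0 <= k < N.+1) t / N.+1%:R * g (k%:R * (t / N.+1%:R)).

(** The mean value theorem on each cell, accumulated by induction on the number of cells. The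
    explicit error is what makes the inner sums of [cvg_riemann_sum2] uniformly close to their
    integrals. *)
Lemma riemann_sum_error (N : nat) (t e : R) g : 0 <= t -> continuous g ->
  (forall x h, 0 <= x <= t -> `|h| <= t / N.+1%:R -> `|g (x + h) - g x| <= e) ->
  `|riemann_sum N t g - \int[mu]_(x in `[0, t]) g x| <= t * e.
Proof.
move=> t0 cg hg; pose G := prim g; have G0 : G 0 = 0 := prim0 g.
have cG : continuous G := prim_continuous cg.
have dG (x : R) : 0 < x -> is_derive x 1 G (g x) by exact: is_derive_prim.
rewrite -/(G t).
pose h := t / N.+1%:R; have h0 : 0 <= h by rewrite divr_ge0.
have Nh : N.+1%:R * h = t by rewrite mulrC divfK.
suff H m : (m <= N.+1)%N ->
    `|\sum_(0 <= k < m) h * g (k%:R * h) - G (m%:R * h)| <= m%:R * h * e.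
  by have := H N.+1 (leqnn _); rewrite Nh.
elim: m => [_|m ih mN]; first by rewrite big_nil !mul0r G0 subrr normr0.
rewrite big_nat_recr//=.
have m0 : 0 <= m%:R * h by rewrite mulr_ge0.
have mE : m.+1%:R * h = m%:R * h + h by rewrite -natr1 mulrDl mul1r.
have mm : m%:R * h <= m.+1%:R * h by rewrite mE lerDl.
have [c /andP[c1 c2] Gc] := primitive_mean_value cG dG m0 mm.
have -> : \sum_(0 <= k < m) h * g (k%:R * h) + h * g (m%:R * h) - G (m.+1%:R * h) =
  (\sum_(0 <= k < m) h * g (k%:R * h) - G (m%:R * h)) - h * (g (m%:R * h + (c - m%:R * h)) - g (m%:R * h)).
  have -> : G (m.+1%:R * h) = g c * h + G (m%:R * h).
    by rewrite -[LHS](subrK (G (m%:R * h))) Gc mE [_ + h - _]addrAC subrr add0r.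
  by rewrite [m%:R * h + _]addrC subrK; ring.
rewrite mE mulrDl (le_trans (ler_normB _ _))// lerD//; first exact/ih/ltnW.
rewrite normrM ger0_norm// ler_wpM2l//; apply: hg.
  by rewrite m0/= -Nh ler_wpM2r// ler_nat ltnW.
by rewrite ger0_norm ?subr_ge0// lerBlDr addrC -mE.
Qed.

Lemma near_mesh (t d : R) : 0 < d -> \forall N \near \oo, t / N.+1%:R < d.
Proof.
move=> d0; have h : t / N.+1%:R @[N --> \oo] --> (0 : R).
  by rewrite -[X in _ --> X](mulr0 t); apply: cvgM; [exact: cvg_cst|exact: cvg_harmonic].
exact: (cvgr_lt 0 h).
Qed.

Lemma cvg_riemann_sum (t : R) g : 0 <= t -> continuous g ->
  riemann_sum N t g @[N --> \oo] --> \int[mu]_(x in `[0, t]) g x.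
Proof.
move=> t0 cg; apply/cvgrPdist_le => e e0.
have t1 : 0 < t + 1 by rewrite ltr_wpDl.
have e1 : 0 < e / (t + 1) by rewrite divr_gt0.
have [d d0 hd] := itvcc_modulus 0 t cg e1.
have [N0 _ hN] := near_mesh t d0; exists N0 => // N /hN /= hN'.
rewrite distrC; apply: (le_trans (riemann_sum_error t0 cg (e := e / (t + 1)) _)).
  by move=> x h xt hh; apply/ltW/hd => //; exact: (le_lt_trans hh).
by rewrite mulrCA ler_piMr ?(ltW e0)// ler_pdivrMr// mul1r lerDl.
Qed.

Lemma continuous_section (g : R -> R -> R) (s : R) :
  continuous (fun p : R * R => g p.1 p.2) -> continuous (g s).
Proof.
move=> cg x.
exact: (@continuous2_cvg R R R R (nbhs x) _ (fun=> s) id g s x (cg (s, x)) (cvg_cst s) cvg_id).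
Qed.

Lemma continuous_Rintegral_param (g : R -> R -> R) (t : R) :
  continuous (fun p : R * R => g p.1 p.2) ->
  continuous (fun s => \int[mu]_(x in `[0, t]) g s x).
Proof.
move=> cg s0; apply/cvgrPdist_le => e e0.
have cs := continuous_section cg.
have [t0|t0] := ltP t 0.
  by near=> s; rewrite set_itv_ge ?bnd_simp -?ltNge// !Rintegral_set0 subrr normr0 ltW.
have t1 : 0 < t + 1 by rewrite ltr_wpDl.
have e1 : 0 < e / (t + 1) by rewrite divr_gt0.
have c x : `[0, t]%classic x -> {for (x, s0), continuous (fun p : R * R => g p.2 p.1)}.
  move=> _; exact: (@continuous2_cvg (R * R)%type R R R (nbhs (x, s0)) _ snd fst g s0 x (cg (s0, x))
    cvg_snd cvg_fst).
have := @compact_modulus _ R R `[0, t]%classic s0 (fun x s => g s x) (@segment_compact _ 0 t) c _ e1.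
apply: filterS => s hs.
have i := fun s => integrable_continuous_itvcc 0 t (cs s).
rewrite -RintegralB//.
apply: (@le_trans _ _ ((e / (t + 1)) * t)); last first.
  by rewrite mulrAC ler_pdivrMr// ler_pM2l// lerDl.
apply: norm_Rintegral_itv_le => //; first exact: integrable_funB.
by move=> x xt; rewrite distrC ltW// hs//= in_itv.
Unshelve. all: by end_near. Qed.

(** The inner sum is replaced by the integral at an error uniform in the outer variable, by
    compactness of the square; the outer sum then runs over a continuous function. *)
Lemma cvg_riemann_sum2 (t : R) (g : R -> R -> R) : 0 <= t ->
  continuous (fun p : R * R => g p.1 p.2) ->
  riemann_sum N t (fun s => riemann_sum N t (g s)) @[N --> \oo] -->
  \int[mu]_(s in `[0, t]) \int[mu]_(x in `[0, t]) g s x.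
Proof.
move=> t0 cg; have cphi := continuous_Rintegral_param (t := t) cg.
have cs := continuous_section cg.
have h1 := cvg_riemann_sum t0 cphi.
suff h2 : riemann_sum N t (fun s => riemann_sum N t (g s)) -
    riemann_sum N t (fun s => \int[mu]_(x in `[0, t]) g s x) @[N --> \oo] --> (0 : R).
  rewrite -[X in _ --> X]add0r (_ : (fun N => _) = (fun N => (riemann_sum N t (fun s => riemann_sum N t (g s)) -
    riemann_sum N t (fun s => \int[mu]_(x in `[0, t]) g s x)) +
    riemann_sum N t (fun s => \int[mu]_(x in `[0, t]) g s x))); last by apply/funext => N; rewrite subrK.
  exact: cvgD h2 h1.
apply/cvgrPdist_le => e e0.
have t1 : 0 < t ^+ 2 + 1 by rewrite ltr_wpDl ?sqr_ge0.
have e1 : 0 < e / (t ^+ 2 + 1) by rewrite divr_gt0.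
pose K := (`[0, t] `*` `[0, t])%classic : set (R * R).
have cK : compact K by apply: compact_setX; exact: segment_compact.
have c x : K x -> {for (x, (0 : R)), continuous (fun p : (R * R) * R => g p.1.1 (p.1.2 + p.2))}.
  move=> _; have c1 : (fun p : (R * R) * R => p.1.1) @ (x, (0 : R)) --> x.1.
    exact: (cvg_comp _ _ cvg_fst cvg_fst).
  have c2 : (fun p : (R * R) * R => p.1.2 + p.2) @ (x, (0 : R)) --> x.2 + 0.
    by apply: cvgD; [exact: (cvg_comp _ _ cvg_fst cvg_snd)|exact: cvg_snd].
  exact: (@continuous2_cvg ((R * R) * R)%type R R R (nbhs (x, (0 : R))) _ _ _ g _ _ (cg (x.1, x.2 + 0)) c1 c2).
have /nbhs_ballP[d /= d0 hd] := @compact_modulus _ (R * R)%type R K 0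
  (fun x h => g x.1 (x.2 + h)) cK c _ e1.
have [N0 _ hN] := near_mesh t d0; exists N0 => // N /hN /= hN'.
rewrite sub0r normrN /riemann_sum -sumrB.
pose h := t / N.+1%:R; have h0 : 0 <= h by rewrite divr_ge0.
have Nh : N.+1%:R * h = t by rewrite mulrC divfK.
apply: (@le_trans _ _ (\sum_(0 <= k < N.+1) h * (t * (e / (t ^+ 2 + 1))))); last first.
  rewrite sumr_const_nat subn0 -[leLHS]mulr_natl mulrA Nh mulrA -expr2 mulrCA ler_piMr ?(ltW e0)//.
  by rewrite ler_pdivrMr// mul1r lerDl.
rewrite !big_mkord; apply: (le_trans (ler_norm_sum _ _ _)); apply: ler_sum => k _.
rewrite -mulrBr normrM ger0_norm// ler_wpM2l//.
have kt : 0 <= k%:R * h <= t by rewrite mulr_ge0//= -[leRHS]Nh ler_wpM2r// ler_nat ltnW.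
apply: riemann_sum_error => // x y xt yh; rewrite -[in X in _ - X](addr0 x); apply/ltW.
apply: (hd y _ (k%:R * h, x)); first by rewrite -ball_normE/= sub0r normrN (le_lt_trans yh).
by split; rewrite /= in_itv.
Qed.

End primitives.

Section continuity_rules.
Context {R : realType}.
Implicit Types (f g : R -> R).

(** Like [tends_to], a synonym on which the tactic [continuity_tac] can match. *)
Definition cont f : Prop := continuous f.

Lemma contP f : cont f -> continuous f. Proof. by []. Qed.

Lemma cont_add f g : cont f -> cont g -> cont (fun x => f x + g x).
Proof. by move=> cf cg x; apply: cvgD; [exact: cf|exact: cg]. Qed.

Lemma cont_opp f : cont f -> cont (fun x => - f x).
Proof. by move=> cf x; apply: cvgN; exact: cf. Qed.

Lemma cont_mul f g : cont f -> cont g -> cont (fun x => f x * g x).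
Proof. by move=> cf cg x; apply: cvgM; [exact: cf|exact: cg]. Qed.

Lemma cont_expR f : cont f -> cont (fun x => expR (f x)).
Proof. by move=> cf x; apply: (cvg_comp_continuous (h := expR)); [exact: continuous_expR|exact: cf]. Qed.

Lemma cont_cst (c : R) : cont (fun=> c).
Proof. by move=> x; exact: cvg_cst. Qed.

Lemma cont_id : cont (fun x => x).
Proof. by move=> x; exact: cvg_id. Qed.

Lemma cont_exp f n : cont f -> cont (fun x => f x ^+ n).
Proof.
move=> cf; elim: n => [|n ih].
  by rewrite (_ : (fun x => _) = fun=> 1); [exact: cont_cst|apply/funext => x; rewrite expr0].
by rewrite (_ : (fun x => _) = fun x => f x * f x ^+ n); [exact: cont_mul|apply/funext => x; rewrite exprS].
Qed.

Lemma cont_prim f : cont f -> cont (prim f).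
Proof. exact: prim_continuous. Qed.

End continuity_rules.

Ltac cont_loop := cbv beta; lazymatch goal with
  | |- @cont ?R (fun _ => ?c) => exact: cont_cst
  | |- @cont ?R (fun y => y) => exact: cont_id
  | |- @cont ?R (fun y => @GRing.add _ (@?f y) (@?g y)) =>
      refine (@cont_add R f g _ _); cont_loop
  | |- @cont ?R (fun y => @GRing.opp _ (@?f y)) => refine (@cont_opp R f _); cont_loop
  | |- @cont ?R (fun y => @GRing.mul _ (@?f y) (@?g y)) =>
      refine (@cont_mul R f g _ _); cont_loop
  | |- @cont ?R (fun y => @GRing.exp _ (@?f y) ?n) => refine (@cont_exp R f n _); cont_loop
  | |- @cont ?R (fun y => expR (@?f y)) => refine (@cont_expR R f _); cont_loop
  | |- @cont ?R (fun y => prim ?g y) => refine (@cont_prim R g _); cont_loop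
  | |- @cont ?R (prim ?g) => refine (@cont_prim R g _); cont_loop
  | |- @cont ?R (fun y => ?f y) => change (@cont R f); try assumption
  | |- cont ?f => try assumption
  end.

Ltac continuity_tac := apply: contP;
  lazymatch goal with |- @cont ?R ?f => change (@cont R (fun y => f y)) end; cont_loop.

Lemma norm_le_1Dsqr (R : realType) (z : R) : `|z| <= 1 + z ^+ 2.
Proof.
rewrite -[z ^+ 2]real_normK ?num_real//; have := sqr_ge0 (`|z| - 1).
have -> : (`|z| - 1) ^+ 2 = `|z| ^+ 2 - 2 * `|z| + 1 by ring.
by have := normr_ge0 z; move: (`|z|) => p; lra.
Qed.

(** * The explicit solution and closed forms of its integrals *)

Section vasicek_path.
Context {R : realType}.
Local Notation mu := (@lebesgue_measure R).
Variables (a b sigma y0 : R) (beta : R -> R).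
Hypotheses (b_gt0 : 0 < b) (cbeta : cont beta).

Definition path_Z (t : R) := prim (fun s => expR (- (b * s)) * beta s) t.
Definition path_L (t : R) := prim (fun s => expR (b * s) * beta s) t.
Definition path_Q (t : R) := expR (- (b * t)) * path_L t.
(** Chosen so that L eta + sigma E has the derivative beta (e^(bt) eta + sigma beta), the term that
    occurs in the integral of Y^2. *)
Definition path_E (t : R) := prim (fun s => beta s * (beta s - b * path_Q s)) t.
Definition path_eta (t : R) := y0 + a / b + b * sigma * path_Z t.
(** The differentiable part of the solution: its derivative is a + b Y. *)
Definition path_M (t : R) := expR (b * t) * path_eta t - a / b.
Definition path_Y (t : R) := path_M t + sigma * beta t.

Let bn0 : b != 0. Proof. by rewrite gt_eqF. Qed.

Lemma path_Z_continuous : cont path_Z.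
Proof. by rewrite /path_Z; continuity_tac. Qed.
Lemma path_L_continuous : cont path_L.
Proof. by rewrite /path_L; continuity_tac. Qed.
Lemma path_Q_continuous : cont path_Q.
Proof. have h := path_L_continuous; rewrite /path_Q; continuity_tac. Qed.
Lemma path_E_continuous : cont path_E.
Proof. have h := path_Q_continuous; rewrite /path_E; continuity_tac. Qed.
Lemma path_M_continuous : cont path_M.
Proof. have h := path_Z_continuous; rewrite /path_M /path_eta; continuity_tac. Qed.
Lemma path_Y_continuous : cont path_Y.
Proof. have h := path_M_continuous; rewrite /path_Y; continuity_tac. Qed.

Lemma expRbN (t : R) : expR (b * t) * expR (- (b * t)) = 1.
Proof. by rewrite -expRD subrr expR0. Qed.

Lemma is_derive_path_Z (t : R) : 0 < t -> is_derive t 1 path_Z (expR (- (b * t)) * beta t).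
Proof. by apply: is_derive_prim; continuity_tac. Qed.

Lemma is_derive_path_L (t : R) : 0 < t -> is_derive t 1 path_L (expR (b * t) * beta t).
Proof. by apply: is_derive_prim; continuity_tac. Qed.

Lemma is_derive_path_E (t : R) : 0 < t -> is_derive t 1 path_E (beta t * (beta t - b * path_Q t)).
Proof.
by have h := path_Q_continuous; apply: is_derive_prim; continuity_tac.
Qed.

Lemma is_derive_path_eta (t : R) : 0 < t ->
  is_derive t 1 path_eta (b * sigma * (expR (- (b * t)) * beta t)).
Proof.
move=> t0; have h := is_derive_path_Z t0.
by rewrite /path_eta; eapply is_derive_eq; [derive_tac|rewrite /=; ring].
Qed.

Lemma is_derive_path_M (t : R) : 0 < t -> is_derive t 1 path_M (a + b * path_Y t).
Proof.
move=> t0; have h := is_derive_path_eta t0.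
rewrite /path_M; eapply is_derive_eq; [derive_tac|rewrite /path_Y /path_M /=].
have := expRbN t; move: (expR (b * t)) (expR (- (b * t))) (path_eta t) (beta t) => e f n x ef.
have -> : e * (b * sigma * (f * x)) = b * sigma * x * (e * f) by ring.
by rewrite ef; field.
Qed.

Lemma path_eta0 : path_eta 0 = y0 + a / b.
Proof. by rewrite /path_eta /path_Z prim0 mulr0 addr0. Qed.

Lemma path_M0 : path_M 0 = y0.
Proof. by rewrite /path_M path_eta0 mulr0 expR0 mul1r addrK. Qed.

Lemma path_Y_sol (t : R) : 0 <= t ->
  path_Y t = y0 + prim (fun s => a + b * path_Y s) t + sigma * beta t.
Proof.
move=> t0; have c := path_Y_continuous.
have h := Rintegral_primitive (g := fun s => a + b * path_Y s) _ path_M_continuous is_derive_path_M t0.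
by rewrite h; [rewrite path_M0 /path_Y; ring|continuity_tac].
Qed.

Lemma path_I1 (t : R) : 0 <= t -> prim path_Y t = (path_M t - y0 - a * t) / b.
Proof.
move=> t0; have c := path_M_continuous.
have d (x : R) : 0 < x -> is_derive x 1 (fun x => (path_M x - a * x) * b^-1) (path_Y x).
  move=> x0; have h := is_derive_path_M x0.
  by eapply is_derive_eq; [derive_tac|rewrite /=; field].
rewrite (Rintegral_primitive (G := fun x => (path_M x - a * x) * b^-1) path_Y_continuous _ d t0).
  by rewrite path_M0; field.
by continuity_tac.
Qed.

(** From Y = M + sigma beta and M' = a + b Y: the function b Y^2 is the derivative of M^2/2 + sigma
    b (L eta + sigma E) minus a times the integral of Y. *)
Definition path_I2 (t : R) : R :=
  (2^-1 * path_M t ^+ 2 + sigma * b * (path_L t * path_eta t + sigma * path_E t) - a * prim path_Y t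
   - 2^-1 * y0 ^+ 2) / b.

Lemma path_I2E (t : R) : 0 <= t -> prim (fun s => path_Y s ^+ 2) t = path_I2 t.
Proof.
move=> t0; have cY := path_Y_continuous; have cM := path_M_continuous.
have cL := path_L_continuous; have cE := path_E_continuous; have cZ := path_Z_continuous.
have d (x : R) : 0 < x -> is_derive x 1 (fun x => (2^-1 * (path_M x * path_M x) +
   sigma * b * (path_L x * path_eta x + sigma * path_E x) - a * prim path_Y x) * b^-1) (path_Y x ^+ 2).
  move=> x0; have h1 := is_derive_path_M x0; have h2 := is_derive_path_L x0.
  have h3 := is_derive_path_eta x0; have h4 := is_derive_path_E x0.
  have h5 := is_derive_prim cY x0.
  eapply is_derive_eq; [derive_tac|rewrite /=].
  rewrite /path_Q; have := expRbN x; have : path_M x = expR (b * x) * path_eta x - a / b by [].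
  rewrite /path_Y; move: (expR (b * x)) (expR (- (b * x))) (path_eta x) (beta x) (path_M x) (path_L x) (path_E x).
  move=> e f n be m l E' mE ef.
  have hn : e * n = m + a / b by rewrite mE subrK.
  have -> : n * (e * be) = (m + a / b) * be by rewrite -hn; ring.
  by move: (prim _ x) => p; field.
rewrite (Rintegral_primitive (G := fun x => (2^-1 * (path_M x * path_M x) +
   sigma * b * (path_L x * path_eta x + sigma * path_E x) - a * prim path_Y x) * b^-1) _ _ d t0).
- by rewrite /path_I2 path_M0 /path_L /path_E !prim0; field.
- by continuity_tac.
- by rewrite /path_eta; continuity_tac.
Qed.

Lemma norm_prim_le (f g : R -> R) (t : R) : cont f -> cont g -> 0 <= t ->
  (forall x, 0 <= x <= t -> `|f x| <= g x) -> `|prim f t| <= prim g t.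
Proof.
move=> cf cg t0 fg; have jf := integrable_continuous_itvcc 0 t cf.
apply: (le_trans (le_normr_Rintegral _ _)) => //; apply: le_Rintegral => //.
- exact: integrable_norm.
- exact: integrable_continuous_itvcc.
Qed.

(** Let S be the integral of beta^2. By |beta| <= 1 + beta^2 the average [path_Q] is at most t + S
    on [0, t], so that E is quadratic in t + S. The path enters through its energy S alone. *)
Lemma path_E_le (t : R) : 0 <= t ->
  `|path_E t| <= prim (fun s => beta s ^+ 2) t + b * (t + prim (fun s => beta s ^+ 2) t) ^+ 2.
Proof.
move=> t0; pose S (s : R) := prim (fun s => beta s ^+ 2) s; rewrite -/(S t).
have cQ := path_Q_continuous; have cb2 : cont (fun s => beta s ^+ 2) by continuity_tac.
have cS : cont S by rewrite /S; continuity_tac.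
have b1 := @norm_le_1Dsqr R.
have dS (x : R) : 0 < x -> is_derive x 1 S (beta x ^+ 2) by exact: is_derive_prim.
have mono (s : R) : 0 <= s -> s <= t -> S s <= S t.
  move=> s0 st; have [c _ e] := primitive_mean_value cS dS s0 st.
  by rewrite -subr_ge0 e mulr_ge0 ?sqr_ge0// subr_ge0.
have prim1 (s : R) : 0 <= s -> prim (fun x => 1 + beta x ^+ 2) s = s + S s.
  move=> s0; have d (x : R) : 0 < x -> is_derive x 1 (fun x => x + S x) (1 + beta x ^+ 2).
    by move=> x0; have h := dS x x0; eapply is_derive_eq; [derive_tac|rewrite /=; ring].
  rewrite (Rintegral_primitive (G := fun x => x + S x) _ _ d s0); [|by continuity_tac..].
  by rewrite /S prim0 addr0 subr0.
have Qle (s : R) : 0 <= s -> s <= t -> `|path_Q s| <= t + S t.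
  move=> s0 st; apply: (@le_trans _ _ (s + S s)); last by rewrite lerD// mono.
  rewrite /path_Q normrM (ger0_norm (expR_ge0 _)) -[leRHS]mul1r -(expRbN s) [expR (b * s) * expR _]mulrC -mulrA.
  rewrite ler_wpM2l ?expR_ge0//.
  have -> : expR (b * s) * (s + S s) = prim (fun x => expR (b * s) * (1 + beta x ^+ 2)) s.
    rewrite /prim RintegralZl//; first by rewrite -/(prim _ s) prim1.
    by apply: integrable_continuous_itvcc; continuity_tac.
  apply: norm_prim_le => //; [by continuity_tac..|].
  move=> x /andP[x0 xs]; rewrite normrM (ger0_norm (expR_ge0 _)) ler_pM ?expR_ge0//.
  by rewrite ler_expR ler_wpM2l// ltW.
have tS0 : 0 <= t + S t.
  by apply: (le_trans _ (Qle 0 (lexx 0) t0)).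
have -> : S t + b * (t + S t) ^+ 2 = prim (fun x => beta x ^+ 2 + b * (t + S t) * (1 + beta x ^+ 2)) t.
  rewrite /prim RintegralD//; last 2 first.
  - by apply: integrable_continuous_itvcc; continuity_tac.
  - by apply: integrable_continuous_itvcc; continuity_tac.
  rewrite RintegralZl//; last by apply: integrable_continuous_itvcc; continuity_tac.
  by rewrite -/(prim (fun x => 1 + beta x ^+ 2) t) prim1// -/(S t) expr2 mulrA.
apply: norm_prim_le => //; [by continuity_tac..|].
move=> x /andP[x0 xt]; rewrite mulrBr (le_trans (ler_normB _ _))//.
have hb := ltW b_gt0.
rewrite -expr2 (ger0_norm (sqr_ge0 _)) lerD2l mulrCA normrM (ger0_norm hb) -mulrA ler_wpM2l//.
by rewrite normrM mulrC ler_pM// Qle.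
Qed.

(** At first [D] is merely integrable. Its integral, frozen outside [0, K], is continuous and agrees
    with [D] on [0, K] up to the factor [b]; then e^(-bt) times the primitive has derivative 0 and
    starts at 0. *)
Lemma linear_volterra_eq0 (D : R -> R) :
  (forall t, 0 <= t -> mu.-integrable `[0, t] (EFin \o D) /\ D t = b * \int[mu]_(s in `[0, t]) D s) ->
  forall t, 0 <= t -> D t = 0.
Proof.
move=> h K; rewrite le_eqVlt => /predU1P[<-|K0].
  by rewrite (h 0 (lexx 0)).2 set_itv1 Rintegral_set1 mulr0.
have [iD _] := h K (ltW K0).
pose p (t : R) := Num.min (Num.max t 0) K.
have pK t : `[0, K]%classic (p t).
  by rewrite /= in_itv/= /p le_min le_max lexx orbT (ltW K0)/= ge_min lexx orbT.
have cp : continuous p.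
  by move=> t; rewrite /p; apply: (@continuous_min _ _ (fun t : R => Num.max t 0) (fun=> K)); [exact: continuous_max0|exact: cvg_cst].
have cI := continuous_within_comp (parameterized_integral_continuous (ltW K0) iD) cp pK.
pose Dh t := b * \int[mu]_(s in `[0, p t]) D s.
have cDh : cont Dh by move=> t; apply: cvgM; [exact: cvg_cst|exact: cI].
have pid t : 0 <= t <= K -> p t = t by move=> /andP[t0 tK]; rewrite /p max_l// min_l.
have DE t : 0 <= t <= K -> Dh t = D t.
  by move=> tK; rewrite /Dh pid//; have /andP[t0 _] := tK; rewrite -(h t t0).2.
have GE t : 0 <= t <= K -> Dh t = b * prim Dh t.
  move=> /andP[t0 tK]; rewrite DE ?t0// (h t t0).2; congr (_ * _); apply: eq_Rintegral => x.
  by rewrite inE/= in_itv/= => /andP[x0 xt]; rewrite DE// x0 (le_trans xt).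
have cG : cont (fun t => expR (- (b * t)) * prim Dh t) by continuity_tac.
have [|c _] := @MVT_segment _ (fun t => expR (- (b * t)) * prim Dh t) (fun=> 0) 0 K (ltW K0) _
  (continuous_subspaceT cG).
  move=> x; rewrite in_itv/= => /andP[x0 xK]; have d := is_derive_prim cDh x0.
  eapply is_derive_eq; [derive_tac|rewrite /=].
  rewrite GE ?(ltW x0) ?(ltW xK)//; ring.
rewrite mul0r prim0 mulr0 subr0 => /eqP; rewrite mulf_eq0 gt_eqF ?expR_gt0//= => /eqP e.
by rewrite -DE ?lexx ?ltW// GE ?lexx ?ltW// e mulr0.
Qed.

(** The difference of two solutions solves the homogeneous equation of [linear_volterra_eq0]. *)
Lemma path_Y_unique (y : R -> R) :
  (forall t, 0 <= t -> mu.-integrable `[0, t] (EFin \o y) /\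
     y t = y0 + \int[mu]_(s in `[0, t]) (a + b * y s) + sigma * beta t) ->
  forall t, 0 <= t -> y t = path_Y t.
Proof.
move=> h t t0; apply/eqP; rewrite -subr_eq0; apply/eqP.
apply: (linear_volterra_eq0 (D := fun t => y t - path_Y t)) => // {}t {}t0.
have cY := path_Y_continuous; have [iy ey] := h t t0.
have jY := integrable_continuous_itvcc 0 t cY.
have ja : mu.-integrable `[0, t] (EFin \o (fun=> a)).
  by apply: integrable_continuous_itvcc; continuity_tac.
have iD : mu.-integrable `[0, t] (EFin \o (fun s => y s - path_Y s)) by exact: integrable_funB.
split => //; rewrite ey path_Y_sol// /prim.
have by_ : mu.-integrable `[0, t] (EFin \o (fun s => b * y s)) by exact: integrable_funZ.
have bY : mu.-integrable `[0, t] (EFin \o (fun s => b * path_Y s)) by exact: integrable_funZ.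
have e (f : R -> R) : mu.-integrable `[0, t] (EFin \o f) ->
    \int[mu]_(s in `[0, t]) (a + b * f s) = \int[mu]_(s in `[0, t]) a + b * \int[mu]_(s in `[0, t]) f s.
  by move=> jf; rewrite RintegralD//; [rewrite RintegralZl|exact: integrable_funZ].
by rewrite !e// RintegralB//; ring.
Qed.

End vasicek_path.

(* The rescaled estimation errors as functions of eta, q, x (standing for eta_T,
   Q_T, B_T - b Q_T) and of d1 = e^(-bT), d2 = T e^(-bT), d3 = E_T e^(-bT), d4 = 1/T. *)
Section estimation_errors.
Context {R : realType}.
Variables (a b sigma y0 : R).
Hypothesis b_gt0 : 0 < b.
Implicit Types (eta q x d : R).

(** With e = e^(bT), [est_i1] is the integral of Y divided by e and [est_i2] the integral of Y^2
    divided by e^2. [est_n2] is 1/e times the noise part of (Y_T^2 - y0^2)/2, that is, what is left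
    of it besides a times the first and b times the second integral. *)
Definition est_i1 eta d1 d2 := (eta - d1 * (a / b + y0) - a * d2) / b.
Definition est_i2 eta q d1 d2 d3 :=
  (2^-1 * ((eta - d1 * (a / b)) ^+ 2 - (d1 * y0) ^+ 2) + sigma * (b * q * eta * d1 + b * sigma * d3 * d1)
   - a * est_i1 eta d1 d2 * d1) / b.
Definition est_n2 eta q x d1 d3 :=
  sigma * (eta * x - a / b * (x + b * q) * d1 - b * sigma * d3) + 2^-1 * (sigma * (x + b * q)) ^+ 2 * d1.
Definition est_den eta q d1 d2 d3 d4 := est_i2 eta q d1 d2 d3 - d4 * est_i1 eta d1 d2 ^+ 2.
Definition est_num_a eta q x d1 d2 d3 :=
  sigma * (x + b * q) * est_i2 eta q d1 d2 d3 - est_n2 eta q x d1 d3 * est_i1 eta d1 d2.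
Definition est_num_b eta q x d1 d2 d3 d4 :=
  est_n2 eta q x d1 d3 - d4 * (sigma * (x + b * q)) * est_i1 eta d1 d2.

Lemma est_den0 eta q : est_den eta q 0 0 0 0 = eta ^+ 2 / (2 * b).
Proof. by rewrite /est_den /est_i2 /est_i1; field; rewrite gt_eqF. Qed.

Lemma est_a0 eta q x : eta != 0 ->
  est_num_a eta q x 0 0 0 / est_den eta q 0 0 0 0 = b * sigma * q - sigma * x.
Proof.
move=> e0; rewrite est_den0 /est_num_a /est_n2 /est_i2 /est_i1.
by field; rewrite e0 gt_eqF.
Qed.

Lemma est_b0 eta q x : eta != 0 ->
  est_num_b eta q x 0 0 0 0 / est_den eta q 0 0 0 0 = 2 * b * sigma * x / eta.
Proof.
move=> e0; rewrite est_den0 /est_num_b /est_n2 /est_i1.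
by field; rewrite e0 gt_eqF.
Qed.

(** The estimators are Cramer's solution of the linear system satisfied by (a, b) when the noise
    terms sigma B and e n2 are dropped from the two hypotheses. The true parameters therefore
    cancel, and only the noise terms remain in the numerators. *)
Lemma estimation_error_algebra (t e y i1 i2 B n2 : R) : t != 0 -> e != 0 ->
  i2 - t^-1 * i1 ^+ 2 != 0 ->
  y - y0 = a * t + b * (e * i1) + sigma * B ->
  2^-1 * (y ^+ 2 - y0 ^+ 2) = a * (e * i1) + b * (e ^+ 2 * i2) + e * n2 ->
  t * ((y - y0) * (e ^+ 2 * i2 - 2^-1 * (y + y0) * (e * i1)) / (t * (e ^+ 2 * i2) - (e * i1) ^+ 2) - a)
    = (sigma * B * i2 - n2 * i1) / (i2 - t^-1 * i1 ^+ 2) /\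
  e * ((y - y0) * (2^-1 * t * (y + y0) - e * i1) / (t * (e ^+ 2 * i2) - (e * i1) ^+ 2) - b)
    = (n2 - t^-1 * (sigma * B) * i1) / (i2 - t^-1 * i1 ^+ 2).
Proof.
move=> t0 e0 den0 h1 h2.
have D : t * (e ^+ 2 * i2) - (e * i1) ^+ 2 = t * e ^+ 2 * (i2 - t^-1 * i1 ^+ 2) by field.
have D0 : t * (e ^+ 2 * i2) - (e * i1) ^+ 2 != 0 by rewrite D !mulf_neq0 ?expf_neq0.
have A1 : (y - y0) * (e ^+ 2 * i2 - 2^-1 * (y + y0) * (e * i1)) =
    a * (t * (e ^+ 2 * i2) - (e * i1) ^+ 2) + e ^+ 2 * (sigma * B * i2 - n2 * i1).
  have -> : (y - y0) * (e ^+ 2 * i2 - 2^-1 * (y + y0) * (e * i1)) =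
    (y - y0) * (e ^+ 2 * i2) - 2^-1 * (y ^+ 2 - y0 ^+ 2) * (e * i1) by ring.
  by rewrite h1 h2; ring.
have A2 : (y - y0) * (2^-1 * t * (y + y0) - e * i1) =
    b * (t * (e ^+ 2 * i2) - (e * i1) ^+ 2) + e * (t * n2 - sigma * B * i1).
  have -> : (y - y0) * (2^-1 * t * (y + y0) - e * i1) =
    t * (2^-1 * (y ^+ 2 - y0 ^+ 2)) - (y - y0) * (e * i1) by ring.
  by rewrite h1 h2; ring.
rewrite A1 A2 !mulrDl !mulfK// ![_ + _ - _]addrAC !subrr !add0r D.
move: (i2 - t^-1 * i1 ^+ 2) den0 => den den0.
by split; field; rewrite ?t0 ?e0 ?den0.
Qed.

Variable beta : R -> R.
Hypothesis cbeta : cont beta.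

Lemma estimation_error_path (y : R -> R) (t : R) (e := expR (b * t)) (q := path_Q b beta t)
    (eta := path_eta a b sigma y0 beta t) (x := beta t - b * q) (d3 := path_E b beta t / e) : 0 < t ->
  (forall s, 0 <= s <= t -> y s = path_Y a b sigma y0 beta s) ->
  est_den eta q e^-1 (t / e) d3 t^-1 != 0 ->
  t * (a_hat y0 y t - a) = est_num_a eta q x e^-1 (t / e) d3 / est_den eta q e^-1 (t / e) d3 t^-1 /\
  e * (b_hat y0 y t - b) = est_num_b eta q x e^-1 (t / e) d3 t^-1 / est_den eta q e^-1 (t / e) d3 t^-1.
Proof.
move=> t0 hy den0; have e0 : e != 0 by rewrite gt_eqF ?expR_gt0.
have b0 : b != 0 by rewrite gt_eqF.
have tn0 : t != 0 by rewrite gt_eqF.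
have M : path_M a b sigma y0 beta t = e * eta - a / b by [].
have L : path_L b beta t = e * q by rewrite /q /path_Q mulrA expRbN mul1r.
have I1 : \int[lebesgue_measure]_(s in `[0, t]) y s = e * est_i1 eta e^-1 (t / e).
  have -> : \int[lebesgue_measure]_(s in `[0, t]) y s = prim (path_Y a b sigma y0 beta) t.
    by apply: eq_Rintegral => s; rewrite inE/= in_itv/=; exact: hy.
  by rewrite path_I1 ?ltW// M /est_i1; field; rewrite e0 b0.
have I2 : \int[lebesgue_measure]_(s in `[0, t]) y s ^+ 2 = e ^+ 2 * est_i2 eta q e^-1 (t / e) d3.
  have -> : \int[lebesgue_measure]_(s in `[0, t]) y s ^+ 2 = prim (fun s => path_Y a b sigma y0 beta s ^+ 2) t.
    by apply: eq_Rintegral => s; rewrite inE/= in_itv/= => /hy ->.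
  rewrite path_I2E ?ltW// /path_I2 path_I1 ?ltW// M L -/eta /est_i2 /est_i1 /d3.
  by clearbody e eta q; field; rewrite e0 b0.
have Y : y t = e * eta - a / b + sigma * (x + b * q).
  by rewrite hy ?lexx ?ltW// /path_Y M /x subrK.
rewrite /a_hat /b_hat I1 I2; apply: estimation_error_algebra => //.
  by rewrite Y /est_i1; field; rewrite e0 b0.
by rewrite Y /est_i2 /est_i1 /est_n2 /d3; field; rewrite e0 b0.
Qed.

End estimation_errors.

Section primitive_calculus.
Context {R : realType}.
Local Notation mu := (@lebesgue_measure R).
Implicit Types (f g G : R -> R).

Lemma cont_comp f g : cont f -> cont g -> cont (fun x => f (g x)).
Proof. by move=> cf cg x; apply: (@continuous_comp _ _ _ g f); [exact: cg|exact: cf]. Qed.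

(** The derivative is asked for inside ]0, t[ only: the kink of [prim f] at 0 becomes a kink of s
    |-> [prim f (T - s)] at T. *)
Definition primitive_on (t : R) G f : Prop := forall x : R, 0 < x -> x < t -> is_derive x 1 G (f x).

Lemma Rintegral_primitive_itv f G (t : R) : cont f -> cont G -> 0 <= t ->
  primitive_on t G f -> prim f t = G t - G 0.
Proof.
move=> cf cG t0 dG.
have cF : cont (fun y => prim f y - G y) by continuity_tac.
have [|c _] := @MVT_segment _ (fun y => prim f y - G y) (fun=> 0) 0 t t0 _ (continuous_subspaceT cF).
  move=> x; rewrite in_itv/= => /andP[x0 xt].
  have d1 := is_derive_prim cf x0; have d2 := dG x x0 xt.
  by eapply is_derive_eq; [derive_tac|rewrite /=; ring].
by rewrite mul0r prim0 => /eqP; rewrite subr_eq0 sub0r => /eqP e; rewrite -[prim f t](subrK (G t)) e addrC.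
Qed.

Lemma primD f g (t : R) : cont f -> cont g -> prim (fun s => f s + g s) t = prim f t + prim g t.
Proof. by move=> cf cg; rewrite /prim RintegralD//; exact: integrable_continuous_itvcc. Qed.

Lemma primZ (k : R) f (t : R) : cont f -> prim (fun s => k * f s) t = k * prim f t.
Proof. by move=> cf; rewrite /prim RintegralZl//; exact: integrable_continuous_itvcc. Qed.

Lemma eq_prim f g (t : R) : (forall s, 0 <= s -> s <= t -> f s = g s) -> prim f t = prim g t.
Proof.
by move=> fg; apply: eq_Rintegral => s; rewrite inE/= in_itv/= => /andP[s0 st]; exact: fg.
Qed.

Lemma is_derive_sub (T x l : R) f : is_derive (T - x) 1 f l -> is_derive x 1 (fun s => f (T - s)) (- l).
Proof.
move=> df; have d : is_derive x 1 (fun s : R => T - s) (- 1).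
  by eapply is_derive_eq; [derive_tac|rewrite /=; ring].
have := @is_derive1_comp R f (fun s : R => T - s) x l (- 1) df d.
by rewrite mulrN1.
Qed.

Lemma prim_reflect f (T : R) : cont f -> 0 <= T -> prim (fun s => f (T - s)) T = prim f T.
Proof.
move=> cf T0.
have cTs : cont (fun s : R => T - s) by continuity_tac.
have c1 := cont_comp cf cTs; have c2 := cont_comp (cont_prim cf) cTs.
rewrite (Rintegral_primitive_itv (G := fun s => - prim f (T - s)) c1 _ T0).
- by rewrite subrr prim0 subr0 oppr0 sub0r opprK.
- exact: cont_opp.
- move=> x x0 xT; have Tx : 0 < T - x by rewrite subr_gt0.
  have d := is_derive_sub (is_derive_prim cf Tx).
  by eapply is_derive_eq; [derive_tac|rewrite opprK].
Qed.

Lemma prim_shift f (s x : R) : cont f -> 0 <= s -> 0 <= x ->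
  prim f (s + x) = prim f s + prim (fun t => f (s + t)) x.
Proof.
move=> cf s0 x0; have cs : cont (fun t : R => s + t) by continuity_tac.
have c1 := cont_comp cf cs; have c2 := cont_comp (cont_prim cf) cs.
rewrite (Rintegral_primitive_itv (G := fun t => prim f (s + t)) c1 c2 x0).
  by rewrite addr0 [RHS]addrC subrK.
move=> y y0 _; have sy : 0 < s + y by rewrite ltr_wpDl.
have d0 : is_derive y 1 (fun t : R => s + t) 1.
  by eapply is_derive_eq; [derive_tac|rewrite /=; ring].
have := @is_derive1_comp R (prim f) (fun t : R => s + t) y _ 1 (is_derive_prim cf sy) d0.
by rewrite mulr1.
Qed.

Lemma prim_expRN (b t : R) : 0 < b -> 0 <= t ->
  prim (fun s => expR (- (b * s))) t = (1 - expR (- (b * t))) / b.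
Proof.
move=> b0 t0; rewrite (Rintegral_primitive_itv (G := fun s => - b^-1 * expR (- (b * s))) _ _ t0).
- by rewrite mulr0 oppr0 expR0; field; rewrite gt_eqF.
- by continuity_tac.
- by continuity_tac.
- by move=> x _ _; eapply is_derive_eq; [derive_tac|rewrite /=; field; rewrite gt_eqF].
Qed.

Lemma norm_prim_expRN_le (b M t : R) f : 0 < b -> 0 <= t -> 0 <= M -> cont f ->
  (forall s, 0 <= s -> s <= t -> `|f s| <= M * expR (- (b * s))) -> `|prim f t| <= M / b.
Proof.
move=> b0 t0 M0 cf fM; have ce : cont (fun s => expR (- (b * s))) by continuity_tac.
apply: (@le_trans _ _ (prim (fun s => M * expR (- (b * s))) t)).
  apply: norm_prim_le => //; first by continuity_tac.
  by move=> x /andP[x0 xt]; exact: fM.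
rewrite primZ// prim_expRN// mulrA ler_pM2r ?invr_gt0// ler_piMr// gerBl expR_ge0.
Qed.

(** The integrands are extended by 0 beyond [t n], which puts them on one half-line, dominated by M
    e^(-bs). *)
Lemma cvg_prim_dominated (b M : R) (t : nat -> R) (f_ : nat -> R -> R) (f : R -> R) : 0 < b ->
  (forall n, 0 < t n) -> t n @[n --> \oo] --> +oo -> (forall n, cont (f_ n)) ->
  measurable_fun (`[0%R, +oo[ : set (measurableTypeR R)) f ->
  (forall n s, 0 <= s -> s <= t n -> `|f_ n s| <= M * expR (- (b * s))) ->
  (forall s, 0 <= s -> f_ n s @[n --> \oo] --> f s) ->
  prim (f_ n) (t n) @[n --> \oo] --> \int[mu]_(s in `[0%R, +oo[) f s.
Proof.
move=> b0 t0 tn cf mf fM ff.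
have M0 : 0 <= M.
  have := fM 0%N 0 (lexx 0) (ltW (t0 0%N)); rewrite mulr0 oppr0 expR0 mulr1.
  exact: le_trans.
have E n : prim (f_ n) (t n) = \int[mu]_(s in `[0%R, +oo[) (f_ n \_ `[0, t n]) s.
  rewrite -Rintegral_mkcondr; congr (Rintegral _ _ _); apply/esym/setIidr.
  by move=> x /=; rewrite !in_itv/= => /andP[-> _].
rewrite (funext E); apply: (@cvg_Rintegral _ (measurableTypeR R) _ mu `[0%R, +oo[%classic _
   (fun n => f_ n \_ `[0, t n]) f (fun s => M * expR (- (b * s)))) => //.
- move=> n; apply: measurable_funTS; apply/(measurable_restrictT _ _).1 => //.
  by apply: (@measurable_fun_itvcc_continuous _ (f_ n) 0 (t n)) => x _; exact: cf.
- move=> x /=; rewrite in_itv/= andbT => x0.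
  have h := ff x x0; have /cvgryPge/(_ x)[N _ hN] := tn.
  apply: cvg_trans h; apply: near_eq_cvg; exists N => // n /hN /= xn.
  by rewrite patchE mem_set//= in_itv/= x0.
- by apply: integrable_funZ => //; exact: integrable_expRN.
- move=> n x /=; rewrite in_itv/= andbT => x0; rewrite patchE; case: ifPn.
    by rewrite inE/= in_itv/= => /andP[_ xt]; exact: fM.
  by rewrite normr0 mulr_ge0 ?expR_ge0.
Qed.

End primitive_calculus.

(** * Asymptotic law of the path functionals *)

Section covariance_limits.
Context {R : realType}.
Variables (H lambda b : R).
Hypotheses (H_gt0 : 0 < H) (lambda_gt0 : 0 < lambda) (b_gt0 : 0 < b).
Local Notation r := (acov H lambda).
Local Notation E s := (expR (- (b * s))).

Let cr : cont r. Proof. exact: acov_continuous. Qed.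
Let bn0 : b != 0. Proof. by rewrite gt_eqF. Qed.
Let r_le u : `|r u| <= r 0. Proof. exact: norm_acov_le. Qed.

Definition exp_acov (t : R) : R := prim (fun s => E s * r s) t.
Definition acov_conv (t : R) : R := E t * prim (fun s => expR (b * s) * r s) t.

Lemma exp_acov_cont : cont exp_acov.
Proof. by rewrite /exp_acov; continuity_tac. Qed.

Lemma acov_conv_cont : cont acov_conv.
Proof. by rewrite /acov_conv; continuity_tac. Qed.

Lemma cont_acov_sub (x : R) : cont (fun s => r (x - s)).
Proof. by apply: (cont_comp cr); continuity_tac. Qed.

Arguments cont_acov_sub : clear implicits.

Lemma expRND (s t : R) : E (s + t) = E s * E t.
Proof. by rewrite mulrDr opprD expRD. Qed.

Lemma expRNB (s t : R) : E (s - t) = E s * expR (b * t).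
Proof. by rewrite mulrBr opprB addrC expRD. Qed.

Lemma prim_acov_conv (t : R) : 0 <= t -> prim (fun s => E s * r (t - s)) t = acov_conv t.
Proof.
move=> t0; have c1 := cont_acov_sub t.
rewrite -(prim_reflect _ t0); last by continuity_tac.
rewrite /acov_conv -primZ; last by continuity_tac.
by apply: eq_prim => s _ _; rewrite expRNB opprB [t + _]addrC subrK mulrA.
Qed.

(** The integral is split at [s]: the left part is a reflected convolution, and on the right part
    the evenness of the covariance gives [exp_acov]. *)
Lemma prim_exp_acov_sub (s t : R) : 0 <= s -> s <= t ->
  prim (fun x => E x * r (s - x)) t = acov_conv s + E s * exp_acov (t - s).
Proof.
move=> s0 st; have c1 := cont_acov_sub s.
have c : cont (fun x => E x * r (s - x)) by continuity_tac.
have ts : 0 <= t - s by rewrite subr_ge0.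
have -> : t = s + (t - s) by rewrite addrC subrK.
rewrite prim_shift// prim_acov_conv// [s + (t - s) - s]addrAC subrr add0r; congr (_ + _).
rewrite /exp_acov -primZ; last by continuity_tac.
by apply: eq_prim => x _ _; rewrite expRND opprD addrA subrr sub0r acovN mulrA.
Qed.

Lemma norm_acov_conv_le (t : R) : 0 <= t -> `|acov_conv t| <= r 0 / b.
Proof.
move=> t0; rewrite -prim_acov_conv//; have c1 := cont_acov_sub t.
apply: norm_prim_expRN_le => //; [exact: acov_ge0|by continuity_tac|].
by move=> s _ _; rewrite normrM ger0_norm ?expR_ge0// mulrC ler_wpM2r ?expR_ge0.
Qed.

Lemma norm_exp_acov_le (t : R) : 0 <= t -> `|exp_acov t| <= r 0 / b.
Proof.
move=> t0; apply: norm_prim_expRN_le => //; [exact: acov_ge0|by continuity_tac|].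
by move=> s _ _; rewrite normrM ger0_norm ?expR_ge0// mulrC ler_wpM2r ?expR_ge0.
Qed.

Variable t : nat -> R.
Hypotheses (t0 : forall n, 0 < t n) (tn : t n @[n --> \oo] --> +oo).

Lemma cvg_seq_sub (s : R) : t n - s @[n --> \oo] --> +oo.
Proof.
apply/cvgryPge => A; have /cvgryPge/(_ (A + s))[N _ hN] := tn.
by exists N => // n /hN /=; rewrite lerBrDr.
Qed.

Lemma cvg_expRN_seq (s : R) : E (t n - s) @[n --> \oo] --> 0.
Proof.
have h : b * (t n - s) @[n --> \oo] --> +oo by apply/cvgryPge => A; have /cvgryPge/(_ (A / b))[N _ hN] := cvg_seq_sub s;
    exists N => // n /hN /=; rewrite ler_pdivrMr// mulrC.
exact: (cvg_comp (fun n => b * (t n - s)) (fun x => expR (- x)) h (@cvgr_expR R)).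
Qed.

Lemma cvg_exp_acov : exp_acov (t n) @[n --> \oo] --> acov_laplace H lambda b.
Proof.
apply: (cvg_prim_dominated (b := b) (M := r 0) (f_ := fun _ s => E s * r s)) => //.
- by move=> n; continuity_tac.
- apply: measurable_funM; last exact: measurable_acov.
  by apply: measurable_fun_expR; apply: measurableT_comp => //; exact: measurable_funM.
- by move=> n s _ _; rewrite normrM ger0_norm ?expR_ge0// mulrC ler_wpM2r ?expR_ge0.
- by move=> s _; exact: cvg_cst.
Qed.

(** After reflection the covariance is taken at u_n - s, which tends to infinity for every fixed s,
    under the integrable weight e^(-bs). *)
Lemma cvg_acov_conv_seq (u : nat -> R) : (forall n, 0 < u n) -> u n @[n --> \oo] --> +oo ->
  acov_conv (u n) @[n --> \oo] --> 0.
Proof.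
move=> u0 un; have E0 : \int[@lebesgue_measure R]_(s in `[0%R, +oo[) (0 : R) = 0.
  by rewrite /Rintegral integral0.
rewrite -[X in _ --> X]E0 (funext (fun n => esym (prim_acov_conv (ltW (u0 n))))).
apply: (cvg_prim_dominated (b := b) (M := r 0)) => //.
- by move=> n; have c1 := cont_acov_sub (u n); continuity_tac.
- by move=> n s _ _; rewrite normrM ger0_norm ?expR_ge0// mulrC ler_wpM2r ?expR_ge0.
- move=> s s0; rewrite -[X in _ --> X](mulr0 (E s)); apply: cvgM; first exact: cvg_cst.
  apply: cvg_acov_seq => //; apply/cvgryPge => A; have /cvgryPge/(_ (A + s))[N _ hN] := un.
  by exists N => // n /hN /=; rewrite lerBrDr.
Qed.

Lemma cvg_acov_conv (s : R) : acov_conv (t n - s) @[n --> \oo] --> 0.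
Proof.
have /cvgryPge/(_ 1)[N _ hN] := cvg_seq_sub s.
have h : acov_conv (Num.max 1 (t n - s)) @[n --> \oo] --> 0.
  apply: cvg_acov_conv_seq => [n|]; first by rewrite lt_max ltr01.
  apply/cvgryPge => A; have /cvgryPge/(_ A)[N' _ hN'] := cvg_seq_sub s.
  by exists N' => // n /hN' /= h; rewrite le_max h orbT.
apply: cvg_trans h; apply: near_eq_cvg; exists N => // n /hN /= h.
by rewrite max_r.
Qed.

(** By [prim_exp_acov_sub] this is the double integral of e^(-bs) e^(-bx) r(s - x) over the square
    [0, T]^2, the quadratic term in the variance of Z_T. *)
Lemma prim_exp_conv (T : R) : 0 <= T ->
  prim (fun s => E s * (acov_conv s + E s * exp_acov (T - s))) T =
  (exp_acov T - E T * acov_conv T) / b.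
Proof.
move=> T0; have c1 := cont_acov_sub T; have c2 := acov_conv_cont; have c3 := exp_acov_cont.
have c4 : cont (fun s => exp_acov (T - s)) by apply: (cont_comp c3); continuity_tac.
pose A s := prim (fun s => expR (b * s) * r s) s.
pose q s := prim (fun s => E s * r (T - s)) s.
have cA : cont A by rewrite /A; continuity_tac.
have cq : cont q by rewrite /q; continuity_tac.
(* Integration by parts of e^(-2bs) against [A s] + [exp_acov (T - s)]: what is left over, e^(-bs)
   r(s) and e^(-bT) e^(-bs) r(T - s), has the primitives [exp_acov] and e^(-bT) [q]. *)
rewrite (Rintegral_primitive_itv (G := fun s => (2 * b)^-1 * (- (E s * E s) * (A s + exp_acov (T - s))
   + (exp_acov s - E T * q s))) _ _ T0).
- rewrite subrr subr0 mulr0 oppr0 expR0 /A /q /exp_acov !prim0 prim_acov_conv// /acov_conv.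
  by move: (prim _ T) (prim _ T) (E T) => p p' e; field.
- by continuity_tac.
- by continuity_tac.
move=> x x0 xT; have Tx : 0 < T - x by rewrite subr_gt0.
have d1 : is_derive x 1 A (expR (b * x) * r x) by apply: is_derive_prim => //; continuity_tac.
have d2 : is_derive x 1 q (E x * r (T - x)) by apply: is_derive_prim => //; continuity_tac.
have d3 : is_derive x 1 exp_acov (E x * r x) by apply: is_derive_prim => //; continuity_tac.
have d4 : is_derive x 1 (fun s => exp_acov (T - s)) (- (E (T - x) * r (T - x))).
  by apply: is_derive_sub; apply: is_derive_prim => //; continuity_tac.
eapply is_derive_eq; [derive_tac|rewrite /=].
rewrite /acov_conv -/(A x) expRNB; have := expRbN b x.
move: (expR (b * x)) (E x) (E T) (r x) (r (T - x)) (A x) (exp_acov (T - x)) => e f g p p' k l ef.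
have e1 : f * f * (e * p) = f * p by rewrite -[f * p]mulr1 -ef; ring.
have e2 : f * f * (g * e * p') = g * (f * p') by rewrite (_ : _ * _ = e * f * (g * (f * p'))); [rewrite ef mul1r|ring].
transitivity (f * (f * k + f * l) - (2 * b)^-1 * (f * f * (e * p)) + (2 * b)^-1 * (f * f * (g * e * p'))
  + (2 * b)^-1 * (f * p - g * (f * p'))).
  by field.
by rewrite e1 e2; field.
Qed.

(** The mixed double integral: the weights e^(-bx) and e^(-b(t-s)) sit at opposite ends of [0, t],
    at distances where the covariance is small. Reflection fixes the second weight at 0, and
    dominated convergence applies. *)
Lemma cvg_prim_cross :
  prim (fun s => E (t n - s) * (acov_conv s + E s * exp_acov (t n - s))) (t n) @[n --> \oo] --> 0.
Proof.
have c2 := acov_conv_cont; have c3 := exp_acov_cont.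
have c4 n : cont (fun s => acov_conv (t n - s)) by apply: (cont_comp c2); continuity_tac.
have c5 n : cont (fun s => exp_acov (t n - s)) by apply: (cont_comp c3); continuity_tac.
have c6 n : cont (fun s => E (t n - s)) by continuity_tac.
have e n : prim (fun s => E (t n - s) * (acov_conv s + E s * exp_acov (t n - s))) (t n) =
    prim (fun s => E s * (acov_conv (t n - s) + E (t n - s) * exp_acov s)) (t n).
  rewrite -(prim_reflect _ (ltW (t0 n))); last by have := c5 n; have := c6 n => *; continuity_tac.
  by apply: eq_prim => s _ _; rewrite opprB [t n + _]addrC subrK.
rewrite (funext e).
have E0 : \int[@lebesgue_measure R]_(s in `[0%R, +oo[) (0 : R) = 0.
  by rewrite /Rintegral integral0.
rewrite -[X in _ --> X]E0.
have k0 : 0 <= r 0 / b by rewrite divr_ge0 ?acov_ge0// ltW.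
apply: (cvg_prim_dominated (b := b) (M := r 0 / b + r 0 / b)) => //.
- by move=> n; have := c4 n; have := c6 n => *; continuity_tac.
- move=> n s s0 sn; have tns : 0 <= t n - s by rewrite subr_ge0.
  rewrite normrM ger0_norm ?expR_ge0// mulrC ler_wpM2r ?expR_ge0//.
  apply: (le_trans (ler_normD _ _)); apply: lerD; first exact: norm_acov_conv_le.
  rewrite normrM ger0_norm ?expR_ge0// -[leRHS]mul1r ler_pM ?expR_ge0 ?norm_exp_acov_le//.
  by rewrite -expR0 ler_expR oppr_le0 mulr_ge0// ltW.
- move=> s s0.
  have h : E s * (0 + 0 * exp_acov s) = 0 by rewrite mul0r addr0 mulr0.
  rewrite -[X in _ --> X]h.
  apply: cvgM; first exact: cvg_cst.
  apply: cvgD; first exact: cvg_acov_conv.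
  by apply: cvgM; [exact: cvg_expRN_seq|exact: cvg_cst].
Qed.

End covariance_limits.

Lemma gauss_cf_limit (R : realType) (v : nat -> R) (l phi x : R) : v n @[n --> \oo] --> l ->
  cos phi * gauss_cf (v n) @[n --> \oo] --> x -> x = cos phi * gauss_cf l.
Proof.
move=> vl h2; have h3 : cos phi * gauss_cf (v n) @[n --> \oo] --> cos phi * gauss_cf l.
  by apply: cvgM; [exact: cvg_cst|exact: cvg_gauss_cf].
exact: (cvg_unique _ h2 h3).
Qed.

Section tfbm_functional.
Context d (T : measurableType d) (R : realType) (P : probability T R).
Variables (H lambda : R) (W B : R -> {RV P >-> R}).
Hypotheses (H_gt0 : 0 < H) (lambda_gt0 : 0 < lambda).
Hypotheses (W_wiener : wiener_process W) (B_tfbm : tfbm H lambda W B).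

(** The integral of a continuous path is a pointwise limit of Riemann sums, finite sums of random
    variables. *)
Lemma measurable_prim (X : R -> T -> R) (t : R) : 0 <= t -> (forall s, measurable_fun setT (X s)) ->
  (forall om, cont (fun s => X s om)) -> measurable_fun setT (fun om => prim (fun s => X s om) t).
Proof.
move=> t0 mX cX.
apply: (@measurable_fun_cvg _ _ _ setT (fun N om => riemann_sum N t (fun s => X s om))).
  by move=> N; apply: measurable_sum => i; apply: measurable_funM.
by move=> om _; exact: (cvg_riemann_sum t0 (cX om)).
Qed.

(** The path frozen at its initial value for negative times, which makes it continuous on the whole
    line. *)
Definition ext_path (om : T) (s : R) : R := B (Num.max s 0) om.

Lemma ext_path_cont om : cont (ext_path om).
Proof.
have cf : {within `[0%R, +oo[, continuous (fun s : R => B s om)} by case: B_tfbm => _; apply.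
apply: (@continuous_within_comp R `[0%R, +oo[%classic (fun s => B s om) (fun s : R => Num.max s 0) cf
  (@continuous_max0 R)) => s.
by rewrite /= in_itv/= andbT le_max lexx orbT.
Qed.

Arguments ext_path_cont : clear implicits.

Lemma ext_pathE om s : 0 <= s -> ext_path om s = B s om.
Proof. by move=> s0; rewrite /ext_path max_l. Qed.

(** The variance of the integral of w(s) B_s over [0, t] plus c B_t. *)
Definition functional_var (w : R -> R) (c t : R) : R :=
  prim (fun s => prim (fun x => w s * w x * tfbm_cov H lambda s x) t) t +
  2 * c * prim (fun s => w s * tfbm_cov H lambda s t) t + c ^+ 2 * tfbm_cov H lambda t t.

Lemma tfbm_cov_cont2 : continuous (fun p : R * R => tfbm_cov H lambda p.1 p.2).
Proof.
have cr : cont (acov H lambda) by exact: acov_continuous.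
move=> p; rewrite /tfbm_cov; apply: cvgD; last exact: cvg_cst.
have c1 : (fun q : R * R => q.1) @ p --> p.1 by exact: cvg_fst.
have c2 : (fun q : R * R => q.2) @ p --> p.2 by exact: cvg_snd.
apply: cvgB; last exact: (cvg_comp _ _ c2 (cr _)).
apply: cvgB; last exact: (cvg_comp _ _ c1 (cr _)).
have c3 : (fun q : R * R => q.1 - q.2) @ p --> p.1 - p.2 by exact: cvgB.
exact: (cvg_comp _ _ c3 (cr _)).
Qed.

Lemma cvg_functional_var (w : R -> R) (c t : R) : cont w -> 0 <= t ->
  riemann_sum N t (fun s => riemann_sum N t (fun x => w s * w x * tfbm_cov H lambda s x)) +
  2 * c * riemann_sum N t (fun s => w s * tfbm_cov H lambda s t) + c ^+ 2 * tfbm_cov H lambda t t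
  @[N --> \oo] --> functional_var w c t.
Proof.
move=> cw t0; apply: cvgD; last exact: cvg_cst.
apply: cvgD.
  apply: (@cvg_riemann_sum2 R t (fun s x => w s * w x * tfbm_cov H lambda s x)) => // p.
  apply: cvgM; last exact: tfbm_cov_cont2.
  have c1 : (fun q : R * R => q.1) @ p --> p.1 by exact: cvg_fst.
  have c2 : (fun q : R * R => q.2) @ p --> p.2 by exact: cvg_snd.
  by apply: cvgM; [exact: (cvg_comp _ _ c1 (cw _))|exact: (cvg_comp _ _ c2 (cw _))].
apply: cvgM; first exact: cvg_cst.
apply: cvg_riemann_sum => // s; apply: cvgM; first exact: cw.
have h := continuous_section (s := t) tfbm_cov_cont2.
rewrite (funext (fun s => tfbm_covC H lambda s t)) tfbm_covC; exact: h.
Qed.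

Lemma riemann_functional_char (w : R -> R) (c t : R) (N : nat) : 0 <= t ->
  char_gaussian P (fun om => riemann_sum N t (fun s => w s * ext_path om s) + c * B t om)
   (riemann_sum N t (fun s => riemann_sum N t (fun x => w s * w x * tfbm_cov H lambda s x)) +
  2 * c * riemann_sum N t (fun s => w s * tfbm_cov H lambda s t) + c ^+ 2 * tfbm_cov H lambda t t).
Proof.
move=> t0; pose h := t / N.+1%:R; have h0 : 0 <= h by rewrite divr_ge0.
(* The grid times occupy the indices up to [N]; index N + 1 carries the additional term c B_t. *)
pose cc (i : nat) := if (i < N.+1)%N then h * w (i%:R * h) else c.
pose tau (i : nat) := if (i < N.+1)%N then i%:R * h else t.
have tau0 i : 0 <= tau i by rewrite /tau; case: ifP => // _; rewrite mulr_ge0.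
have := tfbm_char H_gt0 lambda_gt0 W_wiener B_tfbm N.+2 cc tau0.
have cN : cc N.+1 = c by rewrite /cc ltnn.
have tN : tau N.+1 = t by rewrite /tau ltnn.
have ci i : (0 <= i < N.+1)%N -> cc i = h * w (i%:R * h) by rewrite /cc /= => ->.
have ti i : (0 <= i < N.+1)%N -> tau i = i%:R * h by rewrite /tau /= => ->.
have -> : (fun om => \sum_(0 <= i < N.+2) cc i * B (tau i) om) =
    (fun om => riemann_sum N t (fun s => w s * ext_path om s) + c * B t om).
  apply/funext => om; rewrite big_nat_recr//= cN tN; congr (_ + _).
  apply: eq_big_nat => i iN; rewrite ci// ti// -/h -mulrA ext_pathE//.
  by rewrite mulr_ge0.
congr (char_gaussian P _ _).
pose g s x := tfbm_cov H lambda s x.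
rewrite big_nat_recr//= cN tN -/(g t t) [X in _ + X]big_nat_recr//= cN tN.
under eq_bigr do under eq_bigr do rewrite -/(g _ _); under [X in _ + (X + _)]eq_bigr do rewrite -/(g _ _).
have -> : \sum_(0 <= i < N.+1) \sum_(0 <= j < N.+2) cc i * cc j * g (tau i) (tau j) =
   \sum_(0 <= i < N.+1) (\sum_(0 <= j < N.+1) cc i * cc j * g (tau i) (tau j) + c * (cc i * g (tau i) t)).
  apply: eq_big_nat => i iN; rewrite big_nat_recr//= cN tN; congr (_ + _); ring.
rewrite big_split/= -mulr_sumr.
have e1 : \sum_(0 <= i < N.+1) cc i * g (tau i) t = riemann_sum N t (fun s => w s * g s t).
  by apply: eq_big_nat => i iN; rewrite ci// ti// -/h mulrA.
have -> : \sum_(0 <= i < N.+1) c * cc i * g t (tau i) = c * riemann_sum N t (fun s => w s * g s t).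
  rewrite -e1 mulr_sumr; apply: eq_big_nat => i iN; rewrite -mulrA; congr (_ * (_ * _)).
  by rewrite /g tfbm_covC.
have -> : \sum_(0 <= i < N.+1) \sum_(0 <= j < N.+1) cc i * cc j * g (tau i) (tau j) =
    riemann_sum N t (fun s => riemann_sum N t (fun x => w s * w x * g s x)).
  apply: eq_big_nat => i iN; rewrite /riemann_sum mulr_sumr; apply: eq_big_nat => j jN.
  by rewrite !ci// !ti// -/h; ring.
by rewrite e1 /g; ring.
Qed.

(** Passes from the Riemann sums to the integral, by dominated convergence for the cosines and by
    convergence of the variances on the other side. *)
Lemma tfbm_functional_char (w : R -> R) (c t : R) : cont w -> 0 <= t ->
  char_gaussian P (fun om => prim (fun s => w s * ext_path om s) t + c * B t om)
    (functional_var w c t).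
Proof.
move=> cw t0 phi.
have cwB om : cont (fun s => w s * ext_path om s) by have h := ext_path_cont om; continuity_tac.
pose X N om := riemann_sum N t (fun s => w s * ext_path om s) + c * B t om.
have mX N : measurable_fun setT (X N).
  apply: measurable_funD; last by apply: measurable_funM.
  by apply: measurable_sum => i; apply: measurable_funM => //; apply: measurable_funM.
have h1 : \int[P]_om cos (X N om + phi) @[N --> \oo] -->
    \int[P]_om cos (prim (fun s => w s * ext_path om s) t + c * B t om + phi).
  apply: (@cvg_Rintegral _ _ _ P setT _ (fun N om => cos (X N om + phi)) _ (fun=> 1)) => //.
  - by move=> N; apply: measurable_fun_cos; apply: measurable_funD.
  - move=> om _; apply: (cvg_comp_continuous (h := cos)); first exact: continuous_cos.
    apply: cvgD; last exact: cvg_cst.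
    by apply: cvgD; [exact: (cvg_riemann_sum t0 (cwB om))|exact: cvg_cst].
  - by apply: (integrable_bounded P (M := 1)) => // om; rewrite normr1.
  - by move=> N om _; exact: cos_max.
have e : (fun N => \int[P]_om cos (X N om + phi)) = (fun N => cos phi * gauss_cf (
   riemann_sum N t (fun s => riemann_sum N t (fun x => w s * w x * tfbm_cov H lambda s x)) +
  2 * c * riemann_sum N t (fun s => w s * tfbm_cov H lambda s t) + c ^+ 2 * tfbm_cov H lambda t t)).
  by apply/funext => N; exact: riemann_functional_char.
by move: h1; rewrite e; apply: gauss_cf_limit; exact: cvg_functional_var.
Qed.

End tfbm_functional.

(** * Limit of the variance of the path functionals *)

Section functional_variance.
Context {R : realType}.
Variables (H lambda b : R).
Hypotheses (H_gt0 : 0 < H) (lambda_gt0 : 0 < lambda) (b_gt0 : 0 < b).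
Local Notation r := (acov H lambda).
Local Notation E s := (expR (- (b * s))).

Let cr : cont r. Proof. exact: acov_continuous. Qed.

(** The weight with which c Z_t + k Q_t integrates the path. *)
Definition exp_weight (c k t s : R) : R := c * E s + k * E (t - s).
Local Notation K t s := (acov_conv H lambda b s + E s * exp_acov H lambda b (t - s)).

Lemma exp_weight_cont c k t : cont (exp_weight c k t).
Proof. by rewrite /exp_weight; continuity_tac. Qed.

Arguments exp_weight_cont : clear implicits.

Lemma prim_exp_weight (c k t : R) : 0 <= t ->
  prim (exp_weight c k t) t = (c + k) * ((1 - E t) / b).
Proof.
move=> t0; rewrite /exp_weight primD; [|by continuity_tac..].
rewrite !primZ; [|by continuity_tac..].
have -> : prim (fun s => E (t - s)) t = prim (fun s => E s) t.
  by rewrite (@prim_reflect _ (fun s => E s))//; continuity_tac.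
by rewrite prim_expRN// -mulrDl.
Qed.

Lemma prim_exp_weight_acov (c k t s : R) : 0 <= s -> s <= t ->
  prim (fun x => exp_weight c k t x * r (s - x)) t = c * K t s + k * K t (t - s).
Proof.
move=> s0 st; have c1 : cont (fun x => r (s - x)) by apply: (cont_comp cr); continuity_tac.
have c2 : cont (fun x => r (t - s - x)) by apply: (cont_comp cr); continuity_tac.
have t0 := le_trans s0 st.
rewrite (@eq_prim _ _ (fun x => c * (E x * r (s - x)) + k * (E (t - x) * r (s - x)))); last first.
  by move=> x _ _; rewrite /exp_weight; ring.
rewrite primD; [|by continuity_tac..].
rewrite !primZ; [|by continuity_tac..].
congr (_ * _ + _ * _); first exact: prim_exp_acov_sub.
have e : prim (fun x => E x * r (t - s - x)) t = K t (t - s).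
  by apply: prim_exp_acov_sub => //; rewrite ?subr_ge0 ?gerBl.
rewrite -e.
rewrite -(prim_reflect _ t0); last by continuity_tac.
apply: eq_prim => x _ _; rewrite opprB [t + _]addrC subrK; congr (_ * _).
by rewrite -acovN; congr (acov _ _ _); ring.
Qed.

(** Write B_s = X_s - X_0. Then [I] is the total weight and [S] the covariance of the weighted
    integral of X with X_0; the terms - 2 S I + r(0) I^2 come from the subtraction of X_0. *)
Lemma functional_varE (c k m t : R) (I := (c + k) * ((1 - E t) / b))
    (S := c * K t 0 + k * K t t) : 0 <= t ->
  functional_var H lambda (exp_weight c k t) m t =
  ((c ^+ 2 + k ^+ 2) * prim (fun s => E s * K t s) t + 2 * c * k * prim (fun s => E (t - s) * K t s) t
   - 2 * S * I + r 0 * I ^+ 2)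
  + 2 * m * (c * K t t + k * K t 0 - r t * I - S + r 0 * I) + m ^+ 2 * (2 * (r 0 - r t)).
Proof.
move=> t0; set w := exp_weight c k t; have cw : cont w := exp_weight_cont c k t.
have cA := @acov_conv_cont R H lambda b H_gt0 lambda_gt0.
have cX := @exp_acov_cont R H lambda b H_gt0 lambda_gt0.
have cX2 : cont (fun s => exp_acov H lambda b (t - s)) by apply: (cont_comp cX); continuity_tac.
have cA2 : cont (fun s => acov_conv H lambda b (t - s)) by apply: (cont_comp cA); continuity_tac.
have cX3 : cont (fun s => exp_acov H lambda b (t - (t - s))) by apply: (cont_comp cX2); continuity_tac.
have cK : cont (fun s => K t s) by continuity_tac.
have cK2 : cont (fun s => K t (t - s)) by apply: (cont_comp cK); continuity_tac.
have Iw : prim w t = I by exact: prim_exp_weight.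
have Sw : prim (fun s => w s * r s) t = S.
  have := @prim_exp_weight_acov c k t 0 (lexx 0) t0; rewrite {2}subr0 /S subr0 => <-.
  by apply: eq_prim => s _ _; rewrite sub0r acovN.
have inner s : 0 <= s -> s <= t ->
    prim (fun x => w s * w x * tfbm_cov H lambda s x) t =
    w s * (c * K t s + k * K t (t - s)) - I * (w s * r s) + (r 0 * I - S) * w s.
  move=> s0 st; have c1 : cont (fun x => r (s - x)) by apply: (cont_comp cr); continuity_tac.
  rewrite (@eq_prim _ _ (fun x => w s * (w x * r (s - x)) + (w s * (r 0 - r s) * w x + - w s * (w x * r x)))); last first.
    by move=> x _ _; rewrite /tfbm_cov; ring.
  rewrite primD; [|by continuity_tac..].
  rewrite primD; [|by continuity_tac..].
  rewrite !primZ; [|by continuity_tac..].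
  by rewrite Iw Sw prim_exp_weight_acov//; ring.
rewrite /functional_var.
have -> : prim (fun s => prim (fun x => w s * w x * tfbm_cov H lambda s x) t) t =
   (c ^+ 2 + k ^+ 2) * prim (fun s => E s * K t s) t + 2 * c * k * prim (fun s => E (t - s) * K t s) t
   - 2 * S * I + r 0 * I ^+ 2.
  rewrite (eq_prim inner).
  rewrite (@eq_prim _ _ (fun s => (c ^+ 2 * (E s * K t s) + c * k * (E (t - s) * K t s) +
     (c * k * (E s * K t (t - s)) + k ^+ 2 * (E (t - s) * K t (t - s)))) + (- I * (w s * r s) + (r 0 * I - S) * w s)));
    last by move=> s _ _; rewrite /w /exp_weight; ring.
  rewrite primD; [|by continuity_tac..].
  rewrite primD; [|by continuity_tac..].
  rewrite (@primD _ (fun s => - I * (w s * r s))); [|by continuity_tac..].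
  rewrite (@primD _ (fun s => c ^+ 2 * (E s * K t s))); [|by continuity_tac..].
  rewrite (@primD _ (fun s => c * k * (E s * K t (t - s)))); [|by continuity_tac..].
  rewrite !primZ; [|by continuity_tac..].
  have -> : prim (fun s => E s * K t (t - s)) t = prim (fun s => E (t - s) * K t s) t.
    rewrite -(prim_reflect _ t0); last by continuity_tac.
    by apply: eq_prim => s _ _; rewrite !subKr.
  have -> : prim (fun s => E (t - s) * K t (t - s)) t = prim (fun s => E s * K t s) t.
    by rewrite -[RHS](prim_reflect _ t0)//; continuity_tac.
  by rewrite Iw Sw; ring.
have -> : prim (fun s => w s * tfbm_cov H lambda s t) t = c * K t t + k * K t 0 - r t * I - S + r 0 * I.
  have c1 : cont (fun x => r (t - x)) by apply: (cont_comp cr); continuity_tac.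
  rewrite (@eq_prim _ _ (fun s => w s * r (t - s) + ((r 0 - r t) * w s + - 1 * (w s * r s)))); last first.
    by move=> s _ _; rewrite /tfbm_cov acov_subC; ring.
  rewrite primD; [|by continuity_tac..].
  rewrite primD; [|by continuity_tac..].
  rewrite !primZ; [|by continuity_tac..].
  by rewrite Iw Sw prim_exp_weight_acov// subrr; ring.
by rewrite /tfbm_cov subrr; ring.
Qed.

Variable t : nat -> R.
Hypotheses (t0 : forall n, 0 < t n) (tn : t n @[n --> \oo] --> +oo).

Lemma cvg_functional_var_limit (c k m : R) (L := acov_laplace H lambda b) :
  functional_var H lambda (exp_weight c k (t n)) m (t n) @[n --> \oo] -->
  ((c ^+ 2 + k ^+ 2) * (L / b) - 2 * (c * L) * ((c + k) / b) + r 0 * ((c + k) / b) ^+ 2)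
  + 2 * m * (k * L - c * L + r 0 * ((c + k) / b)) + m ^+ 2 * (2 * r 0).
Proof.
rewrite (funext (fun n => @functional_varE c k m (t n) (ltW (t0 n)))).
have eE : E (t n) @[n --> \oo] --> 0.
  by have := @cvg_expRN_seq R b b_gt0 t tn 0; under eq_fun do rewrite subr0.
have cA : acov_conv H lambda b (t n) @[n --> \oo] --> 0 by exact: cvg_acov_conv_seq.
have cX : exp_acov H lambda b (t n) @[n --> \oo] --> L by exact: cvg_exp_acov.
have cR : r (t n) @[n --> \oo] --> 0 by exact: cvg_acov_seq.
have cD : prim (fun s => E (t n - s) * K (t n) s) (t n) @[n --> \oo] --> 0 by exact: cvg_prim_cross.
have K0 n : K (t n) 0 = exp_acov H lambda b (t n).
  by rewrite /acov_conv prim0 subr0 !mulr0 add0r oppr0 expR0 mul1r.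
have Kt n : K (t n) (t n) = acov_conv H lambda b (t n).
  by rewrite subrr /exp_acov prim0 mulr0 addr0.
under eq_fun => n do rewrite K0 Kt prim_exp_conv ?ltW//.
have -> : ((c ^+ 2 + k ^+ 2) * (L / b) - 2 * (c * L) * ((c + k) / b) + r 0 * ((c + k) / b) ^+ 2)
  + 2 * m * (k * L - c * L + r 0 * ((c + k) / b)) + m ^+ 2 * (2 * r 0) =
  ((c ^+ 2 + k ^+ 2) * ((L - 0 * 0) / b) + 2 * c * k * 0 - 2 * (c * L + k * 0) * ((c + k) * ((1 - 0) / b))
    + r 0 * ((c + k) * ((1 - 0) / b)) ^+ 2) + 2 * m * (c * 0 + k * L - 0 * ((c + k) * ((1 - 0) / b)) -
   (c * L + k * 0) + r 0 * ((c + k) * ((1 - 0) / b))) + m ^+ 2 * (2 * (r 0 - 0)).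
  by field; rewrite gt_eqF.
(* With variables in place of the covariance integrals, [cvg_tac] meets a polynomial expression in
   convergent sequences. *)
have aux (e A X Q D : nat -> R) : e n @[n --> \oo] --> 0 -> A n @[n --> \oo] --> 0 ->
    X n @[n --> \oo] --> L -> Q n @[n --> \oo] --> 0 -> D n @[n --> \oo] --> 0 ->
  ((c ^+ 2 + k ^+ 2) * ((X n - e n * A n) / b) + 2 * c * k * D n -
   2 * (c * X n + k * A n) * ((c + k) * ((1 - e n) / b)) + r 0 * ((c + k) * ((1 - e n) / b)) ^+ 2) +
  2 * m * (c * A n + k * X n - Q n * ((c + k) * ((1 - e n) / b)) - (c * X n + k * A n) +
    r 0 * ((c + k) * ((1 - e n) / b))) + m ^+ 2 * (2 * (r 0 - Q n)) @[n --> \oo] -->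
  ((c ^+ 2 + k ^+ 2) * ((L - 0 * 0) / b) + 2 * c * k * 0 - 2 * (c * L + k * 0) * ((c + k) * ((1 - 0) / b))
    + r 0 * ((c + k) * ((1 - 0) / b)) ^+ 2) + 2 * m * (c * 0 + k * L - 0 * ((c + k) * ((1 - 0) / b)) -
   (c * L + k * 0) + r 0 * ((c + k) * ((1 - 0) / b))) + m ^+ 2 * (2 * (r 0 - 0)).
  by move=> h1 h2 h3 h4 h5; cvg_tac.
exact: (aux _ _ _ _ _ eE cA cX cR cD).
Qed.

End functional_variance.

Section gaussian_vector.
Context d (T : measurableType d) (R : realType) (P : probability T R).
Variables (H lambda b : R).
Hypotheses (H_gt0 : 0 < H) (lambda_gt0 : 0 < lambda) (b_gt0 : 0 < b).

Definition Sigma_form (c1 c2 c3 : R) : R :=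
  c1 ^+ 2 * (beta2 H lambda b / b ^+ 2) + 2 * c1 * c2 * (beta2 H lambda b / b ^+ 2) +
  c2 ^+ 2 * ((alpha2 H lambda - beta2 H lambda b) / b ^+ 2) + c3 ^+ 2 * beta2 H lambda b.

(** A sum of squares: b xi1, b xi2 - b xi1 and xi3 are uncorrelated with variances beta^2, 2 b L and
    beta^2, where L is the Laplace transform of the covariance at [b]. Nonnegativity and the sign
    symmetries used later are read off here. *)
Lemma Sigma_formE c1 c2 c3 : Sigma_form c1 c2 c3 =
  ((c1 + c2) / b) ^+ 2 * beta2 H lambda b + (c2 / b) ^+ 2 * (2 * b * acov_laplace H lambda b) +
  c3 ^+ 2 * beta2 H lambda b.
Proof. by rewrite /Sigma_form beta2E// alpha2E//; field; rewrite gt_eqF. Qed.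

Lemma Sigma_form_ge0 c1 c2 c3 : 0 <= Sigma_form c1 c2 c3.
Proof.
have h := ltW (beta2_gt0 H_gt0 lambda_gt0 b_gt0).
have r := acov_laplace_ge0 lambda H_gt0 b.
by rewrite Sigma_formE !addr_ge0// mulr_ge0 ?sqr_ge0// mulr_ge0// mulr_ge0// ltW.
Qed.

(* What the limit theorem needs of a vector with law N(0, Sigma): its
   characteristic function and the absence of atoms. *)
Definition gaussian_triple (x1 x2 x3 : T -> R) : Prop :=
  [/\ forall c1 c2 c3 k, char_gaussian P (fun w => k * (c1 * x1 w + c2 * x2 w + c3 * x3 w))
        (k ^+ 2 * Sigma_form c1 c2 c3),
      forall x, P [set w | x1 w = x] = 0%E &
      forall x, P [set w | x3 w = x] = 0%E].

Variables (xi1 xi2 xi3 : {RV P >-> R}).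

Lemma gaussian_vector_triple : centered_gaussian_vector (Sigma H lambda b)
  (fun i : 'I_3 => nth xi1 [:: xi1; xi2; xi3] i) -> gaussian_triple xi1 xi2 xi3.
Proof.
move=> [_ h]; have lin c1 c2 c3 :
    centered_gaussian P (fun w => c1 * xi1 w + c2 * xi2 w + c3 * xi3 w) (Sigma_form c1 c2 c3).
  have := h (fun i : 'I_3 => nth 0 [:: c1; c2; c3] i).
  have -> : (fun w => \sum_(i < 3) nth 0 [:: c1; c2; c3] i * nth xi1 [:: xi1; xi2; xi3] i w) =
      (fun w => c1 * xi1 w + c2 * xi2 w + c3 * xi3 w).
    by apply/funext => w; rewrite !big_ord_recl big_ord0 /= addr0 addrA.
  congr (centered_gaussian P _ _).
  by rewrite !big_ord_recl !big_ord0 /= !mxE /= /Sigma_form; ring.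
have b2 := beta2_gt0 H_gt0 lambda_gt0 b_gt0.
split=> [c1 c2 c3 k|x|x].
- apply: centered_gaussian_char; last exact: lin.
  by apply: measurable_funD; [apply: measurable_funD|]; apply: measurable_funM.
- have e : (fun w => 1 * xi1 w + 0 * xi2 w + 0 * xi3 w) = xi1 by apply/funext => w; ring.
  have := lin 1 0 0; rewrite e => g; apply: (centered_gaussian_neq x g).
  have -> : Sigma_form 1 0 0 = beta2 H lambda b / b ^+ 2 by rewrite /Sigma_form; ring.
  by rewrite lt0r_neq0// divr_gt0 ?exprn_gt0.
- have e : (fun w => 0 * xi1 w + 0 * xi2 w + 1 * xi3 w) = xi3 by apply/funext => w; ring.
  have := lin 0 0 1; rewrite e => g; apply: (centered_gaussian_neq x g).
  have -> : Sigma_form 0 0 1 = beta2 H lambda b by rewrite /Sigma_form; ring.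
  exact: lt0r_neq0.
Qed.

End gaussian_vector.

Section law_of_path_functionals.
Context d (T : measurableType d) (R : realType) (P : probability T R).
Variables (H lambda b : R) (W B : R -> {RV P >-> R}).
Hypotheses (H_gt0 : 0 < H) (lambda_gt0 : 0 < lambda) (b_gt0 : 0 < b).
Hypotheses (W_wiener : wiener_process W) (B_tfbm : tfbm H lambda W B).
Local Notation beta om := (ext_path B om).

Definition rv_Z (t : R) (om : T) : R := path_Z b (beta om) t.
Definition rv_Q (t : R) (om : T) : R := path_Q b (beta om) t.
Definition rv_X (t : R) (om : T) : R := B t om - b * rv_Q t om.

Lemma measurable_rv_Z t : 0 <= t -> measurable_fun setT (rv_Z t).
Proof.
move=> t0; apply: (@measurable_prim _ _ _ (fun s om => expR (- (b * s)) * beta om s)) => //.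
  by move=> s; apply: measurable_funM.
by move=> om; have h := ext_path_cont B_tfbm (om := om); continuity_tac.
Qed.

Lemma measurable_rv_Q t : 0 <= t -> measurable_fun setT (rv_Q t).
Proof.
move=> t0; apply: measurable_funM => //.
apply: (@measurable_prim _ _ _ (fun s om => expR (b * s) * beta om s)) => //.
  by move=> s; apply: measurable_funM.
by move=> om; have h := ext_path_cont B_tfbm (om := om); continuity_tac.
Qed.

Lemma measurable_rv_X t : 0 <= t -> measurable_fun setT (rv_X t).
Proof.
by move=> t0; apply: measurable_funB => //; apply: measurable_funM => //; exact: measurable_rv_Q.
Qed.

(** Since X_t = B_t - b Q_t, the coefficient of Q_t becomes c2 - b c3 and only the term c3 B_t stays
    outside the integral. *)
Lemma rv_lin_functional (c1 c2 c3 t : R) om : 0 <= t ->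
  c1 * rv_Z t om + c2 * rv_Q t om + c3 * rv_X t om =
  prim (fun s => exp_weight b c1 (c2 - b * c3) t s * beta om s) t + c3 * B t om.
Proof.
move=> t0; have h := ext_path_cont B_tfbm (om := om).
rewrite /rv_X /rv_Z /rv_Q /path_Z /path_Q /path_L -[expR _ * prim _ _]primZ; last by continuity_tac.
set z := prim _ _; set q := prim _ _.
have -> : prim (fun s => exp_weight b c1 (c2 - b * c3) t s * beta om s) t = c1 * z + (c2 - b * c3) * q.
  rewrite /z /q -!primZ; [|by continuity_tac..].
  rewrite -primD; [|by continuity_tac..].
  apply: eq_prim => s _ _; rewrite /exp_weight expRNB; ring.
ring.
Qed.

Lemma rv_char (c1 c2 c3 k t : R) : 0 <= t ->
  char_gaussian P (fun om => k * (c1 * rv_Z t om + c2 * rv_Q t om + c3 * rv_X t om))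
    (k ^+ 2 * functional_var H lambda (exp_weight b c1 (c2 - b * c3) t) c3 t).
Proof.
move=> t0; set w := exp_weight b c1 (c2 - b * c3) t.
have cw : cont w by exact: exp_weight_cont.
have ckw : cont (fun s => k * w s) by continuity_tac.
have := tfbm_functional_char H_gt0 lambda_gt0 W_wiener B_tfbm (w := fun s => k * w s) (k * c3) ckw t0.
have -> : (fun om => prim (fun s => k * w s * beta om s) t + k * c3 * B t om) =
    (fun om => k * (c1 * rv_Z t om + c2 * rv_Q t om + c3 * rv_X t om)).
  apply/funext => om; have h := ext_path_cont B_tfbm (om := om).
  rewrite rv_lin_functional// -/w mulrDr mulrA -primZ; last by continuity_tac.
  by congr (_ + _); apply: eq_prim => s _ _; rewrite mulrA.
congr (char_gaussian P _ _); rewrite /functional_var.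
have c2s s : cont (fun x => tfbm_cov H lambda s x).
  by apply: continuous_section; exact: tfbm_cov_cont2.
have ct : cont (fun s => tfbm_cov H lambda s t).
  by rewrite (funext (fun s => tfbm_covC H lambda s t)).
have cc : cont (fun s => prim (fun x => w s * w x * tfbm_cov H lambda s x) t).
  apply: (@continuous_Rintegral_param R (fun s x => w s * w x * tfbm_cov H lambda s x)) => p.
  apply: cvgM; last exact: tfbm_cov_cont2.
  have h1 : (fun q : R * R => q.1) @ p --> p.1 by exact: cvg_fst.
  have h2 : (fun q : R * R => q.2) @ p --> p.2 by exact: cvg_snd.
  by apply: cvgM; [exact: (cvg_comp _ _ h1 (cw _))|exact: (cvg_comp _ _ h2 (cw _))].
have -> : prim (fun s => prim (fun x => k * w s * (k * w x) * tfbm_cov H lambda s x) t) t =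
    k ^+ 2 * prim (fun s => prim (fun x => w s * w x * tfbm_cov H lambda s x) t) t.
  rewrite -primZ//; apply: eq_prim => s _ _; rewrite -primZ; last by have := c2s s => ?; continuity_tac.
  by apply: eq_prim => x _ _; ring.
have -> : prim (fun s => k * w s * tfbm_cov H lambda s t) t =
    k * prim (fun s => w s * tfbm_cov H lambda s t) t.
  by rewrite -primZ; [apply: eq_prim => s _ _; rewrite mulrA|continuity_tac].
ring.
Qed.

(** [char_gaussian_moment] asks for a nonnegative parameter. A negative one has square root 0, so
    that its [gauss_cf] is that of 0, and raising it to 0 changes nothing. *)
Lemma char_gaussian_max0 (X : T -> R) (v : R) :
  (forall k, char_gaussian P (fun om => k * X om) (k ^+ 2 * v)) ->
  forall k, char_gaussian P (fun om => k * X om) (k ^+ 2 * Num.max v 0).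
Proof.
move=> h k; have [v0|v0] := leP 0 v; first exact: h.
move=> phi; rewrite h mulr0 gauss_cf0; congr (_ * _).
rewrite -gauss_cf0 /gauss_cf sqrtr0 ler0_sqrtr//.
by rewrite mulr_ge0_le0 ?sqr_ge0// ltW.
Qed.

Context d' (T' : measurableType d') (P' : probability T' R).
Variables (xi1 xi2 xi3 : {RV P' >-> R}).
Hypothesis xi_gauss : gaussian_triple P' H lambda b xi1 xi2 xi3.
Variable t : nat -> R.
Hypotheses (t0 : forall n, 0 < t n) (tn : t n @[n --> \oo] --> +oo).

Lemma cvg_functional_var_Sigma (c1 c2 c3 : R) :
  functional_var H lambda (exp_weight b c1 (c2 - b * c3) (t n)) c3 (t n) @[n --> \oo] -->
  Sigma_form H lambda b c1 c2 c3.
Proof.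
have := cvg_functional_var_limit H_gt0 lambda_gt0 b_gt0 t0 tn (c := c1) (k := c2 - b * c3) (m := c3).
move=> /= h; suff -> : Sigma_form H lambda b c1 c2 c3 = (c1 ^+ 2 + (c2 - b * c3) ^+ 2) * (acov_laplace H lambda b / b) -
   2 * (c1 * acov_laplace H lambda b) * ((c1 + (c2 - b * c3)) / b) +
   acov H lambda 0 * ((c1 + (c2 - b * c3)) / b) ^+ 2 +
   2 * c3 * ((c2 - b * c3) * acov_laplace H lambda b - c1 * acov_laplace H lambda b +
     acov H lambda 0 * ((c1 + (c2 - b * c3)) / b)) + c3 ^+ 2 * (2 * acov H lambda 0) by exact: h.
by rewrite /Sigma_form beta2E// alpha2E//; field; rewrite gt_eqF.
Qed.

Lemma cvg_rv_cos (c1 c2 c3 phi : R) :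
  \int[P]_w cos (c1 * rv_Z (t n) w + c2 * rv_Q (t n) w + c3 * rv_X (t n) w + phi) @[n --> \oo] -->
  \int[P']_w cos (c1 * xi1 w + c2 * xi2 w + c3 * xi3 w + phi).
Proof.
have -> : \int[P']_w cos (c1 * xi1 w + c2 * xi2 w + c3 * xi3 w + phi) =
    cos phi * gauss_cf (Sigma_form H lambda b c1 c2 c3).
  have [+ _ _] := xi_gauss; move=> /(_ c1 c2 c3 1 phi); rewrite expr1n mul1r => <-.
  by under [RHS]eq_Rintegral do rewrite mul1r.
have e n : \int[P]_w cos (c1 * rv_Z (t n) w + c2 * rv_Q (t n) w + c3 * rv_X (t n) w + phi) =
    cos phi * gauss_cf (functional_var H lambda (exp_weight b c1 (c2 - b * c3) (t n)) c3 (t n)).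
  have := rv_char c1 c2 c3 1 (ltW (t0 n)) phi; rewrite expr1n mul1r => <-.
  by under [RHS]eq_Rintegral do rewrite mul1r.
rewrite (funext e); apply: cvgM; first exact: cvg_cst.
by apply: cvg_gauss_cf; exact: cvg_functional_var_Sigma.
Qed.

(** The variances converge, hence are bounded by some [M], and [char_gaussian_moment] turns this
    into one bound for all [n]. *)
Lemma rv_moment (c1 c2 c3 : R) : exists C : R, forall n,
  (\int[P]_w ((c1 * rv_Z (t n) w + c2 * rv_Q (t n) w + c3 * rv_X (t n) w) ^+ 2)%:E <= C%:E)%E.
Proof.
pose v n := functional_var H lambda (exp_weight b c1 (c2 - b * c3) (t n)) c3 (t n).
have cv : cvgn v by apply/cvg_ex; eexists; exact: cvg_functional_var_Sigma.
have [M0 [_ hM0]] := cvg_seq_bounded cv; pose M := M0 + 1.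
have hM n : `|v n| <= M by apply: hM0; rewrite // ltrDl.
exists (2 / gauss_cf M) => n.
apply: (char_gaussian_moment W_wiener (v := Num.max (v n) 0)).
- have tn0 := ltW (t0 n).
  by apply: measurable_funD; [apply: measurable_funD|]; apply: measurable_funM => //;
    [exact: measurable_rv_Z|exact: measurable_rv_Q|exact: measurable_rv_X].
- by rewrite le_max lexx orbT.
- have h := hM n; rewrite ge_max (le_trans (normr_ge0 _) h) andbT.
  exact: le_trans (ler_norm _) h.
- by apply: char_gaussian_max0 => k; apply: rv_char; exact: ltW.
Qed.

Lemma xi_moment (c1 c2 c3 : R) : exists C : R,
  (\int[P']_w ((c1 * xi1 w + c2 * xi2 w + c3 * xi3 w) ^+ 2)%:E <= C%:E)%E.
Proof.
exists (2 / gauss_cf (Sigma_form H lambda b c1 c2 c3)).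
apply: (char_gaussian_moment W_wiener (v := Sigma_form H lambda b c1 c2 c3)) => //.
- by apply: measurable_funD; [apply: measurable_funD|]; apply: measurable_funM.
- exact: Sigma_form_ge0.
- by move=> k; have [+ _ _] := xi_gauss; apply.
Qed.

Lemma rv_moments : exists C : R,
  [/\ forall n, (\int[P]_w (rv_Z (t n) w ^+ 2)%:E <= C%:E)%E,
      forall n, (\int[P]_w (rv_Q (t n) w ^+ 2)%:E <= C%:E)%E &
      forall n, (\int[P]_w (rv_X (t n) w ^+ 2)%:E <= C%:E)%E] /\
  [/\ (\int[P']_w (xi1 w ^+ 2)%:E <= C%:E)%E, (\int[P']_w (xi2 w ^+ 2)%:E <= C%:E)%E &
      (\int[P']_w (xi3 w ^+ 2)%:E <= C%:E)%E].
Proof.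
have [C1 h1] := rv_moment 1 0 0; have [C2 h2] := rv_moment 0 1 0; have [C3 h3] := rv_moment 0 0 1.
have [C4 h4] := xi_moment 1 0 0; have [C5 h5] := xi_moment 0 1 0; have [C6 h6] := xi_moment 0 0 1.
pose C := Num.max C1 (Num.max C2 (Num.max C3 (Num.max C4 (Num.max C5 C6)))).
have e1 (x y z : R) : 1 * x + 0 * y + 0 * z = x by ring.
have e2 (x y z : R) : 0 * x + 1 * y + 0 * z = y by ring.
have e3 (x y z : R) : 0 * x + 0 * y + 1 * z = z by ring.
exists C; split; [split => n|split].
- have := h1 n; under eq_integral do rewrite e1; move=> /le_trans; apply.
  by rewrite lee_fin /C !le_max lexx.
- have := h2 n; under eq_integral do rewrite e2; move=> /le_trans; apply.
  by rewrite lee_fin /C !le_max lexx !orbT.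
- have := h3 n; under eq_integral do rewrite e3; move=> /le_trans; apply.
  by rewrite lee_fin /C !le_max lexx !orbT.
- have := h4; under eq_integral do rewrite e1; move=> /le_trans; apply.
  by rewrite lee_fin /C !le_max lexx !orbT.
- have := h5; under eq_integral do rewrite e2; move=> /le_trans; apply.
  by rewrite lee_fin /C !le_max lexx !orbT.
- have := h6; under eq_integral do rewrite e3; move=> /le_trans; apply.
  by rewrite lee_fin /C !le_max lexx !orbT.
Qed.

Lemma cvg_rv_law (f : R * R * R -> R) (M : R) : continuous f -> (forall z, `|f z| <= M) ->
  \int[P]_w f (rv_Z (t n) w, rv_Q (t n) w, rv_X (t n) w) @[n --> \oo] -->
  \int[P']_w f (xi1 w, xi2 w, xi3 w).
Proof.
move=> cf fM; have [C [[m1 m2 m3] [m4 m5 m6]]] := rv_moments.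
have tn0 n := ltW (t0 n).
apply: (trigonometric_cvg (x1 := fun n => rv_Z (t n)) (x2 := fun n => rv_Q (t n))
   (x3 := fun n => rv_X (t n)) (C := C) _ _ _ _ _ _ _ m1 m2 m3 m4 m5 m6 cf fM) => //.
- by move=> n; exact: measurable_rv_Z.
- by move=> n; exact: measurable_rv_Q.
- by move=> n; exact: measurable_rv_X.
- by move=> c1 c2 c3 phi; exact: cvg_rv_cos.
Qed.

End law_of_path_functionals.

(** * Convergence of the estimation errors *)

Section error_modulus.
Context {R : realType}.
Variables (a b sigma y0 : R).
Hypothesis b_gt0 : 0 < b.
Variables (F : R * R -> R) (kap : R).
Hypotheses (cF : continuous F) (kap_gt0 : 0 < kap).

Local Notation eta_of z := (y0 + a / b + b * sigma * z).

Definition err_den (p : R * R * R) (d : R * R * R * R) : R :=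
  est_den a b sigma y0 (eta_of p.1.1) p.1.2 d.1.1.1 d.1.1.2 d.1.2 d.2.

(* The maximum with [kap] makes the estimators' quotients continuous; it is removed
   on the event that the limit of [err_den] is at least [2 * kap]. *)
Definition err_test (p : R * R * R) (d : R * R * R * R) : R :=
  F (est_num_a a b sigma y0 (eta_of p.1.1) p.1.2 p.2 d.1.1.1 d.1.1.2 d.1.2 / Num.max (err_den p d) kap,
     est_num_b a b sigma y0 (eta_of p.1.1) p.1.2 p.2 d.1.1.1 d.1.1.2 d.1.2 d.2 / Num.max (err_den p d) kap).

Lemma cvg_est (S : Type) (G : set_system S) (FG : Filter G) (z q x d1 d2 d3 d4 : S -> R)
    (z' q' x' d1' d2' d3' d4' : R) :
  z s @[s --> G] --> z' -> q s @[s --> G] --> q' -> x s @[s --> G] --> x' ->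
  d1 s @[s --> G] --> d1' -> d2 s @[s --> G] --> d2' -> d3 s @[s --> G] --> d3' -> d4 s @[s --> G] --> d4' ->
  [/\ est_den a b sigma y0 (eta_of (z s)) (q s) (d1 s) (d2 s) (d3 s) (d4 s) @[s --> G] -->
      est_den a b sigma y0 (eta_of z') q' d1' d2' d3' d4',
      est_num_a a b sigma y0 (eta_of (z s)) (q s) (x s) (d1 s) (d2 s) (d3 s) @[s --> G] -->
      est_num_a a b sigma y0 (eta_of z') q' x' d1' d2' d3' &
      est_num_b a b sigma y0 (eta_of (z s)) (q s) (x s) (d1 s) (d2 s) (d3 s) (d4 s) @[s --> G] -->
      est_num_b a b sigma y0 (eta_of z') q' x' d1' d2' d3' d4'].
Proof.
move=> hz hq hx h1 h2 h3 h4.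
rewrite /est_den /est_num_a /est_num_b /est_n2 /est_i2 /est_i1.
by split; cvg_tac.
Qed.

Lemma continuous_maxr (k : R) : continuous (fun t : R => Num.max t k).
Proof. by move=> t; apply: continuous_max; [exact: cvg_id|exact: cvg_cst]. Qed.

Lemma cvg_projections (p : R * R * R) (d : R * R * R * R) :
  let N := nbhs (p, d) in
  [/\ (fun s : (R * R * R) * (R * R * R * R) => s.1.1.1) @ N --> p.1.1, (fun s => s.1.1.2) @ N --> p.1.2,
    (fun s => s.1.2) @ N --> p.2 & [/\ (fun s => s.2.1.1.1) @ N --> d.1.1.1, (fun s => s.2.1.1.2) @ N --> d.1.1.2,
    (fun s => s.2.1.2) @ N --> d.1.2 & (fun s => s.2.2) @ N --> d.2]].
Proof.
have f1 (U V : topologicalType) (u : U) (v : V) : (fun s : U * V => s.1) @ (u, v) --> u by exact: cvg_fst.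
have f2 (U V : topologicalType) (u : U) (v : V) : (fun s : U * V => s.2) @ (u, v) --> v by exact: cvg_snd.
case: p d => [[z q] x] [[[d1 d2] d3] d4] /=.
have hp := f1 _ _ (z, q, x) (d1, d2, d3, d4); have hd := f2 _ _ (z, q, x) (d1, d2, d3, d4).
have hp1 := cvg_comp _ _ hp (f1 _ _ (z, q) x); have hd1 := cvg_comp _ _ hd (f1 _ _ (d1, d2, d3) d4).
have hd2 := cvg_comp _ _ hd1 (f1 _ _ (d1, d2) d3).
split; [exact: (cvg_comp _ _ hp1 (f1 _ _ z q))|exact: (cvg_comp _ _ hp1 (f2 _ _ z q))|
  exact: (cvg_comp _ _ hp (f2 _ _ (z, q) x))|split].
- exact: (cvg_comp _ _ hd2 (f1 _ _ d1 d2)).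
- exact: (cvg_comp _ _ hd2 (f2 _ _ d1 d2)).
- exact: (cvg_comp _ _ hd1 (f2 _ _ (d1, d2) d3)).
- exact: (cvg_comp _ _ hd (f2 _ _ (d1, d2, d3) d4)).
Qed.

Lemma err_den_continuous : continuous (fun s : (R * R * R) * (R * R * R * R) => err_den s.1 s.2).
Proof.
move=> [p d]; have [hz hq hx [h1 h2 h3 h4]] := cvg_projections p d.
by have [] := cvg_est _ hz hq hx h1 h2 h3 h4.
Qed.

Lemma err_test_continuous : continuous (fun s : (R * R * R) * (R * R * R * R) => err_test s.1 s.2).
Proof.
move=> [p d]; have [hz hq hx [h1 h2 h3 h4]] := cvg_projections p d.
have [hd ha hb] := cvg_est _ hz hq hx h1 h2 h3 h4.
have hm : (fun s : (R * R * R) * (R * R * R * R) => (Num.max (err_den s.1 s.2) kap)^-1) @ (p, d) -->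
    (Num.max (err_den p d) kap)^-1.
  apply: cvgV; first by rewrite gt_eqF// lt_max kap_gt0 orbT.
  by apply: (cvg_comp_continuous (h := fun x => Num.max x kap)); [exact: continuous_maxr|exact: hd].
have hF (u v : R) : (fun z : R * R => (fun x y => F (x, y)) z.1 z.2) @ (u, v) --> F (u, v).
  by rewrite (_ : (fun z => _) = F); [exact: cF|apply/funext => -[]].
apply: (@continuous2_cvg ((R * R * R) * (R * R * R * R))%type R R R (nbhs (p, d)) _
  (fun s => est_num_a a b sigma y0 (eta_of s.1.1.1) s.1.1.2 s.1.2 s.2.1.1.1 s.2.1.1.2 s.2.1.2 *
     (Num.max (err_den s.1 s.2) kap)^-1)
  (fun s => est_num_b a b sigma y0 (eta_of s.1.1.1) s.1.1.2 s.1.2 s.2.1.1.1 s.2.1.1.2 s.2.1.2 s.2.2 *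
     (Num.max (err_den s.1 s.2) kap)^-1) (fun x y => F (x, y)) _ _ (hF _ _)).
  by apply: cvgM; [exact: ha|exact: hm].
by apply: cvgM; [exact: hb|exact: hm].
Qed.

(** Compactness of the cube makes the vanishing of the remainders uniform. The second estimate, with
    tolerance [kap], serves to remove the maximum of [err_test] where the limit denominator is at
    least 2 kap. *)
Lemma error_modulus (L e : R) : 0 < e -> exists2 del : R, 0 < del &
  forall z q x d1 d2 d3 d4 : R, `|z| <= L -> `|q| <= L -> `|x| <= L ->
    `|d1| < del -> `|d2| < del -> `|d3| < del -> `|d4| < del ->
    `|err_test (z, q, x) (d1, d2, d3, d4) - err_test (z, q, x) (0, 0, 0, 0)| < e /\
    `|err_den (z, q, x) (d1, d2, d3, d4) - err_den (z, q, x) (0, 0, 0, 0)| < kap.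
Proof.
move=> e0; pose K : set (R * R * R) := `[- L, L] `*` `[- L, L] `*` `[- L, L].
have cK : compact K by apply: compact_setX; [apply: compact_setX|]; exact: segment_compact.
have /nbhs_ballP[e1 /= e1_gt0 h1] := compact_modulus (d0 := (0, 0, 0, 0) : R * R * R * R) cK
  (fun x _ => @err_test_continuous (x, (0, 0, 0, 0))) e0.
have /nbhs_ballP[e2 /= e2_gt0 h2] := compact_modulus (d0 := (0, 0, 0, 0) : R * R * R * R) cK
  (fun x _ => @err_den_continuous (x, (0, 0, 0, 0))) kap_gt0.
exists (Num.min e1 e2) => [|z q x d1 d2 d3 d4 zL qL xL]; first by rewrite lt_min e1_gt0.
rewrite !lt_min => /andP[a1 b1] /andP[a2 b2] /andP[a3 b3] /andP[a4 b4].
have Kp : K (z, q, x) by rewrite /K /=; split; [split|]; rewrite /= in_itv/= -ler_norml.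
have bb (r : R) : `|d1| < r -> `|d2| < r -> `|d3| < r -> `|d4| < r ->
    ball ((0, 0, 0, 0) : R * R * R * R) r (d1, d2, d3, d4).
  by move=> ? ? ? ?; split; [split; [split|]|]; rewrite /= -ball_normE/= sub0r normrN.
by split; [exact: (h1 _ (bb _ a1 a2 a3 a4) _ Kp)|exact: (h2 _ (bb _ b1 b2 b3 b4) _ Kp)].
Qed.

Definition limit_test (p : R * R * R) : R := err_test p (0, 0, 0, 0).

Lemma limit_test_continuous : continuous limit_test.
Proof.
move=> p; apply: (@continuous2_cvg (R * R * R)%type (R * R * R)%type (R * R * R * R)%type R (nbhs p) _
  id (fun=> (0, 0, 0, 0)) err_test p (0, 0, 0, 0) (@err_test_continuous (p, (0, 0, 0, 0)))).
  exact: cvg_id.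
exact: cvg_cst.
Qed.

Lemma limit_testE (z q x : R) : kap <= eta_of z ^+ 2 / (2 * b) ->
  limit_test (z, q, x) = F (b * sigma * q - sigma * x, 2 * b * sigma * x / eta_of z).
Proof.
move=> hk; have e0 : eta_of z != 0.
  by apply: contraTneq hk => ->; rewrite expr0n/= mul0r -ltNge.
rewrite /limit_test /err_test /err_den /= max_l; last by rewrite est_den0.
by rewrite est_a0// est_b0.
Qed.

End error_modulus.

Section exponential_bounds.
Context {R : realType}.

(** From e^(ct) >= (ct/2)^2, itself the square of e^(ct/2) >= ct/2. *)
Lemma mul_expRN_le (c t : R) : 0 < c -> 0 < t -> t * expR (- (c * t)) <= 4 / (c ^+ 2 * t).
Proof.
move=> c0 t0; have h : c * t / 2 <= expR (c * t / 2).
  by rewrite (le_trans _ (expR_ge1Dx _))// lerDr.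
have p0 : 0 < c * t / 2 by rewrite divr_gt0// mulr_gt0.
have h2 : (c * t / 2) ^+ 2 <= expR (c * t).
  have -> : c * t = c * t / 2 + c * t / 2 by rewrite -splitr.
  by rewrite expRD -expr2 -splitr lerXn2r ?nnegrE ?expR_ge0// ltW.
rewrite expRN; apply: (@le_trans _ _ (t * ((c * t / 2) ^+ 2)^-1)).
  by rewrite ler_wpM2l ?(ltW t0)// lef_pV2 ?posrE ?expR_gt0 ?exprn_gt0.
by rewrite le_eqVlt; apply/orP; left; apply/eqP; field; rewrite !gt_eqF.
Qed.

Lemma mul_expRN_near (c del : R) : 0 < c -> 0 < del ->
  exists2 A : R, 0 < A & forall t, A <= t -> t * expR (- (c * t)) < del.
Proof.
move=> c0 d0; exists (1 + 4 / (c ^+ 2 * del)) => [|t tA].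
  by rewrite ltr_pwDl// divr_ge0// mulr_ge0 ?sqr_ge0// ltW.
have k0 : 0 < c ^+ 2 * del by rewrite mulr_gt0 ?exprn_gt0.
have At : 4 / (c ^+ 2 * del) < t by rewrite (lt_le_trans _ tA)// ltrDr.
have t0 : 0 < t by rewrite (le_lt_trans _ At)// divr_ge0// ltW.
rewrite (le_lt_trans (mul_expRN_le c0 t0))//.
rewrite ltr_pdivrMr ?mulr_gt0 ?exprn_gt0//; move: At; rewrite ltr_pdivrMr//.
by rewrite mulrCA mulrA mulrC.
Qed.

End exponential_bounds.

Section estimators.
Context d (T : measurableType d) (R : realType) (P : probability T R).
Variables (H lambda a b sigma y0 : R) (W B Y : R -> {RV P >-> R}).
Hypotheses (H_gt0 : 0 < H) (lambda_gt0 : 0 < lambda) (b_gt0 : 0 < b).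
Hypotheses (W_wiener : wiener_process W) (B_tfbm : tfbm H lambda W B).
Hypothesis Y_solution : vasicek_solution a b sigma y0 B Y.
Local Notation beta om := (ext_path B om).

Definition err_a (t : R) (om : T) : R := t * (a_hat y0 (fun s => Y s om) t - a).
Definition err_b (t : R) (om : T) : R := expR (b * t) * (b_hat y0 (fun s => Y s om) t - b).

Lemma vasicek_pathE om s : 0 <= s -> Y s om = path_Y a b sigma y0 (beta om) s.
Proof.
move=> s0; have h := ext_path_cont B_tfbm (om := om).
apply: (path_Y_unique b_gt0 h (y := fun s => Y s om)) => // t t0.
have [h1 h2] := Y_solution om t0; split; first exact: h1.
by rewrite ext_pathE.
Qed.

Lemma measurable_err t : 0 <= t ->
  measurable_fun setT (err_a t) /\ measurable_fun setT (err_b t).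
Proof.
move=> t0; pose X (s : R) om := Y (Num.max s 0) om.
have cX om : cont (fun s => X s om).
  rewrite (_ : (fun s => _) = fun s => path_Y a b sigma y0 (beta om) (Num.max s 0)).
    have h := ext_path_cont B_tfbm (om := om); have h2 := path_Y_continuous (a := a) (b := b) (sigma := sigma) (y0 := y0) h.
    by apply: (cont_comp h2); exact: continuous_max0.
  by apply/funext => s; rewrite /X vasicek_pathE// le_max lexx orbT.
have m1 : measurable_fun setT (fun om => \int[lebesgue_measure]_(s in `[0, t]) Y s om).
  rewrite (_ : (fun om => _) = fun om => prim (fun s => X s om) t); last first.
    apply/funext => om; apply: eq_Rintegral => s; rewrite inE/= in_itv/= => /andP[s0 _].
    by rewrite /X max_l.
  exact: measurable_prim.
have m2 : measurable_fun setT (fun om => \int[lebesgue_measure]_(s in `[0, t]) (Y s om ^+ 2)).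
  rewrite (_ : (fun om => _) = fun om => prim (fun s => X s om ^+ 2) t); last first.
    apply/funext => om; apply: eq_Rintegral => s; rewrite inE/= in_itv/= => /andP[s0 _].
    by rewrite /X max_l.
  apply: (@measurable_prim _ _ _ (fun s om => X s om ^+ 2)) => //.
    by move=> s; apply: measurable_funX.
  by move=> om; have h := cX om; continuity_tac.
split; rewrite /err_a /err_b /a_hat /b_hat.
- apply: measurable_funM => //; apply: measurable_funB => //; apply: measurable_funM.
    apply: measurable_funM; first exact: measurable_funB.
    apply: measurable_funB => //; apply: measurable_funM => //.
    by apply: measurable_funM => //; exact: measurable_funD.
  apply: measurable_fun_inv; apply: measurable_funB; first exact: measurable_funM.
  exact: measurable_funX.
- apply: measurable_funM => //; apply: measurable_funB => //; apply: measurable_funM.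
    apply: measurable_funM; first exact: measurable_funB.
    apply: measurable_funB => //; apply: measurable_funM => //.
    exact: measurable_funD.
  apply: measurable_fun_inv; apply: measurable_funB; first exact: measurable_funM.
  exact: measurable_funX.
Qed.

Definition energy (t : R) (om : T) : R := prim (fun s => beta om s ^+ 2) t.

Lemma measurable_energy t : 0 <= t -> measurable_fun setT (energy t).
Proof.
move=> t0; apply: (@measurable_prim _ _ _ (fun s om => beta om s ^+ 2)) => //.
  by move=> s; apply: measurable_funX.
by move=> om; have h := ext_path_cont B_tfbm (om := om); continuity_tac.
Qed.

Lemma energy_ge0 t om : 0 <= energy t om.
Proof. by apply: Rintegral_ge0 => s _; exact: sqr_ge0. Qed.

(** E B_s^2 is bounded uniformly in s, so every Riemann sum of the energy has mean at most C t;
    Fatou's lemma carries this to the integral. *)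
Lemma energy_mean (t : R) : 0 <= t ->
  (\int[P]_w (energy t w)%:E <= (2 / gauss_cf (2 * acov H lambda 0) * t)%:E)%E.
Proof.
move=> t0; set C := 2 / _.
have mB s : 0 <= s -> (\int[P]_w (B s w ^+ 2)%:E <= C%:E)%E.
  by exact: (tfbm_moment H_gt0 lambda_gt0 W_wiener B_tfbm).
have iB s : 0 <= s -> P.-integrable setT (EFin \o (fun w => B s w ^+ 2)).
  by move=> s0; apply: integrable_sqr_of_lty => //; rewrite (le_lt_trans (mB s s0))// ltry.
apply: (@integral_limit_le _ _ _ P (fun N w => riemann_sum N t (fun s => beta w s ^+ 2))).
- move=> N; apply: measurable_sum => i; apply: measurable_funM => //; exact: measurable_funX.
- by move=> N w; apply: sumr_ge0 => i _; rewrite mulr_ge0 ?sqr_ge0// divr_ge0.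
- move=> w; apply: cvg_riemann_sum => //.
  by have h := ext_path_cont B_tfbm (om := w); continuity_tac.
move=> N; pose h := t / N.+1%:R; have h0 : 0 <= h by rewrite divr_ge0.
have Nh : N.+1%:R * h = t by rewrite mulrC divfK.
have kh (k : nat) : 0 <= k%:R * h by rewrite mulr_ge0.
have e w : riemann_sum N t (fun s => beta w s ^+ 2) = \sum_(0 <= k < N.+1) h * (B (k%:R * h) w ^+ 2).
  by apply: eq_bigr => k _; rewrite ext_pathE.
under eq_integral do rewrite e.
have ik (k : nat) : P.-integrable setT (EFin \o (fun w => h * (B (k%:R * h) w ^+ 2))).
  by apply: integrable_funZ => //; exact: iB.
rewrite EFin_Rintegral//; last exact: integrable_fun_sum.
rewrite lee_fin Rintegral_sum//.
apply: (@le_trans _ _ (\sum_(0 <= k < N.+1) h * C)).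
  apply: ler_sum => k _; rewrite RintegralZl//; last exact: iB.
  by rewrite ler_wpM2l// -lee_fin -EFin_Rintegral//; [exact: mB|exact: iB].
by rewrite sumr_const_nat subn0 -[leLHS]mulr_natl mulrA Nh mulrC.
Qed.

(** Markov's inequality in pointwise form. [path_E_le] is quadratic in the energy, while the mean of
    its first power is what is bounded; the square root of the inequality is therefore taken, which
    leaves half of the exponent, e^(bt/2). *)
Lemma remainder_large (t del : R) om : 0 <= t -> 0 < del ->
  del <= `|path_E b (beta om) t / expR (b * t)| ->
  1 <= (1 + t + energy t om) / (Num.sqrt (del / (1 + b)) * expR (b / 2 * t)).
Proof.
move=> t0 del0 hd; have d0 := ltW del0; have cb := ext_path_cont B_tfbm (om := om).
have S0 := energy_ge0 t om; set S := energy t om in S0 *.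
have e0 := expR_gt0 (b * t).
have b1 : 0 < 1 + b by rewrite addr_gt0.
have hE := path_E_le b_gt0 cb t0; rewrite -/S in hE.
set s := Num.sqrt _ * _; have s0 : 0 <= s by rewrite mulr_ge0 ?sqrtr_ge0 ?expR_ge0.
have s2 : s ^+ 2 = del / (1 + b) * expR (b * t).
  rewrite exprMn sqr_sqrtr; last by rewrite divr_ge0// ltW.
  by congr (_ * _); rewrite expr2 -expRD; congr expR; field.
have sp : 0 < s by rewrite mulr_gt0 ?expR_gt0// sqrtr_gt0 divr_gt0.
rewrite ler_pdivlMr// mul1r -(@ler_pXn2r _ 2) ?nnegrE//; last by rewrite !addr_ge0.
rewrite s2 mulrAC ler_pdivrMr//.
have h1 : del * expR (b * t) <= `|path_E b (beta om) t|.
  by move: hd; rewrite normrM normfV (gtr0_norm e0) ler_pdivlMr.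
apply: (le_trans h1); apply: (le_trans hE).
have -> : (1 + t + S) ^+ 2 * (1 + b) = S + b * (t + S) ^+ 2 + (1 + 2 * t + S + (t + S) ^+ 2 + b + 2 * b * (t + S)) by ring.
by rewrite lerDl !addr_ge0 ?mulr_ge0 ?sqr_ge0 ?addr_ge0// ltW.
Qed.

End estimators.

Lemma lt_of_dist (R : realType) (u v k : R) : `|u - v| < k -> 2 * k <= v -> k < u.
Proof. by rewrite ltr_norml => /andP[] h1 h2 h3; lra. Qed.

Section error_limit.
Context d (T : measurableType d) (R : realType) (P : probability T R).
Variables (H lambda a b sigma y0 : R) (W B Y : R -> {RV P >-> R}).
Hypotheses (H_gt0 : 0 < H) (lambda_gt0 : 0 < lambda) (b_gt0 : 0 < b) (sigma_gt0 : 0 < sigma).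
Hypotheses (W_wiener : wiener_process W) (B_tfbm : tfbm H lambda W B).
Hypothesis Y_solution : vasicek_solution a b sigma y0 B Y.
Local Notation beta om := (ext_path B om).
Local Notation Z t om := (rv_Z b B t om).
Local Notation Q t om := (rv_Q b B t om).
Local Notation X t om := (rv_X b B t om).
Local Notation eta_of z := (y0 + a / b + b * sigma * z).
Local Notation S t om := (energy B t om).
Variables (F : R * R -> R) (M : R).
Hypotheses (cF : continuous F) (FM : forall z, `|F z| <= M).
Local Notation errF t om := (F (err_a a y0 Y t om, err_b b y0 Y t om)).

(** A stand-in for the indicator of |eta| < rho: at least 1 there, at most 2 everywhere. For rho > 0
    it is continuous, so that its mean passes to the limit in law. *)
Definition eta_bump (rho z : R) : R := 2 * rho ^+ 2 / (eta_of z ^+ 2 + rho ^+ 2).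

Lemma eta_bump_ge0 rho z : 0 <= eta_bump rho z.
Proof. by rewrite divr_ge0 ?addr_ge0 ?sqr_ge0// mulr_ge0 ?sqr_ge0. Qed.

Lemma eta_bump_le2 rho z : `|eta_bump rho z| <= 2.
Proof.
rewrite ger0_norm ?eta_bump_ge0// /eta_bump.
have [->|r0] := eqVneq rho 0; first by rewrite expr0n/= mulr0 mul0r.
have h : 0 < rho ^+ 2 by rewrite exprn_even_gt0.
by rewrite ler_pdivrMr ?ltr_wpDl ?sqr_ge0// ler_wpM2l// lerDr sqr_ge0.
Qed.

Lemma eta_bump_large rho z : 0 < rho -> `|eta_of z| < rho -> 1 <= eta_bump rho z.
Proof.
move=> r0 h; rewrite /eta_bump ler_pdivlMr ?ltr_wpDl ?sqr_ge0 ?exprn_gt0// mul1r.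
have : eta_of z ^+ 2 <= rho ^+ 2.
  by rewrite -[eta_of z ^+ 2]real_normK ?num_real// lerXn2r ?nnegrE// ltW.
by move: (eta_of z ^+ 2) (rho ^+ 2) => u v h1; rewrite mulr2n mulrDl mul1r lerD2r.
Qed.

Lemma eta_bump_continuous rho : 0 < rho -> continuous (fun p : R * R * R => eta_bump rho p.1.1).
Proof.
move=> r0 p; have f1 : (fun s : R * R * R => s.1.1) @ p --> p.1.1.
  by apply: (cvg_comp _ _ (cvg_fst (F := nbhs p.1) (G := nbhs p.2)) (cvg_fst (F := nbhs p.1.1) (G := nbhs p.1.2))).
have h : eta_of p.1.1 ^+ 2 + rho ^+ 2 != 0 by rewrite gt_eqF// ltr_wpDl ?sqr_ge0// exprn_gt0.
rewrite /continuous_at /eta_bump.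
have f2 : (fun s : R * R * R => eta_of s.1.1) @ p --> eta_of p.1.1.
  by apply: cvgD; [exact: cvg_cst|apply: cvgM; [exact: cvg_cst|exact: f1]].
apply: cvgM; first exact: cvg_cst.
apply: cvgV => //; apply: cvgD; last exact: cvg_cst.
by rewrite expr2; under eq_fun do rewrite expr2; exact: cvgM.
Qed.

(** When all remainders are below [del], the modulus gives [e]. Each other case (a coordinate beyond
    [L], eta near 0, a large d3) is paid for by the trivial bound 2 M times a summand that is at
    least 1 there. With this [kap], |eta| >= rho makes the limit denominator eta^2/(2b) at least 2
    kap. *)
Lemma err_pointwise (e L rho del t : R) om (kap := rho ^+ 2 / (4 * b)) :
  0 < e -> 0 < L -> 0 < rho -> 0 < del -> 0 < t ->
  (forall z q x d1 d2 d3 d4 : R, `|z| <= L -> `|q| <= L -> `|x| <= L ->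
    `|d1| < del -> `|d2| < del -> `|d3| < del -> `|d4| < del ->
    `|err_test a b sigma y0 F kap (z, q, x) (d1, d2, d3, d4) -
      err_test a b sigma y0 F kap (z, q, x) (0, 0, 0, 0)| < e /\
    `|err_den a b sigma y0 (z, q, x) (d1, d2, d3, d4) -
      err_den a b sigma y0 (z, q, x) (0, 0, 0, 0)| < kap) ->
  (expR (b * t))^-1 < del -> t / expR (b * t) < del -> t^-1 < del ->
  `|errF t om - limit_test a b sigma y0 F kap (Z t om, Q t om, X t om)| <=
    e + 2 * M * ((Z t om ^+ 2 + Q t om ^+ 2 + X t om ^+ 2) / L ^+ 2 + eta_bump rho (Z t om) +
      (1 + t + S t om) / (Num.sqrt (del / (1 + b)) * expR (b / 2 * t))).
Proof.
move=> e0 L0 rho0 del0 t0 hmod hd1 hd2 hd4; have t0' := ltW t0.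
set z := Z t om; set q := Q t om; set x := X t om.
have M0 : 0 <= M := le_trans (normr_ge0 _) (FM (0, 0)).
have A0 : 0 <= (z ^+ 2 + q ^+ 2 + x ^+ 2) / L ^+ 2 by rewrite divr_ge0 ?addr_ge0 ?sqr_ge0.
have B0 := eta_bump_ge0 rho z.
have C0 : 0 <= (1 + t + S t om) / (Num.sqrt (del / (1 + b)) * expR (b / 2 * t)).
  by rewrite divr_ge0 ?mulr_ge0 ?sqrtr_ge0 ?expR_ge0// !addr_ge0// energy_ge0.
have triv : `|errF t om - limit_test a b sigma y0 F kap (z, q, x)| <= 2 * M.
  have -> : 2 * M = M + M by ring.
  by apply: (le_trans (ler_normB _ _)); exact: lerD (FM _) (FM _).
have big (u : R) : 1 <= u -> 2 * M <= 2 * M * u by move=> u1; rewrite ler_peMr ?mulr_ge0.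
have fin (u : R) : 1 <= u -> u <= (z ^+ 2 + q ^+ 2 + x ^+ 2) / L ^+ 2 + eta_bump rho z +
      (1 + t + S t om) / (Num.sqrt (del / (1 + b)) * expR (b / 2 * t)) ->
   `|errF t om - limit_test a b sigma y0 F kap (z, q, x)| <= e + 2 * M * ((z ^+ 2 + q ^+ 2 + x ^+ 2) / L ^+ 2 + eta_bump rho z +
      (1 + t + S t om) / (Num.sqrt (del / (1 + b)) * expR (b / 2 * t))).
  move=> u1 uS; apply: (le_trans triv); apply: (le_trans (big _ (le_trans u1 uS))).
  by rewrite lerDr ltW.
have le1 (u v w : R) : 0 <= v -> 0 <= w -> u <= u + v + w.
  by move=> v0 w0; rewrite -addrA lerDl addr_ge0.
have le2 (u v w : R) : 0 <= u -> 0 <= w -> v <= u + v + w.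
  by move=> u0 w0; rewrite addrAC lerDr addr_ge0.
have sqbig (v : R) : L < `|v| -> L ^+ 2 <= v ^+ 2.
  by move=> h; rewrite -[v ^+ 2]real_normK ?num_real// lerXn2r ?nnegrE// ltW.
have L2 : 0 < L ^+ 2 by rewrite exprn_gt0.
have [zL|zL] := leP `|z| L; last first.
  apply: (fin ((z ^+ 2 + q ^+ 2 + x ^+ 2) / L ^+ 2)); last exact: le1.
  rewrite ler_pdivlMr// mul1r; apply: (le_trans (sqbig _ zL)).
  by apply: le1; exact: sqr_ge0.
have [qL|qL] := leP `|q| L; last first.
  apply: (fin ((z ^+ 2 + q ^+ 2 + x ^+ 2) / L ^+ 2)); last exact: le1.
  rewrite ler_pdivlMr// mul1r; apply: (le_trans (sqbig _ qL)).
  by apply: le2; exact: sqr_ge0.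
have [xL|xL] := leP `|x| L; last first.
  apply: (fin ((z ^+ 2 + q ^+ 2 + x ^+ 2) / L ^+ 2)); last exact: le1.
  rewrite ler_pdivlMr// mul1r; apply: (le_trans (sqbig _ xL)).
  by rewrite lerDr addr_ge0 ?sqr_ge0.
have [eL|eL] := leP rho `|eta_of z|; last first.
  by apply: (fin (eta_bump rho z)); [exact: eta_bump_large|exact: le2].
have [dL|dL] := ltP `|path_E b (beta om) t / expR (b * t)| del; last first.
  by apply: (fin _ (remainder_large b_gt0 B_tfbm t0' del0 dL)); rewrite lerDr addr_ge0.
set d3 := path_E b (beta om) t / expR (b * t) in dL.
have ep := expR_gt0 (b * t).
have [h1 h2] := hmod z q x (expR (b * t))^-1 (t / expR (b * t)) d3 t^-1 zL qL xL
  ltac:(by rewrite gtr0_norm ?invr_gt0) ltac:(by rewrite gtr0_norm ?divr_gt0) dL ltac:(by rewrite gtr0_norm ?invr_gt0).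
have den0 : err_den a b sigma y0 (z, q, x) (0, 0, 0, 0) = eta_of z ^+ 2 / (2 * b) by rewrite /err_den /= est_den0.
have kap0 : 0 < kap by rewrite divr_gt0 ?mulr_gt0 ?exprn_gt0.
have den1 : kap < err_den a b sigma y0 (z, q, x) ((expR (b * t))^-1, t / expR (b * t), d3, t^-1).
  have : 2 * kap <= eta_of z ^+ 2 / (2 * b).
    have -> : 2 * kap = rho ^+ 2 / (2 * b) by rewrite /kap; field; rewrite gt_eqF.
    rewrite ler_pM2r ?invr_gt0 ?mulr_gt0// -[eta_of z ^+ 2]real_normK ?num_real//.
    by rewrite lerXn2r ?nnegrE ?(ltW rho0).
  by move=> h; apply: (lt_of_dist h2); rewrite den0.
have cb := ext_path_cont B_tfbm (om := om).
have den2 : est_den a b sigma y0 (path_eta a b sigma y0 (beta om) t) (path_Q b (beta om) t) (expR (b * t))^-1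
   (t / expR (b * t)) (path_E b (beta om) t / expR (b * t)) t^-1 != 0.
  by rewrite gt_eqF//; exact: (lt_trans kap0 den1).
have [eA eB] := estimation_error_path b_gt0 cb t0
  (fun s hs => vasicek_pathE b_gt0 B_tfbm Y_solution om (proj1 (andP hs))) den2.
have xE : ext_path B om t - b * path_Q b (ext_path B om) t = x by rewrite /x /rv_X /rv_Q ext_pathE.
rewrite xE in eA eB.
have -> : errF t om = err_test a b sigma y0 F kap (z, q, x) ((expR (b * t))^-1, t / expR (b * t), d3, t^-1).
  by rewrite /err_a /err_b eA eB /err_test max_l//; exact: ltW.
apply: (le_trans (ltW h1)); rewrite lerDl mulr_ge0 ?mulr_ge0// !addr_ge0//.
Qed.

Context d' (T' : measurableType d') (P' : probability T' R).
Variables (xi1 xi2 xi3 : {RV P' >-> R}).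
Hypothesis xi_gauss : gaussian_triple P' H lambda b xi1 xi2 xi3.
Local Notation limF w := (F (b * sigma * xi2 w - sigma * xi3 w, 2 * b * sigma * xi3 w / eta_of (xi1 w))).

Lemma measurable_limit_errors :
  measurable_fun setT (fun w => b * sigma * xi2 w - sigma * xi3 w) /\
  measurable_fun setT (fun w => 2 * b * sigma * xi3 w / eta_of (xi1 w)).
Proof.
split; first by apply: measurable_funB; apply: measurable_funM.
apply: measurable_funM; first exact: measurable_funM.
by apply: measurable_fun_inv; apply: measurable_funD => //; apply: measurable_funM.
Qed.

(** For |eta| >= rho the truncation in [limit_test] is inactive and the two sides agree; otherwise
    the bump is at least 1. *)
Lemma limit_pointwise (rho : R) w : 0 < rho ->
  `|limF w - limit_test a b sigma y0 F (rho ^+ 2 / (4 * b)) (xi1 w, xi2 w, xi3 w)| <=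
    2 * M * eta_bump rho (xi1 w).
Proof.
move=> rho0; have M0 : 0 <= M := le_trans (normr_ge0 _) (FM (0, 0)).
have [eL|eL] := leP rho `|eta_of (xi1 w)|; last first.
  apply: (@le_trans _ _ (2 * M)); last by rewrite ler_peMr ?mulr_ge0// eta_bump_large.
  have -> : 2 * M = M + M by ring.
  by apply: (le_trans (ler_normB _ _)); exact: lerD (FM _) (FM _).
have k0 : 0 < rho ^+ 2 / (4 * b) by rewrite divr_gt0 ?mulr_gt0 ?exprn_gt0.
have hk : rho ^+ 2 / (4 * b) <= eta_of (xi1 w) ^+ 2 / (2 * b).
  rewrite -[eta_of _ ^+ 2]real_normK ?num_real//.
  apply: (@le_trans _ _ (rho ^+ 2 / (2 * b))); last first.
    by rewrite ler_pM2r ?invr_gt0 ?mulr_gt0// lerXn2r ?nnegrE ?(ltW rho0).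
  by rewrite ler_wpM2l ?sqr_ge0// lef_pV2 ?posrE ?mulr_gt0// ler_pM2r// ler_nat.
rewrite limit_testE// subrr normr0; apply: mulr_ge0; first exact: mulr_ge0.
exact: eta_bump_ge0.
Qed.

Lemma eta_neq0 : {ae P', forall w, eta_of (xi1 w) != 0}.
Proof.
have [_ h _] := xi_gauss.
exists [set w | xi1 w = - (y0 + a / b) / (b * sigma)]; split => //.
- by have := measurable_preimage (measurable_funPT xi1) (measurable_set1 (- (y0 + a / b) / (b * sigma))); apply.
- move=> w /= /negP; rewrite negbK => /eqP e.
  have bs : b * sigma != 0 by rewrite mulf_neq0 ?gt_eqF.
  apply: (mulfI bs); rewrite [RHS]mulrC divfK//; apply/eqP; rewrite -subr_eq0 opprK addrC e//.
Qed.

(** The bump tends to 0 wherever eta is nonzero, which is almost sure because xi1 has no atoms. *)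
Lemma cvg_bump_mean : \int[P']_w eta_bump n.+1%:R^-1 (xi1 w) @[n --> \oo] --> 0.
Proof.
have -> : 0 = \int[P']_w (0 : R) by rewrite Rintegral_prob_cst.
have mb n : measurable_fun setT (fun w => eta_bump n.+1%:R^-1 (xi1 w)).
  apply: measurable_funM => //; apply: measurable_fun_inv; apply: measurable_funD => //.
  by apply: measurable_funX; apply: measurable_funD => //; apply: measurable_funM.
apply: (@cvg_Rintegral_ae _ _ _ P' setT _ (fun n w => eta_bump n.+1%:R^-1 (xi1 w)) (fun=> 0) (fun=> 2)) => //.
- have [N [mN N0 hN]] := eta_neq0; exists N; split => // w /= nw; apply: hN => /= e0; apply: nw => _.
  rewrite /eta_bump.
  have h : (n.+1%:R^-1 : R) @[n --> \oo] --> (0 : R) by exact: cvg_harmonic.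
  have -> : 0 = 2 * 0 ^+ 2 / (eta_of (xi1 w) ^+ 2 + 0 ^+ 2) by rewrite expr0n/= mulr0 mul0r.
  have nz : eta_of (xi1 w) ^+ 2 + 0 ^+ 2 != 0 by rewrite expr0n addr0 expf_neq0.
  have aux (k : R) (u : nat -> R) : k + 0 ^+ 2 != 0 -> u n @[n --> \oo] --> (0 : R) ->
      2 * u n ^+ 2 / (k + u n ^+ 2) @[n --> \oo] --> 2 * 0 ^+ 2 / (k + 0 ^+ 2).
    by move=> k0 hu; cvg_tac.
  exact: (aux _ _ nz h).
- by apply: (integrable_bounded P' (M := 2)) => // w; rewrite ger0_norm.
- by move=> n w _; exact: eta_bump_le2.
Qed.

End error_limit.

Section dominated_difference.
Context d (T : measurableType d) (R : realType) (P : probability T R).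

Lemma norm_Rintegral_sub_le (f g h : T -> R) : P.-integrable setT (EFin \o f) ->
  P.-integrable setT (EFin \o g) -> P.-integrable setT (EFin \o h) ->
  (forall w, `|f w - g w| <= h w) -> `|\int[P]_w f w - \int[P]_w g w| <= \int[P]_w h w.
Proof.
move=> jf jg jh fgh; rewrite -RintegralB//.
apply: (le_trans (le_normr_Rintegral _ _)) => //; first exact: integrable_funB.
by apply: le_Rintegral => //; apply: integrable_norm => //; exact: integrable_funB.
Qed.

Lemma integrable_mean_le (f : T -> R) (C : R) : measurable_fun setT f -> (forall w, 0 <= f w) ->
  (\int[P]_w (f w)%:E <= C%:E)%E -> P.-integrable setT (EFin \o f) /\ \int[P]_w f w <= C.
Proof.
move=> mf f0 fC; have jf : P.-integrable setT (EFin \o f).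
  apply/integrableP; split; first exact/measurable_EFinP.
  rewrite (_ : (fun x => _) = fun x => (f x)%:E); first by rewrite (le_lt_trans fC)// ltry.
  by apply/funext => x /=; rewrite ger0_norm.
by split => //; rewrite -lee_fin -EFin_Rintegral.
Qed.

End dominated_difference.

Section error_limit_mean.
Context d (T : measurableType d) (R : realType) (P : probability T R).
Variables (H lambda a b sigma y0 : R) (W B Y : R -> {RV P >-> R}).
Hypotheses (H_gt0 : 0 < H) (lambda_gt0 : 0 < lambda) (b_gt0 : 0 < b) (sigma_gt0 : 0 < sigma).
Hypotheses (W_wiener : wiener_process W) (B_tfbm : tfbm H lambda W B).
Hypothesis Y_solution : vasicek_solution a b sigma y0 B Y.
Context d' (T' : measurableType d') (P' : probability T' R).
Variables (xi1 xi2 xi3 : {RV P' >-> R}).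
Hypothesis xi_gauss : gaussian_triple P' H lambda b xi1 xi2 xi3.
Variables (F : R * R -> R) (M : R).
Hypotheses (cF : continuous F) (FM : forall z, `|F z| <= M).
Local Notation eta_of z := (y0 + a / b + b * sigma * z).
Local Notation errF t om := (F (err_a a y0 Y t om, err_b b y0 Y t om)).
Local Notation limF w := (F (b * sigma * xi2 w - sigma * xi3 w, 2 * b * sigma * xi3 w / eta_of (xi1 w))).
Variable t : nat -> R.
Hypotheses (t0 : forall n, 0 < t n) (tn : t n @[n --> \oo] --> +oo).

Lemma measurable_test2 d1 (S : measurableType d1) (u v : S -> R) : measurable_fun setT u ->
  measurable_fun setT v -> measurable_fun setT (fun s => F (u s, v s)).
Proof.
move=> mu mv; have cf : continuous (fun p : R * R * R => F p.1).
  by move=> p; apply: continuous_comp; [exact: cvg_fst|exact: cF].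
by apply: (measurable_continuous_comp3 cf (fun z => FM z.1) (z := fun=> 0)).
Qed.

Lemma integrable_test2 d1 (S : measurableType d1) (Q : probability S R) (u v : S -> R) :
  measurable_fun setT u -> measurable_fun setT v -> Q.-integrable setT (EFin \o (fun s => F (u s, v s))).
Proof. by move=> mu mv; apply: (integrable_bounded Q (M := M)) => //; exact: measurable_test2. Qed.

(** The order of the choices matters: the cube [L] from the second moments, the threshold [rho] from
    the limit law, [del] from the modulus on that cube, and the time last. *)
Lemma cvg_err_mean : \int[P]_w errF (t n) w @[n --> \oo] --> \int[P']_w limF w.
Proof.
apply/cvgrPdist_le => eps eps0.
have M0 : 0 <= M := le_trans (normr_ge0 _) (FM (0, 0)).
have M1 : 0 < 10 * (1 + M) by rewrite mulr_gt0// ltr_pwDl.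
(* The errors collected at the end amount to (2 + 10 M) e. *)
pose e := eps / (10 * (1 + M)); have e0 : 0 < e by rewrite divr_gt0.
have eE : eps = 10 * (1 + M) * e by rewrite /e mulrC divfK// gt_eqF.
clearbody e.
have [C [[m1 m2 m3] [m4 _ _]]] := rv_moments H_gt0 lambda_gt0 b_gt0 W_wiener B_tfbm xi_gauss t0 tn.
have C0 : 0 <= C.
  by rewrite -lee_fin (le_trans _ m4)// integral_ge0// => x _; rewrite lee_fin sqr_ge0.
have C1 : 0 < 3 * C + 1 by rewrite ltr_wpDl// mulr_ge0.
pose L := Num.sqrt ((3 * C + 1) / e).
have L0 : 0 < L by rewrite sqrtr_gt0 divr_gt0.
have L2 : 3 * C / L ^+ 2 <= e.
  rewrite sqr_sqrtr; last by rewrite ltW// divr_gt0.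
  have -> : 3 * C / ((3 * C + 1) / e) = e * (3 * C / (3 * C + 1)) by field; rewrite !gt_eqF.
  by rewrite ler_piMr ?(ltW e0)// ler_pdivrMr// mul1r lerDl.
clearbody L.
have [m _ hm] := cvgr_le 0 (cvg_bump_mean a y0 b_gt0 sigma_gt0 xi_gauss) e e0.
have {}hm := hm m (leqnn m); move: hm; set rho : R := m.+1%:R^-1 => hm.
have rho0 : 0 < rho by rewrite invr_gt0.
clearbody rho.
pose kap := rho ^+ 2 / (4 * b).
have kap0 : 0 < kap by rewrite divr_gt0 ?mulr_gt0 ?exprn_gt0.
have [del del0 hdel] := error_modulus a b sigma y0 cF kap0 L e0.
have b1 : 0 < 1 + b by rewrite addr_gt0.
pose k := Num.sqrt (del / (1 + b)); have k0 : 0 < k by rewrite sqrtr_gt0 divr_gt0.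
pose CB := 2 / gauss_cf (2 * acov H lambda 0).
have CB0 : 0 <= CB.
  by rewrite divr_ge0// ltW// (gauss_cf_gt0 W_wiener)// mulr_ge0// acov_ge0.
have CB2 : 0 < 2 + CB by rewrite ltr_pwDl.
have b2 : 0 < b / 2 by rewrite divr_gt0.
(* For t >= 1, 1 + t + CB t <= (2 + CB) t, so this bound on t e^(-bt/2) keeps the energy term below
   [e]. *)
have ek : 0 < e * k / (2 + CB) by apply: divr_gt0 => //; exact: mulr_gt0.
have [A1 _ hA1] := mul_expRN_near b2 ek.
have [A2 _ hA2] := mul_expRN_near b_gt0 del0.
(* The four thresholds provide t >= 1, the energy bound, t e^(-bt) < del and 1/t < del; the bound on
   e^(-bt) follows from the first and third. *)
have /cvgryPge/(_ (Num.max 1 (Num.max A1 (Num.max A2 (1 + del^-1)))))[n0 _ hn0] := tn.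
pose lt := limit_test a b sigma y0 F kap.
have clt : continuous lt by exact: limit_test_continuous.
have ltM p : `|lt p| <= M by exact: FM.
have /cvgrPdist_le/(_ e e0)[n1 _ hn1] :=
  cvg_rv_law H_gt0 lambda_gt0 b_gt0 W_wiener B_tfbm xi_gauss t0 tn clt ltM.
pose bump (p : R * R * R) := eta_bump a b sigma y0 rho p.1.1.
have cbump : continuous bump by exact: eta_bump_continuous.
have bump2 p : `|bump p| <= 2 by exact: eta_bump_le2.
have /cvgrPdist_le/(_ e e0)[n2 _ hn2] :=
  cvg_rv_law H_gt0 lambda_gt0 b_gt0 W_wiener B_tfbm xi_gauss t0 tn cbump bump2.
exists (maxn n0 (maxn n1 n2)) => // n; rewrite /= !geq_max => /andP[/hn0 /= tnA /andP[/hn1 /= ln /hn2 /= bn]].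
move: tnA; rewrite !ge_max => /andP[t1 /andP[tA1 /andP[tA2 td]]].
have tp := t0 n; have tp' := ltW tp.
have mZ := measurable_rv_Z b B_tfbm tp'; have mQ := measurable_rv_Q b B_tfbm tp'.
have mX := measurable_rv_X b B_tfbm tp'.
have [iZ hZ] := integrable_mean_le (measurable_funX 2 mZ) (fun w => sqr_ge0 _) (m1 n).
have [iQ hQ] := integrable_mean_le (measurable_funX 2 mQ) (fun w => sqr_ge0 _) (m2 n).
have [iX hX] := integrable_mean_le (measurable_funX 2 mX) (fun w => sqr_ge0 _) (m3 n).
have [iS hS] := integrable_mean_le (measurable_energy B_tfbm tp') (energy_ge0 B (t n))
  (energy_mean H_gt0 lambda_gt0 W_wiener B_tfbm tp').
have [mU mV] := measurable_err b_gt0 B_tfbm Y_solution tp'.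
have iF := integrable_test2 P mU mV.
have [mU' mV'] := measurable_limit_errors a b sigma y0 xi1 xi2 xi3.
have iF' := integrable_test2 P' mU' mV'.
have ilt : P.-integrable setT (EFin \o (fun w => lt (rv_Z b B (t n) w, rv_Q b B (t n) w, rv_X b B (t n) w))).
  by apply: (integrable_bounded P (M := M)) => //; apply: (measurable_continuous_comp3 clt ltM).
have ilt' : P'.-integrable setT (EFin \o (fun w => lt (xi1 w, xi2 w, xi3 w))).
  by apply: (integrable_bounded P' (M := M)) => //; apply: (measurable_continuous_comp3 clt ltM).
have ibu : P.-integrable setT (EFin \o (fun w => bump (rv_Z b B (t n) w, rv_Q b B (t n) w, rv_X b B (t n) w))).
  by apply: (integrable_bounded P (M := 2)) => //; apply: (measurable_continuous_comp3 cbump bump2).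
have ibu' : P'.-integrable setT (EFin \o (fun w => bump (xi1 w, xi2 w, xi3 w))).
  by apply: (integrable_bounded P' (M := 2)) => //; apply: (measurable_continuous_comp3 cbump bump2).
have icst (c : R) : P.-integrable setT (EFin \o (fun=> c)).
  by apply: (integrable_bounded P (M := `|c|)).
pose s := k * expR (b / 2 * t n); have s0 : 0 < s by rewrite mulr_gt0 ?expR_gt0.
have sE : s^-1 = k^-1 * expR (- (b / 2 * t n)) by rewrite /s invfM expRN.
have hs : (1 + t n + CB * t n) / s <= e.
  apply: (@le_trans _ _ ((2 + CB) * t n / s)).
    rewrite ler_pM2r ?invr_gt0// mulrDl lerD2r mulr2n mulrDl mul1r lerD2r//.
  rewrite sE; have -> : (2 + CB) * t n * (k^-1 * expR (- (b / 2 * t n))) =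
    (2 + CB) / k * (t n * expR (- (b / 2 * t n))) by ring.
  apply: (@le_trans _ _ ((2 + CB) / k * (e * k / (2 + CB)))).
    by rewrite ler_wpM2l ?divr_ge0 ?(ltW CB2) ?(ltW k0)// ltW// hA1.
  by rewrite le_eqVlt; apply/orP; left; apply/eqP; field; rewrite !gt_eqF.
have d2 : t n / expR (b * t n) < del by rewrite -expRN hA2.
have d1 : (expR (b * t n))^-1 < del.
  by apply: (le_lt_trans _ d2); rewrite ler_peMl ?invr_ge0 ?expR_ge0.
have d4 : (t n)^-1 < del.
  rewrite -[del]invrK ltf_pV2 ?posrE ?invr_gt0//; apply: (lt_le_trans _ td).
  by rewrite ltrDr.
have P1 w := err_pointwise b_gt0 B_tfbm Y_solution FM w e0 L0 rho0 del0 tp hdel d1 d2 d4.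
pose bd w := e + 2 * M * ((rv_Z b B (t n) w ^+ 2 + rv_Q b B (t n) w ^+ 2 + rv_X b B (t n) w ^+ 2) / L ^+ 2 +
   bump (rv_Z b B (t n) w, rv_Q b B (t n) w, rv_X b B (t n) w) + (1 + t n + energy B (t n) w) / s).
have iD (f g : T -> R) : P.-integrable setT (EFin \o f) -> P.-integrable setT (EFin \o g) ->
    P.-integrable setT (EFin \o (fun w => f w + g w)) by exact: integrable_funD.
have iM (f : T -> R) (c : R) : P.-integrable setT (EFin \o f) ->
    P.-integrable setT (EFin \o (fun w => f w * c)).
  by move=> jf; under [X in EFin \o X]eq_fun do rewrite mulrC; exact: integrable_funZ.
have j1 : P.-integrable setT (EFin \o (fun w => (rv_Z b B (t n) w ^+ 2 + rv_Q b B (t n) w ^+ 2 + rv_X b B (t n) w ^+ 2) / L ^+ 2)).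
  by apply: iM; apply: (iD (fun w => _ + _)) => //; exact: iD.
have j2 : P.-integrable setT (EFin \o (fun w => (1 + t n + energy B (t n) w) / s)).
  by apply: iM; apply: (iD (fun w => _)).
have j3 := iD _ _ (iD _ _ j1 ibu) j2.
have j4 := integrable_funZ measurableT (2 * M) j3.
have ibd : P.-integrable setT (EFin \o bd) by exact: iD.
have E1 := norm_Rintegral_sub_le iF ilt ibd P1.
have RM (f : T -> R) (c : R) : P.-integrable setT (EFin \o f) -> \int[P]_w (f w * c) = c * \int[P]_w f w.
  by move=> jf; under eq_Rintegral do rewrite mulrC; rewrite RintegralZl.
have Ebd : \int[P]_w bd w <= e + 2 * M * (e + (e + e) + e).
  rewrite /bd RintegralD// Rintegral_prob_cst lerD2l RintegralZl// ler_wpM2l ?mulr_ge0//.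
  rewrite RintegralD//; last exact: iD.
  rewrite RintegralD//; apply: lerD; first apply: lerD.
  - rewrite RM; last by apply: (iD (fun w => _ + _)) => //; exact: iD.
    rewrite RintegralD//; last exact: iD.
    rewrite RintegralD// mulrC; apply: le_trans L2; rewrite ler_pM2r ?invr_gt0 ?exprn_gt0//.
    by rewrite (_ : 3 * C = C + C + C); [rewrite !lerD|ring].
  (* The mean of the bump at time t is within [e] of its mean under the limit law, which is at most
     [e]. *)
  - move: bn; rewrite ler_norml => /andP[+ _]; rewrite lerBrDr addrC lerBlDr => bn.
    by apply: (le_trans bn); exact: lerD hm (lexx e).
  - rewrite RM; last by apply: (iD (fun w => _)).
    rewrite RintegralD// Rintegral_prob_cst mulrC; apply: le_trans hs.
    by rewrite ler_pM2r ?invr_gt0// lerD2l.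
have iD' : P'.-integrable setT (EFin \o (fun w => 2 * M * bump (xi1 w, xi2 w, xi3 w))) by exact: integrable_funZ.
have E2 := norm_Rintegral_sub_le iF' ilt' iD' (fun w => limit_pointwise a sigma y0 b_gt0 FM xi1 xi2 xi3 w rho0).
have E3 : \int[P']_w (2 * M * bump (xi1 w, xi2 w, xi3 w)) <= 2 * M * e.
  by rewrite RintegralZl// ler_wpM2l ?mulr_ge0.
rewrite eE.
set I1 := \int[P']_w _ in E2 *; set I2 := \int[P]_w errF _ _ in E1 *.
set I3 := \int[P]_w _ in E1 ln; set I4 := \int[P']_w _ in E2 ln.
have -> : I1 - I2 = (I1 - I4) + (I4 - I3) - (I2 - I3) by ring.
rewrite (le_trans (ler_normB _ _))//.
apply: (@le_trans _ _ ((2 * M * e + e) + (e + 2 * M * (e + (e + e) + e)))).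
  apply: lerD; last exact: le_trans E1 Ebd.
  rewrite (le_trans (ler_normD _ _))// lerD//; exact: le_trans E2 E3.
have Me : 0 <= M * e by rewrite mulr_ge0// ltW.
have -> : 10 * (1 + M) * e = 10 * e + 10 * (M * e) by ring.
have -> : 2 * M * e + e + (e + 2 * M * (e + (e + e) + e)) = 2 * e + 10 * (M * e) by ring.
by rewrite lerD2r ler_pM2r// ler_nat.
Qed.

End error_limit_mean.

(** * Dependence of the limit errors *)

Section gaussian_symmetries.
Context d (T : measurableType d) (R : realType) (P : probability T R).
Variables (H lambda b : R) (W : R -> {RV P >-> R}).
Hypotheses (H_gt0 : 0 < H) (lambda_gt0 : 0 < lambda) (b_gt0 : 0 < b).
Hypothesis W_wiener : wiener_process W.
Context d' (T' : measurableType d') (P' : probability T' R).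
Variables (xi1 xi2 xi3 : {RV P' >-> R}).
Hypothesis xi_gauss : gaussian_triple P' H lambda b xi1 xi2 xi3.

(** A linear map that preserves the quadratic form preserves the law: the image, taken as a constant
    sequence, has the characteristic function of the original, and [trigonometric_cvg] equates the
    means. *)
Lemma gaussian_triple_sym (p q r : R) (f : R * R * R -> R) (M : R) :
  (forall c1 c2 c3, Sigma_form H lambda b (c1 + p * c2) (q * c2) (r * c3) = Sigma_form H lambda b c1 c2 c3) ->
  continuous f -> (forall z, `|f z| <= M) ->
  \int[P']_w f (xi1 w, p * xi1 w + q * xi2 w, r * xi3 w) = \int[P']_w f (xi1 w, xi2 w, xi3 w).
Proof.
move=> hS cf fM; have [hc _ _] := xi_gauss.
have [C1 h1] := xi_moment H_gt0 lambda_gt0 b_gt0 W_wiener xi_gauss 1 0 0.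
have [C2 h2] := xi_moment H_gt0 lambda_gt0 b_gt0 W_wiener xi_gauss 0 1 0.
have [C3 h3] := xi_moment H_gt0 lambda_gt0 b_gt0 W_wiener xi_gauss 0 0 1.
have [C4 h4] := xi_moment H_gt0 lambda_gt0 b_gt0 W_wiener xi_gauss p q 0.
have [C5 h5] := xi_moment H_gt0 lambda_gt0 b_gt0 W_wiener xi_gauss 0 0 r.
pose C := Num.max C1 (Num.max C2 (Num.max C3 (Num.max C4 C5))).
have mom (y : T' -> R) (c1 c2 c3 D : R) :
    (\int[P']_w ((c1 * xi1 w + c2 * xi2 w + c3 * xi3 w) ^+ 2)%:E <= D%:E)%E -> D <= C ->
    (forall w, c1 * xi1 w + c2 * xi2 w + c3 * xi3 w = y w) -> (\int[P']_w (y w ^+ 2)%:E <= C%:E)%E.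
  by move=> hD DC e; under eq_integral do rewrite -e; apply: (le_trans hD); rewrite lee_fin.
have k1 : C1 <= C by rewrite /C !le_max lexx.
have k2 : C2 <= C by rewrite /C !le_max lexx !orbT.
have k3 : C3 <= C by rewrite /C !le_max lexx !orbT.
have k4 : C4 <= C by rewrite /C !le_max lexx !orbT.
have k5 : C5 <= C by rewrite /C !le_max lexx !orbT.
have m1 : (\int[P']_w (xi1 w ^+ 2)%:E <= C%:E)%E by apply: (mom _ _ _ _ _ h1 k1) => w; ring.
have m2 : (\int[P']_w (xi2 w ^+ 2)%:E <= C%:E)%E by apply: (mom _ _ _ _ _ h2 k2) => w; ring.
have m3 : (\int[P']_w (xi3 w ^+ 2)%:E <= C%:E)%E by apply: (mom _ _ _ _ _ h3 k3) => w; ring.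
have m4 : (\int[P']_w ((p * xi1 w + q * xi2 w) ^+ 2)%:E <= C%:E)%E.
  by apply: (mom _ _ _ _ _ h4 k4) => w; ring.
have m5 : (\int[P']_w ((r * xi3 w) ^+ 2)%:E <= C%:E)%E by apply: (mom _ _ _ _ _ h5 k5) => w; ring.
have my2 : measurable_fun setT (fun w => p * xi1 w + q * xi2 w).
  by apply: measurable_funD; apply: measurable_funM.
have my3 : measurable_fun setT (fun w => r * xi3 w) by apply: measurable_funM.
have key : \int[P']_w f (xi1 w, p * xi1 w + q * xi2 w, r * xi3 w) @[n --> \oo] -->
    \int[P']_w f (xi1 w, xi2 w, xi3 w).
  apply: (@trigonometric_cvg _ T' _ T' R P' P' (fun n : nat => xi1) (fun n w => p * xi1 w + q * xi2 w)
     (fun n w => r * xi3 w) xi1 xi2 xi3 C _ _ _ _ _ _ _ (fun=> m1) (fun=> m4) (fun=> m5) m1 m2 m3 f M cf fM) => //.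
  move=> c1 c2 c3 phi.
  have -> : \int[P']_w cos (c1 * xi1 w + c2 * xi2 w + c3 * xi3 w + phi) =
      \int[P']_w cos (c1 * xi1 w + c2 * (p * xi1 w + q * xi2 w) + c3 * (r * xi3 w) + phi).
    have a1 := hc c1 c2 c3 1 phi; have a2 := hc (c1 + p * c2) (q * c2) (r * c3) 1 phi.
    rewrite hS -a1 in a2; transitivity (\int[P']_w cos (1 * (c1 * xi1 w + c2 * xi2 w + c3 * xi3 w) + phi)).
      by apply: eq_Rintegral => w _; rewrite mul1r.
    rewrite -a2; apply: eq_Rintegral => w _; congr cos; ring.
  exact: cvg_cst.
exact: (cvg_unique _ (cvg_cst _) key).
Qed.

End gaussian_symmetries.

Lemma double_prod_le (R : realType) (c x n : R) : 0 <= c -> `|2 * n * x| <= n ^+ 2 + x ^+ 2 + c.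
Proof.
move=> c0; have h1 := sqr_ge0 (n + x); have h2 := sqr_ge0 (n - x).
have e1 : (n + x) ^+ 2 = n ^+ 2 + x ^+ 2 + 2 * n * x by ring.
have e2 : (n - x) ^+ 2 = n ^+ 2 + x ^+ 2 - 2 * n * x by ring.
by rewrite ler_norml; apply/andP; split; lra.
Qed.

(** Gives an integrable majorant of |b xi1 + kap| |xi3| from the second moments of b xi1 and xi3. *)
Lemma norm_product_le (R : realType) (p k n : R) :
  `|p + k| * `|n| <= 2 * p ^+ 2 + n ^+ 2 + 2 * k ^+ 2.
Proof.
rewrite -normrM; have h := double_prod_le (p + k) n (lexx 0).
have e : 2 * n * (p + k) = 2 * ((p + k) * n) by ring.
rewrite e normrM normr_nat in h.
have h1 := sqr_ge0 (p - k); have h2 := sqr_ge0 n; have h3 := sqr_ge0 p; have h4 := sqr_ge0 k.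
have e1 : (p + k) ^+ 2 = p ^+ 2 + k ^+ 2 + 2 * (p * k) by ring.
have e2 : (p - k) ^+ 2 = p ^+ 2 + k ^+ 2 - 2 * (p * k) by ring.
by lra.
Qed.

Section limit_dependence.
Context d (T : measurableType d) (R : realType) (P : probability T R).
Variables (H lambda a b sigma y0 : R) (W : R -> {RV P >-> R}).
Hypotheses (H_gt0 : 0 < H) (lambda_gt0 : 0 < lambda) (b_gt0 : 0 < b) (sigma_gt0 : 0 < sigma).
Hypothesis W_wiener : wiener_process W.
Context d' (T' : measurableType d') (P' : probability T' R).
Variables (xi1 xi2 xi3 : {RV P' >-> R}).
Hypothesis xi_gauss : gaussian_triple P' H lambda b xi1 xi2 xi3.

Local Notation kap := ((y0 + a / b) / sigma).
Local Notation et w := (b * xi1 w + kap).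
Local Notation ze w := (b * xi2 w - b * xi1 w).

(** For c = 0 this is h, discontinuous at the origin; c > 0 makes it continuous, as the symmetry of
    the law is available for continuous functions. At the origin the quotient 0/0 is 0, which is
    also the limit as c tends to 0. *)
Definition ratio_reg (c x n : R) : R := 2 * n * x / (n ^+ 2 + x ^+ 2 + c).

Lemma ratio_reg_le1 c x n : 0 <= c -> `|ratio_reg c x n| <= 1.
Proof.
move=> c0; rewrite /ratio_reg normrM normfV.
have D0 : 0 <= n ^+ 2 + x ^+ 2 + c by rewrite !addr_ge0 ?sqr_ge0.
have h : `|2 * n * x| <= n ^+ 2 + x ^+ 2 + c.
  exact: double_prod_le.
rewrite (ger0_norm D0); have [->|Dn] := eqVneq (n ^+ 2 + x ^+ 2 + c) 0; first by rewrite invr0 mulr0.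
by rewrite ler_pdivrMr ?mul1r// lt_def Dn.
Qed.

Lemma ratio_reg_continuous c (f g : R * R * R -> R) : 0 < c -> continuous f -> continuous g ->
  continuous (fun p => ratio_reg c (f p) (g p)).
Proof.
move=> c0 cf cg p; have hf := cf p; have hg := cg p.
have nz : g p ^+ 2 + f p ^+ 2 + c != 0 by rewrite gt_eqF// ltr_wpDl// addr_ge0 ?sqr_ge0.
rewrite /continuous_at /ratio_reg; cvg_tac.
Qed.

Lemma ratio_reg_cvg x n : ratio_reg k.+1%:R^-1 x n @[k --> \oo] --> ratio_reg 0 x n.
Proof.
have [e|nz] := eqVneq (n ^+ 2 + x ^+ 2) 0.
  have x0 : x = 0.
    apply/eqP; rewrite -sqrf_eq0; move/eqP: e; rewrite paddr_eq0 ?sqr_ge0// => /andP[_] //.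
  rewrite /ratio_reg x0 mulr0 mul0r (_ : (fun k => _) = fun=> 0); first exact: cvg_cst.
  by apply/funext => k; rewrite mul0r.
have h : (k.+1%:R^-1 : R) @[k --> \oo] --> (0 : R) by exact: cvg_harmonic.
have aux (u : nat -> R) : u k @[k --> \oo] --> (0 : R) -> ratio_reg (u k) x n @[k --> \oo] --> ratio_reg 0 x n.
  have nz' : n ^+ 2 + x ^+ 2 + 0 != 0 by rewrite addr0.
  by move=> hu; rewrite /ratio_reg; cvg_tac.
exact: aux.
Qed.

(** In the variables of [Sigma_formE], the map xi2 |-> 2 xi1 - xi2 changes the sign of b xi2 - b
    xi1; the next lemma does the same for xi3. *)
Lemma Sigma_form_sym2 c1 c2 c3 : Sigma_form H lambda b (c1 + 2 * c2) (- 1 * c2) (1 * c3) = Sigma_form H lambda b c1 c2 c3.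
Proof. by rewrite !Sigma_formE//; ring. Qed.

Lemma Sigma_form_sym3 c1 c2 c3 : Sigma_form H lambda b (c1 + 0 * c2) (1 * c2) (- 1 * c3) = Sigma_form H lambda b c1 c2 c3.
Proof. by rewrite !Sigma_formE//; ring. Qed.

(* G is averaged over the law-preserving maps (zeta, n) |-> (+-zeta, +-n). *)
Lemma symmetrized_mean (u c : R) : 0 < c ->
  \int[P']_w (cos (u * (b * xi2 w + kap - xi3 w)) * ratio_reg c (et w) (xi3 w)) =
  \int[P']_w (sin (u * et w) * sin (u * xi3 w) * cos (u * ze w) * ratio_reg c (et w) (xi3 w)).
Proof.
move=> c0; pose G (s : R) (p : R * R * R) :=
  cos (u * (b * p.1.2 + kap - s * p.2)) * ratio_reg c (b * p.1.1 + kap) (s * p.2).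
have cG s : continuous (G s).
  have f1 : continuous (fun p : R * R * R => b * p.1.1 + kap).
    move=> p; apply: cvgD; last exact: cvg_cst.
    apply: cvgM; first exact: cvg_cst.
    exact: (cvg_comp _ _ (cvg_fst (F := nbhs p.1) (G := nbhs p.2)) (cvg_fst (F := nbhs p.1.1) (G := nbhs p.1.2))).
  have f3 : continuous (fun p : R * R * R => s * p.2).
    by move=> p; apply: cvgM; [exact: cvg_cst|exact: cvg_snd].
  move=> p; apply: cvgM; last exact: ratio_reg_continuous.
  apply: (cvg_comp_continuous (h := cos)); first exact: continuous_cos.
  apply: cvgM; first exact: cvg_cst.
  apply: cvgB; last exact: f3.
  apply: cvgD; last exact: cvg_cst.
  apply: cvgM; first exact: cvg_cst.
  exact: (cvg_comp _ _ (cvg_fst (F := nbhs p.1) (G := nbhs p.2)) (cvg_snd (F := nbhs p.1.1) (G := nbhs p.1.2))).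
have GM s p : `|G s p| <= 1.
  by rewrite normrM -[leRHS]mul1r ler_pM ?cos_max// ratio_reg_le1// ltW.
have mG s y2 y3 : measurable_fun setT y2 -> measurable_fun setT y3 ->
    P'.-integrable setT (EFin \o (fun w => G s (xi1 w, y2 w, y3 w))).
  move=> m2 m3; apply: (integrable_bounded P' (M := 1)) => //.
  exact: (measurable_continuous_comp3 (cG s) (GM s)).
have m2 : measurable_fun setT (fun w => 2 * xi1 w + - 1 * xi2 w).
  by apply: measurable_funD; apply: measurable_funM.
have m1 : measurable_fun setT (fun w => 1 * xi3 w) by apply: measurable_funM.
have e1 := gaussian_triple_sym H_gt0 lambda_gt0 b_gt0 W_wiener xi_gauss Sigma_form_sym2 (cG 1) (GM 1).
have e2 := gaussian_triple_sym H_gt0 lambda_gt0 b_gt0 W_wiener xi_gauss Sigma_form_sym3 (cG 1) (GM 1).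
have e3 := gaussian_triple_sym H_gt0 lambda_gt0 b_gt0 W_wiener xi_gauss Sigma_form_sym2 (cG (- 1)) (GM (- 1)).
set I := \int[P']_w G 1 (xi1 w, xi2 w, xi3 w) in e1 e2.
have e4 : \int[P']_w G (- 1) (xi1 w, xi2 w, xi3 w) = I.
  rewrite -e2; apply: eq_Rintegral => w _; rewrite /G /=.
  by rewrite !mul0r add0r !mul1r.
rewrite e4 in e3.
have -> : \int[P']_w (cos (u * (b * xi2 w + kap - xi3 w)) * ratio_reg c (et w) (xi3 w)) = I.
  by apply: eq_Rintegral => w _; rewrite /G /= !mul1r.
have -> : I = 4^-1 * (I + I + (I + I)) by field.
rewrite -{1}e1 -{2}e3 -{2}e4 -!RintegralD//; try by do ?(exact: mG || (apply: integrable_funD => //)).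
rewrite -RintegralZl//; last by apply: integrable_funD => //; apply: integrable_funD => //; exact: mG.
apply: eq_Rintegral => w _; rewrite /G /=.
(* The sign change of xi3 also reverses the ratio, so that the average keeps the product of
   sines. *)
have odd : ratio_reg c (et w) (- 1 * xi3 w) = - ratio_reg c (et w) (xi3 w).
  by rewrite /ratio_reg mulN1r sqrrN mulrN mulNr mulNr.
rewrite !mul1r odd.
have -> : u * (b * (2 * xi1 w + - 1 * xi2 w) + kap - xi3 w) = - (u * ze w) + (u * et w - u * xi3 w) by ring.
have -> : u * (b * (2 * xi1 w + - 1 * xi2 w) + kap - - 1 * xi3 w) = - (u * ze w) + (u * et w + u * xi3 w) by ring.
have -> : u * (b * xi2 w + kap - xi3 w) = u * ze w + (u * et w - u * xi3 w) by ring.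
have -> : u * (b * xi2 w + kap - - 1 * xi3 w) = u * ze w + (u * et w + u * xi3 w) by ring.
rewrite !(cosD (- _)) !(cosD (u * ze w)) cosN sinN cosB cosD sinB sinD.
by field.
Qed.

Lemma measurable_et : measurable_fun setT (fun w => et w).
Proof. by apply: measurable_funD => //; apply: measurable_funM. Qed.

Lemma measurable_ze : measurable_fun setT (fun w => ze w).
Proof. by apply: measurable_funB; apply: measurable_funM. Qed.

Lemma measurable_ratio_reg c : measurable_fun setT (fun w => ratio_reg c (et w) (xi3 w)).
Proof.
have m := measurable_et; rewrite /ratio_reg.
apply: measurable_funM; first by apply: measurable_funM => //; apply: measurable_funM.
apply: measurable_fun_inv; apply: measurable_funD => //.
by apply: measurable_funD; apply: measurable_funX.
Qed.

Lemma cvg_ratio_reg_mean (g : T' -> R) : measurable_fun setT g -> (forall w, `|g w| <= 1) ->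
  \int[P']_w (g w * ratio_reg k.+1%:R^-1 (et w) (xi3 w)) @[k --> \oo] -->
  \int[P']_w (g w * ratio_reg 0 (et w) (xi3 w)).
Proof.
move=> mg g1; have i1 : P'.-integrable setT (EFin \o (fun=> 1 : R)).
  by apply: (integrable_bounded P' (M := 1)) => // w; rewrite normr1.
apply: cvg_Rintegral i1 _ => //.
- by move=> k; apply: measurable_funM => //; exact: measurable_ratio_reg.
- by move=> w _; apply: cvgM; [exact: cvg_cst|exact: ratio_reg_cvg].
- by move=> k w _; rewrite normrM -[leRHS]mul1r ler_pM// ratio_reg_le1// invr_ge0.
Qed.

Lemma symmetrized_ratio_mean (u : R) :
  \int[P']_w (cos (u * (b * xi2 w + kap - xi3 w)) * ratio_reg 0 (et w) (xi3 w)) =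
  \int[P']_w (sin (u * et w) * sin (u * xi3 w) * cos (u * ze w) * ratio_reg 0 (et w) (xi3 w)).
Proof.
have m1 := measurable_et; have m2 := measurable_ze.
have h1 := @cvg_ratio_reg_mean (fun w => cos (u * (b * xi2 w + kap - xi3 w))).
have h2 := @cvg_ratio_reg_mean (fun w => sin (u * et w) * sin (u * xi3 w) * cos (u * ze w)).
have e : (fun k : nat => \int[P']_w (cos (u * (b * xi2 w + kap - xi3 w)) * ratio_reg k.+1%:R^-1 (et w) (xi3 w))) =
   (fun k : nat => \int[P']_w (sin (u * et w) * sin (u * xi3 w) * cos (u * ze w) * ratio_reg k.+1%:R^-1 (et w) (xi3 w))).
  by apply/funext => k; apply: symmetrized_mean; rewrite invr_gt0.
rewrite e in h1; apply: (cvg_unique _ (h1 _ _) (h2 _ _)) => //.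
- apply: measurable_fun_cos; apply: measurable_funM => //; apply: measurable_funB => //.
  by apply: measurable_funD => //; apply: measurable_funM.
- by move=> w; exact: cos_max.
- apply: measurable_funM; last by apply: measurable_fun_cos; apply: measurable_funM.
  by apply: measurable_funM; apply: measurable_fun_sin; apply: measurable_funM.
- move=> w; rewrite 2!normrM -[leRHS]mul1r ler_pM ?cos_max//.
  by rewrite -[leRHS]mul1r ler_pM ?sin_max.
Qed.

(** The limit is taken along u = 1/(n+1), dominated by |e xi3| because |n sin (x/n)| <= |x|. The
    limit variable is nonnegative and would have mean 0, hence vanish almost surely; but it is
    positive off the null events e = 0 and xi3 = 0. *)
Lemma symmetrized_ratio_mean_neq0 :
  ~ (forall u : R, \int[P']_w (sin (u * et w) * sin (u * xi3 w) * cos (u * ze w) * ratio_reg 0 (et w) (xi3 w)) = 0).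
Proof.
move=> h0; have m1 := measurable_et; have m2 := measurable_ze; have mr := measurable_ratio_reg 0.
pose f n w := n.+1%:R * sin (et w / n.+1%:R) * (n.+1%:R * sin (xi3 w / n.+1%:R)) * cos (ze w / n.+1%:R) *
  ratio_reg 0 (et w) (xi3 w).
pose l w := et w * xi3 w * ratio_reg 0 (et w) (xi3 w).
have msin (n : nat) (g : T' -> R) : measurable_fun setT g -> measurable_fun setT (fun w => n.+1%:R * sin (g w / n.+1%:R)).
  by move=> mg; apply: measurable_funM => //; apply: measurable_fun_sin; apply: measurable_funM.
have [C1 hC1] := xi_moment H_gt0 lambda_gt0 b_gt0 W_wiener xi_gauss b 0 0.
have [C3 hC3] := xi_moment H_gt0 lambda_gt0 b_gt0 W_wiener xi_gauss 0 0 1.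
have i1 : P'.-integrable setT (EFin \o (fun w => (b * xi1 w) ^+ 2)).
  apply: integrable_sqr_of_lty; first exact: measurable_funM.
  apply: le_lt_trans (ltry C1); apply: le_trans hC1; rewrite le_eqVlt; apply/orP; left; apply/eqP.
  by apply: eq_integral => w _; congr (_ ^+ 2)%:E; ring.
have i3 : P'.-integrable setT (EFin \o (fun w => (xi3 w) ^+ 2)).
  apply: integrable_sqr_of_lty => //.
  apply: le_lt_trans (ltry C3); apply: le_trans hC3; rewrite le_eqVlt; apply/orP; left; apply/eqP.
  by apply: eq_integral => w _; congr (_ ^+ 2)%:E; ring.
have ig : P'.-integrable setT (EFin \o (fun w => 2 * (b * xi1 w) ^+ 2 + xi3 w ^+ 2 + 2 * kap ^+ 2)).
  apply: integrable_funD => //; last exact: (integrable_bounded P' (M := `|2 * kap ^+ 2|)).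
  apply: integrable_funD => //.
  rewrite (_ : EFin \o _ = fun w => (2%:E * (EFin \o (fun w => (b * xi1 w) ^+ 2)%R) w)%E)//.
  exact: integrableZl.
have nsin n (x : R) : `|n.+1%:R * sin (x / n.+1%:R)| <= `|x|.
  have n0 : 0 < n.+1%:R :> R by [].
  rewrite normrM gtr0_norm// -ler_pdivlMl// (le_trans (norm_sin_le _))//.
  by rewrite normrM normfV normr_nat mulrC.
have lim : \int[P']_w f n w @[n --> \oo] --> \int[P']_w l w.
  apply: cvg_Rintegral ig _ => //.
  - move=> n; apply: measurable_funM => //; apply: measurable_funM; last first.
      by apply: measurable_fun_cos; apply: measurable_funM.
    by apply: measurable_funM; apply: msin.
  - move=> w _; rewrite /f /l -[et w * xi3 w]mulr1 -[X in et w * xi3 w * X](cos0 R).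
    apply: cvgM; last exact: cvg_cst.
    apply: cvgM; first by apply: cvgM; exact: cvg_scaled_sin.
    apply: (cvg_comp_continuous (h := cos)); first exact: continuous_cos.
    rewrite -[X in _ --> X](mulr0 (ze w)); apply: cvgM; first exact: cvg_cst.
    exact: cvg_harmonic.
  - move=> n w _; rewrite /f 2!normrM.
    apply: (@le_trans _ _ (`|et w| * `|xi3 w| * 1 * 1)).
      rewrite ler_pM ?ratio_reg_le1// ?ler_pM ?cos_max//.
      by rewrite normrM ler_pM.
    by rewrite !mulr1; exact: norm_product_le.
have f0 n : \int[P']_w f n w = 0.
  transitivity (\int[P']_w (n.+1%:R ^+ 2 * (sin (n.+1%:R^-1 * et w) * sin (n.+1%:R^-1 * xi3 w) *
      cos (n.+1%:R^-1 * ze w) * ratio_reg 0 (et w) (xi3 w)))).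
    by apply: eq_Rintegral => w _; rewrite /f ![_ / n.+1%:R]mulrC; ring.
  rewrite RintegralZl// ?h0 ?mulr0//.
  apply: (integrable_bounded P' (M := 1)).
    apply: measurable_funM => //; apply: measurable_funM; last by apply: measurable_fun_cos; apply: measurable_funM.
    by apply: measurable_funM; apply: measurable_fun_sin; apply: measurable_funM.
  move=> w; rewrite 3!normrM -[leRHS]mul1r ler_pM ?ratio_reg_le1//.
  by rewrite -[leRHS]mul1r ler_pM ?cos_max// -[leRHS]mul1r ler_pM ?sin_max.
have l0 : \int[P']_w l w = 0.
  rewrite (_ : (fun n => _) = fun=> 0) in lim; last by apply/funext.
  exact: (cvg_unique _ lim (cvg_cst _)).
have lge0 w : 0 <= l w.
  rewrite /l /ratio_reg (_ : _ * _ = 2 * (et w * xi3 w) ^+ 2 / (xi3 w ^+ 2 + et w ^+ 2 + 0)); last first.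
    by rewrite mulrA; congr (_ / _); ring.
  by rewrite divr_ge0 ?addr0 ?addr_ge0 ?sqr_ge0// mulr_ge0 ?sqr_ge0.
have ml : measurable_fun setT l by apply: measurable_funM => //; apply: measurable_funM.
have il : P'.-integrable setT (EFin \o l).
  apply: (le_integrable measurableT _ _ ig); first exact/measurable_EFinP.
  move=> w _ /=; rewrite lee_fin /l normrM [leRHS]ger0_norm; last first.
    by rewrite !addr_ge0 ?sqr_ge0// mulr_ge0 ?sqr_ge0.
  apply: (@le_trans _ _ (`|et w| * `|xi3 w| * 1)); first by rewrite normrM ler_pM ?ratio_reg_le1.
  by rewrite mulr1; exact: norm_product_le.
have ae0 : {ae P', forall w, l w = 0}.
  have /(ae_eq_integral_abs P' measurableT (f := EFin \o l)) : (\int[P']_w `|(EFin \o l) w| = 0)%E.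
    rewrite (eq_integral (EFin \o l)).
      by rewrite -(fineK (integrable_fin_num measurableT il)) -/(Rintegral _ _ _) l0.
    by move=> w _ /=; rewrite ger0_norm.
  have mEl : measurable_fun setT (EFin \o l) by exact/measurable_EFinP.
  by move=> /(_ mEl); apply: filterS => w /= /(_ I) [].
have [_ at1 at3] := xi_gauss.
have ae1 : {ae P', forall w, xi1 w <> - kap / b}.
  exists [set w | xi1 w = - kap / b]; split => //; last by move=> w /= /contrapT.
  by have := measurable_preimage (measurable_funPT xi1) (measurable_set1 (- kap / b)); apply.
have ae3 : {ae P', forall w, xi3 w <> 0}.
  exists [set w | xi3 w = 0]; split => //; last by move=> w /= /contrapT.
  by have := measurable_preimage (measurable_funPT xi3) (measurable_set1 (0 : R)); apply.
have : {ae P', forall w, False}.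
  apply: filterS3 ae0 ae1 ae3 => w + h1 h3.
  have x3 : xi3 w != 0 by apply/eqP.
  have e1 : et w != 0.
    apply/eqP => e; apply: h1; apply: (mulfI (lt0r_neq0 b_gt0)).
    by rewrite [RHS]mulrC divfK ?gt_eqF//; apply/eqP; rewrite -subr_eq0 opprK e.
  rewrite /l /ratio_reg => /eqP; rewrite !mulf_eq0 invr_eq0 (negbTE x3) (negbTE e1) /= addr0 pnatr_eq0 /=.
  by rewrite paddr_eq0 ?sqr_ge0// !sqrf_eq0 (negbTE x3).
move=> [A [mA A0 hA]]; have : P' setT = 0%E.
  by rewrite -A0; congr (P' _); apply/esym; rewrite -subTset => w _; apply: hA.
by rewrite probability_setT => /eqP; rewrite onee_eq0.
Qed.

End limit_dependence.

(** Homogeneity of degree 0 makes h a function of the ratio, which is the second limit component up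
    to a constant. At x = 0 the inverse is 0 and both sides vanish. *)
Lemma ratio_reg_div (R : realType) (x n : R) : ratio_reg 0 1 (n / x) = ratio_reg 0 x n.
Proof.
have [->|x0] := eqVneq x 0; first by rewrite /ratio_reg invr0 !mulr0 !mul0r.
have h1 : (n / x) ^+ 2 + 1 ^+ 2 + 0 != 0.
  by rewrite addr0 expr1n gt_eqF// ltr_wpDl ?sqr_ge0.
have h2 : n ^+ 2 + x ^+ 2 + 0 != 0.
  by rewrite addr0 gt_eqF// ltr_wpDl ?sqr_ge0// lt_def sqr_ge0 sqrf_eq0 x0.
rewrite /ratio_reg; apply/eqP; rewrite eqr_div//; apply/eqP.
by field.
Qed.

Section limit_errors_dependent.
Context d (T : measurableType d) (R : realType) (P : probability T R).
Variables (H lambda a b sigma y0 : R) (W : R -> {RV P >-> R}).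
Hypotheses (H_gt0 : 0 < H) (lambda_gt0 : 0 < lambda) (b_gt0 : 0 < b) (sigma_gt0 : 0 < sigma).
Hypothesis W_wiener : wiener_process W.
Context d' (T' : measurableType d') (P' : probability T' R).
Variables (xi1 xi2 xi3 : {RV P' >-> R}).
Hypothesis xi_gauss : gaussian_triple P' H lambda b xi1 xi2 xi3.

Local Notation kap := ((y0 + a / b) / sigma).
Local Notation U_lim w := (b * sigma * xi2 w - sigma * xi3 w).
Local Notation V_lim w := (2 * b * sigma * xi3 w / (y0 + a / b + b * sigma * xi1 w)).

(** Test functions of the two components: U / sigma + kap = b xi2 + kap - xi3, and V / (2 b) = xi3 /
    (b xi1 + kap). *)
Let cosU (u x : R) := cos (u * (x / sigma + kap)).
Let ratioV (v : R) := ratio_reg 0 1 (v / (2 * b)).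

Let continuous_cosU u : continuous (cosU u).
Proof.
move=> x; apply: (cvg_comp_continuous (h := cos)); first exact: continuous_cos.
apply: cvgM; first exact: cvg_cst.
apply: cvgD; last exact: cvg_cst.
by apply: cvgM; [exact: cvg_id|exact: cvg_cst].
Qed.

Let continuous_ratioV : continuous ratioV.
Proof.
move=> v; have nz : (v / (2 * b)) ^+ 2 + 1 ^+ 2 + 0 != 0.
  by rewrite addr0 expr1n gt_eqF// ltr_wpDl ?sqr_ge0.
have h : v0 / (2 * b) @[v0 --> v] --> v / (2 * b) by apply: cvgM; [exact: cvg_id|exact: cvg_cst].
have aux (S : Type) (G : set_system S) (FG : Filter G) (f : S -> R) (x : R) : x ^+ 2 + 1 ^+ 2 + 0 != 0 ->
    f s @[s --> G] --> x -> ratio_reg 0 1 (f s) @[s --> G] --> ratio_reg 0 1 x.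
  by move=> x0 fx; rewrite /ratio_reg; cvg_tac.
exact: aux nz h.
Qed.

(** Stated for any pair with the same means of bounded continuous functions, so that it covers both
    the explicit limit vector and an arbitrary limit in the definition of asymptotic
    independence. *)
Lemma limit_errors_not_independent d2 (T2 : measurableType d2) (Q : probability T2 R) (Z1 Z2 : T2 -> R) :
  measurable_fun setT Z1 -> measurable_fun setT Z2 ->
  (forall F : R * R -> R, continuous F -> (exists M : R, forall z, `|F z| <= M) ->
     \int[Q]_w F (Z1 w, Z2 w) = \int[P']_w F (U_lim w, V_lim w)) ->
  ~ independent2 Q Z1 Z2.
Proof.
move=> mZ1 mZ2 sameF ind.
have h u : \int[Q]_w (cosU u (Z1 w) * ratioV (Z2 w)) =
    \int[P']_w (sin (u * (b * xi1 w + kap)) * sin (u * xi3 w) * cos (u * (b * xi2 w - b * xi1 w)) *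
      ratio_reg 0 (b * xi1 w + kap) (xi3 w)).
  rewrite -(symmetrized_ratio_mean a sigma y0 H_gt0 lambda_gt0 b_gt0 W_wiener xi_gauss).
  rewrite (sameF (fun p => cosU u p.1 * ratioV p.2)); last 2 first.
  - move=> p; apply: cvgM.
      by apply: (cvg_comp _ _ (cvg_fst (F := nbhs p.1) (G := nbhs p.2))); exact: continuous_cosU.
    by apply: (cvg_comp _ _ (cvg_snd (F := nbhs p.1) (G := nbhs p.2))); exact: continuous_ratioV.
  - exists 1 => z; rewrite normrM -[leRHS]mul1r ler_pM ?cos_max// ratio_reg_le1//.
  apply: eq_Rintegral => w _ /=; congr (cos _ * _).
    by congr (_ * _); field; rewrite !gt_eqF.
  rewrite /ratioV -[RHS]ratio_reg_div; congr ratio_reg.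
  have -> : y0 + a / b + b * sigma * xi1 w = sigma * (b * xi1 w + kap) by field; rewrite !gt_eqF.
  rewrite invfM; move: ((b * xi1 w + kap)^-1) => q; field; by rewrite !gt_eqF.
refine (symmetrized_ratio_mean_neq0 (a := a) (sigma := sigma) (y0 := y0) H_gt0 lambda_gt0 b_gt0 W_wiener xi_gauss _) => u.
have ratio1 v : `|ratioV v| <= 1 by exact: ratio_reg_le1.
have cos1 u' x : `|cosU u' x| <= 1 by exact: cos_max.
have mc u' : measurable_fun setT (cosU u') .
  by apply: continuous_measurable_fun; exact: continuous_cosU.
have mr : measurable_fun setT ratioV by apply: continuous_measurable_fun; exact: continuous_ratioV.
have prod u' := independent2_Rintegral mZ1 mZ2 ind (mc u') (cos1 u') mr ratio1.
have V0 : \int[Q]_w ratioV (Z2 w) = 0.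
  transitivity (\int[Q]_w (cosU 0 (Z1 w) * ratioV (Z2 w))).
    by apply: eq_Rintegral => w _; rewrite /cosU mul0r cos0 mul1r.
  rewrite h; transitivity (\int[P']_w (0 : R)); last exact: Rintegral_prob_cst.
  by apply: eq_Rintegral => w _; rewrite mul0r sin0 !mul0r.
by rewrite -h prod V0 mulr0.
Qed.

End limit_errors_dependent.

(** * A Gaussian vector with the limit covariance, built from [W] *)

Section gaussian_model.
Context d (T : measurableType d) (R : realType) (P : probability T R).
Variables (H lambda b : R) (W : R -> {RV P >-> R}).
Hypotheses (H_gt0 : 0 < H) (lambda_gt0 : 0 < lambda) (b_gt0 : 0 < b).
Hypothesis W_wiener : wiener_process W.

(** Consecutive unit increments: independent standard normal variables. *)
Let N (i : nat) (w : T) : R := W i.+1%:R w - W i%:R w.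

Let N_char (a : nat -> R) (phi : R) :
  \int[P]_w cos (a 0%N * N 0 w + a 1%N * N 1 w + a 2%N * N 2 w + phi) =
  cos phi * gauss_cf (a 0%N ^+ 2 + a 1%N ^+ 2 + a 2%N ^+ 2).
Proof.
have ht : {homo (fun i : nat => i%:R : R) : i j / (i <= j)%N >-> i <= j} by move=> i j ij; rewrite ler_nat.
have := wiener_increments_char W_wiener a 3 ht phi.
have e i : a i ^+ 2 * (i.+1%:R - i%:R) = a i ^+ 2 by rewrite -natrB// subSnn mulr1.
under [in RHS]eq_bigr do rewrite e.
rewrite (gauss_cf_prod W_wiener); last by move=> i; exact: sqr_ge0.
rewrite !big_nat_recr//= big_nil !add0r => <-.
by apply: eq_Rintegral => w _; rewrite !big_nat_recr//= big_nil !add0r.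
Qed.

Let N_atom (c : R) (i : nat) : c != 0 -> forall x, P [set w | c * N i w = x] = 0%E.
Proof.
move=> c0 x; have ii : (i%:R : R) <= i.+1%:R by rewrite ler_nat.
have := centered_gaussian_neq (x / c) (wiener_increment W_wiener ii).
rewrite -natrB// subSnn oner_neq0 => /(_ isT) <-; congr (P _).
apply/seteqP; split => w /= h; first by rewrite -h mulrC mulKf.
by rewrite /N h mulrC divfK.
Qed.

(* Replaces the Gaussian vector where none is given, in the first claim of the theorem. *)
Lemma gaussian_triple_exists : exists xi1 xi2 xi3 : {RV P >-> R}, gaussian_triple P H lambda b xi1 xi2 xi3.
Proof.
have b2 := beta2_gt0 H_gt0 lambda_gt0 b_gt0.
have g2 : 0 <= 2 * b * acov_laplace H lambda b.
  by rewrite mulr_ge0 ?mulr_ge0 ?(ltW b_gt0)// (acov_laplace_ge0 lambda H_gt0 b).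
(* Standard deviations of the independent components in [Sigma_formE]: b xi1 = be N_0, b xi2 - b xi1
   = ga N_1, xi3 = be N_2. *)
pose be := Num.sqrt (beta2 H lambda b); pose ga := Num.sqrt (2 * b * acov_laplace H lambda b).
have beE : be ^+ 2 = beta2 H lambda b by rewrite sqr_sqrtr// ltW.
have gaE : ga ^+ 2 = 2 * b * acov_laplace H lambda b by rewrite sqr_sqrtr.
have be0 : be != 0 by rewrite gt_eqF// sqrtr_gt0.
have mN i : measurable_fun setT (N i) by apply: measurable_funB.
have mlin c c' i j : measurable_fun setT (fun w => c * N i w + c' * N j w).
  by apply: measurable_funD; apply: measurable_funM.
pose X1 : {RV P >-> R} := HB.pack (fun w => be / b * N 0 w + 0 * N 0 w) (isMeasurableFun.Build _ _ _ _ _ (mlin (be / b) 0 0%N 0%N)).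
pose X2 : {RV P >-> R} := HB.pack (fun w => be / b * N 0 w + ga / b * N 1 w) (isMeasurableFun.Build _ _ _ _ _ (mlin (be / b) (ga / b) 0%N 1%N)).
pose X3 : {RV P >-> R} := HB.pack (fun w => be * N 2 w + 0 * N 0 w) (isMeasurableFun.Build _ _ _ _ _ (mlin be 0 2%N 0%N)).
exists X1, X2, X3; split.
- move=> c1 c2 c3 k phi; rewrite Sigma_formE// -beE -gaE.
  have -> : k ^+ 2 * (((c1 + c2) / b) ^+ 2 * be ^+ 2 + (c2 / b) ^+ 2 * ga ^+ 2 + c3 ^+ 2 * be ^+ 2) =
     (k * (c1 + c2) / b * be) ^+ 2 + (k * c2 / b * ga) ^+ 2 + (k * c3 * be) ^+ 2 by ring.
  rewrite -(N_char (fun i => nth 0 [:: k * (c1 + c2) / b * be; k * c2 / b * ga; k * c3 * be] i)).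
  apply: eq_Rintegral => w _; congr cos; rewrite /X1 /X2 /X3 /=; ring.
- move=> x; rewrite -(N_atom (c := be / b) 0 _ x); last by rewrite mulf_neq0// invr_eq0 gt_eqF.
  by congr (P _); apply/seteqP; split => w /=; rewrite mul0r addr0.
- move=> x; rewrite -(N_atom (c := be) 2 be0 x).
  by congr (P _); apply/seteqP; split => w /=; rewrite mul0r addr0.
Qed.

End gaussian_model.

Section limit_in_distribution.
Context d (T : measurableType d) (R : realType) (P : probability T R).
Variables (H lambda a b sigma y0 : R) (W B Y : R -> {RV P >-> R}).
Hypotheses (H_gt0 : 0 < H) (lambda_gt0 : 0 < lambda) (b_gt0 : 0 < b) (sigma_gt0 : 0 < sigma).
Hypotheses (W_wiener : wiener_process W) (B_tfbm : tfbm H lambda W B).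
Hypothesis Y_solution : vasicek_solution a b sigma y0 B Y.
Context d' (T' : measurableType d') (P' : probability T' R).
Variables (xi1 xi2 xi3 : {RV P' >-> R}).
Hypothesis xi_gauss : gaussian_triple P' H lambda b xi1 xi2 xi3.

Local Notation U_lim w := (b * sigma * xi2 w - sigma * xi3 w).
Local Notation V_lim w := (2 * b * sigma * xi3 w / (y0 + a / b + b * sigma * xi1 w)).

Lemma expectation_EFin d1 (S : measurableType d1) (Q : probability S R) (F : R * R -> R) (M : R) (u v : S -> R) :
  continuous F -> (forall z, `|F z| <= M) -> measurable_fun setT u -> measurable_fun setT v ->
  ('E_Q[fun w => F (u w, v w)] = (\int[Q]_w F (u w, v w))%:E)%E.
Proof.
move=> cF FM mu mv; rewrite unlock /Rintegral fineK//.
exact: (integrable_fin_num measurableT (integrable_test2 cF FM Q mu mv)).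
Qed.

(** Along sequences this is [cvg_err_mean]; the errors are known to be measurable for t >= 0, which
    holds near infinity. *)
Lemma cvg_errors : cvg_in_distribution P P' (fun t w => (err_a a y0 Y t w, err_b b y0 Y t w))
  (fun w => (U_lim w, V_lim w)).
Proof.
have [mU mV] := measurable_limit_errors a b sigma y0 xi1 xi2 xi3.
have me t : 0 <= t -> measurable_fun setT (err_a a y0 Y t) /\ measurable_fun setT (err_b b y0 Y t).
  exact: (measurable_err b_gt0 B_tfbm Y_solution).
split.
- near=> t; have t0 : 0 <= t by near: t; exact: nbhs_pinfty_ge.
  by have [h1 h2] := me t t0; exact: measurable_fun_pair.
- exact: measurable_fun_pair.
- move=> F cF [M FM]; rewrite (expectation_EFin _ cF FM mU mV).
  have lim : \int[P]_w F (err_a a y0 Y t w, err_b b y0 Y t w) @[t --> +oo] --> \int[P']_w F (U_lim w, V_lim w).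
    apply: cvg_pinfty_seq => t t0 tn.
    exact: (cvg_err_mean H_gt0 lambda_gt0 b_gt0 sigma_gt0 W_wiener B_tfbm Y_solution xi_gauss cF FM t0 tn).
  have limE : (\int[P]_w F (err_a a y0 Y t w, err_b b y0 Y t w))%:E @[t --> +oo] -->
      (\int[P']_w F (U_lim w, V_lim w))%:E.
    by apply: cvg_EFin; [near=> t|exact: lim].
  apply: cvg_trans limE; apply: near_eq_cvg; near=> t; have t0 : 0 <= t by near: t; exact: nbhs_pinfty_ge.
  by have [h1 h2] := me t t0; rewrite /= (expectation_EFin _ cF FM h1 h2).
Unshelve. all: by end_near.
Qed.

End limit_in_distribution.

Section asymptotic_dependence.
Context d (T : measurableType d) (R : realType) (P : probability T R).
Variables (H lambda a b sigma y0 : R) (W B Y : R -> {RV P >-> R}).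
Hypotheses (H_gt0 : 0 < H) (lambda_gt0 : 0 < lambda) (b_gt0 : 0 < b) (sigma_gt0 : 0 < sigma).
Hypotheses (W_wiener : wiener_process W) (B_tfbm : tfbm H lambda W B).
Hypothesis Y_solution : vasicek_solution a b sigma y0 B Y.

(** By uniqueness of limits, a candidate limit has the same means of bounded continuous functions as
    the explicit one, and the dependence argument applies to it. *)
Lemma not_asymptotically_independent : ~ asymptotically_independent P (err_a a y0 Y) (err_b b y0 Y).
Proof.
move=> [d2 [T2 [Q [Z [[_ mZ hZ] ind]]]]].
have [xi1 [xi2 [xi3 g]]] := gaussian_triple_exists H_gt0 lambda_gt0 b_gt0 W_wiener.
have mZ1 : measurable_fun setT (fun w => (Z w).1) by exact: measurableT_comp measurable_fst mZ.
have mZ2 : measurable_fun setT (fun w => (Z w).2) by exact: measurableT_comp measurable_snd mZ.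
apply: (limit_errors_not_independent (a := a) (y0 := y0) H_gt0 lambda_gt0 b_gt0 sigma_gt0 W_wiener g mZ1 mZ2 _ ind).
move=> F cF bF; have [_ _ h] := cvg_errors H_gt0 lambda_gt0 b_gt0 sigma_gt0 W_wiener B_tfbm Y_solution g.
have [M FM] := bF; have [mU mV] := measurable_limit_errors a b sigma y0 xi1 xi2 xi3.
apply: EFin_inj; rewrite -(expectation_EFin _ cF FM mU mV) -(expectation_EFin _ cF FM mZ1 mZ2).
rewrite (_ : (fun w => F ((Z w).1, (Z w).2)) = fun w => F (Z w)).
  exact: (cvg_unique (@ereal_hausdorff R) (hZ F cF bF) (h F cF bF)).
by apply/funext => w; rewrite -surjective_pairing.
Qed.

End asymptotic_dependence.

Unset Implicit Arguments.

Theorem mainTheorem2 (R : realType)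
  (d : measure_display) (T : measurableType d) (P : probability T R)
  (H lambda a b sigma y0 : R)
  (H_gt0 : 0 < H) (lambda_gt0 : 0 < lambda) (b_gt0 : 0 < b)
  (sigma_gt0 : 0 < sigma)
  (W B Y : R -> {RV P >-> R})
  (W_wiener : wiener_process W)
  (B_tfbm : tfbm H lambda W B)
  (Y_solution : vasicek_solution a b sigma y0 B Y) :
  let U := fun (t : R) (w : T) => t * (a_hat y0 (fun s => Y s w) t - a) in
  let V := fun (t : R) (w : T) =>
    expR (b * t) * (b_hat y0 (fun s => Y s w) t - b) in
  ~ asymptotically_independent P U V /\
  forall (d' : measure_display) (T' : measurableType d')
      (P' : probability T' R) (xi1 xi2 xi3 : {RV P' >-> R}),
    centered_gaussian_vector (Sigma H lambda b)
      (fun i : 'I_3 => nth xi1 [:: xi1; xi2; xi3] i) ->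
    let U_lim := fun w : T' => b * sigma * xi2 w - sigma * xi3 w in
    let V_lim := fun w : T' =>
      2 * b * sigma * xi3 w / (y0 + a / b + b * sigma * xi1 w) in
    cvg_in_distribution P P' (fun t w => (U t w, V t w))
      (fun w => (U_lim w, V_lim w)) /\
    ~ independent2 P' U_lim V_lim.
Proof.
move=> U V; split.
  exact: (not_asymptotically_independent H_gt0 lambda_gt0 b_gt0 sigma_gt0 W_wiener B_tfbm Y_solution).
move=> d' T' P' xi1 xi2 xi3 /(gaussian_vector_triple H_gt0 lambda_gt0 b_gt0) xi_gauss U_lim V_lim; split.
  exact: (cvg_errors H_gt0 lambda_gt0 b_gt0 sigma_gt0 W_wiener B_tfbm Y_solution xi_gauss).
have [mU mV] := measurable_limit_errors a b sigma y0 xi1 xi2 xi3.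
exact: (limit_errors_not_independent (a := a) (y0 := y0) H_gt0 lambda_gt0 b_gt0 sigma_gt0 W_wiener xi_gauss mU mV).
Qed.
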